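(* Let $0<\alpha<1$. Consider the last passage percolation model in which $x_k(0)=-2k$ for $k\in\mathbb{Z}\setminus\{0\}$ and $x_0(0)=1$, $\mathcal{L}^+=\{(k+x_k(0),k):k>0\}$, $\mathcal{L}^-=\{(k+x_k(0),k):k\le 0\}$, and the weights $\omega_{i,j}$, $(i,j)\notin\mathcal{L}^+\cup\mathcal{L}^-$, are independent, exponentially distributed with rate $1$ if $j>0$ and with rate $\alpha$ if $j\le 0$. Let $\phi_n=(I_n,J_n)$ be the associated competition interface. Then for every $s\in\mathbb{R}$, $$\lim_{t\to\infty}\mathbb{P}\left(\frac{I_{\lfloor t\rfloor}-J_{\lfloor t\rfloor}-(\alpha-1)t}{t^{1/3}}\le s\right)=\mathbb{P}(\chi_2-\chi_1\ge 0),$$ where $\chi_1,\chi_2$ are independent real random variables with $$\mathbb{P}(\chi_1\le x)=F_{\rm GOE}\left(\frac{x-\gamma s}{\sigma_1}\right),\qquad \mathbb{P}(\chi_2\le x)=F_{\rm GOE}\left(\frac{x-\gamma s/\alpha}{\sigma_2}\right),$$ $\gamma=2^{4/3}/(2-\alpha)^{4/3}$, $\sigma_1=\frac{2^{2/3}}{(2-\alpha)^{1/3}}$ and $\sigma_2=\frac{2^{2/3}(2-2\alpha+\alpha^2)^{1/3}}{\alpha^{2/3}(2-\alpha)}$.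
   Context: Last passage percolation (LPP): given independent nonnegative random variables $\{\omega_{i,j}\}_{(i,j)\in\mathbb{Z}^2}$, an up-right path is a sequence $\pi=(\pi(0),\dots,\pi(n))$ of points of $\mathbb{Z}^2$ with $\pi(i)-\pi(i-1)\in\{(1,0),(0,1)\}$. For $S_A,S_E\subset\mathbb{Z}^2$, $L_{S_A\to S_E}=\max_\pi\sum_{(i,j)\in\pi\setminus S_A}\omega_{i,j}$, the maximum over up-right paths with $\pi(0)\in S_A$, $\pi(n)\in S_E$ (and $-\infty$ if no such path exists); for a point $B$ write $L_{S_A\to B}=L_{S_A\to\{B\}}$. Competition interface: let $\Gamma_+^\infty=\{(i,j):L_{\mathcal{L}^+\to(i,j)}>L_{\mathcal{L}^-\to(i,j)}\}$ and $\Gamma_-^\infty=\{(i,j):L_{\mathcal{L}^-\to(i,j)}>L_{\mathcal{L}^+\to(i,j)}\}$ (a.s. every $(i,j)\in\mathbb{N}^2$ lies in exactly one of them). Set $\phi_0=(0,0)$ and inductively $\phi_{n+1}=\phi_n+(1,0)$ if $\phi_n+(1,1)\in\Gamma_+^\infty$, and $\phi_{n+1}=\phi_n+(0,1)$ if $\phi_n+(1,1)\in\Gamma_-^\infty$; write $\phi_n=(I_n,J_n)$. $F_{\rm GOE}$ denotes the GOE Tracy–Widom distribution function. *)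

(* Defs.v *)
From HB Require Import structures.
From mathcomp Require Import all_boot all_order all_algebra.
From mathcomp Require Import all_classical all_reals all_analysis.
Set Implicit Arguments. Unset Strict Implicit. Unset Printing Implicit Defensive.
Import Order.TTheory GRing.Theory Num.Theory.
Import numFieldNormedType.Exports.
Local Open Scope classical_set_scope.
Local Open Scope ring_scope.

(* GOE Tracy--Widom distribution via the Ferrari--Spohn / Sasamoto     *)
(* Fredholm determinant  F_GOE(s) = det(1 - P_0 B_s P_0)_{L^2(R)},    *)
(* B_s(x,y) = Ai(x+y+s), written as its Fredholm series.              *)

Definition airy {R : realType} (x : R) : R :=
  pi^-1 * limn (fun N : nat =>
    \int[lebesgue_measure]_(t in `[0, N%:R]) cos (t ^+ 3 / 3%:R + x * t)).

Definition cons_vec {R : Type} (n : nat) (x : R) (v : 'I_n -> R) : 'I_n.+1 -> R :=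
  fun i => oapp v x (unlift ord0 i).

Fixpoint iint_pos {R : realType} (n : nat) : (('I_n -> R) -> R) -> R :=
  match n return (('I_n -> R) -> R) -> R with
  | 0 => fun f => f (fun _ => 0)
  | n'.+1 => fun f =>
      \int[lebesgue_measure]_(x in `]0, +oo[)
        iint_pos (fun v => f (cons_vec x v))
  end.

(* Fredholm series of det(1 - P_0 B_s P_0) *)
Definition F_GOE {R : realType} (s : R) : R :=
  limn (fun N : nat => \sum_(0 <= n < N)
    ((-1) ^+ n / (n `!)%:R *
      iint_pos (fun v : 'I_n -> R =>
        \det (\matrix_(i < n, j < n) airy (v i + v j + s))))).

Definition pt := (int * int)%type.

Definition ur_step (a b : pt) : bool :=
  (b == (a.1 + 1, a.2)) || (b == (a.1, a.2 + 1)).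

(* L_{SA -> SE}: sup over up-right paths pi = x :: s with pi(0) = x in SA and
   pi(n) = last x s in SE of the sum of the weights of the points of pi not in SA;
   -oo if there is no such path. *)
Definition LPP {R : realType} (w : pt -> R) (SA SE : pred pt) : \bar R :=
  ereal_sup [set v : \bar R | exists (x : pt) (s : seq pt),
    [/\ SA x, SE (last x s), path ur_step x s &
        v = (\sum_(q <- x :: s | ~~ SA q) w q)%:E]].

Definition x0 (k : int) : int := if k == 0 then 1 else - (2 * k).

Definition Lplus : pred pt := fun p => (0 < p.2) && (p.1 == p.2 + x0 p.2).
Definition Lminus : pred pt := fun p => (p.2 <= 0) && (p.1 == p.2 + x0 p.2).

(* competition interface: phi_0 = (0,0),
   phi_{n+1} = phi_n + (1,0) if phi_n + (1,1) in Gamma_+ (i.e. L^+ -> . > L^- -> .),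
   phi_n + (0,1) otherwise (in particular if phi_n + (1,1) in Gamma_-). *)
Fixpoint comp_interface {R : realType} (w : pt -> R) (n : nat) : pt :=
  match n with
  | 0 => (0, 0)
  | n'.+1 =>
      let p := comp_interface w n' in
      let q := (p.1 + 1, p.2 + 1) in
      if (LPP w Lminus (pred1 q) < LPP w Lplus (pred1 q))%E
      then (p.1 + 1, p.2) else (p.1, p.2 + 1)
  end.

Definition mutually_independent {d} {T : measurableType d} {R : realType}
  (P : probability T R) {I : eqType} (J : pred I) (X : I -> T -> R) : Prop :=
  forall (F : seq I) (B : I -> set R),
    uniq F -> all J F -> (forall i, measurable (B i)) ->
    P (\big[setI/setT]_(i <- F) (X i @^-1` B i)) =
    (\prod_(i <- F) P (X i @^-1` B i))%E.

Definition independent2 {d} {T : measurableType d} {R : realType}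
  (P : probability T R) (X Y : T -> R) : Prop :=
  forall A B : set R, measurable A -> measurable B ->
    P (X @^-1` A `&` Y @^-1` B) = (P (X @^-1` A) * P (Y @^-1` B))%E.

(* Main.v *)
(* The interface tests whether the passage time from [Lplus] exceeds the one from [Lminus] at a
   point [q] of the antidiagonal, so the theorem is about the joint law of these two passage times.
   Each is a point-to-line passage time: the weights of row [k] and antidiagonal height [n] are
   exponential of rate [b k + b (k - n)].

   One passage time.  For pairwise distinct parameters, the law of such a passage time is computed
   cell by cell: the joint distribution function along a down-right path is a determinant of
   exponentials, and exchanging one corner of the path is a convolution with an exponential weight,
   under which the determinant is stable.  At the end point one finds
     P (L <= u) = det (1 - K), with kernel [k (x + y + 2 u)] on the half-line, k (x) = sum_j c_j e^(- b_j x),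
   and partial fractions turn [k] into a contour integral converging, after centring and scaling, to
   the Airy function.  Dominated convergence in the Fredholm series (Hadamard's bound) gives [F_GOE];
   an arbitrary family of parameters is squeezed between pairwise distinct ones.

   Two passage times.  Move [q] back by [r], with [t^(1/3) << r << t^(2/3)], towards the
   characteristic.  Tilting the parameters shows that the maximal path to the moved point stays on one
   side of the ray from [(1, 0)] to [q], and that the passage time from the moved point to [q] only adds
   its mean up to [o (t^(1/3))].  Hence each passage time is asymptotically a function of the weights on its
   own side of the ray, and the two become independent.  The limit laws being continuous, the
   probability of [L+ <= L-] converges to that of [chi1 <= chi2]. *)
Require Import Defs.
From HB Require Import structures.
From mathcomp Require Import all_boot all_order all_algebra.
From mathcomp Require Import all_classical all_reals all_analysis.
From mathcomp Require Import fingroup perm qpoly measurable_realfun complex ring lra zify.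
Set Implicit Arguments. Unset Strict Implicit. Unset Printing Implicit Defensive.
Import Order.TTheory GRing.Theory Num.Theory.
Import numFieldNormedType.Exports.
Local Open Scope classical_set_scope.
Local Open Scope ring_scope.

(** * Real and complex analysis *)

(** The exact law holds for a field on all rows, while the passage times start from half-lines. Each
    of them lies below the passage time of a full field and above one that keeps to the right of the
    ray and then to a quadrant; the same two bounds give its limit law and its dependence on one
    side only. With [a = alpha / 2] and [b = 1 - alpha / 2], sums of two parameters produce both
    rates: [a + a = alpha] and [a + b = 1].

    The interface runs in direction [(a, b)], the characteristics of the two passage times in
    directions [(a^2, b^2)] and [(1, 1)]. As [a < b], it lies strictly between them, so that each
    maximal path stays on its own side; [ratio_gap] is the quantitative form.

    Exits are controlled by tilting: opposite changes of two groups of parameters are not felt by a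
    path through a given cell, but change the mean to first order. This takes an upper tail bound,
    which the determinant gives, and a lower one, which is drawn from the limit law itself. The
    contour integral of [k] converges only conditionally on a vertical line; that of [x * k x], with
    double poles, converges absolutely. *)

Section Calculus.
Context {R : realType}.
Local Notation mu := (@lebesgue_measure R).
Implicit Types (D : set R) (f g F : R -> R) (a b : R).

Lemma Rintegral_dct D (f_ : nat -> R -> R) f g : measurable D ->
  (forall n, measurable_fun D (f_ n)) ->
  (forall x, D x -> f_ n x @[n --> \oo] --> f x) ->
  mu.-integrable D (EFin \o g) ->
  (forall n x, D x -> `|f_ n x| <= g x) ->
  mu.-integrable D (EFin \o f) /\
  \int[mu]_(x in D) f_ n x @[n --> \oo] --> \int[mu]_(x in D) f x.
Proof.
move=> mD mf_ ff ig fg.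
have mf : measurable_fun D f by exact: (measurable_fun_cvg mf_ ff).
have [|||||i1 _ i3] := @dominated_convergence _ _ _ mu D mD (fun n => EFin \o f_ n)
  (EFin \o f) (EFin \o g).
- by move=> n; apply/measurable_EFinP; exact: mf_.
- by apply/measurable_EFinP; exact: mf.
- by apply: aeW => x Dx; apply: cvg_EFin; [exact: nearW|exact: ff].
- exact: ig.
- by apply: aeW => x n Dx; rewrite /= lee_fin fg.
split => //; apply: fine_cvg; rewrite fineK //.
exact: integrable_fin_num.
Qed.

Lemma continuous_mfun D f : continuous f -> measurable_fun D f.
Proof. by move=> cf; apply: measurable_funTS; exact: continuous_measurable_fun. Qed.

Lemma integrable_le D f g : measurable D -> measurable_fun D f ->
  (forall x, D x -> `|f x| <= g x) -> mu.-integrable D (EFin \o g) ->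
  mu.-integrable D (EFin \o f).
Proof.
move=> mD mf fg; apply: le_integrable => //; first exact/measurable_EFinP.
by move=> x Dx; rewrite /= lee_fin (le_trans (fg x Dx)) // ler_norm.
Qed.

Lemma Rintegral_le D f g : measurable D -> measurable_fun D f ->
  (forall x, D x -> `|f x| <= g x) -> mu.-integrable D (EFin \o g) ->
  `|\int[mu]_(x in D) f x| <= \int[mu]_(x in D) g x.
Proof.
move=> mD mf fg ig.
have if_ := integrable_le mD mf fg ig.
have H := @le_normr_Rintegral _ _ _ mu D f mD if_; apply: (le_trans H).
apply: le_Rintegral => //; exact: (integrable_norm if_).
Qed.

Lemma Rintegral_FTC f F a b : a <= b -> (forall x : R, is_derive x 1 F (f x)) ->
  continuous f -> \int[mu]_(x in `[a, b]) f x = F b - F a.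
Proof.
rewrite le_eqVlt => /predU1P[->|ab] dF cf.
  by rewrite set_itv1 Rintegral_set1 subrr.
have cF : continuous F.
  by move=> x; apply/differentiable_continuous/derivable1_diffP; exact: ex_derive.
rewrite /Rintegral (@continuous_FTC2 _ f F) //.
- exact: continuous_subspaceT.
- split; first by move=> x _; exact: ex_derive.
  + by apply: cvg_at_right_filter; exact: cF.
  + by apply: cvg_at_left_filter; exact: cF.
- by move=> x _; rewrite derive1E; apply: derive_val.
Qed.

Lemma integrable_continuous_itv f a b : continuous f ->
  mu.-integrable `[a, b] (EFin \o f).
Proof.
move=> cf; apply: continuous_compact_integrable; first exact: segment_compact.
exact: continuous_subspaceT.
Qed.

Lemma Rintegral_expand D f : measurable D -> mu.-integrable D (EFin \o f) ->
  \int[mu]_(x in D `&` `[- n%:R, n%:R]) f x @[n --> \oo] --> \int[mu]_(x in D) f x.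
Proof.
move=> mD if_.
have mf : measurable_fun D f by apply/measurable_EFinP; exact: measurable_int if_.
have -> : (fun n : nat => \int[mu]_(x in D `&` `[- n%:R, n%:R]) f x) =
   (fun n : nat => \int[mu]_(x in D) (f \_ `[- n%:R, n%:R]) x).
  by apply/funext => n; rewrite Rintegral_mkcondr.
apply: (proj2 (@Rintegral_dct D (fun n => f \_ `[- n%:R, n%:R]) f (fun x => `|f x|) mD _ _ _ _)).
- by move=> n; apply/measurable_restrict => //; apply: measurable_funS mf.
- move=> x _; apply: cvg_near_cst; near=> n.
  rewrite patchE mem_set //= in_itv /= -ler_norml.
  near: n; exact: nbhs_infty_ger.
- exact: (integrable_norm if_).
- by move=> n x _; rewrite patchE; case: ifP => //; rewrite normr0.
Unshelve. all: by end_near. Qed.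

Lemma integrableRZ D k f : measurable D -> mu.-integrable D (EFin \o f) ->
  mu.-integrable D (EFin \o (fun x => k * f x)).
Proof.
move=> mD /(@integrableZl _ _ R mu D mD k).
by apply: eq_integrable => // t _; rewrite /= EFinM.
Qed.

Lemma integrableRD D f g : measurable D -> mu.-integrable D (EFin \o f) ->
  mu.-integrable D (EFin \o g) -> mu.-integrable D (EFin \o (fun x => f x + g x)).
Proof. by move=> mD i1 /(@integrableD _ _ R mu D mD _ _ i1); apply: eq_integrable. Qed.

Lemma integrableRB D f g : measurable D -> mu.-integrable D (EFin \o f) ->
  mu.-integrable D (EFin \o g) -> mu.-integrable D (EFin \o (fun x => f x - g x)).
Proof. by move=> mD i1 /(@integrableB _ _ R mu D mD _ _ i1); apply: eq_integrable. Qed.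

(** The symmetry of nonnegative functions is applied to [|f|] and to [|f| + f], and the difference
    is taken. *)
Lemma Rintegral_even f : continuous f -> (forall x, f (- x) = f x) ->
  mu.-integrable setT (EFin \o f) ->
  \int[mu]_x f x = 2 * \int[mu]_(x in `[0, +oo[) f x.
Proof.
move=> cf ef if_.
have half (g : R -> R) : continuous g -> (forall x, 0 <= g x) -> (forall x, g (- x) = g x) ->
    mu.-integrable setT (EFin \o g) ->
    \int[mu]_x g x = 2 * \int[mu]_(x in `[0, +oo[) g x.
  move=> cg g0 eg ig; rewrite /Rintegral ge0_symfun_integralT //; last by move=> x /=; rewrite eg.
  rewrite -set_itvcy fineM //; apply: integrable_fin_num => //.
  exact: integrableS ig.
have cn : continuous (fun x => `|f x|) by move=> x; apply: cvg_norm; exact: cf.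
have in_ := integrable_norm if_.
have h1 := half (fun x => `|f x|) cn (fun x => normr_ge0 _) (fun x => congr1 _ (ef x)) in_.
have h2 := half (fun x => `|f x| + f x) _ _ _ _.
have {}h2 : \int[mu]_x (`|f x| + f x) = 2 * \int[mu]_(x in `[0, +oo[) (`|f x| + f x).
  apply: h2.
  - by move=> x; apply: cvgD; [exact: cn|exact: cf].
  - by move=> x; have := ler_norm (- f x); rewrite normrN; lra.
  - by move=> x; rewrite ef.
  - exact: integrableRD.
have sub g : mu.-integrable setT (EFin \o g) -> mu.-integrable `[0, +oo[ (EFin \o g).
  by apply: integrableS.
rewrite RintegralD // in h2; rewrite RintegralD // in h2; [|exact: sub|exact: sub].
apply: (addrI (\int[mu]_x `|f x|)); apply: (etrans h2).
by rewrite mulrDr; congr (_ + _); exact/esym.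
Qed.

End Calculus.

(** * Calculus of complex-valued functions of a real variable, by real and imaginary parts *)

Section ComplexValued.
Local Open Scope complex_scope.
Context {R : realType}.
Local Notation C := R[i].
Local Notation Re := complex.Re.
Local Notation Im := complex.Im.
Local Notation normc := Normc.normc.
Implicit Types (z w d : C) (F G : R -> C) (t : R).

Lemma ReM z w : Re (z * w) = Re z * Re w - Im z * Im w.
Proof. by case: z w => [a b] [c e]. Qed.
Lemma ImM z w : Im (z * w) = Re z * Im w + Im z * Re w.
Proof. by case: z w => [a b] [c e]. Qed.
Lemma ReD z w : Re (z + w) = Re z + Re w.
Proof. by case: z w => [a b] [c e]. Qed.
Lemma ImD z w : Im (z + w) = Im z + Im w.
Proof. by case: z w => [a b] [c e]. Qed.
Lemma ReN z : Re (- z) = - Re z. Proof. by case: z. Qed.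
Lemma ImN z : Im (- z) = - Im z. Proof. by case: z. Qed.
Definition csq z : R := Re z ^+ 2 + Im z ^+ 2.
Lemma ReV z : Re z^-1 = Re z / csq z.
Proof. by case: z. Qed.
Lemma ImV z : Im z^-1 = - Im z / csq z.
Proof. by case: z => a b /=; rewrite mulNr. Qed.

Lemma ceqP z w : Re z = Re w -> Im z = Im w -> z = w.
Proof. by case: z w => [a b] [c e] /= -> ->. Qed.

Lemma csq_gt0 z : z != 0 -> 0 < csq z.
Proof.
move=> z0; rewrite lt_neqAle /csq addr_ge0 ?sqr_ge0 // andbT eq_sym.
apply: contra z0; rewrite paddr_eq0 ?sqr_ge0 // !sqrf_eq0 => /andP[/eqP a /eqP b].
by apply/eqP/ceqP.
Qed.

Lemma normc_sq z : normc z ^+ 2 = csq z.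
Proof. by case: z => a b; rewrite sqr_sqrtr // addr_ge0 ?sqr_ge0. Qed.

Lemma normc_ge0 z : 0 <= normc z.
Proof. by case: z => a b; exact: sqrtr_ge0. Qed.

Lemma Re_le_normc z : `|Re z| <= normc z.
Proof.
rewrite -(ler_pXn2r (n := 2)) ?nnegrE ?normc_ge0 // normc_sq /csq real_normK ?num_real //.
by rewrite lerDl sqr_ge0.
Qed.

Lemma Im_le_normc z : `|Im z| <= normc z.
Proof.
rewrite -(ler_pXn2r (n := 2)) ?nnegrE ?normc_ge0 // normc_sq /csq real_normK ?num_real //.
by rewrite lerDr sqr_ge0.
Qed.

Lemma normc_le z : normc z <= `|Re z| + `|Im z|.
Proof.
rewrite -(ler_pXn2r (n := 2)) ?nnegrE ?normc_ge0 ?addr_ge0 // normc_sq /csq.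
rewrite sqrrD !real_normK ?num_real // lerD2r lerDl mulrn_wge0 // mulr_ge0 //.
Qed.

Definition cexp z : C :=
  (expR (Re z) * cos (Im z)) +i* (expR (Re z) * sin (Im z)).

Lemma cexpD z w : cexp (z + w) = cexp z * cexp w.
Proof.
apply: ceqP; rewrite ?ReM ?ImM /= ReD ImD expRD ?cosD ?sinD; ring.
Qed.

Lemma cexp0 : cexp 0 = 1.
Proof. by apply: ceqP; rewrite /= expR0 ?cos0 ?sin0 mul1r. Qed.

Lemma normc_cexp z : normc (cexp z) = expR (Re z).
Proof.
apply/eqP; rewrite -(eqrXn2 (n := 2)) ?normc_ge0 ?expR_ge0 //.
rewrite normc_sq /csq /= !exprMn -mulrDr cos2Dsin2 mulr1; exact/eqP.
Qed.

Definition ccont F := continuous (fun t => Re (F t)) /\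
  continuous (fun t => Im (F t)).

Lemma ccont_cst z : ccont (fun=> z).
Proof. by split; apply: cst_continuous. Qed.

Lemma ccontD F G : ccont F -> ccont G -> ccont (fun t => F t + G t).
Proof.
move=> [a b] [c d]; split => t.
  under [X in continuous_at _ X]funext => s do rewrite ReD.
  by apply: continuousD; [exact: a|exact: c].
under [X in continuous_at _ X]funext => s do rewrite ImD.
by apply: continuousD; [exact: b|exact: d].
Qed.

Lemma ccontN F : ccont F -> ccont (fun t => - F t).
Proof.
move=> [a b]; split => t.
  under [X in continuous_at _ X]funext => s do rewrite ReN.
  by apply: continuousN; exact: a.
under [X in continuous_at _ X]funext => s do rewrite ImN.
by apply: continuousN; exact: b.
Qed.

Lemma ccontM F G : ccont F -> ccont G -> ccont (fun t => F t * G t).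
Proof.
move=> [a b] [c d]; split => t.
  under [X in continuous_at _ X]funext => s do rewrite ReM.
  by apply: cvgB; apply: cvgM; [exact: a|exact: c|exact: b|exact: d].
under [X in continuous_at _ X]funext => s do rewrite ImM.
by apply: cvgD; apply: cvgM; [exact: a|exact: d|exact: b|exact: c].
Qed.

Lemma ccontV F : (forall t, F t != 0) -> ccont F -> ccont (fun t => (F t)^-1).
Proof.
move=> F0 [a b].
have cs t : {for t, continuous (fun s => (csq (F s))^-1)}.
  apply: continuousV; first by rewrite gt_eqF // csq_gt0.
  by rewrite /csq; apply: cvgD; rewrite !expr2; under eq_fun do rewrite expr2; apply: cvgM; [exact: a|exact: a|exact: b|exact: b].
split => t.
  under [X in continuous_at _ X]funext => s do rewrite ReV.
  by apply: cvgM; [exact: a|exact: cs].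
under [X in continuous_at _ X]funext => s do rewrite ImV.
by apply: cvgM; [apply: cvgN; exact: b|exact: cs].
Qed.

Lemma ccont_cexp F : ccont F -> ccont (fun t => cexp (F t)).
Proof.
move=> [a b]; split => t /=; apply: cvgM.
- by apply: continuous_comp; [exact: a|exact: continuous_expR].
- by apply: continuous_comp; [exact: b|exact: continuous_cos].
- by apply: continuous_comp; [exact: a|exact: continuous_expR].
- by apply: continuous_comp; [exact: b|exact: continuous_sin].
Qed.

Lemma ccont_sum (I : Type) (r : seq I) (F : I -> R -> C) :
  (forall i, ccont (F i)) -> ccont (fun t => \sum_(i <- r) F i t).
Proof.
move=> cF; elim: r => [|i r IH].
  by under [X in ccont X]funext => t do rewrite big_nil; exact: ccont_cst.
by under [X in ccont X]funext => t do rewrite big_cons; exact: ccontD.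
Qed.

Lemma ccont_prod (I : Type) (r : seq I) (F : I -> R -> C) :
  (forall i, ccont (F i)) -> ccont (fun t => \prod_(i <- r) F i t).
Proof.
move=> cF; elim: r => [|i r IH].
  by under [X in ccont X]funext => t do rewrite big_nil; exact: ccont_cst.
by under [X in ccont X]funext => t do rewrite big_cons; exact: ccontM.
Qed.

Definition cder F t d := is_derive t (1 : R) (fun s => Re (F s)) (Re d) /\
  is_derive t (1 : R) (fun s => Im (F s)) (Im d).

Lemma cder_cst z t : cder (fun=> z) t 0.
Proof. by split; apply: is_derive_cst. Qed.

Lemma cderD F G t d e : cder F t d -> cder G t e -> cder (fun s => F s + G s) t (d + e).
Proof.
move=> [a b] [a' b']; split.
  by under [X in is_derive _ _ X]funext => s do rewrite ReD; rewrite ReD; apply: is_deriveD.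
by under [X in is_derive _ _ X]funext => s do rewrite ImD; rewrite ImD; apply: is_deriveD.
Qed.

Lemma cderM F G t d e : cder F t d -> cder G t e ->
  cder (fun s => F s * G s) t (d * G t + F t * e).
Proof.
move=> [a b] [a' b']; split.
  under [X in is_derive _ _ X]funext => s do rewrite ReM.
  apply: is_derive_eq; rewrite -![_ *: _]/(_ * _) !(ReM, ReD, ImM, ImD).
  by move: (Re _) (Im _) (Re _) (Im _) (Re _) (Im _) (Re _) (Im _) => *; ring.
under [X in is_derive _ _ X]funext => s do rewrite ImM.
apply: is_derive_eq; rewrite -![_ *: _]/(_ * _) !(ReM, ReD, ImM, ImD).
by move: (Re _) (Im _) (Re _) (Im _) (Re _) (Im _) (Re _) (Im _) => *; ring.
Qed.

Lemma cderN F t d : cder F t d -> cder (fun s => - F s) t (- d).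
Proof.
move=> [a b]; split.
  by under [X in is_derive _ _ X]funext => s do rewrite ReN; rewrite ReN; apply: is_deriveN.
by under [X in is_derive _ _ X]funext => s do rewrite ImN; rewrite ImN; apply: is_deriveN.
Qed.

Lemma cderV F t d : F t != 0 -> cder F t d ->
  cder (fun s => (F s)^-1) t (- d / (F t) ^+ 2).
Proof.
move=> F0 [a b].
have c0 : csq (F t) != 0 by rewrite gt_eqF // csq_gt0.
have ds : is_derive t (1 : R) (fun s => (csq (F s))^-1)
   (- (csq (F t)) ^- 2 * (2 * Re (F t) * Re d + 2 * Im (F t) * Im d)).
  apply: (@is_deriveV R (fun s => csq (F s))) => //.
  rewrite /csq; apply: is_derive_eq; rewrite -![_ *: _]/(_ * _) /= ?expr1.
  by move: (Re _) (Im _) (Re _) (Im _) => *; ring.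
split.
  under [X in is_derive _ _ X]funext => s do rewrite ReV.
  apply: is_derive_eq; rewrite -![_ *: _]/(_ * _).
  rewrite !(ReM, ImM, ReV, ImV, ReN, ImN) /= /csq !(ReM, ImM).
  move: c0; rewrite /csq; move: (Re _) (Im _) (Re _) (Im _) => x y p q c0.
  have -> : (p * p - q * q) ^+ 2 + (p * q + q * p) ^+ 2 = (p ^+ 2 + q ^+ 2) ^+ 2 by ring.
  by field.
under [X in is_derive _ _ X]funext => s do rewrite ImV.
apply: is_derive_eq; rewrite -![_ *: _]/(_ * _).
rewrite !(ReM, ImM, ReV, ImV, ReN, ImN) /= /csq !(ReM, ImM).
move: c0; rewrite /csq; move: (Re _) (Im _) (Re _) (Im _) => x y p q c0.
have -> : (p * p - q * q) ^+ 2 + (p * q + q * p) ^+ 2 = (p ^+ 2 + q ^+ 2) ^+ 2 by ring.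
by field.
Qed.

Lemma cder_cexp F t d : cder F t d -> cder (fun s => cexp (F s)) t (d * cexp (F t)).
Proof.
move=> [a b].
have e1 : is_derive t (1:R) (fun s => expR (Re (F s))) (expR (Re (F t)) * Re d).
  by apply: is_derive_eq; rewrite mulrC.
have e2 : is_derive t (1:R) (fun s => cos (Im (F s))) (- sin (Im (F t)) * Im d).
  by apply: is_derive_eq; rewrite mulrC.
have e3 : is_derive t (1:R) (fun s => sin (Im (F s))) (cos (Im (F t)) * Im d).
  by apply: is_derive_eq; rewrite mulrC.
split; apply: is_derive_eq; rewrite -![_ *: _]/(_ * _) ?ReM ?ImM /=.
  by ring.
by ring.
Qed.

Lemma cder_eq F t d e : cder F t d -> d = e -> cder F t e.
Proof. by move=> h <-. Qed.

End ComplexValued.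

(** * Cauchy's theorem on a strip, in differentiated form *)

Section Cauchy.
Local Open Scope complex_scope.
Context {R : realType}.
Local Notation C := R[i].
Local Notation Re := complex.Re.
Local Notation Im := complex.Im.
Local Notation normc := Normc.normc.
Local Notation mu := (@lebesgue_measure R).

Lemma derive_ge0_le (f df : R -> R) (a b : R) : a <= b ->
  (forall x, a <= x <= b -> is_derive x (1 : R) f (df x)) ->
  (forall x, a <= x <= b -> 0 <= df x) -> f a <= f b.
Proof.
rewrite le_eqVlt => /predU1P[->//|ab] fd fp.
have [c cab e] : exists2 c, c \in `]a, b[ & f b - f a = df c * (b - a).
  apply: MVT => //.
    by move=> x /[!in_itv] /= /andP[/ltW ax /ltW xb]; apply: fd; rewrite ax xb.
  apply: derivable_within_continuous => x; rewrite in_itv /= => xab.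
  by have h := fd x xab; exact: ex_derive.
rewrite -subr_ge0 e mulr_ge0 ?subr_ge0 ?(ltW ab) // fp //.
by move: cab; rewrite in_itv /= => /andP[/ltW -> /ltW ->].
Qed.

Lemma is_derive_cont (f : R -> R) (x d : R) : is_derive x (1 : R) f d -> {for x, continuous f}.
Proof. by move=> h; apply/differentiable_continuous/derivable1_diffP; exact: ex_derive. Qed.

Lemma sin_le_id (x : R) : 0 <= x -> sin x <= x.
Proof.
move=> x0; rewrite -subr_ge0.
have -> : 0 = (fun y : R => y - sin y) 0 by rewrite /= sin0 subrr.
apply: (@derive_ge0_le (fun y => y - sin y) (fun y => 1 - cos y)) => // y _.
Qed.

Lemma cos_ge_quad (x : R) : 0 <= x -> 1 - x ^+ 2 <= cos x.
Proof.
move=> x0; rewrite -subr_ge0.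
have -> : 0 = (fun y : R => cos y - (1 - y ^+ 2)) 0 by rewrite /= cos0 expr0n /= subr0 subrr.
apply: (@derive_ge0_le (fun y => cos y - (1 - y ^+ 2)) (fun y => 2 * y - sin y)) => // y.
  move=> _; apply: is_derive_eq; rewrite -![_ *: _]/(_ * _) /=; ring.
by move=> /andP[y0 _]; have := sin_le_id y0; lra.
Qed.

Lemma sin_cubic (x : R) : `|sin x - x| <= `|x| ^+ 3.
Proof.
wlog x0 : x / 0 <= x.
  move=> H; have [|/ltW x0] := lerP 0 x; first exact: H.
  by have := H (- x); rewrite oppr_ge0 sinN normrN -opprD normrN; apply.
have h1 := sin_le_id x0.
rewrite distrC ger0_norm ?subr_ge0 // ger0_norm // -subr_ge0.
have -> : 0 = (fun y : R => y ^+ 3 - (y - sin y)) 0 by rewrite /= sin0 expr0n /= !subrr.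
apply: (@derive_ge0_le (fun y => y ^+ 3 - (y - sin y)) (fun y => 3 * y ^+ 2 - (1 - cos y))) => // y.
  move=> _; apply: is_derive_eq; rewrite -![_ *: _]/(_ * _) /=; ring.
move=> /andP[y0 _]; have := cos_ge_quad y0; have := sqr_ge0 y; lra.
Qed.

Lemma sin_abs_le (x : R) : `|sin x| <= `|x|.
Proof.
wlog x0 : x / 0 <= x.
  move=> H; have [|/ltW x0] := lerP 0 x; first exact: H.
  by have := H (- x); rewrite oppr_ge0 sinN !normrN; apply.
rewrite (ger0_norm x0) ler_norml sin_le_id // andbT.
have -> : - x = (fun y : R => sin y + y) 0 - x by rewrite /= sin0 addr0 sub0r.
rewrite lerBlDr.
apply: (@derive_ge0_le (fun y => sin y + y) (fun y => cos y + 1)) => //.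
Qed.

Lemma integrable_oneDsqr : mu.-integrable setT (EFin \o (fun t : R => (1 + t ^+ 2)^-1)).
Proof.
have c : continuous (fun t : R => (1 + t ^+ 2)^-1) by exact: continuous_oneDsqrV.
have p (t : R) : 0 <= (1 + t ^+ 2)^-1 by rewrite invr_ge0 addr_ge0 // sqr_ge0.
apply/integrableP; split.
  by apply/measurable_EFinP; exact: continuous_mfun.
under eq_integral do rewrite /= ger0_norm //.
rewrite ge0_symfun_integralT //; last by move=> x /=; rewrite sqrrN.
rewrite -set_itvcy (_ : (\int[_]_(x in _) _)%E = (pi / 2)%:E); last exact: integral0y_oneDsqr.
by rewrite -EFinM ltry.
Qed.

(** Cauchy's theorem without contours: differentiating under the integral leaves [Re D], which by
    the Cauchy-Riemann equations (the factor ['i]) is also the derivative of [Im F] along the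
    vertical line, so only the two horizontal ends remain. Lines of integration are then shifted by
    estimating these ends. *)
Lemma cauchy_strip (F D : R -> R -> C) (c d T1 T2 M : R) : T1 <= T2 ->
  (forall s t, c < s < d -> cder (F^~ t) s (D s t)) ->
  (forall s t, c < s < d -> cder (F s) t ('i * D s t)) ->
  (forall s, c < s < d -> ccont (D s)) ->
  (forall s t, c < s < d -> T1 <= t <= T2 -> normc (D s t) <= M) ->
  forall s, c < s < d ->
  is_derive s (1 : R) (fun s => \int[mu]_(t in `[T1, T2]) Re (F s t))
     (Im (F s T2) - Im (F s T1)).
Proof.
move=> TT Fs Ft cD bD s scd.
have Ii x : `]c, d[%classic x -> c < x < d by rewrite /= in_itv.
have cF x : c < x < d -> continuous (fun t => Re (F x t)).
  by move=> xcd t; have [h _] := Ft x t xcd; exact: is_derive_cont h.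
have iF x : `]c, d[%classic x -> mu.-integrable `[T1, T2] (EFin \o (fun t => Re (F x t))).
  by move=> /Ii xcd; exact/integrable_continuous_itv/cF.
have dF x t : `]c, d[%classic x -> `[T1, T2]%classic t -> derivable (fun x => Re (F x t)) x 1.
  by move=> /Ii xcd _; have [h _] := Fs x t xcd; exact: ex_derive.
have iG : mu.-integrable `[T1, T2] (EFin \o (fun=> `|M|)).
  by apply: integrable_continuous_itv; exact: cst_continuous.
have e x t : c < x < d -> partial1of2 (fun x t => Re (F x t)) x t = Re (D x t).
  by move=> xcd; rewrite partial1of2E; have [h _] := Fs x t xcd; exact: derive_val.
have bG x t : `]c, d[%classic x -> `[T1, T2]%classic t ->
    `|partial1of2 (fun x t => Re (F x t)) x t| <= `|M|.
  move=> /Ii xcd; rewrite /= in_itv /= => tT.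
  rewrite e //; apply: (le_trans (Re_le_normc _)); apply: (le_trans (bD _ _ xcd tT)).
  exact: ler_norm.
have sI : `]c, d[%classic s by rewrite /= in_itv.
have mI : measurable (`[T1, T2]%classic : set R) by [].
have G0 (t : R) : 0 <= `|M| by [].
have h1 := @derivable_under_integral R _ _ mu (fun s t => Re (F s t)) _ mI s c d sI iF dF (fun=> `|M|) G0 iG bG.
have h2 := @differentiation_under_integral R _ _ mu (fun s t => Re (F s t)) _ mI s c d sI iF dF (fun=> `|M|) G0 iG bG.
apply: DeriveDef; first exact: h1.
have dI t : is_derive t (1 : R) (fun t => Im (F s t)) (Re (D s t)).
  by have [_] := Ft s t scd; rewrite ImM /= mul0r mul1r add0r.
have cR : continuous (fun t => Re (D s t)) by have [] := cD s scd.
rewrite -derive1E h2 -(Rintegral_FTC TT dI cR).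
by apply: eq_Rintegral => t _; rewrite e.
Qed.
End Cauchy.

(** * Vertical line integrals of a double pole *)

Section Fourier.
Local Open Scope complex_scope.
Context {R : realType}.
Local Notation C := R[i].
Local Notation Re := complex.Re.
Local Notation Im := complex.Im.
Local Notation normc := Normc.normc.
Local Notation mu := (@lebesgue_measure R).
Implicit Types (x s t a : R).

(** A double pole makes the integral over a vertical line absolutely convergent, where a simple one
    would leave it conditionally convergent. The price is the factor [x] in [ker_fourier]. *)
Definition pole2 x s t : C := cexp (- (s +i* t) * x%:C) / (s +i* t) ^+ 2.

Lemma cplx_neq0 s t : s != 0 -> (s +i* t) != 0 :> C.
Proof. by apply: contra => /eqP [-> _]. Qed.

Lemma csqE s t : csq (s +i* t) = s ^+ 2 + t ^+ 2. Proof. by []. Qed.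

Lemma normcX2 (z : C) : normc (z ^+ 2) = csq z.
Proof. by rewrite expr2 Normc.normcM -expr2 normc_sq. Qed.

Lemma normc_pole2 x s t : normc (pole2 x s t) = expR (- (s * x)) / (s ^+ 2 + t ^+ 2).
Proof.
rewrite Normc.normcM Normc.normcV normcX2 csqE normc_cexp.
by rewrite ReM ReN ImN /= mulr0 subr0 mulNr.
Qed.

Lemma cder_line_re s t : cder (fun s => s +i* t) s 1.
Proof. by split => /=; [exact: is_derive_id|exact: is_derive_cst]. Qed.

Lemma cder_line_im s t : cder (fun t => s +i* t) t 'i.
Proof. by split => /=; [exact: is_derive_cst|exact: is_derive_id]. Qed.

Lemma ccont_line s : ccont (fun t => s +i* t).
Proof. by split => t /=; [exact: cvg_cst|exact: cvg_id]. Qed.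

Definition dpole2 x s t : C := - x%:C * pole2 x s t - 2 * (pole2 x s t / (s +i* t)).

Lemma cder_pole2 (z : R -> C) (w : C) x u : z u != 0 -> cder z u w ->
  cder (fun u => cexp (- z u * x%:C) / z u ^+ 2) u
   (w * (- x%:C * (cexp (- z u * x%:C) / z u ^+ 2) - 2 * (cexp (- z u * x%:C) / z u ^+ 2 / z u))).
Proof.
move=> z0 dz.
have d1 : cder (fun u => cexp (- z u * x%:C)) u (- w * x%:C * cexp (- z u * x%:C)).
  apply: cder_eq; first apply: (@cder_cexp _ (fun u => - z u * x%:C) u (- w * x%:C)) => //.
  apply: cder_eq.
    apply: (@cderM _ (fun u => - z u) (fun=> x%:C) _ (- w) 0); last exact: cder_cst.
    exact: cderN.
    by ring.
  by [].
have d2 : cder (fun u => (z u ^+ 2)^-1) u (- (2 * w * z u) / (z u ^+ 2) ^+ 2).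
  apply: cderV; first by rewrite expf_neq0.
  by apply: cder_eq; first (apply: cderM; exact: dz); ring.
apply: cder_eq; first apply: (cderM d1 d2).
by cbv beta; move: (cexp (- z u * x%:C)) => E; move: (z u) z0 => Z Z0; field.
Qed.

Lemma ccont_pole2 x s : s != 0 -> ccont (pole2 x s).
Proof.
move=> s0; apply: ccontM.
  apply: ccont_cexp; apply: ccontM; last exact: ccont_cst.
  exact/ccontN/ccont_line.
apply: ccontV; first by move=> t; rewrite expf_neq0 // cplx_neq0.
by apply: ccontM; exact: ccont_line.
Qed.

Lemma inv_sqrD_le s t : s != 0 -> (s ^+ 2 + t ^+ 2)^-1 <= (1 + (s ^+ 2)^-1) * (1 + t ^+ 2)^-1.
Proof.
move=> s0; have mm : 0 < s ^+ 2 by rewrite exprn_even_gt0.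
rewrite ler_pdivlMr; last by rewrite ltr_wpDr ?sqr_ge0.
rewrite mulrC ler_pdivrMr; last by rewrite ltr_wpDr ?sqr_ge0.
have -> : (1 + (s ^+ 2)^-1) * (s ^+ 2 + t ^+ 2) = s ^+ 2 + t ^+ 2 + 1 + t ^+ 2 / s ^+ 2.
  by field.
have := sqr_ge0 t; have : 0 <= t ^+ 2 / s ^+ 2 by rewrite divr_ge0 ?sqr_ge0.
by have := ltW mm; lra.
Qed.

Lemma integrable_lorentz (k : R) : mu.-integrable setT (EFin \o (fun t => k * (1 + t ^+ 2)^-1)).
Proof.
have := @integrableZl _ _ R mu setT measurableT k _ (@integrable_oneDsqr R).
by apply: eq_integrable => // t _; rewrite /= EFinM.
Qed.

Lemma Re_pole2_le x s t : s != 0 ->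
  `|Re (pole2 x s t)| <= expR (- (s * x)) * (1 + (s ^+ 2)^-1) * (1 + t ^+ 2)^-1.
Proof.
move=> s0; apply: (le_trans (Re_le_normc _)); rewrite normc_pole2 -mulrA.
by rewrite ler_pM2l ?expR_gt0 // inv_sqrD_le.
Qed.

Lemma integrable_pole2 x s : s != 0 -> mu.-integrable setT (EFin \o (fun t => Re (pole2 x s t))).
Proof.
move=> s0; have [c1 _] := ccont_pole2 x s0.
apply: (@integrable_le R setT _ (fun t => (expR (- (s * x)) * (1 + (s ^+ 2)^-1)) * (1 + t ^+ 2)^-1)) => //.
- exact: continuous_mfun.
- by move=> t _; exact: Re_pole2_le.
- exact: integrable_lorentz.
Qed.

(** The bound [m] keeps the strip away from the pole at [0]. By [cauchy_strip] the integrals over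
    [[-n, n]] differ only by the horizontal ends, which are of order [1 / n^2]. *)
Lemma Rintegral_pole2_const (x c d m : R) : 0 < m -> 0 < x ->
  (forall s, c < s < d -> m <= `|s|) ->
  forall s1 s2, c < s1 -> s1 <= s2 -> s2 < d ->
  \int[mu]_t Re (pole2 x s1 t) = \int[mu]_t Re (pole2 x s2 t).
Proof.
move=> m0 x0 hm s1 s2 cs1 s12 s2d.
pose K := expR ((`|c| + `|d|) * x).
have m2 s : c < s < d -> m ^+ 2 <= s ^+ 2.
  move=> /hm h; rewrite -[s ^+ 2]real_normK ?num_real //.
  by rewrite ler_pXn2r // nnegrE ltW.
have sn0 s : c < s < d -> s != 0.
  by move=> /hm h; rewrite -normr_gt0 (lt_le_trans m0).
have bK s : c < s < d -> expR (- (s * x)) <= K.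
  move=> /andP[cs sd]; rewrite ler_expR -mulNr ler_pM2r //.
  have := ler_norm (- c); have := normr_ge0 d; rewrite normrN; lra.
have pos s t : c < s < d -> 0 < s ^+ 2 + t ^+ 2.
  by move=> /m2 h; rewrite ltr_wpDr ?sqr_ge0 // (lt_le_trans _ h) // exprn_gt0.
have bF s t : c < s < d -> normc (pole2 x s t) <= K / (m ^+ 2 + t ^+ 2).
  move=> h; rewrite normc_pole2; apply: ler_pM.
  - exact: expR_ge0.
  - by rewrite invr_ge0 ltW // pos.
  - exact: bK.
  - have p1 : 0 < m ^+ 2 + t ^+ 2 by rewrite ltr_wpDr ?sqr_ge0 // exprn_gt0.
    by rewrite lef_pV2 ?posrE ?(pos _ _ h) // lerD2r m2.
have bF0 s t : c < s < d -> normc (pole2 x s t) <= K / m ^+ 2.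
  move=> h; apply: (le_trans (bF s t h)).
  have p1 : 0 < m ^+ 2 + t ^+ 2 by rewrite ltr_wpDr ?sqr_ge0 // exprn_gt0.
  by rewrite ler_pM2l ?expR_gt0 // lef_pV2 ?posrE ?exprn_gt0 // lerDl sqr_ge0.
have cP s : c < s < d -> ccont (pole2 x s) by move=> /sn0; exact: ccont_pole2.
have iP s (h : c < s < d) := integrable_pole2 x (sn0 s h).
have c12 : c < s1 < d by rewrite cs1 (le_lt_trans s12).
have c22 : c < s2 < d by rewrite s2d andbT (lt_le_trans cs1).
pose H n s := \int[mu]_(t in `[- n%:R, n%:R]) Re (pole2 x s t).
have HI s : c < s < d -> H n s @[n --> \oo] --> \int[mu]_t Re (pole2 x s t).
  move=> h; have := @Rintegral_expand R setT _ measurableT (iP s h).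
  by apply: cvg_trans; apply: near_eq_cvg; near=> n; rewrite setTI.
have dH n s : c < s < d -> is_derive s (1:R) (H n)
    (Im (pole2 x s n%:R) - Im (pole2 x s (- n%:R))).
  move=> h.
  have h1 s' t : c < s' < d -> cder ((pole2 x)^~ t) s' (dpole2 x s' t).
    move=> h'; apply: cder_eq.
      by apply: (@cder_pole2 (fun s => s +i* t)); [exact/cplx_neq0/sn0|exact: cder_line_re].
    by rewrite mul1r.
  have h2 s' t : c < s' < d -> cder (pole2 x s') t ('i * dpole2 x s' t).
    move=> h'.
    by apply: (@cder_pole2 (fun t => s' +i* t)); [exact/cplx_neq0/sn0|exact: cder_line_im].
  have h3 s' : c < s' < d -> ccont (dpole2 x s').
    move=> h'; apply: ccontD.
      by apply: ccontM; [exact: ccont_cst|exact: cP].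
    apply: ccontN; apply: ccontM; first exact: ccont_cst.
    apply: ccontM; first exact: cP.
    apply: ccontV; first by move=> t; rewrite cplx_neq0 // sn0.
    exact: ccont_line.
  have h4 s' t : c < s' < d -> - n%:R <= t <= n%:R ->
      normc (dpole2 x s' t) <= x * (K / m ^+ 2) + 2 * (K / m ^+ 2 / m).
    move=> h' _; rewrite /dpole2; have B := bF0 s' t h'.
    move: (pole2 x s' t) B => P B; apply: (le_trans (le_normcD _ _)).
    rewrite normcN !Normc.normcM Normc.normcV normcN.
    have -> : normc x%:C = x by rewrite /= expr0n addr0 sqrtr_sqr ger0_norm // ltW.
    have -> : normc (2 : C) = 2.
      by rewrite (_ : 2 = (2 : R)%:C) /= ?expr0n ?addr0 ?sqrtr_sqr ?ger0_norm // rmorph_nat.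
    apply: lerD; first by rewrite ler_pM2l.
    rewrite ler_pM2l //; apply: ler_pM; rewrite ?normc_ge0 ?invr_ge0 ?normc_ge0 //.
    rewrite lef_pV2 ?posrE //; last first.
      rewrite lt_neqAle normc_ge0 andbT eq_sym; apply: contra (sn0 _ h') => /eqP /Normc.eq0_normc.
      by move=> [->].
    by apply: (le_trans (hm _ h')); apply: (le_trans _ (Re_le_normc _)).
  exact: (@cauchy_strip R (pole2 x) (dpole2 x) c d (- n%:R) n%:R _ (ge0_cp (ler0n _ n)).2 h1 h2 h3 h4 s h).
have bH n : `|H n s2 - H n s1| <= (s2 - s1) * (2 * K / (m ^+ 2 + n%:R ^+ 2)).
  (* The sign [(-1) ^+ e] covers both halves of the absolute value; the monotonicity of [B * s]
     minus the signed integral replaces a mean value inequality. *)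
  have key (e : bool) : (-1) ^+ e * (H n s2 - H n s1) <= (s2 - s1) * (2 * K / (m ^+ 2 + n%:R ^+ 2)).
    pose B := 2 * K / (m ^+ 2 + n%:R ^+ 2).
    have := @derive_ge0_le R (fun s => B * s - (-1) ^+ e * H n s)
      (fun s => B - (-1) ^+ e * (Im (pole2 x s n%:R) - Im (pole2 x s (- n%:R)))) s1 s2 s12.
    move=> /(_ _ _)/le_trans; rewrite -/B => L.
    suff : B * s1 - (-1) ^+ e * H n s1 <= B * s2 - (-1) ^+ e * H n s2 by lra.
    apply: (L _ _ _ (lexx _)).
    - move=> s /andP[h1 h2].
      have hh : c < s < d by rewrite (lt_le_trans cs1) // (le_lt_trans h2).
      have := dH n s hh => ?; apply: is_derive_eq; rewrite -![_ *: _]/(_ * _); ring.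
    - move=> s /andP[h1 h2].
      have hh : c < s < d by rewrite (lt_le_trans cs1) // (le_lt_trans h2).
      rewrite subr_ge0 (le_trans (ler_norm _)) // normrM normrX normrN1 expr1n mul1r.
      apply: (le_trans (ler_normB _ _)); rewrite /B -mulrA mulr_natl mulr2n.
      apply: lerD; apply: (le_trans (Im_le_normc _)); first exact: bF.
      by have := bF s (- n%:R) hh; rewrite sqrrN.
  have := key true; have := key false; rewrite expr0 expr1 mul1r mulN1r => k0 k1.
  by rewrite ler_norml k0 andbT lerNl.
have lim0 : (s2 - s1) * (2 * K / (m ^+ 2 + n%:R ^+ 2)) @[n --> \oo] --> (0 : R).
  have -> : (0 : R) = (s2 - s1) * (2 * K * 0) by rewrite !mulr0.
  apply: cvgM; first exact: cvg_cst.
  apply: cvgM; first exact: cvg_cst.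
  apply/gtr0_cvgV0.
    by near=> n; rewrite ltr_wpDr ?sqr_ge0 // exprn_gt0.
  apply/cvgryPge => A; near=> n.
  apply: (@le_trans _ _ (n%:R ^+ 2)); last by rewrite lerDr sqr_ge0.
  apply: (@le_trans _ _ n%:R).
    by near: n; exact: nbhs_infty_ger.
  rewrite expr2 ler_peMl ?ler0n // ler1n.
  by near: n; exact: nbhs_infty_gt.
have L : `|H n s2 - H n s1| @[n --> \oo] -->
    `|\int[mu]_t Re (pole2 x s2 t) - \int[mu]_t Re (pole2 x s1 t)|.
  by apply: cvg_norm; apply: cvgB; [exact: HI|exact: HI].
have E : `|\int[mu]_t Re (pole2 x s2 t) - \int[mu]_t Re (pole2 x s1 t)| <= 0.
  apply: (ler_cvg_to L lim0); by near=> n; exact: bH.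
by apply/esym/eqP; rewrite -subr_eq0 -normr_le0.
Unshelve. all: by end_near. Qed.

Let K0 : R := \int[mu]_t (1 + t ^+ 2)^-1.

Lemma Rintegral_lorentz k : \int[mu]_t (k * (1 + t ^+ 2)^-1) = k * K0.
Proof. by rewrite RintegralZl //; exact: integrable_oneDsqr. Qed.

Lemma K0_ge0 : 0 <= K0.
Proof. by apply: Rintegral_ge0 => t _; rewrite invr_ge0 addr_ge0 // sqr_ge0. Qed.

(** The line may be moved to the right without meeting the pole, and on [Re z = n] the factor
    [e^(- n x)] makes the integral small; [n] is chosen so large that the bound falls below a
    supposed nonzero value. *)
Lemma Rintegral_pole2_right x s : 0 < x -> 0 < s -> \int[mu]_t Re (pole2 x s t) = 0.
Proof.
move=> x0 s0; apply/eqP; rewrite -normr_le0 leNgt; apply/negP => I0.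
set I := \int[mu]_t _ in I0.
pose n := (Num.truncn (s + 1 + 2 * K0 / (`|I| * x))).+1.
have nlt : s + 1 + 2 * K0 / (`|I| * x) < n%:R by rewrite /n truncnS_gt.
have q0 : 0 <= 2 * K0 / (`|I| * x) by rewrite divr_ge0 ?mulr_ge0 ?K0_ge0 // ltW.
have n1 : 1 < n%:R :> R by lra.
have sn : s <= n%:R by lra.
have n0 : n%:R != 0 :> R by rewrite gt_eqF // (lt_trans _ n1).
have e : I = \int[mu]_t Re (pole2 x n%:R t).
  apply: (@Rintegral_pole2_const x (s / 2) (n%:R + 1) (s / 2)) => //; try lra.
  move=> u /andP[u1 u2]; rewrite ger0_norm; lra.
have : `|I| <= expR (- (n%:R * x)) * (1 + (n%:R ^+ 2)^-1) * K0.
  rewrite e -Rintegral_lorentz; apply: Rintegral_le => //.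
  - by apply: continuous_mfun; have [] := ccont_pole2 x n0.
  - by move=> t _; exact: Re_pole2_le.
  - exact: integrable_lorentz.
apply/negP; rewrite -ltNge.
have e1 : expR (- (n%:R * x)) <= (n%:R * x)^-1.
  have nx : 0 < n%:R * x by rewrite mulr_gt0 //; lra.
  rewrite expRN lef_pV2 ?posrE ?expR_gt0 //.
  by have := expR_ge1Dx (n%:R * x); lra.
have e2 : (1 + (n%:R ^+ 2)^-1 : R) <= 2.
  have : (n%:R ^+ 2)^-1 <= 1 :> R by rewrite invf_le1 ?exprn_gt0 ?exprn_ege1 //; lra.
  lra.
apply: (@le_lt_trans _ _ ((n%:R * x)^-1 * 2 * K0)).
  apply: ler_wpM2r; first exact: K0_ge0.
  by apply: ler_pM => //; rewrite ?expR_ge0 // addr_ge0 // invr_ge0 sqr_ge0.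
have nx : 0 < n%:R * x by rewrite mulr_gt0 //; lra.
rewrite -mulrA mulrC ltr_pdivrMr //.
have : 2 * K0 / (`|I| * x) < n%:R by lra.
by rewrite ltr_pdivrMr ?mulr_gt0 // => h; rewrite mulrCA.
Qed.

(** This integral stands in for the residue at the double pole: its value does not depend on [a],
    and the primitive [G] is elementary. *)
Lemma Rintegral_sqr_lorentz a x : 0 < a ->
  mu.-integrable setT (EFin \o (fun t => 4 * a * x * t ^+ 2 / (a ^+ 2 + t ^+ 2) ^+ 2)) /\
  \int[mu]_t (4 * a * x * t ^+ 2 / (a ^+ 2 + t ^+ 2) ^+ 2) = 2 * pi * x.
Proof.
move=> a0; have an0 : a != 0 by rewrite gt_eqF.
have d0 t : 0 < a ^+ 2 + t ^+ 2 by rewrite ltr_wpDr ?sqr_ge0 // exprn_gt0.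
have dn0 t : a ^+ 2 + t ^+ 2 != 0 by rewrite gt_eqF.
have cf : continuous (fun t => 4 * a * x * t ^+ 2 / (a ^+ 2 + t ^+ 2) ^+ 2).
  have cq : continuous (fun t : R => t ^+ 2) by move=> t; exact: exprn_continuous.
  move=> t; apply: cvgM; first by apply: cvgM; [exact: cvg_cst|exact: cq].
  apply: cvgV; first by rewrite expf_neq0.
  under eq_fun do rewrite expr2.
  by rewrite expr2; apply: cvgM; apply: cvgD; [exact: cvg_cst|exact: cq|exact: cvg_cst|exact: cq].
have if_ : mu.-integrable setT (EFin \o (fun t => 4 * a * x * t ^+ 2 / (a ^+ 2 + t ^+ 2) ^+ 2)).
  apply: (@integrable_le R setT _ (fun t => `|4 * a * x| * (1 + (a ^+ 2)^-1) * (1 + t ^+ 2)^-1)) => //.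
  - exact: continuous_mfun.
  - move=> t _; rewrite -[X in `|X|]mulrA normrM -[X in _ <= X]mulrA ler_wpM2l ?normr_ge0 //.
    apply: le_trans (inv_sqrD_le t an0).
    rewrite ger0_norm ?divr_ge0 ?sqr_ge0 //.
    by rewrite ler_pdivrMr ?exprn_gt0 // [X in _ * X]expr2 mulrA mulVf // mul1r lerDr sqr_ge0.
  - exact: integrable_lorentz.
split => //.
pose G t := x * (- (2 * a) * (t / (a ^+ 2 + t ^+ 2)) + 2 * atan (t / a)).
have dG t : is_derive t (1 : R) G (4 * a * x * t ^+ 2 / (a ^+ 2 + t ^+ 2) ^+ 2).
  have dV : is_derive t (1 : R) (fun t => (a ^+ 2 + t ^+ 2)^-1) (- (a ^+ 2 + t ^+ 2) ^- 2 * (2 * t)).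
    apply: (@is_deriveV R (fun t => a ^+ 2 + t ^+ 2)) => //.
    by apply: is_derive_eq; rewrite -![_ *: _]/(_ * _) /=; ring.
  have dA : is_derive t (1 : R) (fun t => atan (t / a)) ((1 + (t / a) ^+ 2)^-1 * a^-1).
    apply: (@is_derive1_comp R atan (fun t => t / a)).
    by apply: is_derive_eq; rewrite -![_ *: _]/(_ * _) /=; ring.
  apply: is_derive_eq; rewrite -![_ *: _]/(_ * _) /=.
  have n1 : 1 + (t / a) ^+ 2 != 0 by rewrite gt_eqF // ltr_wpDr ?sqr_ge0.
  have n2 := dn0 t.
  by field; rewrite an0 n2.
have GN t : G (- t) = - G t by rewrite /G sqrrN !mulNr atanN; ring.
have L := @Rintegral_expand R setT _ measurableT if_.
have L2 : (fun n : nat => 2 * G n%:R) @ \oo --> 2 * pi * x.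
  have -> : 2 * pi * x = 2 * (x * (- (2 * a) * 0 + 2 * (pi / 2))) by field.
  apply: cvgM; first exact: cvg_cst.
  apply: cvgM; first exact: cvg_cst.
  apply: cvgD; (apply: cvgM; first exact: cvg_cst).
    apply: (@squeeze_cvgr _ _ _ _ (cst 0) (fun n => n%:R^-1)).
    - near=> n; rewrite /= divr_ge0 ?ler0n ?(ltW (d0 _)) //=.
      have n0 : 0 < n%:R :> R by rewrite ltr0n; near: n; exact: nbhs_infty_gt.
      rewrite ler_pdivrMr ?d0 //.
      have -> : n%:R^-1 * (a ^+ 2 + n%:R ^+ 2) = a ^+ 2 / n%:R + n%:R by field; rewrite gt_eqF.
      by rewrite lerDr divr_ge0 ?sqr_ge0 ?ler0n.
    - exact: cvg_cst.
    - apply/gtr0_cvgV0; last exact: cvgr_idn.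
      by near=> n; rewrite ltr0n; near: n; exact: nbhs_infty_gt.
  apply: (@cvg_comp _ _ _ (fun n : nat => n%:R / a) atan \oo (+oo%R)); last exact: cvgy_atan.
  apply/cvgryPge => A; near=> n; rewrite ler_pdivlMr //.
  by near: n; exact: nbhs_infty_ger.
have E : (fun n : nat => \int[mu]_(y in setT `&` `[- n%:R, n%:R]) (4 * a * x * y ^+ 2 / (a ^+ 2 + y ^+ 2) ^+ 2)) =
    (fun n : nat => 2 * G n%:R).
  apply/funext => n; rewrite setTI (Rintegral_FTC (F := G)) //; last by rewrite ge0_cp.
  by rewrite GN; ring.
rewrite E in L; exact: (cvg_unique (@norm_hausdorff _ _) L L2).
Unshelve. all: by end_near. Qed.

(** Instead of a residue theorem, the integral on [Re z = - a] is compared with the vanishing one on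
    [Re z = a]. Up to exponential factors the difference is the integral of [S a], in which
    [sin (t x)] may be replaced by [t x] at a cost of order [a]. Then [a] tends to [0], while the
    integral in question stays constant. *)
Lemma Rintegral_pole2_left x s : 0 < x -> s < 0 -> \int[mu]_t Re (pole2 x s t) = 2 * pi * x.
Proof.
move=> x0 s0.
pose S a t := 4 * a * t * sin (t * x) / (a ^+ 2 + t ^+ 2) ^+ 2.
have ES a t : 0 < a -> expR (a * x) * S a t =
   Re (pole2 x (- a) t) - expR (a * x) * expR (a * x) * Re (pole2 x a t).
  move=> a0; have d0 : a ^+ 2 + t ^+ 2 != 0.
    by rewrite gt_eqF // ltr_wpDr ?sqr_ge0 // exprn_gt0.
  rewrite /pole2 !(ReM, ImM, ReV, ImV, ReN, ImN) /= /csq !(ReM, ImM) /=.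
  rewrite !mulr0 !subr0 !opprK ?add0r ?addr0 !mulNr cosN sinN expRN.
  have e0 : expR (a * x) != 0 by rewrite gt_eqF ?expR_gt0.
  have -> : (a * a - t * t) ^+ 2 + (a * t + t * a) ^+ 2 = (a ^+ 2 + t ^+ 2) ^+ 2 by ring.
  have -> : (- (a * - a) - t * t) ^+ 2 + (- (a * t) + t * - a) ^+ 2 = (a ^+ 2 + t ^+ 2) ^+ 2 by ring.
  rewrite /S; have D0 : (a ^+ 2 + t ^+ 2) ^+ 2 != 0 by rewrite expf_neq0.
  move: (expR _) e0 (sin _) (cos _) ((a ^+ 2 + t ^+ 2) ^+ 2) D0 => E e0 U V D D0.
  by field; rewrite D0 e0.

have bS a t : 0 < a -> `|S a t - 4 * a * x * t ^+ 2 / (a ^+ 2 + t ^+ 2) ^+ 2| <=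
    4 * a * (x ^+ 3 + 2 * x) * (1 + t ^+ 2)^-1.
  move=> a0; have d0 : 0 < a ^+ 2 + t ^+ 2 by rewrite ltr_wpDr ?sqr_ge0 // exprn_gt0.
  have t1 : 0 < 1 + t ^+ 2 by rewrite ltr_wpDr ?sqr_ge0.
  have -> : S a t - 4 * a * x * t ^+ 2 / (a ^+ 2 + t ^+ 2) ^+ 2 =
     4 * a * (t * (sin (t * x) - t * x)) / (a ^+ 2 + t ^+ 2) ^+ 2.
    by rewrite /S; field; rewrite gt_eqF.
  rewrite normrM [`|(_ ^+ 2)^-1|]ger0_norm ?invr_ge0 ?sqr_ge0 // ler_pdivrMr ?exprn_gt0 //.
  rewrite [X in _ <= X](_ : _ = 4 * a * ((x ^+ 3 + 2 * x) * (a ^+ 2 + t ^+ 2) ^+ 2 / (1 + t ^+ 2))); last first.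
    by ring.
  have a4 : 0 < 4 * a by rewrite mulr_gt0.
  rewrite normrM [`|4 * a|]gtr0_norm // ler_pM2l // ler_pdivlMr //.
  have tt : t ^+ 2 = `|t| ^+ 2 by rewrite real_normK ?num_real.
  have s1 : `|sin (t * x) - t * x| <= `|t| ^+ 3 * x ^+ 3.
    by apply: (le_trans (sin_cubic _)); rewrite normrM exprMn (gtr0_norm x0).
  have s2 : `|sin (t * x) - t * x| <= 2 * `|t| * x.
    have p := sin_abs_le (t * x).
    apply: (le_trans (ler_normB _ _)); move: p; rewrite normrM (gtr0_norm x0); lra.
  rewrite normrM tt mulrDr mulr1.
  apply: (@le_trans _ _ ((x ^+ 3 + 2 * x) * `|t| ^+ 4)).
    rewrite mulrDl; apply: lerD.
      rewrite [X in _ <= X](_ : _ = `|t| * (`|t| ^+ 3 * x ^+ 3)); last by ring.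
      by rewrite ler_wpM2l.
    rewrite [X in X <= _](_ : _ = `|t| ^+ 3 * `|sin (t * x) - t * x|); last by ring.
    rewrite [X in _ <= X](_ : _ = `|t| ^+ 3 * (2 * `|t| * x)); last by ring.
    by rewrite ler_wpM2l // exprn_ge0.
  rewrite ler_wpM2l //; first by rewrite addr_ge0 ?mulr_ge0 ?exprn_ge0 // ltW.
  have -> : `|t| ^+ 4 = (`|t| ^+ 2) ^+ 2 by ring.
  rewrite ler_pXn2r ?nnegrE ?addr_ge0 ?sqr_ge0 //.
  by rewrite lerDr sqr_ge0.
have IS a : 0 < a -> \int[mu]_t Re (pole2 x (- a) t) = expR (a * x) * \int[mu]_t S a t /\
    `|\int[mu]_t S a t - 2 * pi * x| <= 4 * a * (x ^+ 3 + 2 * x) * K0.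
  move=> a0; have an0 : a != 0 by rewrite gt_eqF.
  have nan0 : - a != 0 by rewrite oppr_eq0.
  have i1 := integrable_pole2 x nan0.
  have i2 := integrable_pole2 x an0.
  have i2' := integrableRZ (expR (a * x) * expR (a * x)) measurableT i2.
  have [i3 e3] := Rintegral_sqr_lorentz x a0.
  have SE t : S a t = expR (- (a * x)) *
      (Re (pole2 x (- a) t) - expR (a * x) * expR (a * x) * Re (pole2 x a t)).
    by rewrite -ES // mulrA -expRD addNr expR0 mul1r.
  have iD := integrableRB measurableT i1 i2'.
  have iS : mu.-integrable setT (EFin \o (fun t => S a t)).
    have := integrableRZ (expR (- (a * x))) measurableT iD.
    by apply: eq_integrable => // t _; rewrite /= SE.
  split.
    transitivity (\int[mu]_t (expR (a * x) * S a t)); last by rewrite RintegralZl.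
    have -> : (fun t => expR (a * x) * S a t) = (fun t => Re (pole2 x (- a) t) -
        expR (a * x) * expR (a * x) * Re (pole2 x a t)) by apply/funext => t; exact: ES.
    apply/esym; apply: (etrans (@RintegralB _ _ R mu setT _ _ measurableT i1 i2')).
    have e0 := @RintegralZl _ _ R mu setT _ (expR (a * x) * expR (a * x)) measurableT i2.
    rewrite (_ : \int[mu]_u (expR (a * x) * expR (a * x) * Re (pole2 x a u)) = 0) ?subr0 //.
    by apply: (etrans e0); rewrite Rintegral_pole2_right ?mulr0.
  rewrite -e3 -RintegralB // -Rintegral_lorentz.
  apply: Rintegral_le => //.
  - have h := integrableRB measurableT iS i3; apply/measurable_EFinP; exact: measurable_int h.
  - by move=> t _; exact: bS.
  - exact: integrable_lorentz.
have Ia n : \int[mu]_t Re (pole2 x s t) = expR (n.+1%:R^-1 * x) * \int[mu]_t S n.+1%:R^-1 t.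
  have a0 : 0 < n.+1%:R^-1 :> R by rewrite invr_gt0.
  rewrite -(IS _ a0).1; move: (n.+1%:R^-1) a0 => v v0.
  have [le1|/ltW le1] := lerP s (- v).
    apply: (@Rintegral_pole2_const x (s - 1) (- v / 2) (v / 2)) => //; try lra.
    by move=> u /andP[u1 u2]; rewrite ltr0_norm; lra.
  apply/esym; apply: (@Rintegral_pole2_const x (- v - 1) (s / 2) (- s / 2)) => //; try lra.
  by move=> u /andP[u1 u2]; rewrite ltr0_norm; lra.
have v0 : n.+1%:R^-1 @[n --> \oo] --> (0 : R) by exact: cvg_harmonic.
have LS : \int[mu]_t S n.+1%:R^-1 t @[n --> \oo] --> 2 * pi * x.
  apply/subr_cvg0; apply: norm_cvg0.
  apply: (@squeeze_cvgr _ _ _ _ (cst 0) (fun n => n.+1%:R^-1 * (4 * (x ^+ 3 + 2 * x) * K0))).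
  - near=> n; rewrite normr_ge0 /=.
    have a0 : 0 < n.+1%:R^-1 :> R by rewrite invr_gt0.
    apply: (le_trans (IS _ a0).2); rewrite le_eqVlt; apply/orP; left; apply/eqP; ring.
  - exact: cvg_cst.
  - rewrite -[X in _ --> X](mul0r (4 * (x ^+ 3 + 2 * x) * K0)).
    by apply: cvgM v0 _; exact: cvg_cst.
have LE : expR (n.+1%:R^-1 * x) @[n --> \oo] --> (1 : R).
  have h : n.+1%:R^-1 * x @[n --> \oo] --> (0 : R).
    by rewrite -[X in _ --> X](mul0r x); apply: cvgM v0 _; exact: cvg_cst.
  by have := cvg_comp _ _ h (@continuous_expR R 0); rewrite expR0.
have E : (expR (n.+1%:R^-1 * x) * \int[mu]_t S n.+1%:R^-1 t) @[n --> \oo] --> \int[mu]_t Re (pole2 x s t).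
  by under eq_fun do rewrite -Ia; exact: cvg_cst.
have Lim : expR (n.+1%:R^-1 * x) * \int[mu]_t S n.+1%:R^-1 t @[n --> \oo] --> 1 * (2 * pi * x).
  exact: cvgM LE LS.
by rewrite -[RHS]mul1r; exact: (cvg_unique (@norm_hausdorff _ _) E Lim).
Unshelve. all: by end_near. Qed.

End Fourier.

(** * The finite kernel and its Airy limit *)

Section PartialFractions.
Context {F : fieldType} (N : nat) (b : 'I_N -> F).
Hypothesis binj : injective b.
Hypothesis bopp : forall i j, b i + b j != 0.

(** The coefficient of [1 / (b j - z)] in the partial fraction expansion of the product of the
    [(b l + z) / (b l - z)]. *)
Definition pf_coef (j : 'I_N) : F :=
  2 * b j * \prod_(l < N | l != j) ((b j + b l) / (b l - b j)).

Let P : {poly F} := \prod_(l < N) ('X - (- b l)%:P).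
Let Q : {poly F} := \prod_(l < N) ('X - (b l)%:P).
Let Qj j : {poly F} := \prod_(l < N | l != j) ('X - (b l)%:P).
Let d j : F := P.[b j] / (Qj j).[b j].

Let QjE j : Q = ('X - (b j)%:P) * Qj j.
Proof. by rewrite /Q (bigD1 j). Qed.

Let Qjn0 j : (Qj j).[b j] != 0.
Proof.
rewrite horner_prod prodf_seq_neq0; apply/allP => l _; apply/implyP => lj.
by rewrite hornerXsubC subr_eq0; apply: contra lj => /eqP/binj ->.
Qed.

(** The expansion of [P / Q] with denominators cleared: [P] and [Q] are monic of degree [N], so the
    difference of the two sides has degree less than [N], and it vanishes at the [N] distinct points
    [b j]. *)
Let PE : P = Q + \sum_j d j *: Qj j.
Proof.
apply/eqP; rewrite -subr_eq0; apply/eqP.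
set D := P - _.
have sP : size P = N.+1 by rewrite /P size_prod_XsubC /index_enum -enumT size_enum_ord.
have sQ : size Q = N.+1 by rewrite /Q size_prod_XsubC /index_enum -enumT size_enum_ord.
have lP : P`_N = 1.
  have /monicP := monic_prod_XsubC (index_enum 'I_N) xpredT (fun l => - b l).
  by rewrite /lead_coef -/P sP.
have lQ : Q`_N = 1.
  have /monicP := monic_prod_XsubC (index_enum 'I_N) xpredT b.
  by rewrite /lead_coef -/Q sQ.
have sj j : (size (Qj j) <= N)%N.
  have := sQ; rewrite (QjE j) mulrC size_Mmonic ?monicXsubC //; last first.
    by apply: contraTneq (Qjn0 j) => ->; rewrite horner0 eqxx.
  by rewrite size_XsubC addn2 /= => -[->].
have sD : (size D <= N)%N.
  apply/leq_sizeP => i; rewrite leq_eqVlt => /orP[/eqP <-|Ni].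
    rewrite /D coefB coefD lP lQ coef_sum big1 ?addr0 ?subrr // => j _.
    by rewrite coefZ [X in _ * X]nth_default ?mulr0.
  rewrite nth_default // (leq_trans _ Ni) // /D.
  rewrite (leq_trans (size_polyD _ _)) // geq_max sP leqnn size_polyN.
  rewrite (leq_trans (size_polyD _ _)) // geq_max sQ leqnn.
  rewrite (leq_trans (size_sum _ _ _)) //; apply/bigmax_leqP => j _.
  by rewrite (leq_trans (size_scale_leq _ _)) // (leq_trans (sj j)).
have rD j : root D (b j).
  apply/rootP; rewrite /D hornerD hornerN hornerD horner_sum (bigD1 j) //= big1 => [|l lj].
    by rewrite hornerZ /d divfK // (QjE j) hornerM hornerXsubC subrr mul0r add0r addr0 subrr.
  rewrite hornerZ /Qj horner_prod (bigD1 j) 1?eq_sym //=.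
  by rewrite hornerXsubC subrr mul0r mulr0.
apply: (@roots_geq_poly_eq0 _ _ (map b (enum 'I_N))).
- by apply/allP => x /mapP[j _ ->].
- by rewrite map_inj_uniq // enum_uniq.
- by rewrite size_map size_enum_ord.
Qed.

Let deriv_prodXsub (r : 'I_N -> F) (s : seq 'I_N) z : (forall l, z != r l) ->
  (\prod_(l <- s) ('X - (r l)%:P))^`().[z] =
  (\prod_(l <- s) ('X - (r l)%:P)).[z] * \sum_(l <- s) (z - r l)^-1.
Proof.
move=> zr; elim: s => [|l s IH]; first by rewrite !big_nil derivC horner0 mulr0.
have zl : z - r l != 0 by rewrite subr_eq0.
rewrite !big_cons derivM hornerD !hornerM IH derivXsubC hornerXsubC hornerE.
by field.
Qed.

(** Both sides are the derivative of the product of the [(b l + z) / (b l - z)]: on the left its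
    partial fractions are differentiated term by term, on the right the product is differentiated
    logarithmically. *)
Lemma partial_fractions_sqr (z : F) : (forall l, z != b l) -> (forall l, z != - b l) ->
  \sum_j pf_coef j / (b j - z) ^+ 2 =
  \prod_l ((b l + z) / (b l - z)) * \sum_l (2 * b l / (b l ^+ 2 - z ^+ 2)).
Proof.
move=> zb zbN.
have Qz : Q.[z] != 0.
  by rewrite horner_prod prodf_seq_neq0; apply/allP => l _; rewrite hornerXsubC subr_eq0 zb.
have E : P^`().[z] * Q.[z] - P.[z] * Q^`().[z] = - \sum_j d j * (Qj j).[z] ^+ 2.
  rewrite PE derivD raddf_sum !hornerD !horner_sum.
  have -> : forall x y u v : F, (x + y) * u - (u + v) * x = y * u - v * x by move=> *; ring.
  rewrite !mulr_suml -sumrB -sumrN; apply: eq_bigr => j _.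
  rewrite [(_ (d j *: Qj j)).[z]](_ : _ = (d j *: Qj j)^`().[z]) // derivZ !hornerZ (QjE j) derivM derivXsubC mul1r hornerD !hornerM !hornerXsubC.
  ring.
have dP := deriv_prodXsub (index_enum 'I_N) zbN.
have dQ := deriv_prodXsub (index_enum 'I_N) zb.
rewrite -/P in dP; rewrite -/Q in dQ.
have cE j : pf_coef j = - (-1) ^+ N * d j.
  have PjE : P.[b j] = 2 * b j * \prod_(l < N | l != j) (b j + b l).
    rewrite /P horner_prod (bigD1 j) //= hornerXsubC opprK -mulr2n -[b j *+ 2]mulr_natl; congr (_ * _).
    by apply: eq_bigr => l _; rewrite hornerXsubC opprK.
  rewrite /pf_coef /d PjE.
  have -> : (Qj j).[b j] = (-1) ^+ N.-1 * \prod_(l < N | l != j) (b l - b j).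
    rewrite horner_prod.
    under eq_bigr => l _ do rewrite hornerXsubC -opprB -mulN1r.
    rewrite big_split /= prodr_const; congr (_ ^+ _ * _).
    by rewrite cardC1 card_ord.
  have N0 : (0 < N)%N by exact: leq_ltn_trans (leq0n _) (ltn_ord j).
  rewrite prodf_div.
  have -> : (-1) ^+ N = - (-1) ^+ N.-1 :> F by rewrite -{1}(prednK N0) exprS mulN1r.
  rewrite opprK invfM; set A := \prod_(l < N | _) (b j + b l); set B := (\prod_(l < N | _) (b l - b j))^-1.
  have s2 : (-1) ^+ N.-1 * ((-1) ^+ N.-1)^-1 = 1 :> F by rewrite divff // signr_eq0.
  rewrite (_ : (-1) ^+ N.-1 * (2 * b j * A * (((-1) ^+ N.-1)^-1 * B)) =
     ((-1) ^+ N.-1 * ((-1) ^+ N.-1)^-1) * (2 * b j * (A * B))); last by ring.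
  by rewrite s2 mul1r.
have QjE2 j : (b j - z)^-1 ^+ 2 = (Qj j).[z] ^+ 2 / Q.[z] ^+ 2.
  have zj : z - b j != 0 by rewrite subr_eq0.
  have qz : (Qj j).[z] != 0.
    by apply: contraNneq Qz; rewrite (QjE j) hornerM => ->; rewrite mulr0.
  rewrite (QjE j) hornerM hornerXsubC; field.
  by rewrite qz zj -oppr_eq0 opprB zj.
transitivity ((-1) ^+ N * (P^`().[z] * Q.[z] - P.[z] * Q^`().[z]) / Q.[z] ^+ 2).
  rewrite E mulrN -mulNr mulr_sumr mulr_suml; apply: eq_bigr => j _.
  by rewrite cE -exprVn QjE2 !mulrA.
rewrite dP dQ.
have -> : \prod_l ((b l + z) / (b l - z)) = (-1) ^+ N * (P.[z] / Q.[z]).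
  rewrite /P /Q !horner_prod prodf_div.
  under eq_bigr => l _ do rewrite addrC -[b l]opprK -hornerXsubC.
  under [X in _ / X]eq_bigr => l _ do rewrite -opprB -mulN1r -hornerXsubC.
  rewrite big_split /= prodr_const card_ord invfM -signr_odd.
  by case: (odd _); rewrite ?expr1 ?expr0 ?invrN ?invr1; ring.
have -> : \sum_l (2 * b l / (b l ^+ 2 - z ^+ 2)) = \sum_l (z - - b l)^-1 - \sum_l (z - b l)^-1.
  rewrite -sumrB; apply: eq_bigr => l _.
  have z1 : z - b l != 0 by rewrite subr_eq0.
  have z2 : z + b l != 0 by rewrite -[b l]opprK subr_eq0.
  have z3 : b l ^+ 2 - z ^+ 2 != 0 by rewrite subr_sqr mulf_neq0 // ?[b l + z]addrC // -oppr_eq0 opprB.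
  rewrite opprK; field; rewrite z1 z2 z3 //.
by field.
Qed.

End PartialFractions.

(** * The kernel as an integral over a vertical line *)

Section Kernel.
Local Open Scope complex_scope.
Context {R : realType}.
Local Notation C := R[i].
Local Notation Re := complex.Re.
Local Notation Im := complex.Im.
Local Notation normc := Normc.normc.
Local Notation mu := (@lebesgue_measure R).

Lemma Rintegral_bigsum (D : set R) (I : Type) (r : seq I) (f : I -> R -> R) : measurable D ->
  (forall i, mu.-integrable D (EFin \o f i)) ->
  mu.-integrable D (EFin \o (fun x => \sum_(i <- r) f i x)) /\
  \int[mu]_(x in D) (\sum_(i <- r) f i x) = \sum_(i <- r) \int[mu]_(x in D) f i x.
Proof.
move=> mD if_; elim: r => [|i r [IH1 IH2]].
  have e : (fun x : R => \sum_(i <- [::]) f i x) = cst 0 by apply/funext => x; rewrite big_nil.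
  rewrite e big_nil Rintegral_cst // mul0r; split => //.
  exact: (@integrable0 _ _ R mu D).
have e : (fun x : R => \sum_(j <- i :: r) f j x) = (fun x => f i x + \sum_(j <- r) f j x).
  by apply/funext => x; rewrite big_cons.
rewrite e big_cons -IH2; split; first exact: integrableRD.
exact: (@RintegralD _ _ R mu D _ _ mD (if_ i) IH1).
Qed.

Variables (N : nat) (b : 'I_N -> R).

Definition ker (x : R) : R := \sum_j pf_coef b j * expR (- (b j * x)).
Definition cPhi (z : C) : C := \prod_l (((b l)%:C + z) / ((b l)%:C - z)).
Definition cPsi (z : C) : C := \sum_l (2 * (b l)%:C / ((b l)%:C ^+ 2 - z ^+ 2)).

Hypothesis binj : injective b.
Hypothesis b0 : forall l, 0 < b l.

Lemma pf_coefC j : pf_coef (fun l => (b l)%:C) j = (pf_coef b j)%:C.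
Proof.
rewrite /pf_coef rmorphM rmorphM /= rmorph_prod; congr (_ * _ * _).
  by rewrite rmorph_nat.
by apply: eq_bigr => l _; rewrite rmorphM fmorphV /= rmorphD rmorphB.
Qed.

Lemma ker_integrand (s t : R) : 0 < s -> (forall l, s < b l) ->
  cPhi (s +i* t) * cPsi (s +i* t) = \sum_j (pf_coef b j)%:C / ((b j)%:C - (s +i* t)) ^+ 2.
Proof.
move=> s0 sb; rewrite /cPhi /cPsi -(@partial_fractions_sqr _ _ (fun l => (b l)%:C)).
- by apply: eq_bigr => j _; rewrite pf_coefC.
- by move=> i j /complexI /binj.
- by move=> l; rewrite eq_complex /= negb_and lt_eqF.
- by move=> l; rewrite eq_complex /= negb_and gt_eqF // (lt_trans _ s0) // oppr_lt0.
Qed.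

(** Each exponential of [ker] comes from a double pole at [b j], to the right of the line
    [Re z = s]. The factor [x] is later divided out against the size of [cPsi]. *)
Lemma ker_fourier (s x : R) : 0 < x -> 0 < s -> (forall l, s < b l) ->
  2 * pi * (x * ker x) =
  \int[mu]_t Re (cexp (- (s +i* t) * x%:C) * (cPhi (s +i* t) * cPsi (s +i* t))).
Proof.
move=> x0 s0 sb.
pose f j t := pf_coef b j * expR (- (b j * x)) * Re (pole2 x (s - b j) t).
have sn j : s - b j < 0 by rewrite subr_lt0.
have if_ j : mu.-integrable setT (EFin \o f j).
  by apply: integrableRZ => //; apply: integrable_pole2; rewrite lt_eqF.
have e t : Re (cexp (- (s +i* t) * x%:C) * (cPhi (s +i* t) * cPsi (s +i* t))) = \sum_j f j t.
  rewrite ker_integrand // mulr_sumr.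
  have Rsum (r : seq 'I_N) (g : 'I_N -> C) : Re (\sum_(j <- r) g j) = \sum_(j <- r) Re (g j).
    by elim: r => [|j r IH]; rewrite ?big_nil // !big_cons ReD IH.
  rewrite Rsum; apply: eq_bigr => j _; rewrite /f /pole2.
  have -> : cexp (- (s +i* t) * x%:C) * ((pf_coef b j)%:C / ((b j)%:C - (s +i* t)) ^+ 2) =
     (pf_coef b j * expR (- (b j * x)))%:C * (cexp (- ((s - b j) +i* t) * x%:C) / ((s - b j) +i* t) ^+ 2).
    have -> : (b j)%:C - (s +i* t) = - ((s - b j) +i* t) by apply: ceqP; rewrite /= ?opprB ?sub0r.
    rewrite sqrrN.
    have -> : (pf_coef b j * expR (- (b j * x)))%:C = (pf_coef b j)%:C * cexp ((- (b j * x))%:C).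
      by apply: ceqP; rewrite !(ReM, ImM) /= ?cos0 ?sin0; ring.
    have E0 : cexp ((- (b j * x))%:C) * cexp (- ((s - b j) +i* t) * x%:C) = cexp (- (s +i* t) * x%:C).
      by rewrite -cexpD; congr cexp; apply: ceqP; rewrite !(ReD, ImD, ReM, ImM, ReN, ImN) /=; ring.
    by rewrite -E0; move: (cexp _) (cexp _) ((_ ^+ 2)^-1) => X Y Z; ring.
  by rewrite ReM /= mul0r subr0.
under eq_Rintegral => t _ do rewrite e.
rewrite (Rintegral_bigsum (index_enum 'I_N) measurableT if_).2 /ker 2!mulr_sumr.
apply: eq_bigr => j _.
have i1 : mu.-integrable setT (EFin \o (fun t => Re (pole2 x (s - b j) t))).
  by apply: integrable_pole2; rewrite lt_eqF.
rewrite (@RintegralZl _ _ R mu setT _ _ measurableT i1) Rintegral_pole2_left //; ring.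
Qed.

(** The logarithm of the left side is [2 artanh y = 2 y + 2 y^3 / 3 + ...]; the generous cubic
    coefficient absorbs the rest of the series up to [y = 1/2]. *)
Lemma artanh_le (y : R) : 0 <= y -> y <= 2^-1 -> (1 + y) / (1 - y) <= expR (2 * y + 2 * y ^+ 3).
Proof.
move=> y0 y2.
rewrite -[X in X <= _]lnK; last by rewrite posrE divr_gt0 //; lra.
rewrite ler_expR ln_div ?posrE //; [|lra|lra].
pose F y := 2 * y + 2 * y ^+ 3 - (ln (1 + y) - ln (1 - y)) : R.
pose dF y := 2 + 6 * y ^+ 2 - ((1 + y)^-1 + (1 - y)^-1) : R.
have F0 : F 0 = 0 by rewrite /F addr0 subr0 ln1 expr0n /=; ring.
suff : F 0 <= F y by rewrite F0 /F; lra.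
have dF1 u : 0 <= u <= y -> is_derive u (1 : R) F (dF u).
  move=> /andP[u0 u1].
  have d1 : is_derive u (1 : R) (fun y => ln (1 + y)) (1 + u)^-1.
    have p : 0 < 1 + u by lra.
    have := is_derive1_ln p => h.
    have := @is_derive1_comp R (@ln R) (fun y => 1 + y) u (1 + u)^-1 1 h _.
    rewrite mulr1 => H; apply: H.
    by rewrite -[X in is_derive _ _ _ X]add0r; change (is_derive u (1 : R) ((cst 1 : R -> R) + id) (0 + 1)); exact: is_deriveD.
  have d2 : is_derive u (1 : R) (fun y => ln (1 - y)) (- (1 - u)^-1).
    have p : 0 < 1 - u by lra.
    have := is_derive1_ln p => h.
    have := @is_derive1_comp R (@ln R) (fun y => 1 - y) u (1 - u)^-1 (-1) h _.
    rewrite mulrN1 => H; apply: H.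
    by rewrite -[X in is_derive _ _ _ X]sub0r; change (is_derive u (1 : R) ((cst 1 : R -> R) - id) (0 - 1)); exact: is_deriveB.
  by rewrite /F; apply: is_derive_eq; rewrite -![_ *: _]/(_ * _) /dF /=; ring.
apply: (derive_ge0_le y0 dF1) => u /andP[u0 u1].
have p1 : 1 + u != 0 by lra.
have p2 : 1 - u != 0 by lra.
have p3 : 0 < 1 - u ^+ 2 by nra.
rewrite /dF; have -> : 2 + 6 * u ^+ 2 - ((1 + u)^-1 + (1 - u)^-1) =
   (4 * u ^+ 2 - 6 * u ^+ 4) / (1 - u ^+ 2).
  by field; rewrite p1 p2 gt_eqF.
rewrite divr_ge0 ?(ltW p3) //.
have -> : 4 * u ^+ 2 - 6 * u ^+ 4 = u ^+ 2 * (4 - 6 * u ^+ 2) by ring.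
by rewrite mulr_ge0 ?sqr_ge0 //; nra.
Qed.

End Kernel.

(** * Uniform bound of the normalised kernel, on the line [Re z = 1] *)

Section KernelBound.
Local Open Scope complex_scope.
Context {R : realType}.
Local Notation C := R[i].
Local Notation Re := complex.Re.
Local Notation Im := complex.Im.
Local Notation normc := Normc.normc.
Local Notation mu := (@lebesgue_measure R).

Lemma normc_prod (I : Type) (r : seq I) (F : I -> C) :
  normc (\prod_(i <- r) F i) = \prod_(i <- r) normc (F i).
Proof. exact: (big_morph _ (@Normc.normcM R) (@Normc.normc1 R)). Qed.

Lemma expR_bigsum (I : Type) (r : seq I) (F : I -> R) :
  expR (\sum_(i <- r) F i) = \prod_(i <- r) expR (F i).
Proof. exact: (big_morph _ (@expRD R) (@expR0 R)). Qed.

Lemma normc_bigsum (I : Type) (r : seq I) (F : I -> C) :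
  normc (\sum_(i <- r) F i) <= \sum_(i <- r) normc (F i).
Proof.
elim: r => [|i r IH]; first by rewrite !big_nil Normc.normc0.
by rewrite !big_cons (le_trans (le_normcD _ _)) // lerD2l.
Qed.

Lemma normcR (x : R) : normc x%:C = `|x|.
Proof. by rewrite /= expr0n addr0 sqrtr_sqr. Qed.

Lemma normc_le_sq (z : C) (x : R) : 0 <= x -> csq z <= x ^+ 2 -> normc z <= x.
Proof. by move=> x0 h; rewrite -(ler_pXn2r (n := 2)) ?nnegrE ?normc_ge0 // normc_sq. Qed.

Lemma normc_ge_sq (z : C) (x : R) : 0 <= x -> x ^+ 2 <= csq z -> x <= normc z.
Proof. by move=> x0 h; rewrite -(ler_pXn2r (n := 2)) ?nnegrE ?normc_ge0 // normc_sq. Qed.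

Lemma csqM (z w : C) : csq (z * w) = csq z * csq w.
Proof. by rewrite /csq ReM ImM; ring. Qed.

Lemma csqV (z : C) : csq z^-1 = (csq z)^-1.
Proof. by rewrite -!normc_sq Normc.normcV exprVn. Qed.

Definition lor : R := \int[mu]_t (1 + t ^+ 2)^-1.

Variables (N : nat) (b : 'I_N -> R) (q rho : R).
Hypothesis binj : injective b.
Hypothesis q4 : 4 <= q.
Hypothesis rho1 : 1 <= rho.
Hypothesis bq : forall l, q <= b l <= rho * q.
Hypothesis b3 : 2 * \sum_l (b l ^+ 3)^-1 = 1.
Let m : R := \sum_l (b l)^-1.
Let B t : R := q ^+ 2 / (q ^+ 2 + t ^+ 2).

Let b_ge4 l : 4 <= b l. Proof. by have /andP[h _] := bq l; exact: le_trans q4 h. Qed.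
Let q2 : 0 < q ^+ 2. Proof. by rewrite exprn_gt0 //; have := q4; lra. Qed.

(** The normalisation [b3] fixes the sum of the [b^-3], and [1 / b >= q^2 / b^3]. Hence the mean
    outgrows every fixed coordinate [eta] as [q] grows. *)
Lemma ker_mean_ge : q ^+ 2 / 2 <= m.
Proof.
have -> : q ^+ 2 / 2 = \sum_l (q ^+ 2 * (b l ^+ 3)^-1).
  rewrite -mulr_sumr; have := b3; move: (\sum_l _) => S h.
  by have -> : S = 2^-1 by lra.
apply: ler_sum => l _; have q4' := q4; have q2' := q2; have b4 := b_ge4 l; have /andP[h _] := bq l.
have bl0 : 0 < b l by lra.
rewrite ler_pdivrMr ?exprn_gt0 //.
have -> : (b l)^-1 * b l ^+ 3 = b l ^+ 2 by field; rewrite gt_eqF.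
by rewrite ler_pXn2r // nnegrE; lra.
Qed.

(** The squared modulus of a factor is [(1 + y) / (1 - y)] with [y = 2 b / (b^2 + 1 + t^2)]. The
    order [1 / b] sums to [2 m]; the decay in [t] comes with the weight [b^-3], whose sum is
    normalised. [B t] is the smallest of the [b^2 / (b^2 + t^2)] with [b >= q], which is the rate at
    which this decay saturates for [t] beyond [q]. *)
Lemma cPhi_bound t : normc (cPhi b (1 +i* t)) <= expR (2 * m + 4 - t ^+ 2 * B t).
Proof.
have -> : 2 * m + 4 - t ^+ 2 * B t =
    \sum_l (2 * (b l)^-1 + (8 - 2 * (t ^+ 2 * B t)) * (b l ^+ 3)^-1).
  rewrite big_split /= -!mulr_sumr -/m; have := b3; move: (\sum_l _) => S h.
  have -> : S = 2^-1 by lra.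
  by field.
rewrite /cPhi normc_prod expR_bigsum; apply: ler_prod => l _.
rewrite normc_ge0 andTb; have q4' := q4; have q2' := q2; have b4 := b_ge4 l; have /andP[h1 h2] := bq l.
have t2 := sqr_ge0 t.
have bl0 : 0 < b l by lra.
have b2 : 0 < b l ^+ 2 by rewrite exprn_gt0.
pose A := b l ^+ 2 + 1 + t ^+ 2.
have A0 : 0 < A by rewrite /A; lra.
pose y := 2 * b l / A.
have y0 : 0 <= y by rewrite /y divr_ge0 ?(ltW A0) //; lra.
have bt : 0 < b l ^+ 2 + t ^+ 2 by lra.
have yle : y <= 2 * (b l)^-1 - 2 * t ^+ 2 / (b l * (b l ^+ 2 + t ^+ 2)).
  have -> : 2 * (b l)^-1 - 2 * t ^+ 2 / (b l * (b l ^+ 2 + t ^+ 2)) = 2 * b l / (b l ^+ 2 + t ^+ 2).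
    by field; rewrite !gt_eqF.
  rewrite /y ler_pM2l; last by lra.
  by rewrite lef_pV2 ?posrE // /A; lra.
have yb : y <= 2 / b l.
  apply: (le_trans yle); rewrite lerBlDr lerDl divr_ge0 //; first by rewrite mulr_ge0.
  by rewrite ltW // mulr_gt0.
have y12 : y <= 2^-1.
  by apply: (le_trans yb); rewrite ler_pdivrMr //; lra.
have y3 : y ^+ 3 <= 8 * (b l ^+ 3)^-1.
  have -> : 8 * (b l ^+ 3)^-1 = (2 / b l) ^+ 3 by field; rewrite gt_eqF.
  by rewrite ler_pXn2r // nnegrE divr_ge0 // ltW.
have tB : 2 * (t ^+ 2 * B t) * (b l ^+ 3)^-1 <= 2 * t ^+ 2 / (b l * (b l ^+ 2 + t ^+ 2)).
  have -> : 2 * t ^+ 2 / (b l * (b l ^+ 2 + t ^+ 2)) =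
     2 * (t ^+ 2 * (b l ^+ 2 / (b l ^+ 2 + t ^+ 2))) * (b l ^+ 3)^-1.
    by field; rewrite !gt_eqF //; lra.
  rewrite ler_wpM2r ?invr_ge0 ?exprn_ge0 ?(ltW bl0) //.
  rewrite ler_pM2l // ler_wpM2l // /B.
  rewrite ler_pdivrMr; last by lra.
  rewrite mulrAC ler_pdivlMr; last by lra.
  rewrite !mulrDr [X in _ + X <= _]mulrC [X in X + _ <= _]mulrC lerD2l [X in _ <= X]mulrC ler_wpM2l //.
  by rewrite ler_pXn2r // nnegrE; lra.
apply: (@le_trans _ _ (expR (y + y ^+ 3))); last by rewrite ler_expR; lra.
apply: normc_le_sq; first exact: expR_ge0.
have -> : expR (y + y ^+ 3) ^+ 2 = expR (2 * y + 2 * y ^+ 3).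
  by rewrite expr2 -expRD; congr expR; ring.
apply: le_trans (artanh_le y0 y12).
rewrite csqM csqV /csq !(ReD, ImD, ReN, ImN) /= add0r sub0r sqrrN.
have e1 : (b l + 1) ^+ 2 + t ^+ 2 = A * (1 + y) by rewrite /y /A; field; rewrite -/A gt_eqF.
have e2 : (b l - 1) ^+ 2 + t ^+ 2 = A * (1 - y) by rewrite /y /A; field; rewrite -/A gt_eqF.
rewrite e1 e2 le_eqVlt; apply/orP; left; apply/eqP; field.
by apply/andP; split; rewrite gt_eqF //; lra.
Qed.

Lemma cPsi_bound t : normc (cPsi b (1 +i* t)) <= 4 * rho ^+ 2 * m * B t.
Proof.
apply: (le_trans (normc_bigsum _ _)).
have -> : 4 * rho ^+ 2 * m * B t = \sum_l (4 * rho ^+ 2 * (b l)^-1 * B t).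
  by rewrite -mulr_suml -mulr_sumr.
apply: ler_sum => l _; have q4' := q4; have q2' := q2; have b4 := b_ge4 l; have /andP[h1 h2] := bq l.
have t2 := sqr_ge0 t.
have bl0 : 0 < b l by lra.
have b2 : 0 < b l ^+ 2 by rewrite exprn_gt0.
have bt : 0 < b l ^+ 2 + t ^+ 2 by lra.
have lowz : (b l ^+ 2 + t ^+ 2) / 2 <= normc ((b l)%:C ^+ 2 - (1 +i* t) ^+ 2).
  apply: normc_ge_sq; first by rewrite divr_ge0 // ltW.
  rewrite subr_sqr csqM expr2; apply: ler_pM.
  - by rewrite divr_ge0 // ltW.
  - by rewrite divr_ge0 // ltW.
  - by rewrite /csq !(ReD, ImD, ReN, ImN) /= sub0r sqrrN; nra.
  - by rewrite /csq !(ReD, ImD, ReN, ImN) /= add0r; nra.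
rewrite Normc.normcM Normc.normcV Normc.normcM normcR.
have -> : normc (2 : C) = 2 by rewrite (_ : 2 = (2 : R)%:C) ?normcR ?ger0_norm // rmorph_nat.
rewrite (gtr0_norm bl0).
apply: (@le_trans _ _ (2 * b l / ((b l ^+ 2 + t ^+ 2) / 2))).
  rewrite ler_wpM2l ?mulr_ge0 ?(ltW bl0) // lef_pV2 ?posrE ?divr_gt0 //.
  by apply: lt_le_trans lowz; rewrite divr_gt0.
have -> : 2 * b l / ((b l ^+ 2 + t ^+ 2) / 2) = 4 * (b l)^-1 * (b l ^+ 2 / (b l ^+ 2 + t ^+ 2)).
  by field; rewrite !gt_eqF.
have -> : 4 * rho ^+ 2 * (b l)^-1 * B t = 4 * (b l)^-1 * (rho ^+ 2 * B t) by ring.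
rewrite ler_pM2l ?mulr_gt0 ?invr_gt0 // ler_pdivrMr // /B.
have qt : 0 < q ^+ 2 + t ^+ 2 by lra.
have -> : rho ^+ 2 * (q ^+ 2 / (q ^+ 2 + t ^+ 2)) * (b l ^+ 2 + t ^+ 2) =
   rho ^+ 2 * q ^+ 2 * (b l ^+ 2 + t ^+ 2) / (q ^+ 2 + t ^+ 2) by ring.
rewrite ler_pdivlMr //.
have rho1' := rho1; have r2 : 1 <= rho ^+ 2 by rewrite exprn_ege1.
have u1 : b l ^+ 2 <= rho ^+ 2 * q ^+ 2.
  by rewrite -exprMn ler_pXn2r // ?nnegrE ?mulr_ge0 //; lra.
rewrite !mulrDr; apply: lerD.
  by rewrite [X in X <= _]mulrC ler_wpM2r ?(ltW b2) // ler_peMl // ltW.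
by rewrite ler_wpM2r.
Qed.

Definition ker_line (Y t : R) : C :=
  cexp (- (1 +i* t) * Y%:C) * (cPhi b (1 +i* t) * cPsi b (1 +i* t)).

(** The factors [e^(2 m)] cancel. The inequality [(1 + t^2) B <= e^(t^2 B)] then combines the
    saturating decay of [cPhi] with the decay of [cPsi] into the profile [1 / (1 + t^2)], integrable
    uniformly in [q]. The condition on [eta] makes [2 m + eta] at least [m], the size of [cPsi]. *)
Lemma ker_line_bound eta t : - m <= eta ->
  normc (ker_line (2 * m + eta) t) <= (2 * m + eta) * (4 * rho ^+ 2 * expR (4 - eta)) * (1 + t ^+ 2)^-1.
Proof.
move=> em; have t2 := sqr_ge0 t; have qt : 0 < q ^+ 2 + t ^+ 2 by have := q2; lra.
have m0 : 0 < m by have := ker_mean_ge; have := q2; lra.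
have B0 : 0 <= B t by rewrite /B divr_ge0 ?(ltW q2) ?(ltW qt).
rewrite /ker_line !Normc.normcM normc_cexp.
have -> : Re (- (1 +i* t) * (2 * m + eta)%:C) = - (2 * m + eta).
  by rewrite ReM ReN ImN /= mulr0 subr0 mulN1r.
apply: (@le_trans _ _ (expR (- (2 * m + eta)) *
   (expR (2 * m + 4 - t ^+ 2 * B t) * (4 * rho ^+ 2 * m * B t)))).
  rewrite ler_pM2l ?expR_gt0 //; apply: ler_pM; rewrite ?normc_ge0 //.
    exact: cPhi_bound.
  exact: cPsi_bound.
rewrite mulrA -expRD.
have -> : - (2 * m + eta) + (2 * m + 4 - t ^+ 2 * B t) = (4 - eta) + (- (t ^+ 2 * B t)) by ring.
rewrite expRD.
have key : (1 + t ^+ 2) * B t <= expR (t ^+ 2 * B t).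
  apply: le_trans (expR_ge1Dx _); rewrite mulrDl mul1r lerD2r /B ler_pdivrMr // mul1r; lra.
rewrite ler_pdivlMr; last by lra.
have -> : expR (4 - eta) * expR (- (t ^+ 2 * B t)) * (4 * rho ^+ 2 * m * B t) * (1 + t ^+ 2) =
   4 * rho ^+ 2 * expR (4 - eta) * (m * (expR (- (t ^+ 2 * B t)) * ((1 + t ^+ 2) * B t))) by ring.
have r0 : 0 <= rho by have := rho1; lra.
rewrite [X in _ <= X]mulrC ler_wpM2l ?mulr_ge0 ?expR_ge0 ?sqr_ge0 //.
apply: (@le_trans _ _ m); last by lra.
rewrite ler_piMr ?(ltW m0) // expRN mulrC ler_pdivrMr ?expR_gt0 // mul1r.
exact: key.
Qed.

Lemma cPhi_neq0 t l : (b l)%:C - (1 +i* t) != 0.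
Proof. by rewrite subr_eq0 eq_complex /= negb_and gt_eqF //; have := b_ge4 l; lra. Qed.

Lemma cPsi_neq0 t l : (b l)%:C ^+ 2 - (1 +i* t) ^+ 2 != 0.
Proof.
rewrite subr_sqr mulf_neq0 ?cPhi_neq0 // addr_eq0 eq_complex /= negb_and gt_eqF //.
by have := b_ge4 l; lra.
Qed.

Lemma ccont_ker_line Y : ccont (ker_line Y).
Proof.
have cl := @ccont_line R 1.
apply: ccontM.
  by apply/ccont_cexp/ccontM; [exact: ccontN|exact: ccont_cst].
apply: ccontM; first apply: ccont_prod => l; last apply: ccont_sum => l.
  apply: ccontM; first by apply: ccontD => //; exact: ccont_cst.
  apply: ccontV; first by move=> t; exact: cPhi_neq0.
  by apply: ccontD; [exact: ccont_cst|exact: ccontN].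
apply: ccontM; first exact: ccont_cst.
apply: ccontV; first by move=> t; exact: cPsi_neq0.
by apply: ccontD; [exact: ccont_cst|apply: ccontN; exact: ccontM].
Qed.

Lemma ker_bound eta : - m <= eta ->
  `|ker b (2 * m + eta)| <= 2 * rho ^+ 2 / pi * lor * expR (4 - eta).
Proof.
move=> em; have m0 : 0 < m by have := ker_mean_ge; have := q2; lra.
have Y0 : 0 < 2 * m + eta by lra.
have b0 l : 0 < b l by have := b_ge4 l; lra.
have b1 l : 1 < b l by have := b_ge4 l; lra.
have pi0 := @pi_gt0 R.
have E := @ker_fourier R N b binj b0 1 _ Y0 ltr01 b1.
have : `|2 * pi * ((2 * m + eta) * ker b (2 * m + eta))| <=
   (2 * m + eta) * (4 * rho ^+ 2 * expR (4 - eta)) * lor.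
  rewrite E /lor -(@RintegralZl _ _ R mu setT _ _ measurableT (@integrable_oneDsqr R)).
  apply: Rintegral_le => //.
  - by apply: continuous_mfun; have [] := ccont_ker_line (2 * m + eta).
  - by move=> t _; apply: (le_trans (Re_le_normc _)); exact: ker_line_bound.
  - exact: integrable_lorentz.
rewrite !normrM [`|2 * m + eta|]gtr0_norm // (gtr0_norm pi0) [`|2|]gtr0_norm //.
move=> h; have {}h : (2 * m + eta) * (2 * pi * `|ker b (2 * m + eta)|) <=
   (2 * m + eta) * (4 * rho ^+ 2 * expR (4 - eta) * lor).
  by move: h; congr (_ <= _); ring.
rewrite ler_pM2l // in h.
have -> : 2 * rho ^+ 2 / pi * lor * expR (4 - eta) = (2 * rho ^+ 2 * lor * expR (4 - eta)) / pi by ring.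
rewrite ler_pdivlMr //.
by move: h; lra.
Qed.

End KernelBound.

(** * The Airy function as an absolutely convergent integral *)

Section AiryLimit.
Local Open Scope complex_scope.
Context {R : realType}.
Local Notation C := R[i].
Local Notation Re := complex.Re.
Local Notation Im := complex.Im.
Local Notation normc := Normc.normc.
Local Notation mu := (@lebesgue_measure R).

Lemma normc_prod_near1 (I : Type) (r : seq I) (F : I -> C) :
  normc (\prod_(i <- r) F i - 1) <= expR (\sum_(i <- r) normc (F i - 1)) - 1.
Proof.
elim: r => [|i r IH]; first by rewrite !big_nil expR0 !subrr Normc.normc0.
rewrite !big_cons expRD.
set P := \prod_(j <- r) F j in IH *; set S := \sum_(j <- r) _ in IH *; set v := normc (F i - 1).
have v0 : 0 <= v by exact: normc_ge0.
have -> : F i * P - 1 = (P - 1) + ((F i - 1) * (P - 1) + (F i - 1)) by ring.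
apply: (le_trans (le_normcD _ _)).
have h1 : normc ((F i - 1) * (P - 1) + (F i - 1)) <= v * (expR S - 1) + v.
  apply: (le_trans (le_normcD _ _)); rewrite Normc.normcM lerD2r ler_wpM2l //.
apply: le_trans (lerD IH h1) _.
have -> : expR S - 1 + (v * (expR S - 1) + v) = (1 + v) * expR S - 1 by ring.
by rewrite lerD2r ler_wpM2r ?expR_ge0 // expR_ge1Dx.
Qed.

Lemma cder_cube (F : R -> C) t d : cder F t d -> cder (fun s => F s ^+ 3) t (3 * F t ^+ 2 * d).
Proof.
move=> dF; have -> : (fun s => F s ^+ 3) = (fun s => F s * (F s * F s)).
  by apply/funext => s; rewrite !exprS expr0 mulr1.
by apply: cder_eq; [apply: cderM; [exact: dF|apply: cderM; exact: dF]|cbv beta; ring].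
Qed.

(** A factor of [cPhi] with the linear and cubic terms of its logarithm removed; what is left is
    [1 + O(w^5)]. *)
Definition unimod_factor (w : C) : C :=
  (1 + w) / (1 - w) * cexp (- (2 * w + 2 / 3 * w ^+ 3)).

(** Along the segment [v = s w] the logarithmic derivative is [2 w v^4 / (1 - v^2)], so the
    derivative is at most [12 e^2 |w|^5]; the constant doubles because real and imaginary parts are
    treated separately. *)
Lemma unimod_factor_near1 (w : C) : normc w <= 2^-1 ->
  normc (unimod_factor w - 1) <= 24 * expR 2 * normc w ^+ 5.
Proof.
move=> w2.
have sw (s : R) : 0 <= s <= 1 -> normc (s%:C * w) <= 2^-1.
  move=> /andP[s0 s1]; rewrite Normc.normcM normcR ger0_norm //.
  apply: le_trans w2; rewrite ler_piMl ?normc_ge0 //.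
have low (v : C) : normc v <= 2^-1 -> 2^-1 <= normc (1 - v).
  move=> h; have := le_normcD (1 - v) v; rewrite subrK Normc.normc1; lra.
have nz (v : C) : normc v <= 2^-1 -> 1 - v != 0.
  move=> /low h; apply: contraTneq h => ->; rewrite Normc.normc0 -ltNge invr_gt0 //.
pose f s := unimod_factor (s%:C * w).
pose df s := f s * (w * (2 * (s%:C * w) ^+ 4 / (1 - (s%:C * w) ^+ 2))).
have w2s (s : R) : 0 <= s <= 1 -> normc ((s%:C * w) ^+ 2) <= 2^-1.
  move=> /sw h; rewrite expr2 Normc.normcM; have := normc_ge0 (s%:C * w).
  by move: h; move: (normc _) => x; nra.
have Df (s : R) : 0 <= s <= 1 -> cder f s (df s).
  move=> s01; have n1 := nz _ (sw s s01); have n2 := nz _ (w2s s s01).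
  have d0 : cder (fun s : R => s%:C * w) s w.
    have d1 : cder (fun s : R => s%:C) s 1 by split; [exact: is_derive_id|exact: is_derive_cst].
    by apply: cder_eq; first (apply: cderM; [exact: d1|exact: (cder_cst w)]); cbv beta; ring.
  have d1 : cder (fun s : R => 1 + s%:C * w) s w.
    by apply: cder_eq; first (apply: cderD; [exact: (cder_cst 1)|exact: d0]); cbv beta; ring.
  have d2 : cder (fun s : R => (1 - s%:C * w)^-1) s (w / (1 - s%:C * w) ^+ 2).
    apply: cder_eq.
      apply: (@cderV _ (fun s : R => 1 - s%:C * w) s (- w)) => //.
      by apply: cder_eq; first (apply: cderD; [exact: (cder_cst 1)|apply: cderN; exact: d0]); cbv beta; ring.
    by rewrite opprK.
  have d3 : cder (fun s : R => (s%:C * w) ^+ 3) s (3 * (s%:C * w) ^+ 2 * w).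
    exact: cder_cube.
  have d4 : cder (fun s : R => - (2 * (s%:C * w) + 2 / 3 * (s%:C * w) ^+ 3)) s
      (- (2 * w + 2 * (s%:C * w) ^+ 2 * w)).
    apply: cder_eq.
      apply: cderN; apply: cderD; apply: cderM; [exact: (cder_cst 2)|exact: d0|exact: (cder_cst (2/3))|exact: d3].
    by cbv beta; field.
  apply: cder_eq; first (apply: cderM; [apply: cderM; [exact: d1|exact: d2]|exact: (cder_cexp d4)]).
  rewrite /df /f /unimod_factor; cbv beta.
  move: (cexp _) => E; move: (s%:C * w) n1 n2 => v n1 n2.
  have n3 : 1 + v != 0.
    apply: contraNneq n2 => h; have -> : 1 - v ^+ 2 = (1 + v) * (1 - v) by ring.
    by rewrite h mul0r.
  by field; rewrite n1 n2.
have bdf (s : R) : 0 <= s <= 1 -> normc (df s) <= 12 * expR 2 * normc w ^+ 5.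
  move=> s01; have h1 := low _ (sw s s01); have h2 := low _ (w2s s s01); have h3 := sw s s01.
  rewrite /df /f /unimod_factor !(Normc.normcM, Normc.normcV) normc_cexp.
  have e1 : normc (1 + s%:C * w) <= 3 / 2.
    by apply: (le_trans (le_normcD _ _)); rewrite Normc.normc1; lra.
  have e2 : (normc (1 - s%:C * w))^-1 <= 2.
    by rewrite -[2]invrK lef_pV2 ?posrE ?invr_gt0 //; lra.
  have e3 : (normc (1 - (s%:C * w) ^+ 2))^-1 <= 2.
    by rewrite -[2]invrK lef_pV2 ?posrE ?invr_gt0 //; lra.
  have e4 : expR (Re (- (2 * (s%:C * w) + 2 / 3 * (s%:C * w) ^+ 3))) <= expR 2.
    rewrite ler_expR; apply: (le_trans (ler_norm _)); apply: (le_trans (Re_le_normc _)).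
    rewrite normcN; apply: (le_trans (le_normcD _ _)).
    rewrite !(Normc.normcM, Normc.normcV).
    have n2 : normc (2 : C) = 2 by rewrite (_ : 2 = (2 : R)%:C) ?normcR ?ger0_norm // rmorph_nat.
    have n3 : normc (3 : C) = 3 by rewrite (_ : 3 = (3 : R)%:C) ?normcR ?ger0_norm // rmorph_nat.
    rewrite n2 n3 -!Normc.normcM; have := normc_ge0 (s%:C * w); move: h3.
    rewrite (_ : normc ((s%:C * w) ^+ 3) = normc (s%:C * w) ^+ 3); last by rewrite !exprS !expr0 !mulr1 !Normc.normcM.
    move: (normc _) => x; nra.
  have e5 : normc (2 : C) = 2 by rewrite (_ : 2 = (2 : R)%:C) ?normcR ?ger0_norm // rmorph_nat.
  have e6 : normc ((s%:C * w) ^+ 4) <= normc w ^+ 4.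
    have h : normc (s%:C * w) <= normc w.
      move: s01 => /andP[s0 s1]; rewrite Normc.normcM normcR ger0_norm // ler_piMl ?normc_ge0 //.
    have -> : normc ((s%:C * w) ^+ 4) = normc (s%:C * w) ^+ 4.
      by rewrite !exprS !expr0 !Normc.normcM Normc.normc1.
    by rewrite ler_pXn2r // nnegrE normc_ge0.
  rewrite e5.
  have p := @normc_ge0 R.
  apply: (@le_trans _ _ ((3 / 2 * 2 * expR 2) * (normc w * (2 * normc w ^+ 4 * 2)))); last first.
    by rewrite le_eqVlt; apply/orP; left; apply/eqP; field.
  apply: ler_pM; rewrite ?mulr_ge0 ?invr_ge0 ?p ?expR_ge0 //.
    apply: ler_pM; rewrite ?mulr_ge0 ?invr_ge0 ?p ?expR_ge0 //.
    by apply: ler_pM; rewrite ?mulr_ge0 ?invr_ge0 ?p ?expR_ge0 //.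
  rewrite ler_wpM2l ?p //; apply: ler_pM; rewrite ?mulr_ge0 ?invr_ge0 ?p ?expR_ge0 //.
  by apply: ler_wpM2l => //; rewrite -!Normc.normcM; exact: e6.
have f0 : f 0 = 1.
  by rewrite /f mul0r /unimod_factor addr0 subr0 mulr0 expr0n /= mulr0 addr0 oppr0 cexp0 divr1 mulr1.
have f1 : f 1 = unimod_factor w by rewrite /f mul1r.
set K := 12 * expR 2 * normc w ^+ 5 in bdf.
have bnd (g : C -> R) (e : bool) : (forall z, `|g z| <= normc z) ->
   (forall s : R, 0 <= s <= 1 -> is_derive s (1 : R) (fun s : R => g (f s)) (g (df s))) ->
   (-1) ^+ e * (g (f 1) - g (f 0)) <= K.
  move=> gn dg.
  have := @derive_ge0_le R (fun s => K * s - (-1) ^+ e * g (f s)) (fun s => K - (-1) ^+ e * g (df s)) 0 1 ler01.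
  move=> H; have {}H : K * 0 - (-1) ^+ e * g (f 0) <= K * 1 - (-1) ^+ e * g (f 1).
    apply: H => s s01.
      by have := dg s s01 => ?; apply: is_derive_eq; rewrite -![_ *: _]/(_ * _); ring.
    rewrite subr_ge0 (le_trans (ler_norm _)) // normrM normrX normrN1 expr1n mul1r.
    by rewrite (le_trans (gn _)) // bdf.
  by lra.
have nb (g : C -> R) : (forall z, `|g z| <= normc z) -> (forall z v, g (z - v) = g z - g v) ->
   (forall s : R, 0 <= s <= 1 -> is_derive s (1 : R) (fun s : R => g (f s)) (g (df s))) ->
   `|g (unimod_factor w - 1)| <= K.
  move=> gn gB dg; rewrite gB -f1 -f0.
  have := bnd g true gn dg; have := bnd g false gn dg.
  by rewrite expr0 expr1 mul1r mulN1r => k0 k1; rewrite ler_norml k0 andbT lerNl.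
apply: (le_trans (normc_le _)).
have -> : 24 * expR 2 * normc w ^+ 5 = K + K by rewrite /K; ring.
apply: lerD; apply: nb.
- exact: Re_le_normc.
- by move=> z v; rewrite ReD ReN.
- by move=> s /Df[].
- exact: Im_le_normc.
- by move=> z v; rewrite ImD ImN.
- by move=> s /Df[].
Qed.

Definition airy_line (eta t : R) : C :=
  cexp ((1 +i* t) ^+ 3 / 3 - (1 +i* t) * eta%:C).

Let G (eta s t : R) : C := cexp ((s +i* t) ^+ 3 / 3 - (s +i* t) * eta%:C).

Let ReG (eta s t : R) : Re ((s +i* t) ^+ 3 / 3 - (s +i* t) * eta%:C) = s ^+ 3 / 3 - s * t ^+ 2 - s * eta.
Proof.
rewrite (_ : (3 : C)^-1 = (3^-1 : R)%:C); last by rewrite fmorphV /= rmorph_nat.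
by rewrite !exprS !expr0 !mulr1 !(ReD, ReN, ReM, ImM) /=; field.
Qed.

Let ImG (eta s t : R) : Im ((s +i* t) ^+ 3 / 3 - (s +i* t) * eta%:C) = s ^+ 2 * t - t ^+ 3 / 3 - t * eta.
Proof.
rewrite (_ : (3 : C)^-1 = (3^-1 : R)%:C); last by rewrite fmorphV /= rmorph_nat.
by rewrite !exprS !expr0 !mulr1 !(ImD, ImN, ReM, ImM) /=; field.
Qed.

Let Re_cexp (z : C) : Re (cexp z) = expR (Re z) * cos (Im z). Proof. by []. Qed.
Let Im_cexp (z : C) : Im (cexp z) = expR (Re z) * sin (Im z). Proof. by []. Qed.

Let ccontG eta s : ccont (G eta s).
Proof.
have cl := @ccont_line R s.
apply: ccont_cexp; apply: ccontD; last by apply/ccontN/ccontM => //; exact: ccont_cst.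
by apply: ccontM; last exact: ccont_cst; apply: ccontM => //; exact: ccontM.
Qed.

Let G_le eta t : `|Re (G eta 1 t)| <= expR (1 - eta) * (1 + t ^+ 2)^-1.
Proof.
apply: (le_trans (Re_le_normc _)); rewrite normc_cexp ReG.
rewrite ler_pdivlMr; last by rewrite ltr_wpDr ?sqr_ge0.
have h := expR_ge1Dx (t ^+ 2).
apply: (@le_trans _ _ (expR (1 ^+ 3 / 3 - 1 * t ^+ 2 - 1 * eta) * expR (t ^+ 2))).
  by rewrite ler_pM2l ?expR_gt0.
by rewrite -expRD ler_expR expr1n; lra.
Qed.

Lemma integrable_airy_line eta : mu.-integrable setT (EFin \o (fun t => Re (airy_line eta t))).
Proof.
apply: (@integrable_le R setT _ (fun t => expR (1 - eta) * (1 + t ^+ 2)^-1)) => //.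
- by apply: continuous_mfun; have [] := ccontG eta 1.
- by move=> t _; exact: G_le.
- exact: integrable_lorentz.
Qed.

(** [airy] is defined by a conditionally convergent integral along the imaginary axis; on [Re z = 1]
    it converges absolutely. At height [n] the integrand is at most a constant times [e^(- s n^2)],
    so that horizontal end contributes [O(1 / n^2)]; the end on the real axis contributes nothing,
    the integrand being real there. *)
Lemma airyE eta : \int[mu]_t Re (airy_line eta t) = 2 * pi * airy eta.
Proof.
have even t : Re (airy_line eta (- t)) = Re (airy_line eta t).
  rewrite /airy_line !Re_cexp !ReG !ImG sqrrN -[in RHS]cosN; congr (_ * cos _); ring.
have iG := integrable_airy_line eta.
have cG : continuous (fun t => Re (airy_line eta t)) by have [] := ccontG eta 1.
rewrite (Rintegral_even cG even iG).
have iG0 : mu.-integrable `[0, +oo[ (EFin \o (fun t => Re (airy_line eta t))) by exact: integrableS iG.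
have L1 := @Rintegral_expand R _ _ (measurable_itv `[0, +oo[) iG0.
suff L2 : \int[mu]_(t in `[0, N%:R]) cos (t ^+ 3 / 3%:R + eta * t) @[N --> \oo] -->
    \int[mu]_(t in `[0, +oo[) Re (airy_line eta t).
  rewrite /airy (cvg_lim (@norm_hausdorff _ _) L2).
  move: (\int[mu]_(x in _) _) => I; rewrite -mulrA mulVKf //.
  by rewrite gt_eqF ?pi_gt0.
pose D s t : C := ((s +i* t) ^+ 2 - eta%:C) * G eta s t.
have Dz (z : R -> C) (v : C) (u : R) : cder z u v ->
    cder (fun u => cexp (z u ^+ 3 / 3 - z u * eta%:C)) u
         (v * ((z u ^+ 2 - eta%:C) * cexp (z u ^+ 3 / 3 - z u * eta%:C))).
  move=> dz.
  have d1 : cder (fun u => z u ^+ 3 / 3 - z u * eta%:C) u (v * (z u ^+ 2 - eta%:C)).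
    apply: cder_eq.
      apply: cderD; last (apply: cderN; apply: cderM; [exact: dz|exact: (cder_cst eta%:C)]).
      apply: cderM; last exact: (cder_cst 3^-1).
      exact: (cder_cube dz).
    by cbv beta; field.
  by apply: cder_eq; [exact: cder_cexp d1|rewrite mulrA].
have h1 (s t : R) : -1 < s < 2 -> cder ((G eta)^~ t) s (D s t).
  by move=> _; apply: cder_eq; [exact: (Dz _ _ _ (cder_line_re s t))|rewrite mul1r].
have h2 (s t : R) : -1 < s < 2 -> cder (G eta s) t ('i * D s t).
  by move=> _; exact: (Dz _ _ _ (cder_line_im s t)).
have h3 (s : R) : -1 < s < 2 -> ccont (D s).
  move=> _; apply: ccontM; last exact: ccontG.
  by apply: ccontD; [apply: ccontM; exact: ccont_line|exact: ccont_cst].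
have h4 (n : nat) (s t : R) : -1 < s < 2 -> 0 <= t <= n%:R ->
    normc (D s t) <= (4 + n%:R ^+ 2 + `|eta|) * expR (8 + n%:R ^+ 2 + 2 * `|eta|).
  move=> /andP[s1 s2] /andP[t0 tn]; rewrite Normc.normcM; apply: ler_pM; rewrite ?normc_ge0 //.
    apply: (le_trans (le_normcD _ _)); rewrite normcN normcR lerD2r normcX2 csqE; apply: lerD; first by nra.
    by rewrite ler_pXn2r ?nnegrE.
  rewrite normc_cexp ReG ler_expR.
  have e1 : s ^+ 3 <= 8.
    have : 0 <= (2 - s) * (s ^+ 2 + 2 * s + 4) by rewrite mulr_ge0 //; nra.
    by lra.
  have e2 : - (s * t ^+ 2) <= n%:R ^+ 2.
    have : t ^+ 2 <= n%:R ^+ 2 by rewrite ler_pXn2r ?nnegrE.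
    by have := sqr_ge0 t; nra.
  have e3 : - (s * eta) <= 2 * `|eta|.
    apply: (le_trans (ler_norm _)); rewrite normrN normrM ler_wpM2r // ler_norml; lra.
  by move: e1 e2 e3; move: (s ^+ 3) (s * t ^+ 2) (s * eta) => x y u; lra.
pose H n s := \int[mu]_(t in `[0, n%:R]) Re (G eta s t).
have dH (n : nat) (s : R) : -1 < s < 2 -> is_derive s (1 : R) (H n) (Im (G eta s n%:R) - Im (G eta s 0)).
  move=> hs.
  exact: (@cauchy_strip R (G eta) D (-1) 2 0 n%:R _ (ler0n _ n) h1 h2 h3 (h4 n) s hs).
have G0 s : Im (G eta s 0) = 0.
  by rewrite /G Im_cexp ImG mulr0 (_ : 0 - 0 ^+ 3 / 3 - 0 * eta = 0) ?sin0 ?mulr0 //; ring.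
have bH (n : nat) (e : bool) : (0 < n)%N ->
    (-1) ^+ e * (H n 1 - H n 0) <= expR (1 + `|eta|) / n%:R ^+ 2.
  move=> n0; have n2 : 0 < n%:R ^+ 2 :> R by rewrite exprn_gt0 // ltr0n.
  pose K := expR (1 + `|eta|) / n%:R ^+ 2.
  have K0 : 0 <= K by rewrite divr_ge0 ?expR_ge0 // ltW.
  (* [- K * expR (- (n^2 s))] is a primitive of the bound on the horizontal end, so its increment
     dominates that of [H n]. *)
  have Hm : (- K * expR (- (n%:R ^+ 2 * 0))) - (-1) ^+ e * H n 0 <=
      (- K * expR (- (n%:R ^+ 2 * 1))) - (-1) ^+ e * H n 1.
    apply: (@derive_ge0_le R (fun s => - K * expR (- (n%:R ^+ 2 * s)) - (-1) ^+ e * H n s)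
      (fun s => K * n%:R ^+ 2 * expR (- (n%:R ^+ 2 * s)) - (-1) ^+ e * (Im (G eta s n%:R) - Im (G eta s 0))) 0 1 ler01).
      move=> s /andP[s0 s1]; have hs : -1 < s < 2 by apply/andP; split; lra.
      have := dH n s hs => ?.
      by apply: is_derive_eq; rewrite -![_ *: _]/(_ * _); ring.
    move=> s /andP[s0 s1].
    rewrite subr_ge0 G0 subr0 (le_trans (ler_norm _)) // normrM normrX normrN1 expr1n mul1r.
    apply: (le_trans (Im_le_normc _)); rewrite normc_cexp ReG /K divfK ?gt_eqF // -expRD ler_expR.
    have e1 : s ^+ 3 <= 1 by rewrite exprn_ile1.
    have e3 : - (s * eta) <= `|eta|.
      apply: (le_trans (ler_norm _)); rewrite normrN normrM ler_piMl // ger0_norm //.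
      by have := exprn_ge0 3 s0; move: e1 e3; move: (s ^+ 3) (s * eta) => x u; lra.
  move: Hm; rewrite mulr0 oppr0 expR0 mulr1 -/K.
  have : 0 <= K * expR (- n%:R ^+ 2) by rewrite mulr_ge0 ?expR_ge0.
  by lra.
have HE n : H n 0 = \int[mu]_(t in `[0, n%:R]) cos (t ^+ 3 / 3%:R + eta * t).
  apply: eq_Rintegral => t _; rewrite /G Re_cexp ReG ImG !mul0r expr0n /= mul0r !subr0 expR0 mul1r -cosN.
  by congr cos; ring.
have E1 (n : nat) : H n 1 = \int[mu]_(t in `[0, +oo[ `&` `[- n%:R, n%:R]) Re (airy_line eta t).
  rewrite /H; congr Rintegral; apply/seteqP; split => t; rewrite /= !in_itv /= andbT.
    by move=> /andP[t0 tn]; split => //; apply/andP; split => //; apply: le_trans t0; rewrite oppr_le0.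
  by move=> [t0 /andP[_ tn]]; rewrite t0 tn.
have lim0 : H n 1 - H n 0 @[n --> \oo] --> 0.
  apply: norm_cvg0; apply: (@squeeze_cvgr _ _ _ _ (cst 0) (fun n : nat => expR (1 + `|eta|) * (n%:R ^+ 2)^-1)).
  - near=> n; rewrite normr_ge0 /=.
    have n0 : (0 < n)%N by near: n; exact: nbhs_infty_gt.
    have := bH n true n0; have := bH n false n0; rewrite expr0 expr1 mul1r mulN1r => k0 k1.
    by rewrite ler_norml k0 andbT lerNl.
  - exact: cvg_cst.
  - rewrite -[X in _ --> X](mulr0 (expR (1 + `|eta|))); apply: cvgM; first exact: cvg_cst.
    apply/gtr0_cvgV0.
      by near=> n; rewrite exprn_gt0 // ltr0n; near: n; exact: nbhs_infty_gt.
    apply/cvgryPge => A; near=> n.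
    apply: (@le_trans _ _ n%:R); first by near: n; exact: nbhs_infty_ger.
    by rewrite expr2 ler_peMl ?ler0n // ler1n; near: n; exact: nbhs_infty_gt.
have L2 : H n 1 - (H n 1 - H n 0) @[n --> \oo] --> \int[mu]_(t in `[0, +oo[) Re (airy_line eta t) - 0.
  apply: cvgB lim0; under eq_fun do rewrite E1; exact: L1.
rewrite subr0 in L2; move: L2; apply: cvg_trans; apply: near_eq_cvg; near=> n.
by rewrite -HE; ring.
Unshelve. all: by end_near. Qed.

End AiryLimit.

(** * Convergence of the normalised kernel to the Airy function *)

Section KernelLimit.
Local Open Scope complex_scope.
Context {R : realType}.
Local Notation C := R[i].
Local Notation Re := complex.Re.
Local Notation Im := complex.Im.
Local Notation normc := Normc.normc.
Local Notation mu := (@lebesgue_measure R).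

Lemma Rintegral_dct_near (D : set R) (f_ : nat -> R -> R) f g : measurable D ->
  (forall n, measurable_fun D (f_ n)) ->
  (forall x, D x -> f_ n x @[n --> \oo] --> f x) ->
  mu.-integrable D (EFin \o g) ->
  (\forall n \near \oo, forall x, D x -> `|f_ n x| <= g x) ->
  \int[mu]_(x in D) f_ n x @[n --> \oo] --> \int[mu]_(x in D) f x.
Proof.
move=> mD mf fl ig [N _ fg]; rewrite -(@cvg_shiftn N).
apply: (@Rintegral_dct R D (fun n => f_ (n + N)%N) f g mD _ _ ig _).2 => //.
- by move=> x Dx; rewrite (@cvg_shiftn N _ (fun n => f_ n x)); exact: fl.
- by move=> n x Dx; apply: fg => //=; exact: leq_addl.
Qed.

Definition ccvg (u : nat -> C) (l : C) :=
  (Re (u n) @[n --> \oo] --> Re l) /\ (Im (u n) @[n --> \oo] --> Im l).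

Lemma ccvgM u v l m : ccvg u l -> ccvg v m -> ccvg (fun n => u n * v n) (l * m).
Proof.
move=> [u1 u2] [v1 v2]; split; rewrite ?ReM ?ImM; under eq_fun do rewrite ?ReM ?ImM.
  by apply: cvgB; apply: cvgM.
by apply: cvgD; apply: cvgM.
Qed.

Lemma ccvg_cexp u l : ccvg u l -> ccvg (fun n => cexp (u n)) (cexp l).
Proof.
move=> [u1 u2]; split.
  by apply: cvgM; [exact: (cvg_comp _ _ u1 (@continuous_expR R _))|exact: (cvg_comp _ _ u2 (@continuous_cos R _))].
by apply: cvgM; [exact: (cvg_comp _ _ u1 (@continuous_expR R _))|exact: (cvg_comp _ _ u2 (@continuous_sin R _))].
Qed.

Lemma cvg_dist_le (u e : nat -> R) (l : R) : (\forall n \near \oo, `|u n - l| <= e n) ->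
  e n @[n --> \oo] --> (0 : R) -> u n @[n --> \oo] --> l.
Proof.
move=> ue e0; apply/cvgrPdist_le => eps eps0.
move/cvgrPdist_le : e0 => /(_ eps eps0) e0; near=> n.
have h1 : `|u n - l| <= e n by near: n.
have : `|0 - e n| <= eps by near: n.
by rewrite sub0r normrN distrC; apply: le_trans; apply: (le_trans h1); exact: ler_norm.
Unshelve. all: by end_near. Qed.

Lemma ccvg_near u l (e : nat -> R) : (\forall n \near \oo, normc (u n - l) <= e n) ->
  e n @[n --> \oo] --> (0 : R) -> ccvg u l.
Proof.
move=> ue e0; split; apply: cvg_dist_le e0; apply: filterS ue => n.
  by apply: le_trans; rewrite -ReN -ReD Re_le_normc.
by apply: le_trans; rewrite -ImN -ImD Im_le_normc.
Qed.

Lemma airy_lineE (eta t : R) :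
  airy_line eta t = cexp ((3^-1 - t ^+ 2 - eta) +i* (t - t ^+ 3 / 3 - t * eta)).
Proof.
have e3 : (3 : C)^-1 = (3^-1 : R)%:C by rewrite fmorphV /= rmorph_nat.
by congr cexp; apply: ceqP; rewrite e3 !exprS !expr0 !mulr1 !(ReD, ReN, ReM, ImD, ImN, ImM) /=; field.
Qed.

Lemma ccvg_airy_line (eta : nat -> R) (eta0 t : R) : eta n @[n --> \oo] --> eta0 ->
  ccvg (fun n => airy_line (eta n) t) (airy_line eta0 t).
Proof.
move=> ee; rewrite airy_lineE; under eq_fun do rewrite airy_lineE.
apply: ccvg_cexp; split => /=.
  by apply: cvgB ee; exact: cvg_cst.
by apply: cvgB; [exact: cvg_cst|apply: cvgM ee; exact: cvg_cst].
Qed.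

Lemma normc_airy_line_le (eta t : R) : normc (airy_line eta t) <= expR (1 - eta) * (1 + t ^+ 2)^-1.
Proof.
rewrite airy_lineE normc_cexp [complex.Re _]/=.
rewrite ler_pdivlMr; last by rewrite ltr_wpDr ?sqr_ge0.
have h := expR_ge1Dx (t ^+ 2).
apply: (@le_trans _ _ (expR (3^-1 - t ^+ 2 - eta) * expR (t ^+ 2))).
  by rewrite ler_pM2l ?expR_gt0.
by rewrite -expRD ler_expR; lra.
Qed.

Lemma airy_bound (eta : R) : `|airy eta| <= lor / (2 * pi) * expR (1 - eta).
Proof.
have p0 : 0 < 2 * pi :> R by rewrite mulr_gt0 ?pi_gt0.
have -> : airy eta = (2 * pi)^-1 * \int[mu]_t Re (airy_line eta t).
  by rewrite airyE mulKf // gt_eqF.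
rewrite normrM gtr0_norm ?invr_gt0 // mulrC mulrAC ler_pM2r ?invr_gt0 //.
apply: (@le_trans _ _ (\int[mu]_t (expR (1 - eta) * (1 + t ^+ 2)^-1))).
  apply: Rintegral_le => //.
  - by apply/measurable_EFinP; exact: (measurable_int mu (integrable_airy_line _)).
  - by move=> t _; rewrite (le_trans (Re_le_normc _)) // normc_airy_line_le.
  - exact: integrable_lorentz.
rewrite (@RintegralZl _ _ R mu setT _ _ measurableT) //; first by rewrite mulrC.
exact: integrable_oneDsqr.
Qed.

Lemma airy_cvg (eta : nat -> R) (eta0 : R) : eta n @[n --> \oo] --> eta0 ->
  airy (eta n) @[n --> \oo] --> airy eta0.
Proof.
move=> ee; have p0 : 0 < 2 * pi :> R by rewrite mulr_gt0 ?pi_gt0.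
have aE x : airy x = (2 * pi)^-1 * \int[mu]_t Re (airy_line x t) by rewrite airyE mulKf // gt_eqF.
rewrite aE; under eq_fun do rewrite aE.
apply: cvgM; first exact: cvg_cst.
apply: (@Rintegral_dct_near setT _ _ (fun t => expR (2 - eta0) * (1 + t ^+ 2)^-1)) => //.
- by move=> n; apply/measurable_EFinP; exact: (measurable_int mu (integrable_airy_line _)).
- by move=> t _; have [] := ccvg_airy_line t ee.
- exact: integrable_lorentz.
- near=> n => t _; rewrite (le_trans (Re_le_normc _)) // (le_trans (normc_airy_line_le _ _)) //.
  rewrite ler_wpM2r ?invr_ge0 ?addr_ge0 ?sqr_ge0 // ler_expR.
  suff : eta0 - 1 <= eta n by lra.
  by near: n; apply: (cvgr_ge eta0) => //; lra.
Unshelve. all: by end_near. Qed.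

Variables (N : nat -> nat) (b : forall k, 'I_(N k) -> R) (q : nat -> R) (rho : R).
Arguments b : clear implicits.
Hypothesis binj : forall k, injective (b k).
Hypothesis q4 : forall k, 4 <= q k.
Hypothesis rho1 : 1 <= rho.
Hypothesis bq : forall k l, q k <= b k l <= rho * q k.
Hypothesis b3 : forall k, 2 * \sum_l (b k l ^+ 3)^-1 = 1.
Hypothesis qoo : q k @[k --> \oo] --> +oo.
Arguments bq : clear implicits.
Let m k : R := \sum_l (b k l)^-1.

Let invq : (q k)^-1 @[k --> \oo] --> (0 : R).
Proof.
by apply/gtr0_cvgV0; [near=> k; have := q4 k; lra|exact: qoo].
Unshelve. all: by end_near. Qed.

Let b_ge k l : q k <= b k l. Proof. by have /andP[] := bq k l. Qed.
Arguments b_ge : clear implicits.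
Let b_gt0 k l : 0 < b k l. Proof. by have := b_ge k l; have := q4 k; lra. Qed.
Arguments b_gt0 : clear implicits.
Let q_gt0 k : 0 < q k. Proof. by have := q4 k; lra. Qed.

Let m2C k : (2 * m k)%:C = \sum_l 2 / (b k l)%:C :> C.
Proof.
rewrite /m mulr_sumr rmorph_sum; apply: eq_bigr => l _.
by rewrite rmorphM fmorphV /= rmorph_nat.
Qed.

(** The algebra behind the Airy limit: the linear terms of the logarithms add up to [2 m z], and the
    cubic ones to [z^3 / 3] by the normalisation [b3]. *)
Lemma cPhi_unimod k (z : C) : cexp (- z * (2 * m k)%:C) * cPhi (b k) z =
  cexp (z ^+ 3 / 3) * \prod_l unimod_factor (z / (b k l)%:C).
Proof.
rewrite /unimod_factor big_split /=.
have -> : \prod_l ((1 + z / (b k l)%:C) / (1 - z / (b k l)%:C)) = cPhi (b k) z.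
  apply: eq_bigr => l _.
  have h : (b k l)%:C != 0 :> C by rewrite (inj_eq (@complexI _)) gt_eqF.
  rewrite -[X in X / _ = _](mulfK h) -[X in _ / X = _](mulfK h).
  rewrite mulrDl mulrBl !mul1r divfK // -mulf_div divff ?mulr1 //.
  by rewrite invr_eq0.
have -> : \prod_l cexp (- (2 * (z / (b k l)%:C) + 2 / 3 * (z / (b k l)%:C) ^+ 3)) =
   cexp (- z * (2 * m k)%:C - z ^+ 3 / 3).
  rewrite -(big_morph _ (@cexpD R) (@cexp0 R)); congr cexp.
  have e2 : \sum_l 2 * (((b k l)%:C) ^+ 3)^-1 = 1 :> C.
    transitivity ((2 * \sum_l (b k l ^+ 3)^-1)%:C : C); last by rewrite b3.
    rewrite mulr_sumr rmorph_sum; apply: eq_bigr => l _.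
    by rewrite rmorphM fmorphV rmorphXn rmorph_nat.
  have -> : z ^+ 3 / 3 = \sum_l (z ^+ 3 / 3 * (2 * (((b k l)%:C) ^+ 3)^-1)).
    by rewrite -mulr_sumr e2 mulr1.
  rewrite m2C !mulr_sumr -sumrB; apply: eq_bigr => l _.
  by rewrite expr_div_n; field; rewrite (inj_eq (@complexI _)) gt_eqF.
rewrite cexpD [RHS]mulrA [RHS]mulrC -[LHS]mul1r -[in LHS]cexp0 -[in LHS](subrr (z ^+ 3 / 3)) cexpD.
by ring.
Qed.

(** The errors are of order [b^-5 <= b^-3 / q], and the sum of the [b^-3] is normalised. *)
Lemma prod_unimod_cvg1 (z : C) : ccvg (fun k => \prod_l unimod_factor (z / (b k l)%:C)) 1.
Proof.
have V k l : normc (z / (b k l)%:C) = normc z / b k l.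
  by rewrite Normc.normcM Normc.normcV normcR gtr0_norm // b_gt0.
pose K := 24 * expR 2 * normc z ^+ 5.
apply: (@ccvg_near _ _ (fun k => expR (K * (q k)^-1) - 1)); last first.
  rewrite -(subrr 1); apply: cvgB (cvg_cst _).
  rewrite -[X in _ --> X](@expR0 R) -(mulr0 K).
  have h : K * (q k)^-1 @[k --> \oo] --> K * 0 by apply: cvgM invq; exact: cvg_cst.
  exact: (cvg_comp _ _ h (@continuous_expR R _)).
have : \forall k \near \oo, 2 * normc z <= q k.
  by move/cvgryPge : qoo => /(_ (2 * normc z)).
apply: filterS => k qz.
apply: (le_trans (normc_prod_near1 _ _)); rewrite lerD2r ler_expR.
apply: (@le_trans _ _ (\sum_l (K * (q k)^-1 * (2 * (b k l ^+ 3)^-1)))); last first.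
  by rewrite -mulr_sumr -mulr_sumr b3 mulr1.
apply: ler_sum => l _.
have bp := b_gt0 k l; have qp := q_gt0 k; have qb := b_ge k l; have z0 := normc_ge0 z.
apply: (le_trans (unimod_factor_near1 _)); rewrite V.
  by rewrite ler_pdivrMr //; lra.
have -> : K / q k * (2 / b k l ^+ 3) = K * ((q k)^-1 * (2 / b k l ^+ 3)) by rewrite -[LHS]mulrA.
rewrite expr_div_n [X in X <= _]mulrA -/K; apply: ler_wpM2l; first by rewrite !mulr_ge0 ?expR_ge0 ?exprn_ge0.
rewrite (_ : (b k l ^+ 5)^-1 = (b k l ^+ 2)^-1 * (b k l ^+ 3)^-1); last by field; rewrite gt_eqF.
rewrite mulrA ler_wpM2r ?invr_ge0 ?exprn_ge0 ?(ltW bp) //.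
apply: (@le_trans _ _ (q k)^-1); last by rewrite ler_peMr ?invr_ge0 ?(ltW qp) // ler1n.
rewrite lef_pV2 ?posrE ?exprn_gt0 //; have := q4 k; nra.
Qed.

(** [cPsi] differs from [2 m] by terms of order [b^-3], whose sum stays bounded, whereas [m] is at
    least [q^2 / 2]. *)
Lemma cPsi_cvg1 (z : C) (eta : nat -> R) (eta0 : R) : eta n @[n --> \oo] --> eta0 ->
  ccvg (fun k => cPsi (b k) z / (2 * m k + eta k)%:C) 1.
Proof.
move=> ee.
apply: (@ccvg_near _ _ (fun k => (2 * normc z ^+ 2 + `|eta0| + 1) * (q k)^-1)); last first.
  by rewrite -[X in _ --> X](mulr0 (2 * normc z ^+ 2 + `|eta0| + 1)); apply: cvgM invq; exact: cvg_cst.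
near=> k.
have qz : 2 * normc z <= q k by near: k; move/cvgryPge : qoo => /(_ (2 * normc z)).
have qe : 2 * (`|eta0| + 1) <= q k by near: k; move/cvgryPge : qoo => /(_ (2 * (`|eta0| + 1))).
have e1 : `|eta0 - eta k| <= 1 by near: k; exact: (@cvgr_dist_le _ _ _ _ _ _ _ ee 1 ltr01).
have e2 : `|eta k| <= `|eta0| + 1.
  have -> : eta k = eta0 - (eta0 - eta k) by ring.
  by rewrite (le_trans (ler_normB _ _)) // lerD2l.
have mq : q k ^+ 2 / 2 <= m k by exact: (ker_mean_ge (rho := rho)).
have q4k := q4 k; have z0 := normc_ge0 z; have a0 := normr_ge0 eta0.
have xq : q k <= 2 * m k + eta k.
  have : - (`|eta0| + 1) <= eta k by move: e2; rewrite ler_norml => /andP[].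
  nra.
set x := 2 * m k + eta k in xq *.
have x0 : 0 < x by lra.
have xC : x%:C != 0 :> C by rewrite (inj_eq (@complexI _)) gt_eqF.
have -> : cPsi (b k) z / x%:C - 1 = (cPsi (b k) z - x%:C) / x%:C by rewrite mulrBl divff.
rewrite Normc.normcM Normc.normcV normcR gtr0_norm //.
apply: ler_pM; rewrite ?invr_ge0 ?normc_ge0 ?(ltW x0) //; last by rewrite lef_pV2 ?posrE //; exact: lt_le_trans xq.
have -> : cPsi (b k) z - x%:C = \sum_l (2 * z ^+ 2 / ((b k l)%:C * ((b k l)%:C ^+ 2 - z ^+ 2))) - (eta k)%:C.
  have -> : x%:C = (2 * m k)%:C + (eta k)%:C by rewrite /x rmorphD.
  rewrite opprD addrA; congr (_ - _); rewrite m2C.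
  rewrite /cPsi -sumrB; apply: eq_bigr => l _.
  have h : (b k l)%:C != 0 :> C by rewrite (inj_eq (@complexI _)) gt_eqF.
  have h2 : (b k l)%:C ^+ 2 - z ^+ 2 != 0.
    rewrite subr_eq0; apply/eqP => /(congr1 (@Normc.normc R)); rewrite !expr2 !Normc.normcM normcR gtr0_norm //.
    have := b_ge k l; nra.
  by field; rewrite h h2.
apply: (le_trans (le_normcD _ _)); rewrite normcN normcR -addrA; apply: lerD => //.
apply: (le_trans (normc_bigsum _ _)).
apply: (@le_trans _ _ (\sum_l (2 * normc z ^+ 2 * (2 * (b k l ^+ 3)^-1)))); last first.
  by rewrite -mulr_sumr -mulr_sumr b3 mulr1.
apply: ler_sum => l _.
have bp := b_gt0 k l; have qb := b_ge k l.
have n2 : normc (2 : C) = 2 by rewrite (_ : 2 = (2 : R)%:C) ?normcR ?ger0_norm // rmorph_nat.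
have nz2 : normc (z ^+ 2) = normc z ^+ 2 by rewrite !expr2 Normc.normcM.
rewrite Normc.normcM [normc (2 * _)]Normc.normcM Normc.normcV [normc ((b k l)%:C * _)]Normc.normcM n2 nz2 normcR gtr0_norm //.
apply: ler_wpM2l; first by rewrite mulr_ge0 ?exprn_ge0.
have lo : b k l ^+ 2 / 2 <= normc ((b k l)%:C ^+ 2 - z ^+ 2).
  have := le_normcD ((b k l)%:C ^+ 2 - z ^+ 2) (z ^+ 2); rewrite subrK nz2.
  have -> : normc ((b k l)%:C ^+ 2) = b k l ^+ 2.
    by rewrite !expr2 Normc.normcM normcR gtr0_norm.
  nra.
have -> : 2 * (b k l ^+ 3)^-1 = (b k l * (b k l ^+ 2 / 2))^-1 by field; rewrite gt_eqF.
have b20 : 0 < b k l ^+ 2 / 2 by rewrite divr_gt0 ?exprn_gt0.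
rewrite lef_pV2 ?posrE ?mulr_gt0 //; last exact: lt_le_trans lo.
by rewrite ler_pM2l.
Unshelve. all: by end_near. Qed.

(** Dividing [ker_fourier] by [2 m + eta] removes the factor [x] and normalises [cPsi], so that the
    integrand tends to [airy_line]; [ker_line_bound] dominates. *)
Lemma ker_cvg (eta : nat -> R) (eta0 : R) : eta n @[n --> \oo] --> eta0 ->
  ker (b k) (2 * m k + eta k) @[k --> \oo] --> airy eta0.
Proof.
move=> ee; have p0 : 0 < 2 * pi :> R by rewrite mulr_gt0 ?pi_gt0.
have -> : airy eta0 = (2 * pi)^-1 * \int[mu]_t Re (airy_line eta0 t).
  by rewrite airyE mulKf // gt_eqF.
pose x k := 2 * m k + eta k.
pose F k t := (x k)^-1 * Re (ker_line (b k) (x k) t).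
have mq k : q k ^+ 2 / 2 <= m k by exact: (ker_mean_ge (rho := rho)).
have em : \forall k \near \oo, eta0 - 1 <= eta k /\ - m k <= eta k.
  near=> k.
  have h1 : eta0 - 1 <= eta k by near: k; apply: (cvgr_ge eta0) => //; lra.
  split=> //; apply: le_trans h1.
  have : 1 + `|eta0| <= q k by near: k; move/cvgryPge : qoo => /(_ (1 + `|eta0|)).
  have := mq k; have := q4 k; have : - `|eta0| <= eta0 by rewrite lerNl -normrN ler_norm.
  nra.
have KB k t (h : - m k <= eta k) := ker_line_bound (q4 k) rho1 (bq k) (b3 k) t h.
have L : \int[mu]_t F k t @[k --> \oo] --> \int[mu]_t Re (airy_line eta0 t).
  apply: (@Rintegral_dct_near setT _ _ (fun t => 4 * rho ^+ 2 * expR (5 - eta0) * (1 + t ^+ 2)^-1)) => //.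
  - move=> k; apply: continuous_mfun => t.
    have [h _] := @ccont_ker_line R (N k) (b k) (q k) rho (q4 k) (bq k) (x k).
    by apply: (@continuousM _ _ (cst (x k)^-1)); [exact: cst_continuous|exact: h].
  - move=> t _.
    have := ccvgM (ccvgM (ccvg_airy_line t ee) (prod_unimod_cvg1 (1 +i* t))) (cPsi_cvg1 (1 +i* t) ee).
    rewrite !mulr1 => -[+ _]; apply: cvg_trans; apply: near_eq_cvg; near=> k.
    rewrite /F; have -> : (x k)^-1 * Re (ker_line (b k) (x k) t) = Re (ker_line (b k) (x k) t / (x k)%:C).
      by rewrite -fmorphV ReM /= mulr0 subr0 mulrC.
    congr Re; rewrite /ker_line -[RHS]mulrA -[in RHS]mulrA [RHS]mulrA; congr (_ * _).
    have -> : cexp (- (1 +i* t) * (x k)%:C) = cexp (- (1 +i* t) * (2 * m k)%:C) * cexp (- (1 +i* t) * (eta k)%:C).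
      by rewrite -cexpD -mulrDr -rmorphD.
    have -> : airy_line (eta k) t = cexp ((1 +i* t) ^+ 3 / 3) * cexp (- (1 +i* t) * (eta k)%:C).
      by rewrite -cexpD mulNr.
    by rewrite [LHS]mulrAC [RHS]mulrAC -(cPhi_unimod k (1 +i* t)).
  - exact: integrable_lorentz.
  - near=> k => t _.
    have [h1 h2] : eta0 - 1 <= eta k /\ - m k <= eta k by near: k.
    have x0 : 0 < x k by rewrite /x; have := mq k; have := q4 k; nra.
    rewrite /F normrM gtr0_norm ?invr_gt0 // mulrC ler_pdivrMr //.
    apply: (le_trans (Re_le_normc _)); apply: (le_trans (KB k t h2)).
    rewrite -/(m k) -/(x k); move: x0; move: (x k) => X X0.
    have Q0 : 0 <= (1 + t ^+ 2)^-1 by rewrite invr_ge0 addr_ge0 ?sqr_ge0.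
    move: Q0; move: (1 + t ^+ 2)^-1 => Q Q0.
    have h : expR (4 - eta k) <= expR (5 - eta0) by rewrite ler_expR; lra.
    move: h; move: (expR (4 - _)) (expR (5 - _)) => e4 e5 h.
    have -> : X * (4 * rho ^+ 2 * e4) * Q = (4 * rho ^+ 2 * Q * X) * e4 by ring.
    have -> : 4 * rho ^+ 2 * e5 * Q * X = (4 * rho ^+ 2 * Q * X) * e5 by ring.
    have r0 : 0 <= rho ^+ 2 := sqr_ge0 rho; move: r0; move: (rho ^+ 2) => r r0.
    by apply: ler_wpM2l => //; rewrite !mulr_ge0 ?(ltW X0).
have -> : (fun k => ker (b k) (2 * m k + eta k)) = (fun k => ker (b k) (x k)) by [].
have {}L : (2 * pi)^-1 * \int[mu]_t F k t @[k --> \oo] --> (2 * pi)^-1 * \int[mu]_t Re (airy_line eta0 t).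
  by apply: cvgM => //; exact: cvg_cst.
move: L; apply: cvg_trans; apply: near_eq_cvg; near=> k.
have [h1 h2] : eta0 - 1 <= eta k /\ - m k <= eta k by near: k.
have x0 : 0 < x k by rewrite /x; have := mq k; have := q4 k; nra.
rewrite /F (@RintegralZl _ _ R mu setT _ _ measurableT) //; last first.
  apply: (@integrable_le R setT _ (fun t => x k * (4 * rho ^+ 2 * expR (4 - eta k)) * (1 + t ^+ 2)^-1)) => //.
  - by apply: continuous_mfun; have [] := @ccont_ker_line R (N k) (b k) (q k) rho (q4 k) (bq k) (x k).
  - by move=> t _; exact: (le_trans (Re_le_normc _) (KB k t h2)).
  - exact: integrable_lorentz.
have <- : 2 * pi * (x k * ker (b k) (x k)) = \int[mu]_t Re (ker_line (b k) (x k) t).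
  by apply: ker_fourier => //; have := q4 k => h l; have := b_ge k l; lra.
rewrite mulrCA; move: (ker _ _) => K; rewrite mulKf ?gt_eqF //.
by rewrite mulKf // gt_eqF.
Unshelve. all: by end_near. Qed.

End KernelLimit.

(** * Fredholm series *)

Section Gram.
Context {R : realFieldType}.

Lemma mulmx_trE n (v : 'rV[R]_n) : v *m v^T = (\sum_j v 0 j ^+ 2)%:M.
Proof.
apply/matrixP => i j; rewrite !ord1 !mxE eqxx mulr1n.
by apply: eq_bigr => k _; rewrite !mxE expr2.
Qed.

Lemma row_sqr_ge0 n (v : 'rV[R]_n) : 0 <= \sum_j v 0 j ^+ 2.
Proof. by apply: sumr_ge0 => j _; exact: sqr_ge0. Qed.

Lemma row_sqr_eq0 n (v : 'rV[R]_n) : \sum_j v 0 j ^+ 2 = 0 -> v = 0.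
Proof.
move=> h; apply/rowP => j; rewrite !mxE.
apply/eqP; rewrite -sqrf_eq0; apply/eqP.
by apply: (psumr_eq0P _ h) => // k _; exact: sqr_ge0.
Qed.

(* Schur complement of the Gram matrix of the remaining rows. *)
Lemma det_gram_le (m n : nat) (A : 'M[R]_(m, n)) :
  0 <= \det (A *m A^T) <= \prod_i \sum_j A i j ^+ 2.
Proof.
elim: m A => [|m IH] A; first by rewrite det_mx00 big_ord0 ler01 lexx.
pose r : 'rV[R]_n := usubmx (A : 'M[R]_((1 + m)%N, n)).
pose B : 'M[R]_(m, n) := dsubmx (A : 'M[R]_((1 + m)%N, n)).
have AE : A = col_mx r B by rewrite vsubmxK.
have := IH B; set D := \det (B *m B^T) => /andP[D0 D1].
have P1 : \prod_i \sum_j A i j ^+ 2 = (\sum_j r 0 j ^+ 2) * \prod_i \sum_j B i j ^+ 2.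
  rewrite big_ord_recl; congr (_ * _).
    by apply: eq_bigr => j _; rewrite /r mxE; congr (A _ _ ^+ 2); apply/val_inj.
  apply: eq_bigr => i _; apply: eq_bigr => j _; rewrite /B mxE; congr (A _ _ ^+ 2); exact/val_inj.
have s0 := row_sqr_ge0 r.
have GE : A *m A^T = block_mx (r *m r^T) (r *m B^T) (B *m r^T) (B *m B^T).
  transitivity (col_mx r B *m (col_mx r B)^T); first by rewrite -AE.
  by rewrite tr_col_mx mul_col_row.
rewrite P1 GE.
(* If the smaller Gram matrix is singular, some [v] satisfies [v B = 0], and it also annihilates the
   bordered matrix. *)
have [Du|Du] := boolP (B *m B^T \in unitmx); last first.
  have D00 : D = 0 by move: Du; rewrite unitmxE unitfE negbK => /eqP.
  suff -> : \det (block_mx (r *m r^T) (r *m B^T) (B *m r^T) (B *m B^T)) = 0.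
    by rewrite lexx; apply: mulr_ge0 => //; exact: le_trans D0 D1.
  move: D00 => /eqP/det0P [v v0 vB].
  have vB0 : v *m B = 0.
    apply: row_sqr_eq0; have := mulmx_trE (v *m B).
    rewrite trmx_mul mulmxA -(mulmxA v) vB mul0mx => /matrixP /(_ 0 0).
    by rewrite !mxE eqxx mulr1n.
  apply/eqP/det0P; exists (row_mx (0 : 'rV_1) v).
    by apply: contraNneq v0 => /(congr1 rsubmx); rewrite row_mxKr linear0 => ->.
  by rewrite mul_row_block !mul0mx !add0r !mulmxA vB0 !mul0mx row_mx0.
pose c := r *m B^T *m invmx (B *m B^T).
have cG : c *m (B *m B^T) = r *m B^T by rewrite mulmxKV.
have E : block_mx (r *m r^T) (r *m B^T) (B *m r^T) (B *m B^T) *m block_mx 1%:M 0 (- c^T) 1%:M =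
   block_mx (r *m r^T - r *m B^T *m c^T) (r *m B^T) 0 (B *m B^T).
  rewrite mulmx_block !mulmx1 !mulmx0 !mulmxN !add0r; congr block_mx.
  apply/eqP; rewrite subr_eq0; apply/eqP.
  by rewrite -[LHS]trmxK trmx_mul trmxK -cG !trmx_mul !trmxK.
have := congr1 determinant E; rewrite det_mulmx det_lblock !det1 !mulr1 det_ublock -/D => ->.
have -> : r *m B^T *m c^T = (\sum_j (c *m B) 0 j ^+ 2)%:M.
  by rewrite -mulmx_trE -cG !trmx_mul !mulmxA.
rewrite mulmx_trE -raddfB /= det_scalar1.
have q0 := row_sqr_ge0 (c *m B).
move: s0 q0; set s := \sum_j _; set q := \sum_j _ => s0 q0.
(* [s - q] is the squared distance of the new row to the span of the others. *)
have sq : 0 <= s - q.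
  have e : s - q = \sum_j (r - c *m B) 0 j ^+ 2.
    have := mulmx_trE (r - c *m B); rewrite linearB /= mulmxBl !mulmxBr.
    have -> : c *m B *m (c *m B)^T = c *m B *m r^T.
      rewrite trmx_mul !mulmxA -(mulmxA c) cG.
      have GT : B *m r^T = B *m B^T *m c^T by rewrite -[LHS]trmxK trmx_mul trmxK -cG !trmx_mul !trmxK.
      by rewrite -(mulmxA c) GT -cG !mulmxA.
    have hq : r *m (c *m B)^T = q%:M by rewrite -mulmx_trE trmx_mul !mulmxA -cG !mulmxA.
    rewrite subrr subr0 hq mulmx_trE -raddfB => /matrixP /(_ 0 0).
    by rewrite mxE [RHS]mxE eqxx !mulr1n.
  by rewrite e row_sqr_ge0.
rewrite mulr_ge0 //=; apply: ler_pM => //; lra.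
Qed.

Lemma hadamard (n : nat) (A : 'M[R]_n) (M : R) : (forall i j, `|A i j| <= M) ->
  (\det A) ^+ 2 <= n%:R ^+ n * M ^+ (2 * n).
Proof.
move=> AM; have /andP[_] := det_gram_le A; rewrite det_mulmx det_tr -expr2 => /le_trans; apply.
apply: (@le_trans _ _ (\prod_(i < n) (n%:R * M ^+ 2))).
  apply: ler_prod => i _; rewrite sumr_ge0 => [|j _]; last exact: sqr_ge0.
  apply: (@le_trans _ _ (\sum_(j < n) M ^+ 2)).
    apply: ler_sum => j _; rewrite -[A i j ^+ 2]real_normK ?num_real //.
    by rewrite ler_pXn2r // nnegrE ?(le_trans (normr_ge0 (A i j))).
  by rewrite sumr_const card_ord mulr_natl.
by rewrite prodr_const card_ord exprMn -exprM.
Qed.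
End Gram.

(** * Von Koch's expansion of a finite determinant *)

Section VonKoch.
Context {F : fieldType}.

Lemma det_1_mulmx (m n : nat) (A : 'M[F]_(m, n)) (B : 'M[F]_(n, m)) :
  \det (1%:M + A *m B) = \det (1%:M + B *m A).
Proof.
have E1 : block_mx 1%:M (- A) B 1%:M *m block_mx 1%:M A 0 1%:M = block_mx 1%:M 0 B (1%:M + B *m A).
  by rewrite mulmx_block !mulmx1 !mulmx0 !addr0 mul1mx subrr addrC.
have E2 : block_mx 1%:M A 0 1%:M *m block_mx 1%:M (- A) B 1%:M = block_mx (1%:M + A *m B) 0 B 1%:M.
  by rewrite mulmx_block !mulmx1 !mul1mx !mul0mx !add0r addNr.
have := congr1 determinant E1; have := congr1 determinant E2.
rewrite !det_mulmx !det_lblock det_ublock !det1 !mulr1 !mul1r => <- <-.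
by [].
Qed.

Variable (N : nat) (M : 'M[F]_N).

(** Rows outside [S] are those of the identity, so that the determinant is the principal minor of
    [M] on [S]. *)
Let MS (S : {set 'I_N}) : 'M[F]_N := \matrix_(i, j) (if i \in S then M i j else (i == j)%:R).

Lemma det_sub_expand : \det (1%:M - M) = \sum_(S : {set 'I_N}) (-1) ^+ #|S| * \det (MS S).
Proof.
pose f (S : {set 'I_N}) := [ffun i => i \in S].
pose g (h : {ffun 'I_N -> bool}) := [set i | h i]%SET.
rewrite (reindex_onto g f) /=; last by move=> S _; apply/setP => i; rewrite inE ffunE.
rewrite (eq_bigl xpredT); last first.
  by move=> h; apply/eqP/ffunP => i; rewrite ffunE inE.
rewrite /determinant; under [RHS]eq_bigr do rewrite mulr_sumr.
rewrite exchange_big /=; apply: eq_bigr => s _.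
under [RHS]eq_bigr do rewrite mulrCA; rewrite -mulr_sumr; congr (_ * _).
under eq_bigr => i _.
  rewrite !mxE (_ : _ - _ = \sum_(e : bool) (if e then - M i (s i) else (i == s i)%:R)); last first.
    by rewrite big_bool addrC.
  over.
rewrite bigA_distr_bigA /=; apply: eq_bigr => h _.
rewrite -prodr_const.
have -> : \prod_(i in mem (g h)) (-1) = \prod_i (if h i then -1 else 1 : F).
  by rewrite big_mkcond; apply: eq_bigr => i _; rewrite inE.
rewrite -big_split /=; apply: eq_bigr => i _; rewrite mxE inE.
by case: (h i); rewrite ?mulN1r ?mul1r.
Qed.

(** With [Q] the matrix selecting the rows [f i], the minor is the determinant of
    [1 + (Q M - Q) Q^T], which [det_1_mulmx] turns into one of full size. *)
Lemma det_sub_image (n : nat) (f : 'I_n -> 'I_N) : injective f ->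
  \det (\matrix_(i, j) M (f i) (f j)) = \det (MS [set f i | i in 'I_n]%SET).
Proof.
move=> finj; pose Q : 'M[F]_(n, N) := \matrix_(i, j) (f i == j)%:R.
have QM (m : nat) (X : 'M[F]_(N, m)) : Q *m X = \matrix_(i, j) X (f i) j.
  apply/matrixP => i j; rewrite !mxE (bigD1 (f i)) //= mxE eqxx mul1r big1 ?addr0 // => k kf.
  by rewrite mxE eq_sym (negbTE kf) mul0r.
have MQ (m : nat) (X : 'M[F]_(m, N)) : X *m Q^T = \matrix_(i, j) X i (f j).
  apply/matrixP => i j; rewrite !mxE (bigD1 (f j)) //= !mxE eqxx mulr1 big1 ?addr0 // => k kf.
  by rewrite !mxE eq_sym (negbTE kf) mulr0.
have QQ : Q *m Q^T = 1%:M.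
  by apply/matrixP => i j; rewrite MQ !mxE (inj_eq finj).
have -> : \matrix_(i, j) M (f i) (f j) = 1%:M + (Q *m M - Q) *m Q^T.
  rewrite mulmxBl QQ addrC subrK MQ; by apply/matrixP => i j; rewrite QM !mxE.
rewrite det_1_mulmx; congr (\det _); apply/matrixP => i j; rewrite !mxE.
have [/imsetP[k _ ->]|iS] := boolP (i \in [set f i | i in 'I_n]%SET).
  rewrite (bigD1 k) //= big1 => [|l lk]; last first.
    by rewrite !mxE (inj_eq finj) (negbTE lk) mul0r.
  by rewrite [Q^T _ _]mxE [Q _ _]mxE eqxx mul1r addr0 QM !mxE addrC subrK.
rewrite big1 ?addr0 // => k _; rewrite !mxE.
have -> : (f k == i) = false by apply/eqP => e; move: iS; rewrite -e imset_f.
by rewrite mul0r.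
Qed.

(** Maps that are not injective produce two equal rows, and each set of size [n] is the image of
    [n!] injective maps. *)
Lemma sum_det_minors (n : nat) :
  \sum_(f : {ffun 'I_n -> 'I_N}) \det (\matrix_(i, j) M (f i) (f j)) =
  n`!%:R * \sum_(S : {set 'I_N} | #|S| == n) \det (MS S).
Proof.
rewrite (bigID (fun f : {ffun 'I_n -> 'I_N} => injectiveb f)) /= [X in _ + X]big1 ?addr0; last first.
  move=> f /injectivePn [i [j ij fij]].
  apply: (determinant_alternate ij) => k; by rewrite !mxE fij.
rewrite (partition_big (fun f : {ffun 'I_n -> 'I_N} => [set f i | i in 'I_n]%SET) (fun S => #|S| == n)) /=; last first.
  by move=> f /injectiveP finj; rewrite card_imset // card_ord.
rewrite mulr_sumr; apply: eq_bigr => S /eqP Sn.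
rewrite (eq_bigr (fun=> \det (MS S))); last first.
  by move=> f /andP[/injectiveP finj /eqP <-]; rewrite det_sub_image.
rewrite sumr_const mulr_natl; congr (_ *+ _).
have := card_inj_ffuns_on 'I_n (mem S); rewrite card_ord Sn ffactnn => <-.
apply: eq_card => f; rewrite !inE andbC; apply/andP/andP => -[h1 h2]; split => //.
  by apply/ffun_onP => i; rewrite -(eqP h2); apply/imsetP; exists i.
rewrite eqEcard Sn card_imset ?card_ord ?leqnn ?andbT; last exact/injectiveP.
by apply/fintype.subsetP => _ /imsetP[i _ ->]; move/ffun_onP: h2.
Qed.

Lemma von_koch : (forall k : nat, k%:R = 0 :> F -> k = 0%N) ->
  \det (1%:M - M) = \sum_(0 <= n < N.+1) (-1) ^+ n / n`!%:R *
    \sum_(f : {ffun 'I_n -> 'I_N}) \det (\matrix_(i, j) M (f i) (f j)).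
Proof.
move=> char0; rewrite det_sub_expand.
have fn (n : nat) : n`!%:R != 0 :> F.
  by apply/eqP => /char0; have := fact_gt0 n; case: n`!.
rewrite (partition_big (fun S : {set 'I_N} => inord #|S| : 'I_N.+1) xpredT) //=.
rewrite big_mkord; apply: eq_bigr => n _.
rewrite sum_det_minors mulrA divfK // mulr_sumr; apply: congr_big => // S.
  by rewrite -val_eqE /= inordK // ltnS (leq_trans (max_card _)) ?card_ord.
by move=> /eqP h; rewrite -h inordK // ltnS (leq_trans (max_card _)) ?card_ord.
Qed.

Lemma sum_det_minors_gt (n : nat) : (N < n)%N ->
  \sum_(f : {ffun 'I_n -> 'I_N}) \det (\matrix_(i, j) M (f i) (f j)) = 0.
Proof.
move=> Nn; rewrite sum_det_minors big_pred0 ?mulr0 // => S; apply/eqP => h.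
by have := max_card (mem S); rewrite h card_ord leqNgt Nn.
Qed.

End VonKoch.

(** * Dominated convergence for iterated half-line integrals *)

Section Iint.
Context {R : realType}.
Local Notation mu := (@lebesgue_measure R).

Lemma cvg_bigsum (I : Type) (r : seq I) (f : nat -> I -> R) (l : I -> R) :
  (forall i, f k i @[k --> \oo] --> l i) ->
  \sum_(i <- r) f k i @[k --> \oo] --> \sum_(i <- r) l i.
Proof.
move=> fl; elim: r => [|i r IH].
  by rewrite big_nil; under eq_fun do rewrite big_nil; exact: cvg_cst.
by rewrite big_cons; under eq_fun do rewrite big_cons; apply: cvgD.
Qed.

Lemma cvg_bigprod (I : Type) (r : seq I) (f : nat -> I -> R) (l : I -> R) :
  (forall i, f k i @[k --> \oo] --> l i) ->
  \prod_(i <- r) f k i @[k --> \oo] --> \prod_(i <- r) l i.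
Proof.
move=> fl; elim: r => [|i r IH].
  by rewrite big_nil; under eq_fun do rewrite big_nil; exact: cvg_cst.
by rewrite big_cons; under eq_fun do rewrite big_cons; apply: cvgM.
Qed.

Lemma cvg_det (n : nat) (A : nat -> 'M[R]_n) (B : 'M[R]_n) :
  (forall i j, A k i j @[k --> \oo] --> B i j) ->
  \det (A k) @[k --> \oo] --> \det B.
Proof.
move=> AB; rewrite /determinant; apply: cvg_bigsum => s; apply: cvgM; first exact: cvg_cst.
by apply: cvg_bigprod => i; exact: AB.
Qed.

Lemma integral_expN (b : R) : 0 < b ->
  mu.-integrable `]0, +oo[ (EFin \o (fun x => expR (- (b * x)))) /\
  \int[mu]_(x in `]0, +oo[) expR (- (b * x)) = b^-1.
Proof.
move=> b0; have i1 := integrable_exponential_pdf b0.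
have mD : measurable (`]0, +oo[%classic : set R) by exact: measurable_itv.
have i2 : mu.-integrable `]0, +oo[ (EFin \o exponential_pdf b) by exact: integrableS i1.
have E x : `]0, +oo[%classic x -> exponential_pdf b x = b * expR (- (b * x)).
  by rewrite /= in_itv /= andbT => x0; rewrite exponential_pdfE ?mulNr // ltW.
have E2 x : `]0, +oo[%classic x -> expR (- (b * x)) = b^-1 * exponential_pdf b x.
  by move=> /E ->; rewrite mulKf // gt_eqF.
have i3 : mu.-integrable `]0, +oo[ (EFin \o (fun x => expR (- (b * x)))).
  apply: (@eq_integrable _ _ R mu _ mD (EFin \o (fun x => b^-1 * exponential_pdf b x))).
    by move=> x /set_mem xD; rewrite /= E2.
  exact: (integrableRZ _ mD i2).
split=> //.
transitivity (\int[mu]_(x in `]0, +oo[) (b^-1 * exponential_pdf b x)).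
  by apply: eq_Rintegral => x /set_mem; exact: E2.
rewrite (@RintegralZl _ _ R mu _ _ _ mD) // -[RHS]mulr1; congr (_ * _).
have -> : 1 = \int[mu]_x exponential_pdf b x by rewrite /Rintegral integral_exponential_pdf.
rewrite (_ : exponential_pdf b = exponential_pdf b \_ `[0, +oo[ :> (R -> R)); last first.
  apply/funext => x; rewrite patchE; case: ifPn => //.
  by rewrite notin_setE /= in_itv /= andbT => /negP; rewrite -ltNge => /lt0_exponential_pdf.
transitivity (\int[mu]_(x in `]0, +oo[) exponential_pdf b x).
  apply: eq_Rintegral => x /set_mem; rewrite /= in_itv /= andbT patchE => x0.
  by rewrite ifT // mem_setE in_itv /= andbT ltW.
rewrite -[RHS](@Rintegral_mkcond _ _ _ mu) /Rintegral integral_itv_obnd_cbnd //.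
by apply/measurable_EFinP; apply: measurable_funS (measurable_exponential_pdf b).
Qed.

Lemma continuous_seq (g : R -> R) :
  (forall (u : nat -> R) (p : R), u n @[n --> \oo] --> p -> g (u n) @[n --> \oo] --> g p) ->
  continuous g.
Proof. by move=> h p; apply/(@cvg_nbhsP R R^o) => u; exact: h. Qed.

Definition expvec (n : nat) (v : 'I_n -> R) : R := \prod_i expR (- `|v i|).

(* Sequential continuity is stable under freezing coordinates, which makes all iterated integrands measurable. *)
Definition nice (n : nat) (C : R) (f : ('I_n -> R) -> R) :=
  (forall (u : nat -> 'I_n -> R) (v : 'I_n -> R), (forall i, u k i @[k --> \oo] --> v i) ->
     f (u k) @[k --> \oo] --> f v) /\
  (forall v, `|f v| <= C * expvec v).

Lemma cons_vec0 (n : nat) x (v : 'I_n -> R) : cons_vec x v ord0 = x.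
Proof. by rewrite /cons_vec unlift_none. Qed.

Lemma cons_vecS (n : nat) x (v : 'I_n -> R) i : cons_vec x v (lift ord0 i) = v i.
Proof. by rewrite /cons_vec liftK. Qed.

Lemma expvec_cons (n : nat) x (v : 'I_n -> R) :
  expvec (cons_vec x v) = expR (- `|x|) * expvec v.
Proof.
rewrite /expvec big_ord_recl cons_vec0; congr (_ * _).
by apply: eq_bigr => i _; rewrite cons_vecS.
Qed.

Lemma cvg_cons_vec (n : nat) (x : nat -> R) (x0 : R) (u : nat -> 'I_n -> R) (v : 'I_n -> R) :
  x k @[k --> \oo] --> x0 -> (forall i, u k i @[k --> \oo] --> v i) ->
  forall i, cons_vec (x k) (u k) i @[k --> \oo] --> cons_vec x0 v i.
Proof.
move=> xx uv i; case: (unliftP ord0 i) => [j|] ->.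
  by under eq_fun do rewrite cons_vecS; rewrite cons_vecS; exact: uv.
by under eq_fun do rewrite cons_vec0; rewrite cons_vec0.
Qed.

Lemma expvec_gt0 (n : nat) (v : 'I_n -> R) : 0 < expvec v.
Proof. by apply: prodr_gt0 => i _; exact: expR_gt0. Qed.

Lemma nice_ge0 n C (f : ('I_n -> R) -> R) : nice C f -> 0 <= C.
Proof.
move=> [_ /(_ (fun=> 0))] /(le_trans (normr_ge0 _)).
by rewrite pmulr_lge0 // expvec_gt0.
Qed.

Lemma nice_cons n C (f : ('I_n.+1 -> R) -> R) x : nice C f ->
  nice (C * expR (- `|x|)) (fun v => f (cons_vec x v)).
Proof.
move=> [fc fb]; split => [u v uv|v].
  by apply: fc; apply: cvg_cons_vec => //; exact: cvg_cst.
by rewrite -mulrA -expvec_cons.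
Qed.

Lemma nice_le n C C' (f : ('I_n -> R) -> R) : nice C f -> C <= C' -> nice C' f.
Proof.
move=> [fc fb] CC; split => // v; apply: (le_trans (fb v)).
by rewrite ler_wpM2r // ltW // expvec_gt0.
Qed.

Lemma iint_dct n C (f_ : nat -> ('I_n -> R) -> R) (f : ('I_n -> R) -> R) :
  (forall k, nice C (f_ k)) -> (forall v, f_ k v @[k --> \oo] --> f v) ->
  (forall k, `|iint_pos (f_ k)| <= C) /\ iint_pos (f_ k) @[k --> \oo] --> iint_pos f.
Proof.
elim: n C f_ f => [|n IH] C f_ f fC fl.
  split=> [k|] /=; last exact: fl.
  by have [_ /(_ (fun=> 0))] := fC k; rewrite /expvec big_ord0 mulr1.
pose g k x := iint_pos (fun v => f_ k (cons_vec x v)).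
have C0 : 0 <= C := nice_ge0 (fC 0).
have gb k x : `|g k x| <= C * expR (- `|x|).
  have [h _] := IH _ (fun=> fun v => f_ k (cons_vec x v)) (fun v => f_ k (cons_vec x v))
     (fun=> nice_cons x (fC k)) (fun v => cvg_cst _).
  exact: h 0.
have mg k : measurable_fun setT (g k).
  apply: continuous_mfun; apply: continuous_seq => x x0 xx.
  have h j : nice C (fun v => f_ k (cons_vec (x j) v)).
    apply: (nice_le (nice_cons (x j) (fC k))).
    by rewrite ler_piMr // expR_le1 oppr_le0.
  apply: (IH C (fun j => fun v => f_ k (cons_vec (x j) v)) (fun v => f_ k (cons_vec x0 v)) h _).2.
  move=> v; have [fc _] := fC k; apply: fc; apply: cvg_cons_vec => // i; exact: cvg_cst.
have [iE vE] := @integral_expN 1 ltr01.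
have mD : measurable (`]0, +oo[%classic : set R) by exact: measurable_itv.
have iC : mu.-integrable `]0, +oo[ (EFin \o (fun x => C * expR (- (1 * x)))) by exact: integrableRZ.
have gD k x : `]0, +oo[%classic x -> `|g k x| <= C * expR (- (1 * x)).
  by rewrite /= in_itv /= andbT => x0; rewrite mul1r (le_trans (gb k x)) // ger0_norm // ltW.
have mgD k : measurable_fun (`]0, +oo[%classic : set R) (g k) by exact: measurable_funS (mg k).
split=> [k|].
  apply: (le_trans (Rintegral_le mD (mgD k) (gD k) iC)).
  by rewrite (@RintegralZl _ _ R mu _ _ _ mD) // vE invr1 mulr1.
apply: (@Rintegral_dct R _ g (fun x => iint_pos (fun v => f (cons_vec x v))) _ mD mgD _ iC gD).2 => x _.
by have [] := IH _ (fun k v => f_ k (cons_vec x v)) (fun v => f (cons_vec x v))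
     (fun k => nice_cons x (fC k)) (fun v => fl _).
Qed.

Lemma eq_iint n (f g : ('I_n -> R) -> R) : (forall v, (forall i, 0 <= v i) -> f v = g v) ->
  iint_pos f = iint_pos g.
Proof.
elim: n f g => [|n IH] f g fg /=; first by apply: fg; case.
apply: eq_Rintegral => x /set_mem; rewrite /= in_itv /= andbT => x0; apply: IH => v v0.
apply: fg => i; case: (unliftP ord0 i) => [j|] ->; rewrite ?cons_vecS ?cons_vec0 //; exact: ltW.
Qed.

Lemma iint_exp (n : nat) (I : finType) (c : I -> R) (b : I -> 'I_n -> R) :
  (forall i j, 0 < b i j) ->
  iint_pos (fun v => \sum_i c i * \prod_j expR (- (b i j * v j))) = \sum_i c i * \prod_j (b i j)^-1.
Proof.
elim: n c b => [|n IH] c b b0 /=; first by apply: eq_bigr => i _; rewrite !big_ord0.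
have E x : iint_pos (fun v => \sum_i c i * \prod_j expR (- (b i j * cons_vec x v j))) =
    \sum_i (c i * \prod_(j < n) (b i (lift ord0 j))^-1) * expR (- (b i ord0 * x)).
  transitivity (iint_pos (fun v => \sum_i (c i * expR (- (b i ord0 * x))) *
     \prod_(j < n) expR (- (b i (lift ord0 j) * v j)))).
    congr iint_pos; apply/funext => v; apply: eq_bigr => i _.
    rewrite big_ord_recl cons_vec0 mulrA; congr (_ * _).
    by apply: eq_bigr => j _; rewrite cons_vecS.
  by rewrite IH //; apply: eq_bigr => i _; rewrite mulrAC.
under eq_Rintegral do rewrite E.
have mD : measurable (`]0, +oo[%classic : set R) by exact: measurable_itv.
have [_ ->] := @Rintegral_bigsum R _ I (index_enum I)
  (fun i x => (c i * \prod_(j < n) (b i (lift ord0 j))^-1) * expR (- (b i ord0 * x))) mD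
  (fun i => integrableRZ _ mD (integral_expN (b0 i ord0)).1).
apply: eq_bigr => i _; have [i1 i2] := integral_expN (b0 i ord0).
by rewrite (@RintegralZl _ _ R mu _ _ _ mD) // i2 big_ord_recl -mulrA [\prod_(j < n) _ * _]mulrC.
Qed.

End Iint.

(** * Convergence of Fredholm series *)

Section Fredholm.
Context {R : realType}.
Local Notation mu := (@lebesgue_measure R).

Definition fred_term (k : R -> R) (n : nat) : R :=
  (-1) ^+ n / n`!%:R * iint_pos (fun v : 'I_n -> R => \det (\matrix_(i < n, j < n) k (v i + v j))).
Definition fred (k : R -> R) : R := limn (fun N : nat => \sum_(0 <= n < N) fred_term k n).

Lemma F_GOE_fred (s : R) : F_GOE s = fred (fun x => airy (x + s)).
Proof. by []. Qed.

Lemma series_tail (t : nat -> R) (A : R) (M : nat) : 0 <= A ->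
  (forall n, (M <= n)%N -> `|t n| <= A * 2^-1 ^+ n) ->
  cvgn (fun N : nat => \sum_(0 <= n < N) t n) /\
  `|limn (fun N : nat => \sum_(0 <= n < N) t n) - \sum_(0 <= n < M) t n| <= 2 * A * 2^-1 ^+ M.
Proof.
move=> A0 tA; pose S N := \sum_(0 <= n < N) t n.
have geo a b : (a <= b)%N -> \sum_(a <= n < b) (A * 2^-1 ^+ n) = 2 * A * (2^-1 ^+ a - 2^-1 ^+ b).
  move=> ab; rewrite -(subnKC ab); elim: (b - a)%N => [|d IH].
    by rewrite addn0 big_geq // subrr mulr0.
  rewrite addnS big_nat_recr /= ?leq_addr // IH exprS; move: (_ ^+ (a + d)) (_ ^+ a) => x y.
  by field.
have Sb a b : (M <= a)%N -> (a <= b)%N -> `|S b - S a| <= 2 * A * 2^-1 ^+ a.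
  move=> Ma ab; rewrite /S (big_cat_nat _ ab) //= addrAC subrr add0r.
  apply: (le_trans (ler_norm_sum _ _ _)).
  apply: (@le_trans _ _ (\sum_(a <= n < b) (A * 2^-1 ^+ n))).
    by rewrite !big_nat; apply: ler_sum => n /andP[an _]; apply: tA; exact: leq_trans an.
  by rewrite geo // ler_wpM2l ?mulr_ge0 // lerBlDr lerDl exprn_ge0.
have e0 : 2 * A * 2^-1 ^+ n @[n --> \oo] --> (0 : R).
  rewrite -[X in _ --> X](mulr0 (2 * A)); apply: cvgM; first exact: cvg_cst.
  by apply: cvg_expr; rewrite ger0_norm ?invr_ge0 // invf_lt1 // ltr1n.
have Sc : cvgn S.
  pose A' := A + \sum_(0 <= n < M) `|t n| * 2 ^+ n.
  have A'0 : 0 <= A' by rewrite addr_ge0 // sumr_ge0 // => n _; rewrite mulr_ge0 ?exprn_ge0.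
  have tA' n : `|t n| <= A' * 2^-1 ^+ n.
    have [Mn|nM] := leqP M n.
      by rewrite (le_trans (tA _ Mn)) // ler_wpM2r ?exprn_ge0 // lerDl sumr_ge0 // => k _; rewrite mulr_ge0 ?exprn_ge0.
    rewrite exprVn ler_pdivlMr ?exprn_gt0 // /A' big_mkord (bigD1 (Ordinal nM)) //= addrCA lerDl.
    by rewrite addr_ge0 // sumr_ge0 // => k _; rewrite mulr_ge0 ?exprn_ge0.
  apply: (@normed_cvg R R^o t); apply: (@series_le_cvg R _ (geometric A' 2^-1)) => //=.
  - by move=> n; rewrite mulr_ge0 ?exprn_ge0.
  - by apply: is_cvg_geometric_series; rewrite ger0_norm ?invr_ge0 // invf_lt1 // ltr1n.
split=> //.
have l1 : `|S n - S M| @[n --> \oo] --> `|limn S - S M|.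
  by apply: (@cvg_norm _ R^o); apply: cvgB; [exact: Sc|exact: cvg_cst].
by apply: (@ler_cvg_to _ _ _ _ _ _ _ _ l1 (cvg_cst _)); near=> n; apply: Sb => //; near: n; exact: nbhs_infty_ge.
Unshelve. all: by end_near. Qed.

Definition hfact (n : nat) : R := Num.sqrt (n%:R ^+ n).

(** The absolute values extend the integrand from the orthant to the whole space, as [nice] demands.
    Pulling [e^(- |v_i|)] out of row [i] leaves entries at most [C], to which Hadamard's bound
    applies. *)
Lemma nice_det (n : nat) (k : R -> R) (C : R) : 0 <= C -> continuous k ->
  (forall x, 0 <= x -> `|k x| <= C * expR (- x)) ->
  nice (hfact n * C ^+ n) (fun v : 'I_n -> R => \det (\matrix_(i < n, j < n) k (`|v i| + `|v j|))).
Proof.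
move=> C0 kc kC; split => [u v uv|v].
  apply: cvg_det => i j; rewrite mxE; under eq_fun do rewrite mxE.
  have h : `|u m i| + `|u m j| @[m --> \oo] --> `|v i| + `|v j|.
    by apply: cvgD; apply: (@cvg_norm _ R^o); exact: uv.
  exact: (cvg_comp _ _ h (kc _)).
pose B : 'M[R]_n := \matrix_(i, j) (expR `|v i| * k (`|v i| + `|v j|)).
have -> : \matrix_(i < n, j < n) k (`|v i| + `|v j|) = diag_mx (\row_i expR (- `|v i|)) *m B.
  by apply/matrixP => i j; rewrite mul_diag_mx !mxE mulrA -expRD addNr expR0 mul1r.
rewrite det_mulmx det_diag normrM mulrC; apply: ler_pM => //; last first.
  rewrite ger0_norm; last by apply: prodr_ge0 => i _; rewrite mxE expR_ge0.
  by rewrite /expvec; apply: ler_prod => i _; rewrite mxE expR_ge0 lexx.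
have h : (\det B) ^+ 2 <= n%:R ^+ n * C ^+ (2 * n).
  apply: hadamard => i j; rewrite mxE normrM ger0_norm ?expR_ge0 //.
  apply: (@le_trans _ _ (expR `|v i| * (C * expR (- (`|v i| + `|v j|))))).
    by rewrite ler_pM2l ?expR_gt0 // kC // addr_ge0.
  rewrite mulrCA -expRD ler_piMr // expR_le1; have := normr_ge0 (v j); lra.
rewrite -(ler_pXn2r (n := 2)) ?nnegrE ?mulr_ge0 ?sqrtr_ge0 ?exprn_ge0 // real_normK ?num_real //.
by rewrite exprMn sqr_sqrtr ?exprn_ge0 // -exprM [(n * 2)%N]mulnC.
Qed.

Lemma pow_fact_le (n : nat) : n%:R ^+ n / n`!%:R <= expR n%:R :> R.
Proof.
case: n => [|n]; first by rewrite expr0 divr1 (le_trans _ (expR_ge1Dx _)) // lerDl.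
by have := @expR_ge1Dxn R n.+1%:R n (ler0n _ _); lra.
Qed.

(** The square of [hfact n * C^n / n!] is at most [(e C^2)^n / n!]; the extra [4] in the exponential
    leaves a factor [4^(- n)] over. *)
Definition fred_cst (C : R) : R := Num.sqrt (expR (4 * C ^+ 2 * expR 1)).

Lemma hfact_bound (C : R) (n : nat) : 0 <= C ->
  hfact n * C ^+ n / n`!%:R <= fred_cst C * 2^-1 ^+ n.
Proof.
move=> C0; have f0 : 0 < n`!%:R :> R by rewrite ltr0n fact_gt0.
rewrite -(ler_pXn2r (n := 2)) ?nnegrE ?mulr_ge0 ?invr_ge0 ?sqrtr_ge0 ?exprn_ge0 //.
rewrite !exprMn !sqr_sqrtr ?expR_ge0 ?exprn_ge0 //.
have e : expR n%:R = expR 1 ^+ n :> R by rewrite -expRM_natl mulr1.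
have h1 := pow_fact_le n; rewrite e in h1.
have h2 : (4 * C ^+ 2 * expR 1) ^+ n / n`!%:R <= expR (4 * C ^+ 2 * expR 1).
  have : 0 <= 4 * C ^+ 2 * expR 1 by rewrite !mulr_ge0 ?sqr_ge0 ?expR_ge0.
  case: (n) => [|m] x0; first by rewrite expr0 divr1 (le_trans _ (expR_ge1Dx _)) // lerDl.
  by have := expR_ge1Dxn m x0; lra.
apply: (@le_trans _ _ ((4 * C ^+ 2 * expR 1) ^+ n / n`!%:R * (2^-1 ^+ n) ^+ 2)); last first.
  by rewrite ler_wpM2r ?exprn_ge0.
rewrite !exprMn -!exprM [(n * 2)%N]mulnC !exprM.
have -> : (2^-1 ^+ 2) ^+ n = (4 ^+ n)^-1 :> R by rewrite -exprVn; congr (_ ^+ _); field.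
have f4 : 4 ^+ n != 0 :> R by rewrite expf_neq0.
rewrite -[C ^+ n * C ^+ n]exprMn -[C * C]/(C ^+ 2).
move: (expR 1 ^+ n) h1 ((C ^+ 2) ^+ n) (exprn_ge0 n (sqr_ge0 C)) => E h1 D D0.
have -> : 4 ^+ n * D * E / n`!%:R / 4 ^+ n = E * (D / n`!%:R) by field; rewrite f4 gt_eqF.
have -> : n%:R ^+ n * D * n`!%:R^-1 ^+ 2 = (n%:R ^+ n / n`!%:R) * (D / n`!%:R).
  by move: (n%:R ^+ n) => y; field; rewrite gt_eqF.
by rewrite ler_wpM2r // mulr_ge0 ?invr_ge0.
Qed.

Let fred_abs (k : R -> R) n : fred_term k n =
  (-1) ^+ n / n`!%:R * iint_pos (fun v : 'I_n -> R => \det (\matrix_(i < n, j < n) k (`|v i| + `|v j|))).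
Proof.
rewrite /fred_term; congr (_ * _); apply: eq_iint => v v0; congr (\det _).
by apply/matrixP => i j; rewrite !mxE !ger0_norm.
Qed.

Lemma fred_term_le (k : R -> R) (C : R) n : 0 <= C -> continuous k ->
  (forall x, 0 <= x -> `|k x| <= C * expR (- x)) ->
  `|fred_term k n| <= hfact n * C ^+ n / n`!%:R.
Proof.
move=> C0 kc kC; rewrite fred_abs normrM normrM normrX normrN1 expr1n mul1r.
rewrite [X in X * _]ger0_norm ?invr_ge0 // mulrC ler_pM2r ?invr_gt0 ?ltr0n ?fact_gt0 //.
pose F := fun v : 'I_n -> R => \det (\matrix_(i < n, j < n) k (`|v i| + `|v j|)).
exact: (@iint_dct _ n _ (fun=> F) F (fun=> nice_det n C0 kc kC) (fun v => cvg_cst _)).1 0.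
Qed.

Lemma fred_tail (k : R -> R) (C : R) M : 0 <= C -> continuous k ->
  (forall x, 0 <= x -> `|k x| <= C * expR (- x)) ->
  `|fred k - \sum_(0 <= n < M) fred_term k n| <= 2 * fred_cst C * 2^-1 ^+ M.
Proof.
move=> C0 kc kC; apply: (series_tail _ _).2; first exact: sqrtr_ge0.
by move=> n _; rewrite (le_trans (fred_term_le n C0 kc kC)) // hfact_bound.
Qed.

(** Every term but the zeroth carries at least one factor [c]; the remaining factors are estimated
    as for a kernel with constant [1]. *)
Lemma fred_sub1 (k : R -> R) (c : R) : 0 <= c <= 1 -> continuous k ->
  (forall x, 0 <= x -> `|k x| <= c * expR (- x)) ->
  `|fred k - 1| <= fred_cst 1 * c.
Proof.
move=> /andP[c0 c1] kc kC.
have S1 : \sum_(0 <= n < 1) fred_term k n = 1.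
  by rewrite big_nat1 /fred_term expr0 divr1 mul1r /= det_mx00.
have -> : fred k - 1 = fred k - \sum_(0 <= n < 1) fred_term k n by rewrite S1.
have -> : fred_cst 1 * c = 2 * (fred_cst 1 * c) * 2^-1 ^+ 1 by rewrite expr1; field.
apply: (series_tail _ _).2; first by rewrite mulr_ge0 // sqrtr_ge0.
move=> n n1; rewrite (le_trans (fred_term_le n c0 kc kC)) //.
rewrite mulrAC -[X in _ <= X]mulrAC.
apply: ler_pM; rewrite ?mulr_ge0 ?invr_ge0 ?sqrtr_ge0 ?exprn_ge0 //.
  by have := hfact_bound n (@ler01 R); rewrite expr1n mulr1.
by case: n n1 => // n _; rewrite exprS ler_piMr // exprn_ile1.
Qed.

Lemma fred_cvg (k_ : nat -> R -> R) (k : R -> R) (C : R) : 0 <= C ->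
  (forall m, continuous (k_ m)) -> continuous k ->
  (\forall m \near \oo, forall x, 0 <= x -> `|k_ m x| <= C * expR (- x)) ->
  (forall x, 0 <= x -> k_ m x @[m --> \oo] --> k x) ->
  fred (k_ m) @[m --> \oo] --> fred k.
Proof.
move=> C0 k_c kc [m0 _ k_C] kl; rewrite -(@cvg_shiftn m0).
pose h m := k_ (m + m0)%N.
have hc m : continuous (h m) by exact: k_c.
have hC m x : 0 <= x -> `|h m x| <= C * expR (- x) by apply: k_C; exact: leq_addl.
have hl x : 0 <= x -> h m x @[m --> \oo] --> k x.
  by move=> x0; rewrite (@cvg_shiftn m0 _ (fun m => k_ m x)); exact: kl.
have kC x : 0 <= x -> `|k x| <= C * expR (- x).
  move=> x0; have l1 : `|h m x| @[m --> \oo] --> `|k x|.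
    by apply: (@cvg_norm _ R^o); exact: hl.
  by apply: (@ler_cvg_to _ _ _ _ _ _ _ _ l1 (cvg_cst _)); near=> m; exact: hC.
have tl n : fred_term (h m) n @[m --> \oo] --> fred_term k n.
  rewrite fred_abs; under eq_fun do rewrite fred_abs.
  apply: cvgM; first exact: cvg_cst.
  apply: (iint_dct (fun m => nice_det n C0 (hc m) (hC m)) _).2 => v.
  by apply: cvg_det => i j; rewrite mxE; under eq_fun do rewrite mxE; apply: hl; rewrite addr_ge0.
have e0 : 2 * fred_cst C * 2^-1 ^+ n @[n --> \oo] --> (0 : R).
  rewrite -[X in _ --> X](mulr0 (2 * fred_cst C)); apply: cvgM; first exact: cvg_cst.
  by apply: cvg_expr; rewrite ger0_norm ?invr_ge0 // invf_lt1 // ltr1n.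
apply/cvgrPdist_le => e ep.
have [M HM] : exists M : nat, 2 * fred_cst C * 2^-1 ^+ M <= e / 3.
  have : \forall n \near \oo, 2 * fred_cst C * 2^-1 ^+ n <= e / 3.
    by apply: (cvgr_le 0) => //; rewrite divr_gt0.
  by move=> [M _ H]; exists M; apply: H => /=.
have sl : \sum_(0 <= n < M) fred_term (h m) n @[m --> \oo] --> \sum_(0 <= n < M) fred_term k n.
  exact: cvg_bigsum.
have e3 : 0 < e / 3 by rewrite divr_gt0.
near=> m.
have h1 : `|\sum_(0 <= n < M) fred_term k n - \sum_(0 <= n < M) fred_term (h m) n| <= e / 3.
  by near: m; exact: (@cvgr_dist_le _ _ _ _ _ _ _ sl _ e3).
have h2 := fred_tail M C0 kc kC; have h3 := fred_tail M C0 (hc m) (hC m).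
have -> : [sequence fred (k_ (n + m0)%N)]_n m = fred (h m) by [].
move: h1 h2 h3; move: (\sum_(0 <= n < M) _) (\sum_(0 <= n < M) _) (fred _) (fred _) HM => S1 S2 F1 F2.
by move: (2 * _ * _) => t; rewrite !ler_norml => H /andP[a1 a2] /andP[b1 b2] /andP[c1 c2]; apply/andP; split; lra.
Unshelve. all: by end_near. Qed.

(** Expanding determinants and sums separates the variables, so each term can be integrated exactly.
    The result is von Koch's expansion of the finite determinant, which stops at [N]. *)
Lemma fred_exp (N : nat) (a b : 'I_N -> R) : (forall i, 0 < b i) ->
  fred (fun x => \sum_j a j * expR (- (b j * x))) =
  \det (1%:M - \matrix_(i, j) (a i / (b i + b j))).
Proof.
move=> b0; set k := fun x : R => _.
pose M : 'M[R]_N := \matrix_(i, j) (a i / (b i + b j)).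
have T n : fred_term k n = (-1) ^+ n / n`!%:R *
    \sum_(f : {ffun 'I_n -> 'I_N}) \det (\matrix_(i, j) M (f i) (f j)).
  rewrite /fred_term; congr (_ * _).
  pose J := ('S_n * {ffun 'I_n -> 'I_N})%type.
  pose c (p : J) : R := (-1) ^+ p.1 * \prod_i a (p.2 i).
  (* The variable [v j] occurs in row [j] and in column [j], and the permutation meets column [j] in
     row [s^-1 j]. *)
  pose B (p : J) i := b (p.2 i) + b (p.2 ((p.1^-1)%g i)).
  transitivity (iint_pos (fun v : 'I_n -> R => \sum_(p : J) c p * \prod_j expR (- (B p j * v j)))).
    congr iint_pos; apply/funext => v; rewrite -(pair_bigA _ (fun s f => c (s, f) * \prod_j expR (- (B (s, f) j * v j)))) /=.
    rewrite /determinant; apply: eq_bigr => s _; rewrite /c /=; under [RHS]eq_bigr do rewrite -mulrA.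
    rewrite -mulr_sumr; congr (_ * _).
    under eq_bigr do rewrite mxE.
    rewrite bigA_distr_bigA /=; apply: eq_bigr => f _.
    rewrite big_split /=; congr (_ * _).
    under eq_bigr do rewrite mulrDr opprD expRD.
    rewrite big_split /= [X in _ * X](reindex_inj (@perm_inj _ (s^-1)%g)) /=.
    rewrite -big_split /=; apply: eq_bigr => j _.
    by rewrite permKV -expRD /B /= mulrDl opprD.
  rewrite iint_exp; last by move=> p j; rewrite addr_gt0.
  rewrite -(pair_bigA _ (fun s f => c (s, f) * \prod_j (B (s, f) j)^-1)) /= exchange_big /=.
  apply: eq_bigr => f _; rewrite /determinant (reindex_inj invg_inj) /=.
  apply: eq_bigr => s _; rewrite /c /= odd_permV -mulrA; congr (_ * _).
  rewrite -big_split /=; apply: eq_bigr => i _; by rewrite !mxE /B /= invgK.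
have Z n : (N < n)%N -> fred_term k n = 0.
  by move=> Nn; rewrite T sum_det_minors_gt // mulr0.
rewrite -/M von_koch; last by move=> n /eqP; rewrite pnatr_eq0 => /eqP.
under [RHS]eq_bigr do rewrite -T.
apply: (@cvg_lim R^o); first exact: norm_hausdorff.
apply: cvg_near_cst; near=> n.
have Nn : (N.+1 <= n)%N by near: n; exact: nbhs_infty_ge.
rewrite (big_cat_nat _ Nn) //= [X in _ + X]big_nat_cond [X in _ + X]big1 ?addr0 // => i /andP[/andP[Ni _] _].
exact: Z.
Unshelve. all: by end_near. Qed.

End Fredholm.

(** * Asymptotics of the determinant of the kernel *)

Section FredAsymptotics.
Context {R : realType}.

Lemma continuous_ker (N : nat) (b : 'I_N -> R) (s : R) : continuous (fun x => ker b (x + s)).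
Proof.
apply: continuous_seq => u p up; apply: cvg_bigsum => j; apply: cvgM; first exact: cvg_cst.
have h : - (b j * (u n + s)) @[n --> \oo] --> - (b j * (p + s)).
  by apply: cvgN; apply: cvgM; [exact: cvg_cst|apply: cvgD up _; exact: cvg_cst].
exact: (cvg_comp _ _ h (@continuous_expR R _)).
Qed.

Lemma continuous_airy_shift (s : R) : continuous (fun x => airy (x + s)).
Proof.
apply: continuous_seq => u p up; apply: airy_cvg.
by apply: cvgD up _; exact: cvg_cst.
Qed.

Lemma pf_coef_scale (N : nat) (b : 'I_N -> R) (q : R) j : 0 < q ->
  pf_coef (fun l => q * b l) j = q * pf_coef b j.
Proof.
move=> q0; rewrite /pf_coef !mulrA [q * 2]mulrC; congr (_ * _).
apply: eq_bigr => l _; rewrite -mulrDr -mulrBr -mulf_div divff ?mul1r //; by rewrite gt_eqF.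
Qed.

Lemma fred_ker (N : nat) (b : 'I_N -> R) (s : R) : (forall l, 0 < b l) ->
  fred (fun x => ker b (x + s)) =
  \det (1%:M - \matrix_(i, j) (pf_coef b i * expR (- (b i * s)) / (b i + b j))).
Proof.
move=> b0; rewrite -(fred_exp (fun i => pf_coef b i * expR (- (b i * s))) b0).
congr fred; apply/funext => x.
apply: eq_bigr => j _; rewrite mulrDr opprD expRD mulrCA mulrA.
by rewrite [_ * pf_coef _ _]mulrC -!mulrA [expR _ * expR _]mulrC.
Qed.

(** The finite matrix depends only on ratios of the parameters and on the products [b i * s]. This
    reduces to parameters with [2 \sum b^-3 = 1]. *)
Lemma fred_ker_scale (N : nat) (b : 'I_N -> R) (q s : R) : 0 < q -> (forall l, 0 < b l) ->
  fred (fun x => ker b (x + s)) = fred (fun x => ker (fun l => q * b l) (x + s / q)).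
Proof.
move=> q0 b0; rewrite !fred_ker //; last by move=> l; rewrite mulr_gt0.
congr (\det (_ - _)); apply/matrixP => i j; rewrite !mxE pf_coef_scale // -mulrDr.
have -> : q * b i * (s / q) = b i * s by field; rewrite gt_eqF.
rewrite -[q * pf_coef b i * _]mulrA -mulf_div divff ?mul1r //; by rewrite gt_eqF.
Qed.

Definition ker_cst (rho : R) : R := 2 * rho ^+ 2 / pi * lor * expR 4.

Lemma lor_ge0 : 0 <= lor :> R.
Proof. by apply: Rintegral_ge0 => x _; rewrite invr_ge0 addr_ge0 ?sqr_ge0. Qed.

Lemma ker_cst_ge0 (rho : R) : 0 <= ker_cst rho.
Proof.
rewrite /ker_cst mulr_ge0 ?expR_ge0 // mulr_ge0 ?lor_ge0 // divr_ge0 ?(ltW (pi_gt0 _)) //.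
by rewrite mulr_ge0 ?sqr_ge0.
Qed.

Section OneSize.
Variables (N : nat) (b : 'I_N -> R) (beta B q : R).
Hypothesis binj : injective b.
Hypothesis beta0 : 0 < beta.
Hypothesis betaB : beta <= B.
Hypothesis bb : forall l, beta <= b l <= B.
Hypothesis q0 : 0 < q.
Hypothesis q3 : q ^+ 3 = 2 * \sum_l (b l ^+ 3)^-1.
Hypothesis qb : 4 <= q * beta.

Lemma scaled_inj : injective (fun l => q * b l).
Proof. by move=> i j /mulfI h; apply: binj; apply: h; rewrite gt_eqF. Qed.

Lemma scaled_bnd l : q * beta <= q * b l <= B / beta * (q * beta).
Proof.
have -> : B / beta * (q * beta) = q * B by field; rewrite gt_eqF.
by rewrite !ler_pM2l.
Qed.

Lemma scaled_norm : 2 * \sum_l ((q * b l) ^+ 3)^-1 = 1.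
Proof.
under eq_bigr do rewrite exprMn invfM.
rewrite -mulr_sumr mulrCA -q3 mulVf // expf_neq0 // gt_eqF //.
Qed.

Lemma scaled_mean : \sum_l (q * b l)^-1 = (\sum_l (b l)^-1) / q.
Proof. by under eq_bigr do rewrite invfM mulrC; rewrite mulr_suml. Qed.

Lemma ratio_ge1 : 1 <= B / beta.
Proof. by rewrite ler_pdivlMr // mul1r. Qed.

Lemma ker_scaled_bound (eta x : R) : 0 <= x -> - (\sum_l (q * b l)^-1) <= eta ->
  `|ker (fun l => q * b l) (x + (2 * (\sum_l (q * b l)^-1) + eta))| <=
  ker_cst (B / beta) * expR (- eta) * expR (- x).
Proof.
move=> x0 h; rewrite addrC -addrA.
apply: (le_trans (ker_bound scaled_inj qb ratio_ge1 scaled_bnd scaled_norm _)).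
  by rewrite (le_trans h) // lerDl.
by rewrite /ker_cst -!mulrA -!expRD !mulrA opprD addrA.
Qed.

(** The source of the upper tail bound for the passage times. *)
Lemma fred_ker_sub1 (eta : R) : 0 <= eta -> ker_cst (B / beta) * expR (- eta) <= 1 ->
  `|fred (fun x => ker b (x + (2 * \sum_l (b l)^-1 + q * eta))) - 1| <=
  fred_cst 1 * (ker_cst (B / beta) * expR (- eta)).
Proof.
move=> eta0 h1; rewrite (fred_ker_scale _ q0); last first.
  by move=> l; have /andP[h _] := bb l; exact: lt_le_trans h.
have -> : (2 * \sum_l (b l)^-1 + q * eta) / q = 2 * (\sum_l (q * b l)^-1) + eta.
  rewrite scaled_mean; move: (\sum_l _) => S; field; by rewrite gt_eqF.
apply: fred_sub1.
- by rewrite h1 mulr_ge0 ?expR_ge0 ?ker_cst_ge0.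
- exact: continuous_ker.
- move=> x x0; apply: ker_scaled_bound => //; apply: le_trans eta0.
  rewrite oppr_le0 sumr_ge0 // => l _; rewrite invr_ge0 mulr_ge0 ?(ltW q0) //.
  by have /andP[h _] := bb l; rewrite (le_trans (ltW beta0)).
Qed.
End OneSize.

Lemma fred_ker_cvg (N : nat -> nat) (b : forall k, 'I_(N k) -> R) (beta B : R) (q eta : nat -> R) (eta0 : R) :
  (forall k, injective (@b k)) -> 0 < beta -> beta <= B -> (forall k l, beta <= @b k l <= B) ->
  (forall k, 0 < q k) -> (forall k, q k ^+ 3 = 2 * \sum_l (@b k l ^+ 3)^-1) ->
  (forall k, 4 <= q k * beta) -> q k @[k --> \oo] --> +oo ->
  eta k @[k --> \oo] --> eta0 ->
  fred (fun x => ker (@b k) (x + (2 * \sum_l (@b k l)^-1 + q k * eta k))) @[k --> \oo] --> F_GOE eta0.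
Proof.
move=> binj beta0 betaB bb q0 q3 qb qoo ee; rewrite F_GOE_fred.
have bp k l : 0 < @b k l by have /andP[h _] := bb k l; exact: lt_le_trans h.
pose m k := \sum_l (q k * @b k l)^-1.
have m0 k : 0 <= m k by apply: sumr_ge0 => l _; rewrite invr_ge0 mulr_ge0 // ltW.
have E k : fred (fun x => ker (@b k) (x + (2 * \sum_l (@b k l)^-1 + q k * eta k))) =
   fred (fun x => ker (fun l => q k * @b k l) (x + (2 * m k + eta k))).
  rewrite (fred_ker_scale _ (q0 k) (bp k)); congr fred; apply/funext => x; congr (ker _ (_ + _)).
  rewrite /m scaled_mean; move: (\sum_l _) => S; field; by rewrite gt_eqF.
under eq_fun do rewrite E.
have rho1 := ratio_ge1 beta0 betaB.
have qboo : q k * beta @[k --> \oo] --> +oo.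
  apply/cvgryPge => A; move/cvgryPge: qoo => /(_ (A / beta)); apply: filterS => k.
  by rewrite ler_pdivrMr.
apply: (@fred_cvg R _ _ (Num.max (ker_cst (B / beta) * expR (1 - eta0)) (lor / (2 * pi) * expR (1 - eta0)))).
- by rewrite le_max mulr_ge0 ?expR_ge0 ?ker_cst_ge0.
- by move=> k; exact: continuous_ker.
- exact: continuous_airy_shift.
- near=> k => x x0.
  have h1 : eta0 - 1 <= eta k by near: k; apply: (cvgr_ge eta0) => //; lra.
  have h2 : - m k <= eta k.
    apply: le_trans h1.
    have h3 := ker_mean_ge (qb k) (scaled_bnd beta0 (bb k) (q0 k)) (scaled_norm (q0 k) (q3 k)).
    have : 1 + `|eta0| <= q k * beta by near: k; move/cvgryPge : qboo => /(_ (1 + `|eta0|)).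
    have := qb k; have : - `|eta0| <= eta0 by rewrite lerNl -normrN ler_norm.
    by move: h3; rewrite -/(m k); move: (q k * beta) => y; nra.
  apply: (le_trans (ker_scaled_bound (binj k) beta0 betaB (bb k) (q0 k) (q3 k) (qb k) x0 h2)).
  rewrite ler_pM2r ?expR_gt0 // le_max; apply/orP; left.
  by rewrite ler_wpM2l ?ker_cst_ge0 // ler_expR; lra.
- move=> x x0.
  have ee' : x + eta k @[k --> \oo] --> x + eta0 by apply: cvgD ee; exact: cvg_cst.
  have := @ker_cvg R N (fun k l => q k * @b k l) (fun k => q k * beta) (B / beta)
    (fun k => scaled_inj (binj k) (q0 k)) qb rho1
    (fun k => scaled_bnd beta0 (bb k) (q0 k)) (fun k => scaled_norm (q0 k) (q3 k)) qboo _ _ ee'.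
  apply: cvg_trans; apply: near_eq_cvg; near=> k.
  by congr (ker _ _); rewrite /m addrCA.
Unshelve. all: by end_near. Qed.

Lemma F_GOE_cvg (s : nat -> R) (s0 : R) : s k @[k --> \oo] --> s0 ->
  F_GOE (s k) @[k --> \oo] --> F_GOE s0.
Proof.
move=> ss; rewrite F_GOE_fred; under eq_fun do rewrite F_GOE_fred.
apply: (@fred_cvg R _ _ (lor / (2 * pi) * expR (2 - s0))).
- by rewrite !mulr_ge0 ?invr_ge0 ?lor_ge0 ?expR_ge0 ?mulr_ge0 ?(ltW (pi_gt0 _)).
- by move=> k; exact: continuous_airy_shift.
- exact: continuous_airy_shift.
- near=> k => x x0; apply: (le_trans (airy_bound _)); rewrite -[X in _ <= X]mulrA -expRD.
  rewrite ler_wpM2l ?mulr_ge0 ?invr_ge0 ?lor_ge0 ?mulr_ge0 ?(ltW (pi_gt0 _)) // ler_expR.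
  have h1 : s0 - 1 <= s k by near: k; apply: (cvgr_ge s0) => //; lra.
  lra.
- by move=> x x0; apply: airy_cvg; apply: cvgD ss; exact: cvg_cst.
Unshelve. all: by end_near. Qed.

End FredAsymptotics.

(** * The exact law of a point-to-line passage time *)

Section DetDerivative.
Context {R : realType}.
Local Notation mu := (@lebesgue_measure R).

Lemma is_derive_bigsum (I : Type) (r : seq I) (f : I -> R -> R) (df : I -> R) (x : R) :
  (forall i, is_derive x (1 : R) (f i) (df i)) ->
  is_derive x (1 : R) (fun y => \sum_(i <- r) f i y) (\sum_(i <- r) df i).
Proof.
move=> fd; elim: r => [|i r IH].
  by rewrite big_nil; under eq_fun do rewrite big_nil; exact: is_derive_cst.
rewrite big_cons; under eq_fun do rewrite big_cons.
by apply: is_deriveD.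
Qed.

Lemma is_derive_bigprod (n : nat) (f : 'I_n -> R -> R) (df : 'I_n -> R) (x : R) :
  (forall i, is_derive x (1 : R) (f i) (df i)) ->
  is_derive x (1 : R) (fun y => \prod_i f i y) (\sum_j \prod_i (if i == j then df i else f i x)).
Proof.
elim: n f df => [|n IH] f df fd.
  by rewrite big_ord0; under eq_fun do rewrite big_ord0; exact: is_derive_cst.
rewrite big_ord_recl; under eq_fun do rewrite big_ord_recl.
have IH' := IH (fun i => f (lift ord0 i)) (fun i => df (lift ord0 i)) (fun i => fd _).
have h0 := fd ord0.
apply: is_derive_eq; rewrite -![_ *: _]/(_ * _) addrC; congr (_ + _).
  rewrite big_ord_recl eqxx mulrC; congr (_ * _).
rewrite mulr_sumr; apply: eq_bigr => j _; rewrite big_ord_recl /=; congr (_ * _).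
Qed.

Lemma is_derive_det (n : nat) (A : R -> 'M[R]_n) (dA : 'M[R]_n) (x : R) :
  (forall i j, is_derive x (1 : R) (fun y => A y i j) (dA i j)) ->
  is_derive x (1 : R) (fun y => \det (A y))
    (\sum_k \det (\matrix_(i, j) (if j == k then dA i j else A x i j))).
Proof.
move=> Ad.
under eq_fun do rewrite -det_tr /determinant.
have -> : \sum_k \det (\matrix_(i, j) (if j == k then dA i j else A x i j)) =
   \sum_(s : 'S_n) (-1) ^+ s * \sum_k \prod_j (if j == k then dA (s j) j else A x (s j) j).
  under eq_bigr do rewrite -det_tr /determinant.
  rewrite exchange_big /=; apply: eq_bigr => s _; rewrite mulr_sumr; apply: eq_bigr => k _.
  by congr (_ * _); apply: eq_bigr => j _; rewrite !mxE.
apply: is_derive_bigsum => s.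
have h := @is_derive_bigprod n (fun j y => A y (s j) j) (fun j => dA (s j) j) x (fun j => Ad _ _).
have -> : (fun y => (-1) ^+ s * \prod_i (A y)^T i (s i)) = (fun y => (-1) ^+ s * \prod_i A y (s i) i).
  by apply/funext => y; congr (_ * _); apply: eq_bigr => i _; rewrite mxE.
by apply: is_derive_eq.
Qed.

Lemma det_col0 (n : nat) (A : 'M[R]_n) (j : 'I_n) : (forall i, A i j = 0) -> \det A = 0.
Proof.
move=> Aj; rewrite -det_tr; apply/eqP/det0P; exists (delta_mx 0 j).
  by apply/eqP => /rowP /(_ j); rewrite !mxE !eqxx => /eqP; rewrite oner_eq0.
by rewrite -rowE; apply/rowP => i; rewrite !mxE.
Qed.

Lemma det_col_prop (n : nat) (A : 'M[R]_n) (j k : 'I_n) (l : R) : j != k ->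
  (forall i, A i j = l * A i k) -> \det A = 0.
Proof.
move=> jk Aj; rewrite -det_tr; apply/eqP/det0P; exists (delta_mx 0 j - l *: delta_mx 0 k).
  apply/eqP => /rowP /(_ j); rewrite !mxE !eqxx (negbTE jk) /= mulr0 subr0 => /eqP; by rewrite oner_eq0.
by rewrite mulmxBl -scalemxAl -!rowE; apply/rowP => i; rewrite !mxE Aj subrr.
Qed.

Lemma det_col_lin (n : nat) (A B C : 'M[R]_n) (k : 'I_n) (c : R) :
  (forall i, A i k = B i k - c * C i k) ->
  (forall i j, j != k -> A i j = B i j) -> (forall i j, j != k -> A i j = C i j) ->
  \det A = \det B - c * \det C.
Proof.
move=> Ak AB AC; rewrite -(det_tr A) -(det_tr B) -(det_tr C).
rewrite (@determinant_multilinear _ _ A^T B^T C^T k 1 (- c)) ?mul1r ?mulNr //.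
- by apply/rowP => j; rewrite !mxE Ak mul1r mulNr.
- by apply/matrixP => i j; rewrite !mxE AB // eq_sym neq_lift.
- by apply/matrixP => i j; rewrite !mxE AC // eq_sym neq_lift.
Qed.

(** The primitives of consecutive pieces agree at the break points, so the increments telescope. The
    break points in [mixdet_int] are those where one more variable becomes clipped. *)
Lemma FTC_pieces (m : nat) (s : nat -> R) (G g : nat -> R -> R) (h : R -> R) :
  (forall k, (k <= m)%N -> s k <= s k.+1) ->
  (forall k x, (k <= m)%N -> is_derive x (1 : R) (G k) (g k x)) ->
  (forall k, (k <= m)%N -> continuous (g k)) ->
  (forall k x, (k <= m)%N -> s k <= x <= s k.+1 -> h x = g k x) ->
  (forall k, (k < m)%N -> G k (s k.+1) = G k.+1 (s k.+1)) ->
  mu.-integrable `[s 0%N, s m.+1] (EFin \o h) ->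
  \int[mu]_(x in `[s 0%N, s m.+1]) h x = G m (s m.+1) - G 0%N (s 0%N).
Proof.
have piece k : s k <= s k.+1 -> (forall x, is_derive x (1 : R) (G k) (g k x)) ->
    continuous (g k) -> (forall x, s k <= x <= s k.+1 -> h x = g k x) ->
    \int[mu]_(x in `[s k, s k.+1]) h x = G k (s k.+1) - G k (s k).
  move=> sk Gd gc hg; rewrite -(Rintegral_FTC sk Gd gc); apply: eq_Rintegral => x.
  by move=> /set_mem /=; rewrite in_itv /=; exact: hg.
elim: m => [|m IH] s1 s2 s3 s4 s5 ih.
  apply: piece; [exact: s1|by move=> x; exact: s2|exact: s3|by move=> x; exact: s4].
have s0m k : (k <= m.+1)%N -> s 0%N <= s k.
  elim: k => [//|k IHk] km; exact: le_trans (IHk (ltnW km)) (s1 _ (ltnW km)).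
have ih' : mu.-integrable `[s 0%N, s m.+1] (EFin \o h).
  apply: integrableS ih => //.
  by apply: subset_itvl; rewrite bnd_simp; exact: s1.
have := @Rintegral_itvB R h (BLeft (s 0%N)) (BRight (s m.+2)) (s m.+1) ih.
rewrite !bnd_simp => /(_ (s0m _ (leqnn _)) (s1 _ (leqnn _))) /eqP.
rewrite subr_eq => /eqP ->.
rewrite (IH (fun k km => s1 k (leqW km)) (fun k x km => s2 k x (leqW km)) (fun k km => s3 k (leqW km))
  (fun k x km => s4 k x (leqW km)) (fun k km => s5 k (ltnW km)) ih').
rewrite Rintegral_itv_obnd_cbnd; last first.
  apply: integrableS ih => //; apply: subset_itvr; rewrite bnd_simp; exact: s0m.
rewrite (piece _ (s1 _ (leqnn _)) (fun x => s2 _ x (leqnn _)) (s3 _ (leqnn _)) (fun x => s4 _ x (leqnn _))).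
by rewrite (s5 m (ltnSn _)) addrA subrK.
Qed.

End DetDerivative.

(** * Determinants that are stable under the exchange of a corner *)

Section MixedDet.
Context {R : realType}.
Local Notation mu := (@lebesgue_measure R).
Variable b : nat -> R.

Definition newton (r p : nat) (x : R) : R := \prod_(l < p) (x - b (r - l)%N).
(** The prefactor is chosen so that the derivative in [y] is a multiple of the next column
    ([is_derive_fcol_next]) and, by a second relation, a combination of the column with a column for
    one row less ([is_derive_fcol_prev]). *)
Definition fcol (r p i : nat) (y : R) : R :=
  expR (- (b (r - p)%N * y)) * (newton r p (b i) * expR (b i * y) - newton r p (- b i) * expR (- (b i * y))).

Lemma newtonS r p x : newton r p.+1 x = newton r p x * (x - b (r - p)%N).
Proof. by rewrite /newton big_ord_recr. Qed.

Lemma newtonSS r p x : newton r.+1 p.+1 x = (x - b r.+1) * newton r p x.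
Proof. by rewrite /newton big_ord_recl subn0. Qed.

Let is_derive_expl (a y : R) : is_derive y (1 : R) (fun y => expR (a * y)) (a * expR (a * y)).
Proof.
have h : is_derive y (1 : R) (fun y => a * y) a.
  by apply: is_derive_eq; rewrite -![_ *: _]/(_ * _); ring.
have := @is_derive1_comp R expR (fun y => a * y) y _ _ (is_derive_expR (a * y)) h.
by rewrite mulrC.
Qed.

Lemma is_derive_fcol (r p i : nat) (y : R) : is_derive y (1 : R) (fcol r p i)
  (expR (- (b (r - p)%N * y)) * (newton r p (b i) * (b i - b (r - p)%N) * expR (b i * y) -
     newton r p (- b i) * (- b i - b (r - p)%N) * expR (- (b i * y)))).
Proof.
have -> : fcol r p i = (fun y => expR (- b (r - p)%N * y) *
   (newton r p (b i) * expR (b i * y) - newton r p (- b i) * expR (- b i * y))).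
  by apply/funext => z; rewrite /fcol !mulNr.
have h1 := is_derive_expl (- b (r - p)%N) y.
have h2 := is_derive_expl (b i) y.
have h3 := is_derive_expl (- b i) y.
apply: is_derive_eq; rewrite -![_ *: _]/(_ * _) -!mulNr.
by move: (expR _) (expR _) (expR _) => e1 e2 e3; ring.
Qed.

Lemma is_derive_fcol_next (r p i : nat) (y : R) : is_derive y (1 : R) (fcol r p i)
  (expR ((b (r - p.+1)%N - b (r - p)%N) * y) * fcol r p.+1 i y).
Proof.
apply: (is_derive_eq (is_derive_fcol _ _ _ _)).
rewrite /fcol !newtonS mulrA -expRD; congr (expR _ * _).
by ring.
Qed.

Lemma is_derive_fcol_prev (r p i : nat) (y : R) : is_derive y (1 : R) (fcol r.+1 p.+1 i)
  ((b i ^+ 2 - b r.+1 ^+ 2) * fcol r p i y - (b r.+1 + b (r - p)%N) * fcol r.+1 p.+1 i y).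
Proof.
apply: (is_derive_eq (is_derive_fcol _ _ _ _)).
rewrite /fcol !newtonSS subSS.
by move: (newton _ _ _) (newton _ _ _) (expR _) (expR _) (expR _) => n1 n2 e1 e2 e3; ring.
Qed.

Lemma fcol0 r i : fcol r 0 i 0 = 0.
Proof. by rewrite /fcol /newton !big_ord0 !mulr0 oppr0 !mul1r subrr mulr0. Qed.

(** The matrix of the down-right path that follows row [r] up to index [p] and row [r - 1] beyond;
    the factors [b i ^+ 2 - b r ^+ 2] are those produced by [is_derive_fcol_prev]. *)
Definition mixmx (r p : nat) (y : nat -> R) : 'M[R]_r.+1 :=
  \matrix_(i, j) (if (j <= p)%N then fcol r j i (y j)
                  else (b i ^+ 2 - b r ^+ 2) * fcol r.-1 j.-1 i (y j)).
Definition mixdet (r p : nat) (y : nat -> R) : R := \det (mixmx r p y).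

Lemma eq_mixdet r p (y z : nat -> R) : (forall j, (j <= r)%N -> y j = z j) -> mixdet r p y = mixdet r p z.
Proof.
by move=> yz; congr (\det _); apply/matrixP => i j; rewrite !mxE yz // -ltnS.
Qed.

(** In the last matrix row only column [0] survives, the other entries having the factor
    [b i ^+ 2 - b r.+1 ^+ 2 = 0]. This mirrors the independence of the first cell of a new row from
    the rows before it. *)
Lemma mixdet0 r y : mixdet r.+1 0 y = (-1) ^+ r.+1 * \prod_(i < r.+1) (b i ^+ 2 - b r.+1 ^+ 2) *
  (1 - expR (- (2 * b r.+1 * y 0%N))) * mixdet r r (fun j => y j.+1).
Proof.
rewrite /mixdet (expand_det_row _ ord_max) [LHS]big_ord_recl big1 ?addr0 => [|j _]; last first.
  by rewrite mxE /= subrr !mul0r.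
rewrite mxE /= /cofactor /= addn0.
have -> : fcol r.+1 0 r.+1 (y 0%N) = 1 - expR (- (2 * b r.+1 * y 0%N)).
  rewrite /fcol /newton !big_ord0 subn0 !mul1r mulrBr -!expRD addNr expR0; congr (_ - expR _); ring.
have -> : row' ord_max (col' ord0 (mixmx r.+1 0 y)) =
   diag_mx (\row_i (b i ^+ 2 - b r.+1 ^+ 2)) *m mixmx r r (fun j => y j.+1).
  apply/matrixP => i j; rewrite mul_diag_mx !mxE /= -ltnS ltn_ord /=.
  by rewrite /bump leqNgt ltn_ord /= add0n.
rewrite det_mulmx det_diag.
under eq_bigr do rewrite mxE.
by rewrite mulrCA -!mulrA; congr (_ * _); rewrite mulrCA.
Qed.

(** The variables of index [l] to [p + 1] merged into one value, as after clipping. *)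
Definition zvec (p l : nat) (y : nat -> R) (v : R) (j : nat) : R :=
  if (j < l)%N then y j else if (j <= p.+1)%N then v else y j.

(** The derivative of a merged column [k <= p] is proportional to column [k + 1] at the same
    argument, so only the derivative of column [p + 1] counts. The equation obtained is the
    differential form of a convolution with an exponential weight of rate [b r.+1 + b (r - p)]. *)
Lemma is_derive_mixdet (r p l : nat) (y : nat -> R) (v : R) : (p <= r)%N -> (l <= p.+1)%N ->
  is_derive v (1 : R) (fun v => mixdet r.+1 p.+1 (zvec p l y v))
   (mixdet r.+1 p (zvec p l y v) - (b r.+1 + b (r - p)%N) * mixdet r.+1 p.+1 (zvec p l y v)).
Proof.
move=> pr lp.
pose dA : 'M[R]_r.+2 := \matrix_(i, j)
  (if (j < l)%N then 0 else if (j <= p)%N then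
      expR ((b (r.+1 - j.+1)%N - b (r.+1 - j)%N) * v) * fcol r.+1 j.+1 i v
   else if j == p.+1 :> nat then
      (b i ^+ 2 - b r.+1 ^+ 2) * fcol r p i v - (b r.+1 + b (r - p)%N) * fcol r.+1 p.+1 i v else 0).
have pr2 : (p.+1 < r.+2)%N by [].
pose k0 : 'I_r.+2 := Ordinal pr2.
have Ad i j : is_derive v (1 : R) (fun v => mixmx r.+1 p.+1 (zvec p l y v) i j) (dA i j).
  rewrite [dA i j]mxE; under eq_fun do rewrite mxE /zvec.
  case: (ltnP j l) => jl; first exact: is_derive_cst.
  case: (leqP j p) => jp.
    rewrite (leqW jp); exact: is_derive_fcol_next.
  case: eqP => [->|/eqP jp1].
    rewrite leqnn; exact: is_derive_fcol_prev.
  have -> : (j <= p.+1)%N = false by apply/negbTE; rewrite -ltnNge ltn_neqAle eq_sym jp1.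
  exact: is_derive_cst.
have := is_derive_det Ad; rewrite (bigD1 k0) //= big1 ?addr0 => [|k kk0]; last first.
  case: (ltnP k l) => kl.
    by apply: (@det_col0 _ _ _ k) => i; rewrite !mxE eqxx kl.
  case: (leqP k p) => kp; last first.
    apply: (@det_col0 _ _ _ k) => i; rewrite !mxE eqxx ltnNge kl /= leqNgt kp /=.
    by case: eqP => // e; case/eqP: kk0; exact/val_inj.
  have k1 : (k.+1 < r.+2)%N by rewrite ltnS (leq_ltn_trans kp).
  apply: (@det_col_prop _ _ _ k (Ordinal k1) (expR ((b (r.+1 - k.+1)%N - b (r.+1 - k)%N) * v))).
    by rewrite -val_eqE /= neq_ltn ltnSn.
  move=> i; rewrite !mxE eqxx ltnNge kl /= kp -val_eqE /= gtn_eqF // /zvec.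
  by rewrite ltnS kp ltnNge (leqW kl).
congr (is_derive _ _ _ _).
apply: (@det_col_lin _ _ _ _ _ k0).
- move=> i; rewrite !mxE eqxx /= ltnNge lp /= ltnn eqxx leqnn /zvec ltnNge lp /= leqnn.
  by [].
- move=> i j; rewrite -val_eqE /= => jk; rewrite !mxE -val_eqE /= (negbTE jk) /zvec.
  by have -> : (j <= p.+1)%N = (j <= p)%N by rewrite leq_eqVlt (negbTE jk) ltnS.
- by move=> i j; rewrite -val_eqE /= => jk; rewrite !mxE -val_eqE /= (negbTE jk).
Qed.

(** The bounds before the exchange when the new weight leaves [v]: passage times in one row increase
    with the height, so a bound [v] on the last one bounds the earlier ones too. *)
Definition clip (p : nat) (y : nat -> R) (v : R) (j : nat) : R :=
  if (j <= p)%N then Num.min (y j) v else if j == p.+1 then v else y j.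

(** Between consecutive values [y p.+1 - y j] the same variables are clipped, and the integrand is a
    derivative by [is_derive_mixdet]. At the far end column [0] is taken at argument [0], where it
    vanishes. *)
Lemma mixdet_int (r p : nat) (y : nat -> R) (h : R -> R) : (p <= r)%N ->
  0 <= y 0%N -> (forall j, (j <= r)%N -> y j <= y j.+1) ->
  (forall t, 0 <= t <= y p.+1 -> h t = expR (- ((b r.+1 + b (r - p)%N) * t)) *
     mixdet r.+1 p (clip p y (y p.+1 - t))) ->
  mu.-integrable `[0, y p.+1] (EFin \o h) ->
  \int[mu]_(t in `[0, y p.+1]) h t = mixdet r.+1 p.+1 y.
Proof.
move=> pr y0 ymon hE ih; set rho := b r.+1 + b (r - p)%N in hE.
have ym i j : (i <= j)%N -> (j <= r.+1)%N -> y i <= y j.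
  move=> /subnK <-; elim: (j - i)%N => [|k IH]; first by rewrite add0n.
  rewrite addSn => kr; exact: le_trans (IH (ltnW kr)) (ymon _ kr).
pose Y := y p.+1.
(* Piece [k] is the one where the last [k] of the variables up to index [p] are clipped. *)
pose s k := if (k <= p.+1)%N then Y - y (p.+1 - k)%N else Y.
pose G k t := - (expR (- (rho * t)) * mixdet r.+1 p.+1 (zvec p (p.+1 - k) y (Y - t))).
pose g k t := expR (- (rho * t)) * mixdet r.+1 p (zvec p (p.+1 - k) y (Y - t)).
have s0 : s 0%N = 0 by rewrite /s subn0 subrr.
have sS : s p.+2 = Y by rewrite /s ltnn.
have dE t : is_derive t (1 : R) (fun t => expR (- (rho * t))) (- rho * expR (- (rho * t))).
  have -> : (fun t => expR (- (rho * t))) = (fun t => expR (- rho * t)) by apply/funext => z; rewrite mulNr.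
  by rewrite -mulNr; exact: is_derive_expl.
have dz l q t : (q <= r)%N -> (l <= q.+1)%N -> is_derive t (1 : R) (fun t => mixdet r.+1 q.+1 (zvec q l y (Y - t)))
  (- (mixdet r.+1 q (zvec q l y (Y - t)) - (b r.+1 + b (r - q)%N) * mixdet r.+1 q.+1 (zvec q l y (Y - t)))).
  move=> qr lq.
  have h1 : is_derive t (1 : R) (fun t => Y - t) (- 1) by apply: is_derive_eq; ring.
  have h2 := is_derive_mixdet y (Y - t) qr lq.
  by have := @is_derive1_comp R _ (fun t => Y - t) t _ _ h2 h1; rewrite mulrN1.
have dG k t : (k <= p.+1)%N -> is_derive t (1 : R) (G k) (g k t).
  move=> kp; have h1 := dz _ p t pr (leq_subr k p.+1); have h2 := dE t.
  apply: is_derive_eq; rewrite -![_ *: _]/(_ * _) /g -/rho; ring.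
have cg k : (k <= p.+1)%N -> continuous (g k).
  move=> kp t; apply: cvgM; first by apply: (is_derive_cont (dE t)).
  have cont_mix : continuous (fun v => mixdet r.+1 p (zvec p (p.+1 - k) y v)).
    apply: continuous_seq => u v uv; apply: cvg_det => i j; rewrite mxE; under eq_fun do rewrite mxE.
    have cz : zvec p (p.+1 - k) y (u n) j @[n --> \oo] --> zvec p (p.+1 - k) y v j.
      rewrite /zvec; case: ifP => _; first exact: cvg_cst.
      by case: ifP => _ //; exact: cvg_cst.
    case: ifP => _; first exact: (cvg_comp _ _ cz (is_derive_cont (is_derive_fcol _ _ _ _))).
    apply: cvgM; first exact: cvg_cst.
    exact: (cvg_comp _ _ cz (is_derive_cont (is_derive_fcol _ _ _ _))).
  have h1 : {for t, continuous (fun t => Y - t)}.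
    by apply: (@continuousB _ R^o R^o); [exact: cst_continuous|exact: cvg_id].
  exact: (@continuous_comp _ _ _ (fun t => Y - t) (fun v => mixdet r.+1 p (zvec p (p.+1 - k) y v)) t h1 (cont_mix _)).
have sk k : (k <= p.+1)%N -> s k <= s k.+1.
  move=> kp; rewrite /s kp; case: ltnP => [kp'|_].
    by rewrite lerD2l lerN2 ym // ?leq_sub2l // (leq_trans (leq_subr _ _)).
  by rewrite lerBlDr lerDl (le_trans y0) // ym // (leq_trans (leq_subr _ _)).
have hg k t : (k <= p.+1)%N -> s k <= t <= s k.+1 -> h t = g k t.
  move=> kp /andP[st ts].
  have s0k m : (m <= p.+2)%N -> 0 <= s m.
    elim: m => [|m IH] mp; first by rewrite s0.
    exact: le_trans (IH (ltnW mp)) (sk _ mp).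
  have skY : s k.+1 <= Y.
    rewrite /s; case: ltnP => // kp'; rewrite lerBlDr lerDl (le_trans y0) // ym //.
    by rewrite (leq_trans (leq_subr _ _)).
  rewrite hE; last by rewrite (le_trans (s0k k _) st) ?(leqW kp) //= (le_trans ts).
  congr (_ * _); apply: eq_mixdet => j jr; rewrite /clip /zvec.
  case: (leqP j p) => jp.
    rewrite (leqW jp); case: ltnP => jk.
      apply/min_idPl; move: ts; rewrite /s; case: ltnP => kp' ts.
        rewrite lerBrDr -lerBrDl (le_trans ts) // lerD2l lerN2 ym //.
          by rewrite -ltnS -subSn.
        by rewrite (leq_trans (leq_subr _ _)).
      by move: jk; have -> : (p.+1 - k = 0)%N by apply/eqP; rewrite subn_eq0.
    apply/min_idPr; rewrite lerBlDr -lerBlDl (le_trans _ st) // /s kp lerD2l lerN2 ym //.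
  case: eqP => [->|/eqP jp1].
    by rewrite ltnNge leq_subr /= leqnn.
  have -> : (j <= p.+1)%N = false by apply/negbTE; rewrite -ltnNge ltn_neqAle eq_sym jp1.
  by case: ifP.
have gm k : (k < p.+1)%N -> G k (s k.+1) = G k.+1 (s k.+1).
  move=> kp; rewrite /G /s kp; congr (- (_ * _)); apply: eq_mixdet => j jr.
  rewrite /zvec opprB addrCA subrr addr0 -/Y.
  have e : (p.+1 - k = (p.+1 - k.+1).+1)%N by rewrite subnSK.
  rewrite e ltnS; case: (ltngtP j (p.+1 - k.+1)) => [jl|//|->] //.
  by rewrite leq_subr.
have := FTC_pieces sk dG cg hg gm; rewrite s0 sS => /(_ ih) ->.
rewrite /G subnn subn0 subrr subr0 mulr0 oppr0 expR0 mul1r opprK.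
rewrite [X in - (_ * X)](_ : mixdet _ _ _ = 0) ?mulr0 ?oppr0 ?add0r; last first.
  by apply: (@det_col0 _ _ _ ord0) => i; rewrite mxE /= /zvec /= fcol0.
apply: eq_mixdet => j jr; rewrite /zvec; by case: (ltngtP j p.+1) => // ->.
Qed.

(** At equal arguments all exponential prefactors can be pulled out, and those of the rows cancel
    those of the columns. *)
Lemma mixdet_final (r : nat) (u : R) :
  mixdet r r (fun=> u) = \det (\matrix_(i < r.+1, j < r.+1) newton r j (b i) -
     \matrix_(i, j) (expR (- (2 * (b i * u))) * newton r j (- b i))).
Proof.
rewrite /mixdet; set D := _ - _.
have -> : mixmx r r (fun=> u) = diag_mx (\row_(i < r.+1) expR (b i * u)) *m D *m
   diag_mx (\row_(j < r.+1) expR (- (b (r - j)%N * u))).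
  apply/matrixP => i j; rewrite mul_mx_diag mul_diag_mx !mxE -ltnS ltn_ord /fcol [RHS]mulrC.
  congr (_ * _); rewrite mulrBr [X in _ = X - _]mulrC; congr (_ - _).
  by rewrite [RHS]mulrA -expRD [RHS]mulrC; congr (_ * expR _); ring.
rewrite !det_mulmx !det_diag [X in _ * X = _](reindex_inj rev_ord_inj) /= mulrAC -big_split /=.
rewrite big1 ?mul1r // => i _; rewrite !mxE.
have -> : (r - rev_ord i = i)%N by rewrite /= subSS subKn // -ltnS.
by rewrite -expRD addrN expR0.
Qed.

End MixedDet.

(** * Independence of events determined by disjoint sets of cells *)

Section SigmaIndep.
Context {d : measure_display} {T : measurableType d} {R : realType} (P : probability T R).
Context {I : eqType} (E : I -> T -> R).
Hypothesis mE : forall i, measurable_fun setT (E i).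
Hypothesis indE : mutually_independent P xpredT E.

Definition cyl (S : set I) : set (set T) := [set A | exists (F : seq I) (B : I -> set R),
  [/\ uniq F, forall i, i \in F -> S i, forall i, measurable (B i) &
      A = [set o | forall i, i \in F -> B i (E i o)]]].

Let bigsetIE (F : seq I) (B : I -> set R) :
  \big[setI/setT]_(i <- F) (E i @^-1` B i) = [set o | forall i, i \in F -> B i (E i o)].
Proof.
apply/seteqP; split => o; elim: F => [|i F IH]; rewrite ?big_nil ?big_cons //=.
  by move=> [h1 h2] j; rewrite inE => /predU1P[->|] //; exact: IH.
move=> h; split; first by apply: h; rewrite mem_head.
by apply: IH => j jF; apply: h; rewrite inE jF orbT.
Qed.

Lemma cyl_measurable S A : cyl S A -> measurable A.
Proof.
move=> [F [B [_ _ mB ->]]]; rewrite -bigsetIE; apply: bigsetI_measurable => i _.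
by rewrite -[X in measurable X]setTI; apply: mE => //; exact: mB.
Qed.

Lemma cylT S : cyl S setT.
Proof.
by exists [::], (fun=> setT); split => //; apply/seteqP; split.
Qed.

Lemma cyl_setI S : setI_closed (cyl S).
Proof.
move=> _ _ [F1 [B1 [u1 S1 m1 ->]]] [F2 [B2 [u2 S2 m2 ->]]].
exists (undup (F1 ++ F2)), (fun i => (if i \in F1 then B1 i else setT) `&` (if i \in F2 then B2 i else setT)).
split; [exact: undup_uniq| | |].
- by move=> i; rewrite mem_undup mem_cat => /orP[/S1|/S2].
- by move=> i; apply: measurableI; case: ifP.
- apply/seteqP; split => o /=.
    by move=> [h1 h2] i _; split; case: ifP => // iF; [exact: h1|exact: h2].
  move=> h; split => i iF; have := h i; rewrite mem_undup mem_cat iF ?orbT => /(_ isT)[] //.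
Qed.

Lemma cyl_indep S1 S2 A1 A2 : S1 `&` S2 = set0 -> cyl S1 A1 -> cyl S2 A2 ->
  P (A1 `&` A2) = (P A1 * P A2)%E.
Proof.
move=> S12 [F1 [B1 [u1 FS1 m1 ->]]] [F2 [B2 [u2 FS2 m2 ->]]].
have d12 i : i \in F2 -> (i \in F1) = false.
  move=> i2; apply/negP => i1; have : (S1 `&` S2) i by split; [exact: FS1|exact: FS2].
  by rewrite S12.
rewrite -!bigsetIE.
pose B i := if i \in F1 then B1 i else B2 i.
have mB i : measurable (B i) by rewrite /B; case: ifP.
have -> : \big[setI/setT]_(i <- F1) (E i @^-1` B1 i) = \big[setI/setT]_(i <- F1) (E i @^-1` B i).
  by rewrite !big_seq; apply: eq_bigr => i iF; rewrite /B iF.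
have -> : \big[setI/setT]_(i <- F2) (E i @^-1` B2 i) = \big[setI/setT]_(i <- F2) (E i @^-1` B i).
  by rewrite !big_seq; apply: eq_bigr => i iF; rewrite /B d12.
have u12 : uniq (F1 ++ F2).
  by rewrite cat_uniq u1 u2 andbT /=; apply/hasPn => i i2; rewrite /= d12.
rewrite -big_cat (indE u12 (all_predT _) mB) (indE u1 (all_predT _) mB) (indE u2 (all_predT _) mB).
by rewrite big_cat.
Qed.

Definition sgen (S : set I) : set (set T) := <<s cyl S >>.

Lemma sgen_measurable S A : sgen S A -> measurable A.
Proof.
move=> h; apply: (h measurable); split; first exact: sigma_algebra_measurable.
by move=> B /cyl_measurable.
Qed.

(** Uniqueness of measures on a generated sigma-algebra, for [P] restricted to [A1] and for the
    multiple [P A1 * P]; it is used once for each of the two factors. *)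
Let halfP (A1 : set T) (S2 : set I) : (forall A2, cyl S2 A2 -> P (A1 `&` A2) = (P A1 * P A2)%E) -> measurable A1 ->
  forall A2, sgen S2 A2 -> P (A1 `&` A2) = (P A1 * P A2)%E.
Proof.
move=> h mA1 A2 sA2.
have PA1 : 0 <= fine (P A1) by rewrite fine_ge0.
have eA1 : P A1 = (fine (P A1))%:E by rewrite fineK // fin_num_measure.
pose m1 := mrestr P mA1.
pose m2 := mscale (NngNum PA1) P.
have -> : P (A1 `&` A2) = m1 A2 by rewrite /m1 /mrestr /= setIC.
have -> : (P A1 * P A2)%E = m2 A2 by rewrite /m2 /mscale /= -eA1.
apply: (@g_sigma_algebra_measure_unique _ R T (cyl S2) _ (fun=> setT)) => //.
- by move=> A /cyl_measurable.
- by move=> _; exact: cylT.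
- by apply/seteqP; split => // o _; exists 0%N.
- exact: cyl_setI.
- move=> A cA; change (P (A `&` A1) = ((fine (P A1))%:E * P A)%E).
  by rewrite setIC h // -eA1.
- move=> _; change (P (setT `&` A1) < +oo)%E.
  by rewrite setTI ltey_eq fin_num_measure.
Qed.

Lemma sgen_indep S1 S2 A1 A2 : S1 `&` S2 = set0 -> sgen S1 A1 -> sgen S2 A2 ->
  P (A1 `&` A2) = (P A1 * P A2)%E.
Proof.
move=> S12 s1 s2.
apply: (halfP _ (sgen_measurable s1) s2) => B2 cB2.
rewrite setIC muleC; apply: (halfP _ (cyl_measurable cB2) s1) => B1 cB1.
by rewrite setIC muleC; exact: cyl_indep S12 cB1 cB2.
Qed.

Definition smeas (S : set I) (f : T -> R) :=
  measurable_fun (setT : set (g_sigma_algebraType (cyl S))) (f : g_sigma_algebraType (cyl S) -> R).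

Lemma smeas_sgen S f B : smeas S f -> measurable B -> sgen S (f @^-1` B).
Proof. by move=> mf mB; have := mf measurableT B mB; rewrite setTI. Qed.

Lemma sgenI S A B : sgen S A -> sgen S B -> sgen S (A `&` B).
Proof. exact: (@measurableI _ (g_sigma_algebraType (cyl S))). Qed.

Lemma smeas_coord S i : S i -> smeas S (E i).
Proof.
move=> Si _ B mB; rewrite setTI; apply: sub_sigma_algebra.
exists [:: i], (fun=> B); split => //; first by move=> j; rewrite inE => /eqP ->.
apply/seteqP; split => o /=; first by move=> h j; rewrite inE => /eqP ->.
by apply; rewrite mem_head.
Qed.

Lemma smeas_cst S (c : R) : smeas S (fun=> c).
Proof. exact: measurable_cst. Qed.

Lemma smeasD S f g : smeas S f -> smeas S g -> smeas S (fun o => f o + g o).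
Proof. exact: measurable_funD. Qed.

Lemma smeas_max S f g : smeas S f -> smeas S g -> smeas S (fun o => Num.max (f o) (g o)).
Proof. exact: measurable_maxr. Qed.

Lemma smeasZr S f (c : R) : smeas S f -> smeas S (fun o => f o * c).
Proof. by move=> mf; apply: measurable_funM => //; exact: measurable_cst. Qed.

Lemma smeas_if S A f (c : R) : sgen S A -> smeas S f ->
  smeas S (fun o => if o \in A then f o else c).
Proof.
move=> sA mf _ B mB; rewrite setTI.
have sC : sgen S (~` A) by apply: (@measurableC _ (g_sigma_algebraType (cyl S))).
have -> : (fun o => if o \in A then f o else c) @^-1` B =
    (A `&` f @^-1` B) `|` (if c \in B then ~` A else set0).
  apply/seteqP; split => o /=.
    case: ifPn => [/set_mem Ao Bf|/negP oA Bc]; [by left|right].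
    by rewrite mem_set //= => Ao; apply: oA; apply/mem_set.
  move=> [[Ao Bf]|]; first by rewrite mem_set.
  case: ifPn => // /set_mem Bc Ao; by rewrite memNset.
apply: (@measurableU _ (g_sigma_algebraType (cyl S))).
  by apply: sgenI => //; exact: smeas_sgen.
by case: ifP => // _; exact: (@measurable0 _ (g_sigma_algebraType (cyl S))).
Qed.

Lemma smeas_measurable S f : smeas S f -> measurable_fun setT f.
Proof.
by move=> mf _ B mB; rewrite setTI; exact: (sgen_measurable (smeas_sgen mf mB)).
Qed.

Lemma sgen_le S f (x : R) : smeas S f -> sgen S [set o | f o <= x].
Proof.
move=> mf; have -> : [set o | f o <= x] = f @^-1` `]-oo, x].
  by apply/seteqP; split => o; rewrite /= in_itv.
exact: smeas_sgen.
Qed.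

End SigmaIndep.

(** * Convolution with an independent exponential variable *)

Section ExpConvolution.
Context {d : measure_display} {T : measurableType d} {R : realType} (P : probability T R).
Local Notation mu := (@lebesgue_measure R).
Variables (X e : T -> R) (rho u : R).
Hypothesis mX : measurable_fun setT X.
Hypothesis me : measurable_fun setT e.
Hypothesis X0 : forall o, 0 <= X o.
Hypothesis e0 : forall o, 0 <= e o.
Hypothesis rho0 : 0 < rho.
Hypothesis e_cdf : forall x, 0 <= x -> P [set o | e o <= x] = (1 - expR (- (rho * x)))%:E.
Hypothesis ind : forall A B : set R, measurable A -> measurable B ->
  P (X @^-1` A `&` e @^-1` B) = (P (X @^-1` A) * P (e @^-1` B))%E.

Let Xm : {mfun T >-> R} := mfun_Sub (mem_set mX).
Let em : {mfun T >-> R} := mfun_Sub (mem_set me).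
Let m1 : probability _ R := distribution P Xm.
Let m2 : probability _ R := distribution P em.

Let S : set (R * R) := [set p | p.1 + p.2 <= u].

Let mS : measurable S.
Proof.
rewrite (_ : S = (fun p : R * R => p.1 + p.2) @^-1` `]-oo, u]); last first.
  by apply/seteqP; split => p; rewrite /S /= in_itv.
rewrite -[X in measurable X]setTI.
have h : measurable_fun setT (fun p : R * R => p.1 + p.2).
  by apply: measurable_funD; [exact: measurable_fst|exact: measurable_snd].
exact: h.
Qed.

Let mXe : measurable_fun setT (fun o => (X o, e o)).
Proof. by apply/measurable_fun_pairP; split. Qed.

Let PS : P [set o | X o + e o <= u] = (m1 \x m2)%E S.
Proof.
pose m' := pushforward P (fun o => (X o, e o)).
have -> : P [set o | X o + e o <= u] = m' S by [].
symmetry; apply: (@product_measure_unique _ _ _ _ R m1 m2 m') => // A B mA mB.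
Qed.

Let g (p : R * R) : \bar R := (exponential_pdf rho p.2 * \1_S p)%:E.

Let mg : measurable_fun setT g.
Proof.
apply/measurable_EFinP; apply: measurable_funM; last exact: measurable_indic.
exact: (measurableT_comp (measurable_exponential_pdf rho) measurable_snd).
Qed.

Let g0 p : (0 <= g p)%E.
Proof. by rewrite lee_fin mulr_ge0 // exponential_pdf_ge0 // ltW. Qed.

Let inner_t z : (m2 \o xsection S) z = (\int[mu]_t g (z, t))%E.
Proof.
rewrite /= /m2 /distribution /pushforward /=.
have -> : e @^-1` xsection S z = [set o | e o <= u - z].
  by apply/seteqP; split => o; rewrite /= /xsection /= in_setE /S /= lerBrDl.
transitivity (\int[mu]_(t in `[0%R, (u - z)%R]) (exponential_pdf rho t)%:E)%E; last first.
  rewrite integral_mkcond; apply: eq_integral => t _; rewrite patchE /g indicE /S.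
  have -> : ((z, t) \in S) = (t <= u - z).
    by apply/idP/idP => [/set_mem|h]; [|apply/mem_set; move: h]; rewrite /S /= lerBrDl.
  case: ifPn => [|tn].
    by move=> /set_mem; rewrite /= in_itv /= => /andP[_ ->]; rewrite mulr1.
  have [t0|t0] := ltP t 0; first by rewrite lt0_exponential_pdf // mul0r.
  have -> : (t <= u - z) = false.
    by apply/negbTE; apply: contra tn => h; apply/mem_set; rewrite /= in_itv /= t0.
  by rewrite mulr0.
have [zu|uz|zu] := ltgtP (u - z) 0.
- have -> : [set o | e o <= u - z] = set0.
    by apply/seteqP; split => // o /= h; have := e0 o; lra.
  by rewrite measure0 set_itv_ge ?integral_set0 // bnd_simp -ltNge.
- rewrite e_cdf ?ltW //; have := exponential_prob_itv0c rho uz; rewrite /exponential_prob => ->.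
  by rewrite mulNr EFinB.
- by rewrite zu e_cdf // mulr0 oppr0 expR0 subrr set_itv1 integral_set1.
Qed.

Let mXle v : measurable [set o | X o <= v].
Proof.
rewrite (_ : [set o | _] = X @^-1` `]-oo, v]); last by apply/seteqP; split => o; rewrite /= in_itv.
by rewrite -[X in measurable X]setTI; exact: mX.
Qed.

Let inner_z t : (\int[m1]_z g (z, t))%E = (exponential_pdf rho t * fine (P [set o | X o <= u - t]))%:E.
Proof.
have mSt : measurable [set z : R | z <= u - t].
  rewrite (_ : [set z | _] = (`]-oo, u - t]%classic : set R)) //.
have -> : (fun z => g (z, t)) = (fun z => (exponential_pdf rho t)%:E * (\1_[set z : R | z <= u - t] z)%:E)%E.
  apply/funext => z; rewrite /g EFinM; congr (_ * (_)%:E)%E; rewrite !indicE; congr (nat_of_bool _)%:R.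
  by apply/idP/idP => /set_mem h; apply/mem_set; move: h; rewrite /S /= lerBrDr.
rewrite ge0_integralZl //; last 2 first.
- by apply/measurable_EFinP; exact: measurable_indic.
- by rewrite lee_fin exponential_pdf_ge0 // ltW.
rewrite integral_indic // setIT EFinM fineK //.
by rewrite fin_num_measure.
Qed.

(** Only [e] has a density, so Tonelli is used to integrate it last; the law of [X] then enters
    through its distribution function. *)
Lemma exp_convolution :
  mu.-integrable `[0, u] (EFin \o (fun t => rho * expR (- (rho * t)) * fine (P [set o | X o <= u - t]))) /\
  fine (P [set o | X o + e o <= u]) =
  \int[mu]_(t in `[0, u]) (rho * expR (- (rho * t)) * fine (P [set o | X o <= u - t])).
Proof.
pose h t := exponential_pdf rho t * fine (P [set o | X o <= u - t]).
have mD : measurable (`[0, u]%classic : set R) by exact: measurable_itv.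
have hE t : `[0, u]%classic t -> h t = rho * expR (- (rho * t)) * fine (P [set o | X o <= u - t]).
  by rewrite /= in_itv /= => /andP[t0 _]; rewrite /h exponential_pdfE // mulNr.
have mh : measurable_fun setT h.
  apply/measurable_EFinP; apply: (eq_measurable_fun (fubini_G m1 g)).
    by move=> t _; rewrite /fubini_G inner_z.
  exact: (@measurable_fun_fubini_tonelli_G _ _ _ _ R m1 g mg g0).
have h1 t : `|h t| <= exponential_pdf rho t.
  have p0 := exponential_pdf_ge0 (ltW rho0) t.
  rewrite normrM ger0_norm // ger0_norm ?fine_ge0 // ler_piMr //.
  by rewrite -lee_fin fineK ?fin_num_measure //; apply: probability_le1.
have ih : mu.-integrable setT (EFin \o h).
  apply: (@integrable_le R setT h (exponential_pdf rho)) => //.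
  exact: integrable_exponential_pdf.
have ih2 : mu.-integrable `[0, u] (EFin \o h) by exact: integrableS ih.
split.
  apply: (@eq_integrable _ _ R mu _ mD (EFin \o h)) => // t.
  by move=> /set_mem tD; rewrite /= -hE.
rewrite PS /product_measure1 (eq_integral (fun z => \int[mu]_t g (z, t))%E); last first.
  by move=> z _; exact: inner_t.
rewrite (@fubini_tonelli _ _ _ _ R m1 mu g mg g0).
transitivity (\int[mu]_(t in `[0, u]) h t); last by apply: eq_Rintegral => t /set_mem; exact: hE.
rewrite /Rintegral; congr fine; rewrite [RHS]integral_mkcond; apply: eq_integral => t _.
rewrite inner_z patchE; case: ifPn => // tn.
have [t0|t0] := ltP t 0; first by rewrite lt0_exponential_pdf // mul0r.
rewrite (_ : [set o | _] = set0) ?measure0 /= ?mulr0 //.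
apply/seteqP; split => // o /= Xo; move: tn; rewrite notin_setE /= in_itv /= t0 /= => /negP; rewrite -ltNge.
by have := X0 o; lra.
Qed.

End ExpConvolution.

(** * Passage times by the recursion over antidiagonals *)

Section Lpp.
Context {R : realType}.

(** The path ends at the cell of row [j] and height index [n - 1], whose predecessors lie in rows
    [j] and [j - 1]. The value [0] at [n = 0] frees the starting point. *)
Fixpoint lpp (W : nat -> int -> R) (n : nat) (j : int) : R :=
  if n is m.+1 then W m j + Num.max (lpp W m j) (lpp W m (j - 1)) else 0.

Lemma lpp_ge0 W n j : (forall m i, 0 <= W m i) -> 0 <= lpp W n j.
Proof.
move=> W0; elim: n j => [//|n IH] j /=.
by rewrite addr_ge0 // le_max IH.
Qed.

Lemma lpp_leS W n j : (forall m i, 0 <= W m i) -> lpp W n j <= lpp W n.+1 j.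
Proof. by move=> W0 /=; rewrite ler_wpDl // le_max lexx. Qed.

Lemma lpp_le_height W n m j : (forall m i, 0 <= W m i) -> (n <= m)%N -> lpp W n j <= lpp W m j.
Proof.
move=> W0 /subnK <-; elim: (m - n)%N => [|k IH]; first by rewrite add0n.
by rewrite addSn (le_trans IH) // lpp_leS.
Qed.

End Lpp.

(** * Joint law along down-right paths and the end point *)

Section ExactLaw.
Context {d : measure_display} {T : measurableType d} {R : realType} (P : probability T R).

(* [E (n, j)] is the weight of the cell of row [j] on the antidiagonal of height [n + 1]. *)
Definition exp_field (E : nat * int -> T -> R) : Prop :=
  [/\ forall c, measurable_fun setT (E c), forall c o, 0 <= E c o,
      forall c x, 0 <= x -> P [set o | E c o <= x] = (1 - expR (- x))%:E &
      mutually_independent P xpredT E].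

Variable E : nat * int -> T -> R.
Hypothesis fE : exp_field E.
Let mE : forall c, measurable_fun setT (E c). Proof. by case: fE. Qed.
Let indE : mutually_independent P xpredT E. Proof. by case: fE. Qed.

Lemma smeas_lpp (S : set (nat * int)) (W : T -> nat -> int -> R) n j :
  (forall m i, (m < n)%N -> i <= j -> j - (n - m.+1)%N%:Z <= i -> smeas E S (fun o => W o m i)) ->
  smeas E S (fun o => lpp (W o) n j).
Proof.
elim: n j => [|n IH] j SW /=; first exact: smeas_cst.
apply: smeasD; first by apply: SW => //; rewrite subnn subr0.
apply: smeas_max; apply: IH => m i mn ij ji.
  by apply: SW => //; [exact: ltnW|lia].
by apply: SW; [exact: ltnW|lia|lia].
Qed.

Variables (N : nat) (b : nat -> R) (j0 : int) (W : T -> nat -> int -> R).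
Hypothesis b0 : forall l, (l <= N)%N -> 0 < b l.
Hypothesis binj : forall i j, (i <= N)%N -> (j <= N)%N -> b i = b j -> i = j.
Hypothesis W0 : forall o m i, 0 <= W o m i.
Hypothesis WE : forall o r m, (m <= r <= N)%N -> W o m (j0 + r%:Z) = E (m, j0 + r%:Z) o / (b r + b (r - m)%N).

Let X (r p : nat) (o : T) : R := lpp (W o) p.+1 (j0 + r%:Z).
(** Bounds along the down-right path that matches the columns of [mixmx b r p]. *)
Let ev (r p : nat) (y : nat -> R) : set T :=
  [set o | forall j, (j <= r)%N -> (if (j <= p)%N then X r j o else X r.-1 j.-1 o) <= y j].
Let F r p y : R := fine (P (ev r p y)).

Let smeas_W (S : set (nat * int)) r m : (m <= r <= N)%N -> S (m, j0 + r%:Z) -> smeas E S (fun o => W o m (j0 + r%:Z)).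
Proof.
move=> mr Sc; have -> : (fun o => W o m (j0 + r%:Z)) = (fun o => E (m, j0 + r%:Z) o * (b r + b (r - m)%N)^-1).
  by apply/funext => o; exact: WE.
by apply: smeasZr; exact: smeas_coord.
Qed.

Let smeas_X (S : set (nat * int)) r p : (p <= r <= N)%N ->
  (forall m r', (m <= p)%N -> (r' <= r)%N -> S (m, j0 + r'%:Z)) -> smeas E S (X r p).
Proof.
move=> /andP[pr rN] SS; apply: smeas_lpp => m i mp ij ji.
have [r' r'E] : exists r' : nat, i = j0 + r'%:Z.
  exists `|i - j0|%N; lia.
rewrite r'E in ij ji *; apply: smeas_W; first by apply/andP; split; lia.
by apply: SS; lia.
Qed.

Let sgen_bigand (S : set (nat * int)) (n : nat) (p : pred nat) (f : nat -> T -> R) (y : nat -> R) :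
  (forall j, (j < n)%N -> p j -> smeas E S (f j)) ->
  sgen E S [set o | forall j, (j < n)%N -> p j -> f j o <= y j].
Proof.
elim: n => [|n IH] fS.
  have -> : [set o | forall j, (j < 0)%N -> p j -> f j o <= y j] = setT by apply/seteqP; split.
  exact: (@measurableT _ (g_sigma_algebraType (cyl E S))).
have -> : [set o | forall j, (j < n.+1)%N -> p j -> f j o <= y j] =
   [set o | forall j, (j < n)%N -> p j -> f j o <= y j] `&` (if p n then [set o | f n o <= y n] else setT).
  apply/seteqP; split => o /=.
    move=> h; split; first by move=> j jn; apply: h; exact: leqW.
    by case: ifP => // pn; apply: h.
  move=> [h1 h2] j; rewrite ltnS leq_eqVlt => /predU1P[-> pn|jn]; last exact: h1.
  by move: h2; rewrite pn.
apply: sgenI; first by apply: IH => j jn; apply: fS; exact: leqW.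
case: ifP => pn; last exact: (@measurableT _ (g_sigma_algebraType (cyl E S))).
by apply: sgen_le; exact: fS.
Qed.

Let W_cdf r m x : (m <= r <= N)%N -> 0 <= x ->
  P [set o | W o m (j0 + r%:Z) <= x] = (1 - expR (- ((b r + b (r - m)%N) * x)))%:E.
Proof.
move=> /andP[mr rN] x0; have bb : 0 < b r + b (r - m)%N.
  by rewrite addr_gt0 // b0 // (leq_trans (leq_subr _ _)).
have [_ _ c _] := fE.
rewrite -(c (m, j0 + r%:Z)) ?mulr_ge0 ?(ltW bb) //; congr (P _); apply/seteqP; split => o /=;
  by rewrite WE ?mr // ler_pdivrMr // mulrC.
Qed.

Let X_mono r j p o : (j <= p)%N -> X r j o <= X r p o.
Proof. by move=> jp; apply: lpp_le_height => //; exact: W0. Qed.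

Let claim00 : exists K, forall y, 0 <= y 0%N -> F 0 0 y = K * mixdet b 0 0 y.
Proof.
exists 1 => y y0; rewrite mul1r /mixdet det_mx11 mxE /=.
have -> : fcol b 0 0 0 (y 0%N) = 1 - expR (- ((b 0%N + b 0%N) * y 0%N)).
  rewrite /fcol /newton !big_ord0 !mul1r mulrBr -!expRD addNr expR0; congr (_ - expR _); ring.
rewrite -[RHS]/(fine (1 - expR (- ((b 0%N + b (0 - 0)%N) * y 0%N)))%:E) -W_cdf //; congr fine; congr (P _).
apply/seteqP; split => o /=.
  by move=> /(_ 0%N (leqnn _)) /=; rewrite /X /= maxxx addr0.
by move=> h [|//] _; rewrite /X /= maxxx addr0.
Qed.

(** The first cell of the new row is independent of the earlier rows, and [mixdet0] splits off the
    same factor. *)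
Let claim0 r : (r.+1 <= N)%N ->
  (exists K, forall y, 0 <= y 0%N -> (forall j, (j < r)%N -> y j <= y j.+1) -> F r r y = K * mixdet b r r y) ->
  exists K, forall y, 0 <= y 0%N -> (forall j, (j < r.+1)%N -> y j <= y j.+1) ->
     F r.+1 0 y = K * mixdet b r.+1 0 y.
Proof.
move=> rN [K HK]; set k := (-1) ^+ r.+1 * \prod_(i < r.+1) (b i ^+ 2 - b r.+1 ^+ 2).
have k0 : k != 0.
  rewrite mulf_neq0 ?signr_eq0 //; apply/prodf_neq0 => i _.
  have iN : (i <= N)%N by rewrite (leq_trans _ rN) // ltnW.
  rewrite subr_eq0 eqrXn2 ?ltW ?b0 //; apply/eqP => /(binj iN rN) h.
  by have := ltn_ord i; rewrite h ltnn.
exists (K / k) => y y0 ym; rewrite mixdet0 -/k.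
have y1 : 0 <= y 1%N by rewrite (le_trans y0) // ym.
have := HK (fun j => y j.+1) y1 (fun j jr => ym j.+1 jr) => E1.
pose S := [set c : nat * int | c.2 <= j0 + r%:Z].
pose S' := [set c : nat * int | c.2 = j0 + r.+1%:Z].
have sev : sgen E S (ev r r (fun j => y j.+1)).
  have -> : ev r r (fun j => y j.+1) = [set o | forall j, (j < r.+1)%N -> xpredT j -> X r j o <= y j.+1].
    apply/seteqP; split => o h j jr; first by move=> _; have := h j jr; rewrite -ltnS jr.
    by rewrite jr; exact: h.
  apply: sgen_bigand => j jr _; apply: smeas_X; first by rewrite -ltnS jr ltnW.
  by move=> m r' _ r'r; rewrite /S /=; lia.
have -> : F r.+1 0 y = fine (P [set o | (W o 0%N (j0 + r.+1%:Z) <= y 0%N)%R] * P (ev r r (fun j => y j.+1)))%E.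
  rewrite /F -(@sgen_indep _ _ _ _ _ E mE indE S' S) //.
  - congr fine; congr (P _); apply/seteqP; split => o /=.
      move=> h; split; first by have := h 0%N isT; rewrite /X /= maxxx addr0.
      by move=> j jr; have := h j.+1 jr; rewrite jr.
    move=> [h1 h2] [|j] jr; first by rewrite /X /= maxxx addr0.
    by have := h2 j jr; rewrite /= -ltnS jr.
  - by apply/seteqP; split => // -[m i] [] /=; rewrite /S /S' /= => -> ; lia.
  - by apply: sgen_le; apply: smeas_W.
rewrite W_cdf // fineM ?fin_num_measure //; last exact: (sgen_measurable mE sev).
rewrite -/(F r r _) E1 subn0 /=.
have -> : (b r.+1 + b r.+1) * y 0%N = 2 * b r.+1 * y 0%N by ring.
move: (1 - expR _) (mixdet _ _ _ _) => u v; by field.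
Qed.

(** Exchanging a corner adds an exponential weight to the maximum [Z] of two passage times. The
    clipped bounds describe the event before the exchange, and [mixdet_int] is the matching identity
    of determinants; the constant gains the rate [rho]. *)
Let claimS r p : (r.+1 <= N)%N -> (p <= r)%N ->
  (exists K, forall y, 0 <= y 0%N -> (forall j, (j < r.+1)%N -> y j <= y j.+1) -> F r.+1 p y = K * mixdet b r.+1 p y) ->
  exists K, forall y, 0 <= y 0%N -> (forall j, (j < r.+1)%N -> y j <= y j.+1) ->
     F r.+1 p.+1 y = K * mixdet b r.+1 p.+1 y.
Proof.
move=> rN pr [K HK]; pose rho := b r.+1 + b (r - p)%N.
have rho0 : 0 < rho by rewrite addr_gt0 // b0 // (leq_trans (leq_subr _ _)) // ltnW.
exists (rho * K) => y y0 ym; pose Y := y p.+1.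
have ymm i j : (i <= j)%N -> (j <= r.+1)%N -> y i <= y j.
  move=> /subnK <-; elim: (j - i)%N => [|k IH]; first by rewrite add0n.
  rewrite addSn => kr; exact: le_trans (IH (ltnW kr)) (ym _ kr).
pose c0 : nat * int := (p.+1, j0 + r.+1%:Z).
pose S := [set c : nat * int | c != c0].
pose e o := W o p.+1 (j0 + r.+1%:Z).
pose Z o := Num.max (X r.+1 p o) (X r p o).
pose A : set T := [set o | forall j, (j < p.+1)%N -> xpredT j -> X r.+1 j o <= y j] `&`
   [set o | forall j, (j < r.+2)%N -> (p.+1 < j)%N -> X r j.-1 o <= y j].
have sX1 j : (j <= p)%N -> smeas E S (X r.+1 j).
  move=> jp; apply: smeas_X; first by rewrite rN andbT (leq_trans jp) // ltnW.
  by move=> m r' mj _; rewrite /S /c0 /= xpair_eqE negb_and neq_ltn ltnS (leq_trans mj).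
have sX2 j : (j <= r)%N -> smeas E S (X r j).
  move=> jr; apply: smeas_X; first by rewrite jr ltnW.
  move=> m r' _ r'r; rewrite /S /c0 /= xpair_eqE negb_and; apply/orP; right; apply/eqP; lia.
have sA : sgen E S A.
  apply: sgenI; apply: sgen_bigand => j jr; first by move=> _; exact: sX1.
  by move=> pj; apply: sX2; lia.
(* Off [A] the variable is put above [Y], so that [ZA + e <= Y] includes the bounds on the rest of
   the path and the one-dimensional convolution applies. *)
pose ZA o := if o \in A then Z o else Y + 1.
have sZA : smeas E S ZA.
  by apply: smeas_if => //; apply: smeas_max; [exact: sX1|exact: sX2].
have se : smeas E [set c0] e by apply: smeas_W => //; rewrite rN ltnS pr.
have Y0 : 0 <= Y by rewrite (le_trans y0) // ymm.
have ZA0 o : 0 <= ZA o.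
  rewrite /ZA; case: ifP => _; last by rewrite addr_ge0.
  by rewrite le_max lpp_ge0.
have e0 o : 0 <= e o by exact: W0.
have ecdf x : 0 <= x -> P [set o | e o <= x] = (1 - expR (- (rho * x)))%:E.
  by move=> x0; rewrite W_cdf ?rN ?ltnS ?pr // subSS.
have ind (B1 B2 : set R) : measurable B1 -> measurable B2 ->
    P (ZA @^-1` B1 `&` e @^-1` B2) = (P (ZA @^-1` B1) * P (e @^-1` B2))%E.
  move=> mB1 mB2; apply: (@sgen_indep _ _ _ _ _ E mE indE S [set c0]); [|exact: smeas_sgen..].
  by apply/seteqP; split => // c [] /=; rewrite /S /= => /eqP.
have Xrec o : X r.+1 p.+1 o = e o + Z o.
  rewrite /Z /e /X [in LHS]/=; congr (_ + Num.max _ _).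
  by have -> : j0 + r.+1%:Z - 1 = j0 + r%:Z by lia.
have Fstep : F r.+1 p.+1 y = fine (P [set o | ZA o + e o <= Y]).
  rewrite /F; congr fine; congr (P _); apply/seteqP; split => o /=.
    move=> h; have Ao : o \in A.
      apply/mem_set; split => j jr.
        move=> _; have jr' : (j <= r.+1)%N by lia.
        by have := h j jr'; rewrite (ltnW jr).
      by move=> pj; have := h j jr; rewrite leqNgt pj.
    by rewrite /ZA Ao; have := h p.+1 pr; rewrite leqnn Xrec addrC.
  rewrite /ZA; case: ifPn => [/set_mem [A1 A2] h|_ h]; last first.
    by have := e0 o; have := h; rewrite /Y; lra.
  move=> j jr; case: (ltngtP j p.+1) => [jp|jp|->].
  - by apply: A1.
  - by apply: A2.
  - by rewrite Xrec addrC.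
have Fconv t : 0 <= t <= Y -> fine (P [set o | ZA o <= Y - t]) = F r.+1 p (clip p y (Y - t)).
  move=> /andP[t0 tY]; rewrite /F; congr fine; congr (P _); apply/seteqP; split => o /=.
    rewrite /ZA; case: ifPn => [/set_mem [A1 A2]|_ h]; last by lra.
    rewrite ge_max => /andP[h1 h2] j jr; rewrite /clip; case: (leqP j p) => jp.
      by rewrite le_min A1 //= (le_trans _ h1) // X_mono.
    case: eqP => [->|/eqP jp1]; first exact: h2.
    by apply: A2 => //; rewrite ltn_neqAle eq_sym jp1.
  move=> h; have Ao : o \in A.
    apply/mem_set; split => j jr.
      have jr' : (j <= r.+1)%N by lia.
      have jp : (j <= p)%N by [].
      by move=> _; have := h j jr'; rewrite /clip jp le_min => /andP[].
    move=> pj; have := h j jr; rewrite leqNgt (ltnW pj) /clip leqNgt (ltnW pj) /= gtn_eqF //.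
  rewrite /ZA Ao ge_max; apply/andP; split.
    have pr' : (p <= r.+1)%N by lia.
    by have := h p pr'; rewrite leqnn /clip leqnn le_min => /andP[].
  by have := h p.+1 pr; rewrite ltnn /clip ltnn eqxx.
have [ih iE] := @exp_convolution _ _ R P ZA e rho Y (smeas_measurable mE sZA) (smeas_measurable mE se) ZA0 e0 rho0 ecdf ind.
have clip0 t : 0 <= t <= Y -> 0 <= clip p y (Y - t) 0%N.
  by move=> /andP[t0 tY]; rewrite /clip /= le_min y0 subr_ge0.
have clipm t : 0 <= t <= Y -> forall j, (j < r.+1)%N -> clip p y (Y - t) j <= clip p y (Y - t) j.+1.
  move=> /andP[t0 tY] j jr; rewrite /clip; case: (ltngtP j p) => jp.
  - by rewrite le_min ge_min ym //= ge_min lexx orbT.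
  - rewrite [in X in X <= _]eq_sym; case: eqP => [e1|_].
      have -> : (j.+1 == p.+1) = false by apply/eqP; lia.
      by rewrite (le_trans _ (ym _ jr)) // -e1 /Y; lra.
    have -> : (j.+1 == p.+1) = false by rewrite eqSS gtn_eqF.
    exact: ym.
  - by rewrite jp eqxx ge_min lexx orbT.
have hE t : 0 <= t <= Y -> rho * expR (- (rho * t)) * fine (P [set o | ZA o <= Y - t]) =
    rho * K * (expR (- (rho * t)) * mixdet b r.+1 p (clip p y (Y - t))).
  move=> tY; rewrite Fconv // HK; [|exact: clip0|exact: clipm].
  by move: (expR _) (mixdet _ _ _ _) => u v; ring.
have mD : measurable (`[0, Y]%classic : set R) by exact: measurable_itv.
rewrite Fstep iE.
(* Integrability of the determinant is obtained by dividing by [rho * K]; for [K = 0] both sides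
   vanish. *)
have [K0|K0] := eqVneq K 0.
  transitivity (\int[@lebesgue_measure R]_(t in `[0, Y]) (0 : R)).
    by apply: eq_Rintegral => t /set_mem; rewrite /= in_itv /= => tY; rewrite hE // K0 mulr0 mul0r.
  by rewrite /Rintegral integral0 K0 mulr0 mul0r.
pose h t := expR (- (rho * t)) * mixdet b r.+1 p (clip p y (Y - t)).
have ih2 : (@lebesgue_measure R).-integrable `[0, Y] (EFin \o h).
  apply: (@eq_integrable _ _ R (@lebesgue_measure R) _ mD (EFin \o (fun t => (rho * K)^-1 *
     (rho * expR (- (rho * t)) * fine (P [set o | ZA o <= Y - t]))))).
    move=> t /set_mem; rewrite /= in_itv /= => tY; rewrite hE // mulKf //.
    by rewrite mulf_neq0 // gt_eqF.
  exact: integrableRZ.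
rewrite -(mixdet_int pr y0 ym (fun t _ => erefl (h t)) ih2) -(@RintegralZl _ _ R (@lebesgue_measure R) _ _ _ mD ih2).
by apply: eq_Rintegral => t /set_mem; rewrite /= in_itv /=; exact: hE.
Qed.

(** The constant is not tracked through the recursion; [exact_law] recovers it from the total
    mass. *)
Let joint_law : exists K, forall y, 0 <= y 0%N -> (forall j, (j < N)%N -> y j <= y j.+1) -> F N N y = K * mixdet b N N y.
Proof.
have H r : (r <= N)%N -> exists K, forall y, 0 <= y 0%N -> (forall j, (j < r)%N -> y j <= y j.+1) ->
    F r r y = K * mixdet b r r y.
  elim: r => [_|r IH rN]; first by have [K HK] := claim00; exists K => y y0 _; exact: HK.
  have {}IH := IH (ltnW rN).
  have Hp p : (p <= r.+1)%N -> exists K, forall y, 0 <= y 0%N -> (forall j, (j < r.+1)%N -> y j <= y j.+1) ->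
      F r.+1 p y = K * mixdet b r.+1 p y.
    elim: p => [_|p IHp pr]; first exact: claim0.
    by apply: claimS => //; apply: IHp; exact: ltnW.
  exact: Hp.
exact: H.
Qed.

(** Lagrange interpolation with nodes [b j], evaluated at the points [- b i]. *)
Let Lambda : 'M[R]_N.+1 := \matrix_(i, j) \prod_(l < N.+1 | l != j) ((- b i - b l) / (b j - b l)).

Let lagrange : Lambda *m (\matrix_(i < N.+1, j < N.+1) newton b N j (b i)) = \matrix_(i < N.+1, j < N.+1) newton b N j (- b i).
Proof.
apply/matrixP => i j; rewrite !mxE.
have [M bM] : exists M : R, forall l, (l <= N)%N -> b l < M.
  exists (\sum_(l < N.+1) `|b l| + 1) => l lN; rewrite (bigD1 (Ordinal (lN : (l < N.+1)%N))) //=.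
  have : 0 <= \sum_(k < N.+1 | k != Ordinal (lN : (l < N.+1)%N)) `|b k| by exact: sumr_ge0.
  by have := ler_norm (b l); lra.
(* The interpolation formula asks for an injective sequence of nodes; beyond [N] it is continued
   above all the [b l]. *)
pose x l := if (l <= N)%N then b l else M + l%:R.
have xinj : injective x.
  move=> k l; rewrite /x; case: (leqP k N) => kN; case: (leqP l N) => lN.
  - exact: binj.
  - by move=> h; have := bM _ kN; rewrite h ltNge lerDl ler0n.
  - by move=> h; have := bM _ lN; rewrite -h ltNge lerDl ler0n.
  - by move=> /addrI /eqP; rewrite eqr_nat => /eqP.
have xE (k : 'I_N.+1) : x k = b k by rewrite /x -ltnS ltn_ord.
pose q : {poly R} := \prod_(l < j) ('X - (b (N - l)%N)%:P).
have qE z : q.[z] = newton b N j z.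
  by rewrite /q horner_prod; apply: eq_bigr => l _; rewrite hornerXsubC.
have sq : (size q <= N.+1)%N by rewrite size_prod_XsubC /index_enum -enumT size_enum_ord ltn_ord.
rewrite -qE [in RHS](lagrange_gen (ltn0Sn N) xinj sq) horner_sum; apply: eq_bigr => k _.
rewrite !mxE lagrangeE // hornerM hornerC xE qE mulrC hornerM hornerC !horner_prod; congr (_ * _).
rewrite mulrC xE prodf_div; congr (_ / _); apply: eq_bigr => l _; by rewrite hornerXsubC xE.
Qed.

(** Conjugation by the diagonal matrix of the products of the [b l - b i] turns [Lambda] into the
    Cauchy-type matrix of [fred_ker]. *)
Let conj_det (u : R) : \det (1%:M - diag_mx (\row_(i < N.+1) expR (- (2 * (b i * u)))) *m Lambda) =
  fred (fun x => ker (fun l : 'I_N.+1 => b l) (x + 2 * u)).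
Proof.
rewrite fred_ker; last by move=> l; apply: b0; rewrite -ltnS.
pose dd (i : 'I_N.+1) : R := \prod_(l < N.+1 | l != i) (b l - b i).
have dd0 i : dd i != 0.
  apply/prodf_neq0 => l li; rewrite subr_eq0; apply: contra li => /eqP h; apply/eqP/val_inj.
  exact: (binj (ltn_ord l) (ltn_ord i) h).
pose D := diag_mx (\row_i dd i); pose D' := diag_mx (\row_i (dd i)^-1).
have DD : D *m D' = 1%:M.
  by apply/matrixP => i j; rewrite mul_diag_mx !mxE; case: eqP => [->|_]; rewrite ?mulr1n ?mulr0n ?mulr0 ?mulfV.
pose M : 'M[R]_N.+1 := \matrix_(i, j) (pf_coef (fun l : 'I_N.+1 => b l) i * expR (- (b i * (2 * u))) / (b i + b j)).
rewrite -/M.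
have -> : diag_mx (\row_(i < N.+1) expR (- (2 * (b i * u)))) *m Lambda = D *m M *m D'.
  apply/matrixP => i j; rewrite mul_diag_mx mul_mx_diag mul_diag_mx !mxE /pf_coef.
  have -> : b i * (2 * u) = 2 * (b i * u) by ring.
  rewrite prodf_div /= -/(dd i).
  have -> : \prod_(l < N.+1 | l != j) (b j - b l) = (-1) ^+ N * dd j.
    rewrite /dd; have -> : (-1) ^+ N = \prod_(l < N.+1 | l != j) (-1 : R).
      by rewrite prodr_const cardC1 card_ord.
    by rewrite -big_split /=; apply: eq_bigr => l _; rewrite mulN1r opprB.
  have -> : \prod_(l < N.+1 | l != j) (- b i - b l) = (-1) ^+ N * \prod_(l < N.+1 | l != j) (b i + b l).
    have -> : (-1) ^+ N = \prod_(l < N.+1 | l != j) (-1 : R).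
      by rewrite prodr_const cardC1 card_ord.
    by rewrite -big_split /=; apply: eq_bigr => l _; rewrite mulN1r opprD.
  have bij : b i + b j != 0 by rewrite gt_eqF // addr_gt0 // b0 // -ltnS.
  have e1 : \prod_(l < N.+1 | l != j) (b i + b l) = \prod_(l < N.+1) (b i + b l) / (b i + b j).
    by rewrite [X in _ = X / _](bigD1 j) //= mulrAC divff ?mul1r.
  have e2 : 2 * b i * \prod_(l < N.+1 | l != i) (b i + b l) = \prod_(l < N.+1) (b i + b l).
    by rewrite [RHS](bigD1 i) //=; congr (_ * _); ring.
  have e3 : 2 * b i * \prod_(l < N.+1 | l != i) ((b i + b l) / (b l - b i)) = \prod_(l < N.+1) (b i + b l) / dd i.
    by rewrite prodf_div mulrA e2.
  rewrite e3 e1.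
  have s0 : (-1) ^+ N != 0 :> R by rewrite signr_eq0.
  have := dd0 i; have := dd0 j; move: (dd i) (dd j) (expR _) (\prod_(l < N.+1) _) ((-1) ^+ N) s0 => x y e q s s0 y0 x0.
  by field; rewrite s0 y0 x0 bij.
have DM : D *m (1%:M - M) *m D' = 1%:M - D *m M *m D' by rewrite mulmxBr mulmxBl mulmx1 DD.
have dDD : \det D * \det D' = 1 by rewrite -det_mulmx DD det1.
by rewrite -DM !det_mulmx mulrAC dDD mul1r.
Qed.

Let FNN u : 0 <= u -> F N N (fun=> u) = fine (P [set o | X N N o <= u]).
Proof.
move=> u0; rewrite /F; congr fine; congr (P _); apply/seteqP; split => o /=.
  by move=> /(_ N (leqnn _)); rewrite leqnn.
by move=> h j jN; rewrite jN (le_trans _ h) // X_mono.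
Qed.

(** As [u] grows, the probability tends to [1] and the determinant to that of the identity, whence
    [K * \det Ap = 1]. *)
Lemma exact_law (u : R) : 0 <= u ->
  P [set o | lpp (W o) N.+1 (j0 + N%:Z) <= u] =
  (fred (fun x => ker (fun l : 'I_N.+1 => b l) (x + 2 * u)))%:E.
Proof.
have [K HK] := joint_law.
pose Ap : 'M[R]_N.+1 := \matrix_(i < N.+1, j < N.+1) newton b N j (b i).
pose Ee v : 'M[R]_N.+1 := diag_mx (\row_(i < N.+1) expR (- (2 * (b i * v)))).
have sX : smeas E setT (X N N) by apply: smeas_X; rewrite ?leqnn.
have mX v : measurable [set o | X N N o <= v] by apply: (sgen_measurable mE (sgen_le _ sX)).
have law v : 0 <= v -> fine (P [set o | X N N o <= v]) = K * (\det Ap * \det (1%:M - Ee v *m Lambda)).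
  move=> v0; rewrite -FNN // (HK (fun=> v)) // mixdet_final [\det Ap * _]mulrC -det_mulmx mulmxBl mul1mx.
  rewrite -mulmxA lagrange; congr (_ * \det (_ - _)).
  by apply/matrixP => i j; rewrite mul_diag_mx !mxE.
have Elim0 : \det (1%:M - Ee n%:R *m Lambda) @[n --> \oo] --> \det (1%:M : 'M[R]_N.+1).
  apply: cvg_det => i j; rewrite -[X in _ --> X]subr0.
  have EE v : (1%:M - Ee v *m Lambda) i j = (1%:M : 'M[R]_N.+1) i j - expR (- (2 * (b i * v))) * Lambda i j.
    by rewrite /Ee mul_diag_mx !mxE.
  under eq_fun do rewrite EE.
  apply: cvgB; first exact: cvg_cst.
  rewrite -(mul0r (Lambda i j)); apply: cvgM; last exact: cvg_cst.
  have bi0 : 0 < b i by rewrite b0 // -ltnS.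
  have En n : expR (- (2 * (b i * n%:R))) = expR (- (2 * b i)) ^+ n.
    by rewrite -expRM_natl; congr expR; ring.
  under eq_fun do rewrite En.
  by apply: cvg_expr; rewrite ger0_norm ?expR_ge0 // expR_lt1 oppr_lt0 mulr_gt0.
have Elim : \det (1%:M - Ee n%:R *m Lambda) @[n --> \oo] --> (1 : R).
  by move: Elim0; rewrite det1.
have K1 : K * \det Ap = 1.
  have l1 : fine (P [set o | X N N o <= n%:R]) @[n --> \oo] --> (1 : R).
    apply: fine_cvg; rewrite -[X in _ --> X](@probability_setT _ _ _ P).
    have -> : setT = \bigcup_n [set o | X N N o <= n%:R].
      apply/seteqP; split => // o _; exists (Num.truncn (X N N o)).+1 => //=.
      by rewrite ltW // truncnS_gt.
    apply: nondecreasing_cvg_mu => //; first exact: bigcup_measurable.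
    by move=> n m nm; apply/subsetPset => o /= /le_trans; apply; rewrite ler_nat.
  have l2 : fine (P [set o | X N N o <= n%:R]) @[n --> \oo] --> K * \det Ap * 1.
    under eq_fun do rewrite law // mulrA.
    by apply: cvgM; [exact: cvg_cst|exact: Elim].
  have := cvg_unique (@norm_hausdorff _ _) l1 l2; rewrite mulr1 => <-.
  by [].
move=> u0; rewrite -[LHS]fineK; last by rewrite fin_num_measure //; exact: (mX u).
by congr (_%:E); rewrite (law u u0) mulrA K1 mul1r conj_det.
Qed.

End ExactLaw.

(** * Limit law of a point-to-line passage time *)

Section FlatModel.
Context {R : realType}.

(** One standard field serves all parameters: in this coupling, raising parameters lowers every
    weight. *)
Definition wmod (b : int -> R) (e : nat * int -> R) (n : nat) (j : int) : R :=
  e (n, j) / (b j + b (j - n%:Z)).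

Definition flat_mean (b : int -> R) (n : nat) (j : int) : R := \sum_(l < n) (b (j - l%:Z))^-1.
Definition flat_scale (b : int -> R) (n : nat) (j : int) : R :=
  (2 * \sum_(l < n) (b (j - l%:Z) ^+ 3)^-1) `^ 3^-1.

Lemma lpp_le (W W' : nat -> int -> R) n j :
  (forall m i, (m < n)%N -> i <= j -> j - (n - m.+1)%N%:Z <= i -> W m i <= W' m i) ->
  lpp W n j <= lpp W' n j.
Proof.
elim: n j => [//|n IH] j WW /=.
have IH' i : i <= j -> j - 1 <= i -> lpp W n i <= lpp W' n i.
  by move=> ij ji; apply: IH => m k mn ki ik; apply: WW; [exact: ltnW|lia|lia].
apply: lerD; first by apply: WW => //; rewrite subnn subr0.
rewrite ge_max !le_max IH' //= ?IH' ?orbT //; lia.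
Qed.

Lemma sum_ord_le n (F : 'I_n -> R) c : (forall l, F l <= c) -> \sum_l F l <= n%:R * c.
Proof.
move=> Fc; apply: (@le_trans _ _ (\sum_(l < n) c)); first exact: ler_sum.
by rewrite sumr_const card_ord mulr_natl.
Qed.

Lemma sum_ord_ge n (F : 'I_n -> R) c : (forall l, c <= F l) -> n%:R * c <= \sum_l F l.
Proof.
move=> Fc; apply: (@le_trans _ _ (\sum_(l < n) c)); last exact: ler_sum.
by rewrite sumr_const card_ord mulr_natl.
Qed.

Lemma wmod_ge0 b e n j : (forall i, 0 < b i) -> (forall c, 0 <= e c) -> 0 <= wmod b e n j.
Proof. by move=> b0 e0; rewrite divr_ge0 // addr_ge0 // ltW. Qed.

Lemma wmod_anti (b b' : int -> R) e n j : (forall c, 0 <= e c) -> 0 < b j + b (j - n%:Z) ->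
  b j + b (j - n%:Z) <= b' j + b' (j - n%:Z) -> wmod b' e n j <= wmod b e n j.
Proof.
move=> e0 b0 bb; rewrite /wmod ler_wpM2l // lef_pV2 ?posrE //.
exact: lt_le_trans bb.
Qed.

Lemma avoid_seq (s : seq R) (e : R) : 0 < e -> exists x, [/\ 0 < x, x <= e & x \notin s].
Proof.
move=> e0; suff [y [y0 ye H]] : exists y, [/\ 0 < y, y <= e & forall x, 0 < x < y -> x \notin s].
  exists (y / 2); split; [by rewrite divr_gt0|by lra|].
  by apply: H; apply/andP; split; lra.
elim: s => [|a s [y [y0 ye H]]]; first by exists e.
exists (if 0 < a then Num.min y a else y); case: ifPn => a0; split => //.
- by rewrite lt_min y0.
- by rewrite ge_min ye.
- move=> x /andP[x0]; rewrite lt_min => /andP[xy xa].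
  by rewrite inE negb_or H ?x0 // andbT lt_eqF.
- move=> x xy; rewrite inE negb_or H // andbT; case/andP: xy => x0 _.
  by apply: contra a0 => /eqP <-.
Qed.

Lemma distinct_shift (f : nat -> R) (e : R) (N : nat) : 0 < e ->
  exists t : nat -> R, (forall l, 0 <= t l <= e) /\
    (forall i j, (i < N)%N -> (j < N)%N -> f i + t i = f j + t j -> i = j).
Proof.
move=> e0; elim: N => [|N [t [te tinj]]].
  by exists (fun=> 0); split => // l; rewrite lexx ltW.
have [x [x0 xe xs]] := avoid_seq [seq f i + t i - f N | i <- iota 0 N] e0.
exists (fun l => if l == N then x else t l); split.
  by move=> l; case: ifP => // _; rewrite (ltW x0).
have xN i : (i < N)%N -> f i + t i <> f N + x.
  move=> iN h; move/negP: xs; apply; apply/mapP; exists i; first by rewrite mem_iota.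
  by rewrite h addrAC subrr add0r.
move=> i j; rewrite !ltnS [(i <= N)%N]leq_eqVlt [(j <= N)%N]leq_eqVlt.
case: eqVneq => [->|iN] /=; case: eqVneq => [->|jN] //= hi hj.
- by move=> h; case: (xN j hj).
- by move=> h; case: (xN i hi).
- exact: tinj.
Qed.

Lemma flat_scale_cube b n j : (forall i, 0 < b i) -> (0 < n)%N ->
  0 < flat_scale b n j /\ flat_scale b n j ^+ 3 = 2 * \sum_(l < n) (b (j - l%:Z) ^+ 3)^-1.
Proof.
move=> b0; case: n => // n _; have S0 : 0 < 2 * \sum_(l < n.+1) (b (j - l%:Z) ^+ 3)^-1.
  rewrite mulr_gt0 // big_ord_recl ltr_wpDr ?invr_gt0 ?exprn_gt0 //.
  by apply: sumr_ge0 => l _; rewrite invr_ge0 exprn_ge0 // ltW.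
split; first exact: powR_gt0.
by rewrite /flat_scale -powR_mulrn ?powR_ge0 // -powRrM mulVf // powRr1 // ltW.
Qed.

Lemma flat_mean_le b b' n j (e : R) : (forall i, 0 < b i) -> (forall i, 0 < b' i) -> 0 < e < 1 ->
  (forall l, (l < n)%N -> (1 - e) * b (j - l%:Z) <= b' (j - l%:Z)) ->
  flat_mean b' n j <= flat_mean b n j / (1 - e).
Proof.
move=> b0 b'0 /andP[e0 e1] bb; rewrite /flat_mean mulr_suml; apply: ler_sum => l _.
rewrite -invfM lef_pV2 ?posrE // 1?mulrC ?bb // mulr_gt0 // subr_gt0 //.
Qed.

Lemma flat_scale_le b b' n j (e : R) : (0 < n)%N -> (forall i, 0 < b i) -> (forall i, 0 < b' i) -> 0 < e < 1 ->
  (forall l, (l < n)%N -> (1 - e) * b (j - l%:Z) <= b' (j - l%:Z)) ->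
  flat_scale b' n j <= flat_scale b n j / (1 - e).
Proof.
move=> n0 b0 b'0 /andP[e0 e1] bb; have e1' : 0 < 1 - e by rewrite subr_gt0.
have [q0 q3] := flat_scale_cube j b0 n0; have [q0' q3'] := flat_scale_cube j b'0 n0.
rewrite -(ler_pXn2r (n := 3)) ?nnegrE ?(ltW q0') ?divr_ge0 ?(ltW q0) ?(ltW e1') //.
rewrite expr_div_n q3 q3' -mulrA ler_wpM2l // mulr_suml; apply: ler_sum => l _.
rewrite -invfM lef_pV2 ?posrE ?exprn_gt0 // ?mulr_gt0 ?exprn_gt0 //.
rewrite mulrC -exprMn ler_pXn2r ?nnegrE ?bb // ?mulr_ge0 ?(ltW e1') // ltW //.
Qed.

(** A relative change [e] of mean and scale moves the rescaled coordinate by [e] times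
    [|eta| + 2 m / q]. Since [m / q] is large, perturbations have to be small against its
    inverse. *)
Lemma flat_coord_near (m m' q q' eta e : R) : 0 < q -> 0 < q' -> 0 <= m -> 0 < e <= 2^-1 ->
  m' <= m / (1 - e) -> m <= m' / (1 - e) -> q' <= q / (1 - e) -> q <= q' / (1 - e) ->
  `|(2 * m + q * eta - 2 * m') / q' - eta| <= 4 * e * (`|eta| + 2 * m / q).
Proof.
move=> q0 q'0 m0 /andP[e0 e2] h1 h2 h3 h4.
have e1' : 0 < 1 - e by lra.
rewrite ler_pdivlMr // in h1; rewrite ler_pdivlMr // in h2.
rewrite ler_pdivlMr // in h3; rewrite ler_pdivlMr // in h4.
have -> : (2 * m + q * eta - 2 * m') / q' - eta = (2 * (m - m') + (q - q') * eta) / q'.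
  by field; rewrite gt_eqF.
rewrite normrM normfV (gtr0_norm q'0) ler_pdivrMr //.
have -> : 4 * e * (`|eta| + 2 * m / q) * q' = 4 * e * `|eta| * q' + 8 * e * m * (q' / q).
  by field; rewrite gt_eqF.
have qq : 2^-1 <= q' / q by rewrite ler_pdivlMr // ; nra.
apply: (le_trans (ler_normD _ _)); rewrite !normrM (ger0_norm (ler0n _ 2)) addrC; apply: lerD.
  have : `|q - q'| <= 2 * e * q' by rewrite ler_norml; apply/andP; split; nra.
  have h0 := normr_ge0 eta; move: (`|q - q'|) (`|eta|) h0 => x y y0 h.
  have := ler_wpM2r y0 h; have : 0 <= e * q' * y by rewrite !mulr_ge0 // ltW.
  lra.
have h : `|m - m'| <= 2 * e * m by rewrite ler_norml; apply/andP; split; nra.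
have em : 0 <= e * m by rewrite mulr_ge0 // ltW.
have := mulr_ge0 em (_ : 0 <= q' / q - 2^-1); rewrite subr_ge0 => /(_ qq).
move: h; move: (`|m - m'|) (q' / q) => x y; lra.
Qed.

Lemma flat_scale_ge b n j (B : R) : (0 < n)%N -> (forall i, 0 < b i <= B) ->
  2 * n%:R / B ^+ 3 <= flat_scale b n j ^+ 3.
Proof.
move=> n0 bB; have [_ ->] := @flat_scale_cube b n j (fun i => (andP (bB i)).1) n0.
rewrite -mulrA ler_wpM2l //; apply: sum_ord_ge => l; have /andP[b0 b1] := bB (j - l%:Z).
rewrite lef_pV2 ?posrE ?exprn_gt0 //; last exact: lt_le_trans b1.
by rewrite ler_pXn2r ?nnegrE // ltW // (lt_le_trans b0).
Qed.

End FlatModel.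

(** * Exact law and upper tail for general parameters *)

Section FlatLaw.
Context {d : measure_display} {T : measurableType d} {R : realType} (P : probability T R).
Variable E : nat * int -> T -> R.
Hypothesis fE : exp_field P E.
Local Notation e o := (fun c => E c o).

Lemma measurable_flat b n j u : (forall i, 0 < b i) ->
  measurable [set o | lpp (wmod b (e o)) n j <= u].
Proof.
move=> b0; have [mE _ _ _] := fE.
apply: (sgen_measurable mE (sgen_le (S := setT) _ _)).
by apply: smeas_lpp => m i _ _ _; apply: smeasZr; exact: smeas_coord.
Qed.

(** [exact_law] lists the parameters upwards from the lowest row in the cone of the end point, hence
    the reversed indices. *)
Lemma flat_exact b n j u : (forall i, 0 < b i) -> (0 < n)%N ->
  (forall l l', (l < n)%N -> (l' < n)%N -> b (j - l%:Z) = b (j - l'%:Z) -> l = l') -> 0 <= u ->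
  exists b' : 'I_n -> R, [/\ P [set o | lpp (wmod b (e o)) n j <= u] = (fred (fun x => ker b' (x + 2 * u)))%:E,
    injective b', (forall i, exists l : nat, b' i = b (j - l%:Z)),
    \sum_l (b' l)^-1 = flat_mean b n j & 2 * \sum_l (b' l ^+ 3)^-1 = flat_scale b n j ^+ 3].
Proof.
move=> b0; case: n => // N _ binj u0.
have [_ E0 _ _] := fE.
pose b1 (l : nat) := b (j - N%:Z + l%:Z).
have b1E l : (l <= N)%N -> b1 l = b (j - (N - l)%N%:Z) by move=> lN; rewrite /b1; congr b; lia.
exists (fun l : 'I_N.+1 => b1 l); split.
- rewrite -(@exact_law _ _ _ P E fE N b1 (j - N%:Z) (fun o => wmod b (e o))) //.
  + by have -> : j - N%:Z + N%:Z = j by lia.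
  + by move=> l _; exact: b0.
  + move=> i k iN kN; rewrite !b1E // => /binj h.
    have : (N - i = N - k)%N by apply: h; lia.
    lia.
  + by move=> o m i; exact: wmod_ge0.
  + move=> o r m /andP[mr rN]; rewrite /wmod /b1; congr (_ / (_ + b _)); lia.
- move=> i k; rewrite (b1E i (ltn_ord i)) (b1E k (ltn_ord k)) => /binj h; apply/val_inj => /=.
  have : (N - i = N - k)%N by apply: h; lia.
  have := ltn_ord i; have := ltn_ord k; lia.
- move=> i; exists (N - i)%N; rewrite b1E // -ltnS //.
- rewrite /flat_mean [RHS](reindex_inj rev_ord_inj) /=; apply: eq_bigr => l _.
  by rewrite b1E ?subSS // -ltnS.
- have [_ ->] := @flat_scale_cube _ b N.+1 j b0 isT; congr (_ * _).
  rewrite [RHS](reindex_inj rev_ord_inj) /=; apply: eq_bigr => l _.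
  by rewrite b1E ?subSS // -ltnS.
Qed.

(* The exact law requires pairwise distinct parameters. *)
Lemma distinct_params (b : int -> R) n j (eps : R) (s : bool) : (forall i, 0 < b i) -> 0 < eps < 1 ->
  exists b' : int -> R, [/\ forall i, 0 < b' i,
    forall l l', (l < n)%N -> (l' < n)%N -> b' (j - l%:Z) = b' (j - l'%:Z) -> l = l',
    forall i, (1 - eps) * b i <= b' i, forall i, (1 - eps) * b' i <= b i &
    forall i, if s then b i <= b' i else b' i <= b i].
Proof.
move=> b0 /andP[e0 e1].
have [dl [dl0 dlb]] : exists dl : R, 0 < dl /\ forall l, (l < n)%N -> dl <= eps * b (j - l%:Z).
  elim: n => [|n [dl [dl0 dlb]]]; first by exists 1.
  exists (Num.min dl (eps * b (j - n%:Z))); split; first by rewrite lt_min dl0 mulr_gt0.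
  by move=> l; rewrite ltnS leq_eqVlt => /predU1P[->|ln]; rewrite ge_min ?lexx ?orbT // dlb.
(* Lowering parameters amounts to raising their opposites, hence the sign. *)
have [t [te tinj]] := distinct_shift (fun l => (-1) ^+ (~~ s) * b (j - l%:Z)) n dl0.
pose ix i := `|j - i|%N.
pose inw i := (i <= j) && (j - n%:Z < i).
pose b' i := if inw i then b i + (-1) ^+ (~~ s) * t (ix i) else b i.
have tb i : inw i -> 0 <= t (ix i) <= eps * b i.
  move=> iw; have /andP[h1 h2] := te (ix i); rewrite h1 (le_trans h2) //.
  have ij : i = j - (ix i)%:Z by move: iw; rewrite /inw /ix; lia.
  have : (ix i < n)%N by move: iw; rewrite /inw /ix; lia.
  by move=> /dlb; rewrite -ij.
have inwl l : (l < n)%N -> inw (j - l%:Z) by rewrite /inw; lia.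
have ixl l : ix (j - l%:Z) = l by rewrite /ix; lia.
have bnd i : (1 - eps) * b i <= b' i <= (1 + eps) * b i.
  rewrite /b'; case: ifP => iw; have bi := b0 i; last by nra.
  have /andP[h1 h2] := tb i iw; case: s {tinj b'} => /=; rewrite ?expr0 ?expr1; apply/andP; split; nra.
exists b'; split.
- move=> i; have /andP[h _] := bnd i; apply: lt_le_trans h; rewrite mulr_gt0 // subr_gt0 //.
- move=> l l' ln l'n; rewrite /b' !inwl // !ixl => h; apply: tinj => //.
  move: h; case: s {b' bnd}; rewrite /= ?expr0 ?expr1 ?mul1r //; lra.
- by move=> i; have /andP[] := bnd i.
- by move=> i; have /andP[_ h] := bnd i; have := b0 i; nra.
- move=> i; rewrite /b'; have [iw|iw] := boolP (inw i); last by rewrite lexx if_same.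
  have /andP[h1 h2] := tb i iw; case: s {tinj b' bnd} => /=; rewrite ?expr0 ?expr1; lra.
Qed.

Definition prob (A : set T) : R := fine (P A).

Lemma prob_le A B : measurable A -> measurable B -> A `<=` B -> prob A <= prob B.
Proof.
move=> mA mB AB; rewrite /prob fine_le ?fin_num_measure //.
by apply: le_measure => //; exact: mem_set.
Qed.

Lemma flat_mono (b b' : int -> R) n j o : (forall i, 0 < b i) -> (forall i, b i <= b' i) ->
  lpp (wmod b' (e o)) n j <= lpp (wmod b (e o)) n j.
Proof.
move=> b0 bb; have [_ E0 _ _] := fE; apply: lpp_le => m i _ _ _; apply: wmod_anti => //.
  exact: addr_gt0.
exact: lerD.
Qed.

Lemma prob_ge0 A : 0 <= prob A. Proof. exact: fine_ge0. Qed.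
Lemma prob_le1 A : measurable A -> prob A <= 1.
Proof. by move=> mA; rewrite -lee_fin fineK ?fin_num_measure // probability_le1. Qed.
Lemma probE A : measurable A -> P A = (prob A)%:E.
Proof. by move=> mA; rewrite fineK // fin_num_measure. Qed.
Lemma probC A : measurable A -> prob (~` A) = 1 - prob A.
Proof.
move=> mA; rewrite /prob probability_setC // probE //.
Qed.

(** The last two summands make the bound trivial when [eta <= 1] or when the kernel bound is not
    below [1]. The [4] and the [expR 1] pay for perturbed parameters, whose ratio may grow fourfold
    and whose coordinate may drop by [1]. *)
Definition tail_cst (beta B : R) : R := fred_cst 1 * (ker_cst (4 * (B / beta)) * expR 1) + ker_cst (4 * (B / beta)) * expR 1 + expR 1.

Lemma flat_tail (beta B : R) (b : int -> R) n j eta : 0 < beta -> (forall i, beta <= b i <= B) ->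
  (8 / beta) ^+ 3 <= 2 * n%:R / B ^+ 3 -> (0 < n)%N -> 0 <= eta ->
  prob [set o | flat_mean b n j + flat_scale b n j / 2 * eta < lpp (wmod b (e o)) n j] <=
  tail_cst beta B * expR (- eta).
Proof.
move=> beta0 bB nB n0 eta0.
have b0 i : 0 < b i by have /andP[h _] := bB i; exact: lt_le_trans h.
have B0 : 0 < B by have /andP[_] := bB 0; exact: lt_le_trans.
have betaB : beta <= B by have /andP[h1 h2] := bB 0; exact: le_trans h2.
have [q0 q3] := flat_scale_cube j b0 n0.
set q := flat_scale b n j in q0 q3 *; set m := flat_mean b n j.
have m0 : 0 <= m by apply: sumr_ge0 => l _; rewrite invr_ge0 ltW.
set u := m + q / 2 * eta.
have u0 : 0 <= u by rewrite addr_ge0 // !mulr_ge0 // ltW.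
pose D := `|eta| + 2 * m / q.
have D0 : 0 <= D by rewrite addr_ge0 // divr_ge0 ?mulr_ge0 // ltW.
pose eps := (4 * (1 + D))^-1.
have eps0 : 0 < eps by rewrite invr_gt0 mulr_gt0 // ltr_wpDr.
have epsD : 4 * eps * D <= 1.
  have -> : 4 * eps * D = D / (1 + D) by rewrite /eps; field; rewrite gt_eqF // ltr_wpDr.
  by rewrite ler_pdivrMr ?ltr_wpDr //; lra.
have eps2 : eps <= 2^-1 by rewrite /eps lef_pV2 ?posrE ?mulr_gt0 ?ltr_wpDr //; lra.
have eps1 : 0 < eps < 1 by rewrite eps0 /=; lra.
have [b' [b'0 b'inj b'1 b'2 b'b]] := distinct_params n j false b0 eps1.
have mE v : measurable [set o | lpp (wmod b (e o)) n j <= v] by exact: measurable_flat.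
have mE' v : measurable [set o | lpp (wmod b' (e o)) n j <= v] by exact: measurable_flat.
have -> : [set o | u < lpp (wmod b (e o)) n j] = ~` [set o | lpp (wmod b (e o)) n j <= u].
  by apply/seteqP; split => o /=; rewrite ltNge => /negP.
rewrite probC //.
have le1 : prob [set o | lpp (wmod b' (e o)) n j <= u] <= prob [set o | lpp (wmod b (e o)) n j <= u].
  apply: prob_le => // o /=; apply: le_trans; exact: flat_mono.
have [b1 [b1E b1inj b1b b1m b1q]] := flat_exact b'0 n0 b'inj u0.
have [q'0 q'3] := flat_scale_cube j b'0 n0.
set q' := flat_scale b' n j in q'0 q'3 b1q; set m' := flat_mean b' n j in b1m.
pose eta' := (2 * m + q * eta - 2 * m') / q'.
have uE : 2 * u = 2 * m' + q' * eta' by rewrite /u /eta'; field; rewrite gt_eqF.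
have near : `|eta' - eta| <= 1.
  apply: le_trans epsD; apply: flat_coord_near => //; first by rewrite eps0.
  - by apply: flat_mean_le => // l _; exact: b'1.
  - by apply: flat_mean_le => // l _; exact: b'2.
  - by apply: flat_scale_le => // l _; exact: b'1.
  - by apply: flat_scale_le => // l _; exact: b'2.
have b1B l : beta / 2 <= b1 l <= 2 * B.
  have [k ->] := b1b l; have /andP[h1 h2] := bB (j - k%:Z); apply/andP; split.
    apply: le_trans (b'1 _); have := b0 (j - k%:Z); nra.
  by apply: (le_trans (b'b _)); lra.
have eta1' : eta - 1 <= eta' by move: near; rewrite ler_norml; lra.
have C0 := @ker_cst_ge0 R (4 * (B / beta)).
have ex : expR (- (eta - 1)) = expR 1 * expR (- eta) by rewrite -expRD; congr expR; ring.
have f0 : 0 <= fred_cst 1 :> R by exact: sqrtr_ge0.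
have p1 := prob_le1 (mE u); have p0 := prob_ge0 [set o | lpp (wmod b (e o)) n j <= u].
set K := ker_cst (4 * (B / beta)) in C0.
have tE : tail_cst beta B * expR (- eta) = fred_cst 1 * (K * expR (- (eta - 1))) + K * expR (- (eta - 1)) + expR (- (eta - 1)).
  rewrite ex /tail_cst -/K; ring.
have K0 : 0 <= K * expR (- (eta - 1)) by rewrite mulr_ge0 ?expR_ge0.
rewrite tE; have [eta_le|eta_gt] := leP eta 1.
  have : 1 <= expR (- (eta - 1)) by apply: (le_trans _ (expR_ge1Dx _)); lra.
  have := mulr_ge0 f0 K0; lra.
have e0 := expR_gt0 (- (eta - 1)).
have [big|small] := leP 1 (K * expR (- (eta - 1))).
  by have := mulr_ge0 f0 K0; lra.
have KK : K * expR (- eta') <= K * expR (- (eta - 1)) by rewrite ler_wpM2l // ler_expR lerN2.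
have rat : 2 * B / (beta / 2) = 4 * (B / beta) by field; rewrite gt_eqF.
have q4 : 4 <= q' * (beta / 2).
  have h1 : 2 * n%:R / B ^+ 3 <= q' ^+ 3.
    apply: flat_scale_ge => // i; rewrite b'0 /= (le_trans (b'b i)) //.
    by have /andP[_] := bB i.
  have h2 : 8 / beta <= q'.
    rewrite -(ler_pXn2r (n := 3)) ?nnegrE ?(ltW q'0) ?divr_ge0 ?(ltW beta0) //.
    exact: le_trans h1.
  by move: h2; rewrite ler_pdivrMr //; lra.
have := @fred_ker_sub1 R n b1 (beta / 2) (2 * B) q' b1inj (divr_gt0 beta0 (ltr0n R 2)) _ b1B q'0 (esym b1q) q4 eta'.
rewrite rat -/K b1m -uE => H.
have {}H : `|fred (fun x : R => ker b1 (x + 2 * u)) - 1| <= fred_cst 1 * (K * expR (- eta')).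
  apply: H; [lra|lra|exact: le_trans KK (ltW small)].
have pE : prob [set o | lpp (wmod b' (e o)) n j <= u] = fred (fun x : R => ker b1 (x + 2 * u)).
  by rewrite /prob b1E.
move: H; rewrite -pE ler_norml => /andP[H _].
have := ler_wpM2l f0 KK; lra.
Qed.

End FlatLaw.

(** * The limit law [F_GOE] for general parameters *)

Section FlatLimit.
Context {d : measure_display} {T : measurableType d} {R : realType} (P : probability T R).

(** One side of a squeeze: raising the parameters ([s] true) lowers the passage time and bounds the
    probability from above, lowering them bounds it from below. The field may vary with [k], as it
    does after a change of origin. *)
Lemma flat_cvg_side (EE : nat -> nat * int -> T -> R) (fEE : forall k, exp_field P (EE k)) (s : bool) (beta B : R) (b : nat -> int -> R) (n : nat -> nat) (j : nat -> int) (eta : nat -> R) (eta0 : R) :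
  0 < beta -> (forall k i, beta <= b k i <= B) ->
  (forall k, (16 / beta) ^+ 3 <= 2 * (n k)%:R / B ^+ 3) -> (forall k, (0 < n k)%N) ->
  ((n k)%:R : R) @[k --> \oo] --> +oo -> eta k @[k --> \oo] --> eta0 ->
  (forall k, 0 <= flat_mean (b k) (n k) (j k) + flat_scale (b k) (n k) (j k) / 2 * eta k) ->
  exists p : nat -> R, p k @[k --> \oo] --> F_GOE eta0 /\
    forall k, let q := prob P [set o | lpp (wmod (b k) (fun c => EE k c o)) (n k) (j k) <=
       flat_mean (b k) (n k) (j k) + flat_scale (b k) (n k) (j k) / 2 * eta k] in
     if s then q <= p k else p k <= q.
Proof.
move=> beta0 bB nB n0 noo ee u0.
have b0 k i : 0 < b k i by have /andP[h _] := bB k i; exact: lt_le_trans h.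
have B0 : 0 < B by have /andP[_] := bB 0%N 0; exact: lt_le_trans.
have betaB : beta <= B by have /andP[h1 h2] := bB 0%N 0; exact: le_trans h2.
pose q k := flat_scale (b k) (n k) (j k); pose m k := flat_mean (b k) (n k) (j k).
pose u k := m k + q k / 2 * eta k.
have q0 k : 0 < q k by have [] := flat_scale_cube (j k) (b0 k) (n0 k).
have m0 k : 0 <= m k by apply: sumr_ge0 => l _; rewrite invr_ge0 ltW.
pose D k := `|eta k| + 2 * m k / q k.
have D0 k : 0 <= D k by rewrite addr_ge0 // divr_ge0 ?mulr_ge0 // ltW.
(* With this choice the perturbed coordinate is within [1 / (k + 1)] of [eta k]. *)
pose eps k := (4 * ((k.+1)%:R * (1 + D k)))^-1.
have c0 k : 0 < (k.+1)%:R * (1 + D k) by rewrite mulr_gt0 // ltr_wpDr.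
have eps0 k : 0 < eps k by rewrite invr_gt0 mulr_gt0.
have epsD k : 4 * eps k * D k <= (k.+1)%:R^-1.
  have -> : 4 * eps k * D k = (D k / (1 + D k)) / (k.+1)%:R.
    have kk : (k.+1)%:R != 0 :> R by rewrite pnatr_eq0.
    have dd : 1 + D k != 0 by rewrite gt_eqF // ltr_wpDr.
    by rewrite /eps; move: ((k.+1)%:R : R) kk => y y0; field; rewrite y0 dd.
  by rewrite ler_piMl ?invr_ge0 // ler_pdivrMr ?ltr_wpDr //; lra.
have eps2 k : eps k <= 2^-1.
  have : 1 <= (k.+1)%:R * (1 + D k) by rewrite mulr_ege1 ?ler1n // lerDl.
  by rewrite /eps lef_pV2 ?posrE ?(mulr_gt0 _ (c0 k)) // => h; lra.
have eps1 k : 0 < eps k < 1 by rewrite eps0 /=; have := eps2 k; lra.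
have H1 k := cid (distinct_params (n k) (j k) s (b0 k) (eps1 k)).
pose b' k := projT1 (H1 k).
have b'P k : [/\ forall i, 0 < b' k i,
    forall l l', (l < n k)%N -> (l' < n k)%N -> b' k (j k - l%:Z) = b' k (j k - l'%:Z) -> l = l',
    forall i, (1 - eps k) * b k i <= b' k i, forall i, (1 - eps k) * b' k i <= b k i &
    forall i, if s then b k i <= b' k i else b' k i <= b k i] by exact: (projT2 (H1 k)).
have b'0 k : forall i, 0 < b' k i by case: (b'P k).
have b'inj k := let: And5 _ h _ _ _ := b'P k in h.
have H2 k := cid (flat_exact (fEE k) (b'0 k) (n0 k) (b'inj k) (u0 k)).
pose b1 k := projT1 (H2 k).
have b1P k := projT2 (H2 k).
pose q' k := flat_scale (b' k) (n k) (j k); pose m' k := flat_mean (b' k) (n k) (j k).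
have q'0 k : 0 < q' k by have [] := flat_scale_cube (j k) (b'0 k) (n0 k).
pose eta' k := (2 * m k + q k * eta k - 2 * m' k) / q' k.
have uE k : 2 * u k = 2 * m' k + q' k * eta' k by rewrite /u /eta'; field; rewrite gt_eqF.
have near k : `|eta' k - eta k| <= (k.+1)%:R^-1.
  have [_ _ b'1 b'2 _] := b'P k.
  apply: le_trans (epsD k); apply: flat_coord_near => //; first by rewrite eps0 eps2.
  - by apply: flat_mean_le => // l _; exact: b'1.
  - by apply: flat_mean_le => // l _; exact: b'2.
  - by apply: flat_scale_le => // l _; exact: b'1.
  - by apply: flat_scale_le => // l _; exact: b'2.
have ee' : eta' k @[k --> \oo] --> eta0.
  have h : eta' k - eta k @[k --> \oo] --> (0 : R).
    apply: (@cvg_dist_le _ _ (fun k => (k.+1)%:R^-1)).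
      by near=> k; rewrite subr0.
    exact: cvg_harmonic.
  have -> : eta' = (fun k => eta' k - eta k) \+ eta by apply/funext => k /=; rewrite subrK.
  by rewrite -[eta0]add0r; exact: cvgD.
have b'B k i : beta / 2 <= b' k i <= 2 * B.
  have [_ _ b'1 b'2 _] := b'P k; have /andP[h1 h2] := bB k i; have := b'1 i; have := b'2 i; have := eps2 k; have := eps0 k.
  by have := b'0 k i; have := b0 k i => *; apply/andP; split; nra.
have b1B k l : beta / 2 <= b1 k l <= 2 * B by have [_ _ /(_ l)[i h] _ _] := b1P k; rewrite /b1 h.
have q'B k : (n k)%:R / (4 * B ^+ 3) <= q' k ^+ 3.
  have := @flat_scale_ge _ (b' k) (n k) (j k) (2 * B) (n0 k) _; rewrite exprMn => H.
  have -> : (n k)%:R / (4 * B ^+ 3) = 2 * (n k)%:R / (2 ^+ 3 * B ^+ 3) by field; rewrite gt_eqF.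
  by apply: H => i; rewrite b'0 /=; have /andP[] := b'B k i.
have q4 k : 4 <= q' k * (beta / 2).
  have h2 : 8 / beta <= q' k.
    rewrite -(ler_pXn2r (n := 3)) ?nnegrE ?(ltW (q'0 k)) ?divr_ge0 ?(ltW beta0) //.
    apply: le_trans (q'B k); have := nB k.
    have -> : (16 / beta) ^+ 3 = 8 * (8 / beta) ^+ 3 by field; rewrite gt_eqF.
    have -> : (n k)%:R / (4 * B ^+ 3) = (2 * (n k)%:R / B ^+ 3) / 8 by field; rewrite gt_eqF.
    by lra.
  by move: h2; rewrite ler_pdivrMr //; lra.
have q'oo : q' k @[k --> \oo] --> +oo.
  apply/cvgryPge => A; pose A' := Num.max A 1.
  have : \forall k \near \oo, A' ^+ 3 * (4 * B ^+ 3) <= (n k)%:R by move/cvgryPge : noo; apply.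
  apply: filterS => k; rewrite -ler_pdivlMr ?mulr_gt0 ?exprn_gt0 // => h.
  have : A' ^+ 3 <= q' k ^+ 3 by exact: le_trans (q'B k).
  rewrite ler_pXn2r ?nnegrE ?(ltW (q'0 k)) //; last by rewrite le_max ler01 orbT.
  by apply: le_trans; rewrite le_max lexx.
exists (fun k => prob P [set o | lpp (wmod (b' k) (fun c => EE k c o)) (n k) (j k) <= u k]); split.
  have := @fred_ker_cvg R n b1 (beta / 2) (2 * B) q' eta' eta0 _ _ _ b1B q'0 _ q4 q'oo ee'.
  move=> H; have {}H := H (fun k => let: And5 _ h _ _ _ := b1P k in h) (divr_gt0 beta0 (ltr0n R 2)).
  have h2 : beta / 2 <= 2 * B by lra.
  have {}H := H h2 (fun k => esym (let: And5 _ _ _ _ h := b1P k in h)).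
  move: H; apply: cvg_trans; apply: near_eq_cvg; near=> k.
  have [h _ _ hm _] := b1P k; rewrite /prob h /= hm; congr fred; apply/funext => x.
  by congr (ker _ (x + _)); exact: esym (uE k).
move=> k /=; have [_ _ _ _ sb] := b'P k.
have M1 := @measurable_flat _ _ _ P (EE k) (fEE k) (b k) (n k) (j k) (u k) (b0 k).
have M2 := @measurable_flat _ _ _ P (EE k) (fEE k) (b' k) (n k) (j k) (u k) (b'0 k).
case: ifP sb => _ sb; apply: prob_le => // o /=; apply: le_trans; exact: (flat_mono (fEE k)).
Unshelve. all: by end_near. Qed.

Lemma flat_cvg (EE : nat -> nat * int -> T -> R) (fEE : forall k, exp_field P (EE k)) (beta B : R) (b : nat -> int -> R) (n : nat -> nat) (j : nat -> int) (eta : nat -> R) (eta0 : R) :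
  0 < beta -> (forall k i, beta <= b k i <= B) ->
  ((n k)%:R : R) @[k --> \oo] --> +oo -> eta k @[k --> \oo] --> eta0 ->
  prob P [set o | lpp (wmod (b k) (fun c => EE k c o)) (n k) (j k) <=
       flat_mean (b k) (n k) (j k) + flat_scale (b k) (n k) (j k) / 2 * eta k] @[k --> \oo] --> F_GOE eta0.
Proof.
move=> beta0 bB noo ee.
have b0 k i : 0 < b k i by have /andP[h _] := bB k i; exact: lt_le_trans h.
have B0 : 0 < B by have /andP[_] := bB 0%N 0; exact: lt_le_trans.
(* A nonnegative level and a large scale are available from some index on, because the mean is of
   order [n] and the scale of order [n^(1/3)]; all sequences are shifted by [k0]. *)
have [k0 _ H] : \forall k \near \oo, [/\ (16 / beta) ^+ 3 <= 2 * (n k)%:R / B ^+ 3, (0 < n k)%N &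
    0 <= flat_mean (b k) (n k) (j k) + flat_scale (b k) (n k) (j k) / 2 * eta k].
  near=> k.
  have nk1 : 1 <= ((n k)%:R : R) by near: k; move/cvgryPge : noo; apply.
  have n0 : (0 < n k)%N by move: nk1; rewrite ler1n.
  have nkB : (16 / beta) ^+ 3 * B ^+ 3 / 2 <= (n k)%:R by near: k; move/cvgryPge : noo; apply.
  pose A := 1 + B * (`|eta0| + 1) / beta ^+ 3.
  have A1 : 1 <= A by rewrite lerDl divr_ge0 ?mulr_ge0 ?exprn_ge0 // ?addr_ge0 // ltW.
  have nkA : A ^+ 3 * B ^+ 3 / 2 <= (n k)%:R by near: k; move/cvgryPge : noo; apply.
  have ek : `|eta k| <= `|eta0| + 1.
    have : `|eta0 - eta k| <= 1 by near: k; exact: (@cvgr_dist_le _ _ _ _ _ _ _ ee 1 ltr01).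
    move=> h; rewrite (_ : eta k = eta0 - (eta0 - eta k)); last by ring.
    by rewrite (le_trans (ler_normB _ _)) // lerD2l.
  split => //.
    by rewrite ler_pdivlMr ?exprn_gt0 //; lra.
  have [q0 q3] := flat_scale_cube (j k) (b0 k) n0.
  have qlo := @flat_scale_ge _ (b k) (n k) (j k) B n0 (fun i => introT andP (conj (b0 k i) (andP (bB k i)).2)).
  set q := flat_scale _ _ _ in q0 q3 qlo *.
  have qA : A <= q.
    rewrite -(ler_pXn2r (n := 3)) ?nnegrE ?(ltW q0) ?(le_trans ler01 A1) // (le_trans _ qlo) //.
    by rewrite ler_pdivlMr ?exprn_gt0 //; lra.
  have qhi : q ^+ 3 <= 2 * ((n k)%:R / beta ^+ 3).
    rewrite q3 ler_wpM2l //; apply: sum_ord_le => l; have /andP[h _] := bB k (j k - l%:Z).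
    rewrite lef_pV2 ?posrE ?exprn_gt0 // ler_pXn2r ?nnegrE // ltW //.
  have mlo : (n k)%:R / B <= flat_mean (b k) (n k) (j k).
    apply: sum_ord_ge => l.
    by have /andP[_ h] := bB k (j k - l%:Z); rewrite lef_pV2 ?posrE.
  have q1 : 1 <= q by exact: le_trans qA.
  suff : q / 2 * (`|eta0| + 1) <= (n k)%:R / B.
    have : - (q / 2 * (`|eta0| + 1)) <= q / 2 * eta k.
      rewrite -mulrN ler_wpM2l ?divr_ge0 ?(ltW q0) //.
      by rewrite lerNl (le_trans _ ek) // -normrN ler_norm.
    by lra.
  have B3 : B * (`|eta0| + 1) <= (A - 1) * beta ^+ 3.
    rewrite /A addrAC subrr add0r divfK // expf_neq0 // gt_eqF //.
  rewrite ler_pdivlMr //.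
  have h1 : q * A <= q ^+ 3.
    have : A <= q ^+ 2 by rewrite (le_trans qA) // expr2 ler_peMl // ltW.
    by move=> h; have := ler_wpM2l (ltW q0) h; rewrite exprS.
  have h2 : q * (A - 1) * beta ^+ 3 <= 2 * (n k)%:R.
    have b3 : 0 < beta ^+ 3 by rewrite exprn_gt0.
    move: qhi; rewrite mulrA ler_pdivlMr // => h; apply: le_trans h.
    by rewrite ler_pM2r // (le_trans _ h1) // mulrBr lerBlDr lerDl mulr1 ltW.
  have := ler_wpM2l (ltW q0) B3; move: h2 => h2 h3; lra.
have H' k : [/\ (16 / beta) ^+ 3 <= 2 * (n (k + k0)%N)%:R / B ^+ 3, (0 < n (k + k0)%N)%N &
    0 <= flat_mean (b (k + k0)%N) (n (k + k0)%N) (j (k + k0)%N) + flat_scale (b (k + k0)%N) (n (k + k0)%N) (j (k + k0)%N) / 2 * eta (k + k0)%N].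
  by apply: H; exact: leq_addl.
rewrite -(@cvg_shiftn k0).
have noo' : ((n (k + k0)%N)%:R : R) @[k --> \oo] --> +oo.
  by rewrite (@cvg_shiftn k0 _ (fun k => (n k)%:R : R)).
have ee' : eta (k + k0)%N @[k --> \oo] --> eta0 by rewrite (@cvg_shiftn k0).
have side s := @flat_cvg_side (fun k => EE (k + k0)%N) (fun k => fEE (k + k0)%N) s beta B (fun k => b (k + k0)%N) (fun k => n (k + k0)%N) (fun k => j (k + k0)%N)
  (fun k => eta (k + k0)%N) eta0 beta0 (fun k => bB _) (fun k => let: And3 h _ _ := H' k in h)
  (fun k => let: And3 _ h _ := H' k in h) noo' ee' (fun k => let: And3 _ _ h := H' k in h).
have [p1 [l1 h1]] := side true; have [p2 [l2 h2]] := side false.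
apply: (@squeeze_cvgr _ _ _ _ p2 p1) => //.
by near=> k; apply/andP; split; [exact: h2|exact: h1].
Unshelve. all: by end_near. Qed.

End FlatLimit.

(** * The competition interface *)

Section LatticePaths.
Context {R : realType}.
Implicit Types (W : nat -> int -> R) (c : nat -> int).

Definition lattice c := forall m, c m.+1 = c m \/ c m.+1 = c m + 1.

Lemma lattice_le c m n : lattice c -> (m <= n)%N -> c m <= c n /\ c n - n%:Z <= c m - m%:Z.
Proof.
move=> lc /subnK <-; elim: (n - m)%N => [|k [h1 h2]]; first by rewrite add0n.
by rewrite addSn; case: (lc (k + m)%N) => ->; split; lia.
Qed.

Lemma lpp_lattice W c n : lattice c -> (0 < n)%N -> \sum_(0 <= m < n) W m (c m) <= lpp W n (c n.-1).
Proof.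
move=> lc; elim: n => [//|[|n] IH] _; rewrite big_nat_recr //=.
  by rewrite big_geq // add0r maxxx addr0.
rewrite addrC lerD2l (le_trans (IH isT)) //= le_max.
by case: (lc n) => ->; rewrite ?lexx // addrK lexx orbT.
Qed.

Lemma lpp_attained W n j : exists c, [/\ lattice c, c n.-1 = j & lpp W n j = \sum_(0 <= m < n) W m (c m)].
Proof.
elim: n j => [|n IH] j; first by exists (fun=> j); rewrite big_geq; split => // m; left.
have {IH} IH k : k = j \/ k = j - 1 -> exists c, [/\ lattice c, c n = j & lpp W n k = \sum_(0 <= m < n) W m (c m)].
  move=> kj; have [c [lc cn E]] := IH k.
  exists (fun m => if (m < n)%N then c m else j); split; last 1 first.
  - by rewrite E; apply: eq_big_nat => m /andP[_ ->].
  - move=> m; have [mn|mn] := ltnP m n; last by rewrite ltnNge ltnW //=; left.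
    have [mn'|mn'] := ltnP m.+1 n; first exact: lc.
    have -> : m = n.-1 by lia.
    by rewrite cn; lia.
  - by rewrite ltnn.
have [c [lc cn E]] : exists c, [/\ lattice c, c n = j & Num.max (lpp W n j) (lpp W n (j - 1)) = \sum_(0 <= m < n) W m (c m)].
  by case: leP => _; apply: IH; [right|left].
by exists c; split => //=; rewrite big_nat_recr //= E cn addrC.
Qed.

Lemma last_exit (Q : pred nat) n : (exists2 m, (m < n)%N & ~~ Q m) ->
  exists m, [/\ (m < n)%N, ~~ Q m & forall k, (m < k < n)%N -> Q k].
Proof.
elim: n => [[]//|n IH [m mn Qm]]; have [Qn|Qn] := boolP (Q n); last first.
  by exists n; split => // k; lia.
have [|k [kn Qk H]] := IH.
  exists m => //; move: mn; rewrite ltnS leq_eqVlt => /predU1P[mn|//].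
  by move: Qm; rewrite mn Qn.
exists k; split => //; first exact: leqW.
move=> l /andP[kl]; rewrite ltnS leq_eqVlt => /predU1P[->//|ln].
by apply: H; rewrite kl.
Qed.

Lemma lppS W n j : lpp W n.+1 j = W n j + Num.max (lpp W n j) (lpp W n (j - 1)).
Proof. by []. Qed.

Lemma lpp_eq0 W n j : (forall m i, (m < n)%N -> i <= j -> j - (n - m.+1)%N%:Z <= i -> W m i = 0) -> lpp W n j = 0.
Proof.
elim: n j => [//|n IH] j W0 /=; rewrite W0 ?subnn ?subr0 // !IH ?maxxx ?addr0 // => m i mn ij ji;
  by apply: W0; lia.
Qed.

(** Reflection of the points in the diagonal; it brings the passage time from [Lplus] into the form
    treated for [Lminus]. *)
Lemma lpp_transpose W n j : lpp (fun m i => W m (m.+1%:Z - i)) n (n%:Z - j) = lpp W n j.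
Proof.
elim: n j => [//|n IH] j /=.
have -> : n.+1%:Z - (n.+1%:Z - j) = j by ring.
have -> : n.+1%:Z - j = n%:Z - (j - 1) by lia.
have -> : n%:Z - (j - 1) - 1 = n%:Z - j by ring.
by rewrite !IH maxC.
Qed.

End LatticePaths.

(** * The interface as a comparison of two passage times *)

Section Interface.
Context {R : realType}.
Variables (Wp Wm : nat -> int -> R).
Hypothesis Wp0 : forall m j, 0 <= Wp m j.
Hypothesis Wm0 : forall m j, 0 <= Wm m j.
Hypothesis Wpm : forall m (j : int), 1 <= j <= m%:Z -> Wp m j = Wm m j.
Hypothesis Wpn : forall m (j : int), j <= 0 -> Wp m j = 0.
Hypothesis Wmn : forall m (j : int), m%:Z < j -> Wm m j = 0.

Lemma lpp_left n j : n%:Z <= j -> lpp Wm n j = 0.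
Proof. by move=> nj; apply: lpp_eq0 => m i mn ij ji; apply: Wmn; lia. Qed.

Lemma lpp_below n (j : int) : j <= 0 -> lpp Wp n j = 0.
Proof. by move=> j0; apply: lpp_eq0 => m i mn ij ji; apply: Wpn; lia. Qed.

Variable J : nat -> int.
Hypothesis J0 : J 0%N = 0.
Hypothesis JS : forall n, J n.+1 = if lpp Wm n.+2 (J n + 1) < lpp Wp n.+2 (J n + 1) then J n else J n + 1.

Lemma J_bnd n : 0 <= J n <= n%:Z.
Proof. by elim: n => [|n IH]; rewrite ?J0 // JS; case: ifP => _; lia. Qed.

(** In the common quadrant both passage times obey the same recursion, so a cell whose two
    predecessors are won by one side is won by that side. The only undecided cell is [J n + 1],
    which is the one tested by the interface. Next to the axes the vanishing of one passage time
    decides. *)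
Lemma interfaceE n (j : int) : 1 <= j <= n%:Z -> (lpp Wm n.+1 j < lpp Wp n.+1 j) = (J n < j).
Proof.
elim: n j => [|n IH] j jn; first by lia.
have Jn := J_bnd n; rewrite JS.
have pl k l : 0 <= lpp Wp k l by exact: lpp_ge0.
have ml k l : 0 <= lpp Wm k l by exact: lpp_ge0.
have [jJ|jJ|jJ] : [\/ j <= J n, j = J n + 1 | J n + 2 <= j].
  have [|] := leP j (J n); first by constructor 1.
  by have [->|] := eqVneq j (J n + 1); [constructor 2|constructor 3; lia].
- have -> : (if lpp Wm n.+2 (J n + 1) < lpp Wp n.+2 (J n + 1) then J n else J n + 1) < j = false.
    by case: ifP => _; lia.
  rewrite !(lppS _ n.+1) Wpm ?ltrD2l //; apply/negbTE; rewrite -leNgt ge_max !le_max; apply/andP; split.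
    by rewrite [X in X || _]leNgt IH -?leNgt ?jJ //; lia.
  have [j0|j0] := leP (j - 1) 0; first by rewrite (lpp_below _ j0) ml.
  rewrite [X in _ || X]leNgt IH -?leNgt; last lia.
  by apply/orP; right; lia.
- by rewrite -jJ; case: ifP => h; rewrite ?h jJ; lia.
- have -> : (if lpp Wm n.+2 (J n + 1) < lpp Wp n.+2 (J n + 1) then J n else J n + 1) < j.
    by case: ifP => _; lia.
  rewrite !(lppS _ n.+1) Wpm ?ltrD2l //.
  have h1 : lpp Wm n.+1 (j - 1) < lpp Wp n.+1 (j - 1) by rewrite IH; lia.
  rewrite gt_max !lt_max h1 orbT andbT.
  have [j0|j0] := leP n.+1%:Z j; last first.
    have j1 : 1 <= j <= n%:Z by clear -jJ Jn j0; lia.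
    by rewrite (IH j j1); have -> : J n < j by clear -jJ; lia.
  by rewrite (lpp_left j0) (le_lt_trans (ml n.+1 (j - 1)) h1) orbT.
Qed.

End Interface.

(** * The passage times from the two half-lines as recursions *)

Section DefsLPP.
Context {R : realType} (w : pt -> R).
Hypothesis w0 : forall p, ~~ Lplus p -> ~~ Lminus p -> 0 <= w p.

Definition Lplus_weight (m : nat) (j : int) : R := if 1 <= j then w (m.+1%:Z - j, j) else 0.
(** The cell [(m, j)] is the point [(m + 1 - j, j)]. The cell [(0, 0)] is excluded, being the point
    [(1, 0)] of [Lminus]. *)
Definition Lminus_weight (m : nat) (j : int) : R :=
  if (j <= m%:Z) && ((m, j) != (0%N, 0)) then w (m.+1%:Z - j, j) else 0.

Lemma LplusE (p : pt) : Lplus p = (0 < p.2) && (p.1 + p.2 == 0).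
Proof.
rewrite /Lplus /x0; case: p => i j /=; have [h|//] := ltP 0 j.
by rewrite /= ifF; [apply/eqP/eqP; lia|lia].
Qed.

Lemma LminusE (p : pt) : Lminus p = if p.2 == 0 then p.1 == 1 else (p.2 < 0) && (p.1 + p.2 == 0).
Proof.
rewrite /Lminus /x0; case: p => i j /=; have [/eqP ->|j0] := boolP (j == 0) => //.
by rewrite lt_neqAle j0 /=; have [h|//] := leP j 0; rewrite /=; apply/eqP/eqP; lia.
Qed.

Lemma weight_ge0 m (j : int) : (m, j) != (0%N, 0) -> 0 <= w (m.+1%:Z - j, j).
Proof.
move=> mj; apply: w0; rewrite ?LplusE ?LminusE /=.
  by rewrite negb_and; apply/orP; right; lia.
case: eqVneq => [j0|j0]; last by rewrite negb_and; apply/orP; right; lia.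
by move: mj; rewrite j0 xpair_eqE eqxx andbT subr0; lia.
Qed.

Lemma Lplus_weight_ge0 m j : 0 <= Lplus_weight m j.
Proof. by rewrite /Lplus_weight; case: ifP => // j1; apply: weight_ge0; apply/eqP => -[_ j0]; rewrite j0 in j1. Qed.

Lemma Lminus_weight_ge0 m j : 0 <= Lminus_weight m j.
Proof. by rewrite /Lminus_weight; case: ifP => // /andP[_]; exact: weight_ge0. Qed.

Let pathsum (SA : pred pt) (x : pt) (s : seq pt) : R := \sum_(q <- x :: s | ~~ SA q) w q.

Let pathsum_rcons SA x s p : pathsum SA x (rcons s p) = pathsum SA x s + (if SA p then 0 else w p).
Proof.
rewrite /pathsum -rcons_cons -cats1 big_cat /= [X in _ + X]big_mkcond big_seq1.
by case: (SA p).
Qed.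

(** [dom] contains the points reachable from [SA]. Outside it the recursion takes the value [0],
    which is harmless in a maximum of nonnegative values as long as one predecessor lies in
    [dom]. *)
Lemma LPP_eq (SA : pred pt) (W : nat -> int -> R) (dom : pt -> bool) :
  (forall m j, 0 <= W m j) ->
  (forall x, SA x -> dom x /\ 0 <= x.1 + x.2) ->
  (forall p q, dom p -> ur_step p q -> dom q) ->
  (forall m (j : int), dom (m.+1%:Z - j, j) -> W m j = if SA (m.+1%:Z - j, j) then 0 else w (m.+1%:Z - j, j)) ->
  (forall m (j : int), ~~ dom (m.+1%:Z - j, j) -> W m j = 0) ->
  (forall j : int, dom (- j, j) -> SA (- j, j)) ->
  (forall m (j : int), dom (m.+1%:Z - j, j) -> dom (m%:Z - j, j) || dom (m%:Z - (j - 1), j - 1)) ->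
  forall n (j : int), dom (n%:Z - j, j) -> LPP w SA (pred1 (n%:Z - j, j)) = (lpp W n j)%:E.
Proof.
move=> W0 SAdom domS WE Wdom SA0 dpred n j dj; apply/eqP; rewrite eq_le; apply/andP; split.
  apply: ub_ereal_sup => _ [x [s [SAx /eqP slast spath ->]]]; rewrite lee_fin -/(pathsum SA x s).
  suff [] : dom (last x s) /\ forall n (j : int), last x s = (n%:Z - j, j) -> pathsum SA x s <= lpp W n j.
    by move=> _; apply.
  elim/last_ind: s spath {slast} => [_|s p IH]; rewrite ?rcons_path ?last_rcons.
    have [dx _] := SAdom _ SAx; split => // k i _.
    by rewrite /pathsum big_cons big_nil SAx /= lpp_ge0.
  move=> /andP[sp st]; have {IH} [ds IH] := IH sp; split; first exact: domS st.
  move=> [|k] i pE.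
    have ll : 0 <= (last x s).1 + (last x s).2.
      elim/last_ind: s sp {ds IH st} => [_|s' q IHs]; first by have [] := SAdom _ SAx.
      rewrite rcons_path last_rcons => /andP[/IHs h] /orP[] /eqP -> /=; lia.
    by move: st; rewrite pE /ur_step => /orP[] /eqP [? ?]; exfalso; lia.
  have dp : dom (k.+1%:Z - i, i) by rewrite -pE; exact: domS st.
  rewrite pathsum_rcons pE lppS addrC (WE _ _ dp) lerD2l le_max.
  move: st; rewrite pE => /orP[] /eqP [e1 e2].
    by rewrite (IH k i) //; case: (last x s) e1 e2 => /= ? ? ? ?; congr pair; lia.
  by apply/orP; right; apply: IH; case: (last x s) e1 e2 => /= ? ? ? ?; congr pair; lia.
suff [x [s [SAx sl sp le]]] : exists x s, [/\ SA x, last x s = (n%:Z - j, j), path ur_step x s &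
    lpp W n j <= pathsum SA x s].
  apply: (@le_trans _ _ (pathsum SA x s)%:E); first by rewrite lee_fin.
  by apply: ereal_sup_ubound; exists x, s; split => //; apply/eqP.
elim: n j dj => [|n IH] j dj.
  have SAj : SA (0%:Z - j, j) by move: dj; rewrite sub0r; exact: SA0.
  by exists (0%:Z - j, j), [::]; split => //; rewrite /pathsum big_cons big_nil SAj.
have out (i : int) : ~~ dom (n%:Z - i, i) -> lpp W n i = 0.
  move=> di; apply: lpp_eq0 => m k mn ki ik; apply: Wdom; apply: contra di => dk.
  have mono (l1 l2 : nat) p : dom p -> dom (p.1 + l1%:Z, p.2 + l2%:Z).
    move=> dp; elim: l1 => [|l1 IH1].
      rewrite addr0; elim: l2 => [|l2 IH2]; first by rewrite addr0; case: p dp.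
      by apply: (domS _ _ IH2); rewrite /ur_step /= [X in _ || X](_ : _ = true) ?orbT //; apply/eqP; congr pair; lia.
    by apply: (domS _ _ IH1); rewrite /ur_step /= [X in X || _](_ : _ = true) //; apply/eqP; congr pair; lia.
  have := mono `|(n%:Z - i - (m.+1%:Z - k))%R|%N `|(i - k)%R|%N _ dk => /=.
  by congr dom; congr pair; lia.
have [i [di ij im]] : exists i : int, [/\ dom (n%:Z - i, i), i = j \/ i = j - 1 & Num.max (lpp W n j) (lpp W n (j - 1)) <= lpp W n i].
  have l0 k l : 0 <= lpp W k l by exact: lpp_ge0.
  have [d1|d1] := boolP (dom (n%:Z - j, j)); have [d2|d2] := boolP (dom (n%:Z - (j - 1), j - 1)).
  - by case: leP => _; [exists (j - 1)|exists j]; split => //; [right|left].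
  - by exists j; split; [|left|rewrite (out _ d2) ge_max lexx l0].
  - by exists (j - 1); split; [|right|rewrite (out _ d1) ge_max lexx l0].
  - by have := dpred _ _ dj; rewrite (negbTE d1) (negbTE d2).
have [x [s [SAx sl sp le]]] := IH i di.
exists x, (rcons s (n.+1%:Z - j, j)); split => //; first by rewrite last_rcons.
  rewrite rcons_path sp sl /= /ur_step /=; case: ij => ->.
    by apply/orP; left; apply/eqP; congr pair; lia.
  by apply/orP; right; apply/eqP; congr pair; lia.
rewrite pathsum_rcons lppS addrC (WE _ _ dj) lerD2r; exact: le_trans im le.
Qed.

Lemma LPP_plus n (j : int) : 1 <= j -> LPP w Lplus (pred1 (n%:Z - j, j)) = (lpp Lplus_weight n j)%:E.
Proof.
move=> j1; apply: (@LPP_eq _ _ (fun p => 1 <= p.2)) => //.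
- exact: Lplus_weight_ge0.
- by move=> x; rewrite LplusE => /andP[h1 /eqP h2]; split; lia.
- by move=> p q h /orP[] /eqP -> /=; lia.
- by move=> m i /= h; rewrite LplusE /Lplus_weight h /= ifF //; lia.
- by move=> m i /= h; rewrite /Lplus_weight (negbTE h).
- by move=> i /= h; rewrite LplusE /=; apply/andP; split; lia.
- by move=> m i /= ->.
Qed.

Lemma LPP_minus n (j : int) : j < n%:Z -> LPP w Lminus (pred1 (n%:Z - j, j)) = (lpp Lminus_weight n j)%:E.
Proof.
move=> jn; apply: (@LPP_eq _ _ (fun p => 1 <= p.1)) => /=; last by lia.
- exact: Lminus_weight_ge0.
- by move=> [x1 x2]; rewrite LminusE /=; case: eqVneq => [->|_] h; split; lia.
- by move=> p q h /orP[] /eqP -> /=; lia.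
- move=> m i h; rewrite LminusE /Lminus_weight /= (_ : i <= m%:Z); last by lia.
  rewrite xpair_eqE; case: (eqVneq i 0) => [->|i0]; last by rewrite andbF /= ifF //; lia.
  by rewrite andbT subr0; case: m {h}.
- by move=> m i h; rewrite /Lminus_weight ifF //; lia.
- by move=> i h; rewrite LminusE /= ifF; lia.
- by move=> m i h; apply/orP; right; lia.
Qed.

Lemma interface_lpp n (j : int) : 1 <= j <= n%:Z ->
  let phi := comp_interface w n in
  phi.1 + phi.2 = n%:Z /\ (phi.2 < j) = (lpp Lminus_weight n.+1 j < lpp Lplus_weight n.+1 j).
Proof.
move=> jn phi; pose J n := (comp_interface w n).2.
have IJ k : (comp_interface w k).1 + (comp_interface w k).2 = k%:Z /\ 0 <= J k <= k%:Z.
  elim: k => [//|k]; rewrite /J /=; case: ifP => _ [] /=; lia.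
have {}IJ1 k := (IJ k).1; have IJ2 k := (IJ k).2.
split; first exact: IJ1.
rewrite (@interfaceE R Lplus_weight Lminus_weight _ _ _ _ _ J) //.
- exact: Lplus_weight_ge0.
- exact: Lminus_weight_ge0.
- move=> m i /andP[h1 h2]; rewrite /Lplus_weight /Lminus_weight h1 h2 /= ifT //.
  by apply/eqP => -[_ i0]; rewrite i0 in h1.
- by move=> m i h; rewrite /Lplus_weight ifF //; lia.
- by move=> m i h; rewrite /Lminus_weight ifF //; lia.
- move=> k; rewrite /J /= -/(J k).
  have -> : ((comp_interface w k).1 + 1, J k + 1) = (k.+2%:Z - (J k + 1), J k + 1).
    by congr pair; have := IJ1 k; rewrite -/(J k); lia.
  rewrite LPP_plus ?LPP_minus ?lte_fin; [|have := IJ2 k; lia..].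
  by case: ifP.
Qed.

End DefsLPP.

Section Reindex.
Context {d : measure_display} {T : measurableType d} {R : realType} (P : probability T R).

Lemma mutually_independent_reindex (I K : eqType) (J : pred I) (J' : pred K) (X : K -> T -> R)
    (f : I -> R -> R) (s : I -> K) (r : K -> I) :
  cancel s r -> (forall i, J i -> J' (s i)) -> (forall i, measurable_fun setT (f i)) ->
  mutually_independent P J' X -> mutually_independent P J (fun i o => f i (X (s i) o)).
Proof.
move=> sr JJ mf ind F B uF JF mB.
have := ind (map s F) (fun k => f (r k) @^-1` B (r k)).
rewrite map_inj_uniq; last exact: can_inj sr.
rewrite !big_map; under eq_bigr do rewrite sr.
under [RHS]eq_bigr do rewrite sr.
apply => //; first by rewrite all_map; apply: sub_all JF => i; exact: JJ.
by move=> k; rewrite -[X in measurable X]setTI; exact: mf.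
Qed.

Lemma exp_field_reindex (E : nat * int -> T -> R) s r : cancel s r ->
  exp_field P E -> exp_field P (fun c => E (s c)).
Proof.
move=> sr [mE E0 PE indE]; split => //; first by move=> c x; exact: PE.
by apply: (@mutually_independent_reindex _ _ xpredT xpredT E (fun _ x => x) s r).
Qed.

Lemma exponential_prob_le (r x : R) : 0 <= x ->
  exponential_prob r `]-oo, x] = (1 - expR (- (r * x)))%:E.
Proof.
move=> x0; have -> : exponential_prob r `]-oo, x] = exponential_prob r `[0, x].
  rewrite /exponential_prob integral_mkcond [RHS]integral_mkcond; apply: eq_integral => t _.
  rewrite !patchE !mem_setE !in_itv /=; have [t0|t0] := ltP t 0; last by [].
  by rewrite lt0_exponential_pdf //; case: ifP.
have [->|x1] := eqVneq x 0.
  by rewrite set_itv1 /exponential_prob integral_set1 mulr0 oppr0 expR0 subrr.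
by rewrite exponential_prob_itv0c ?lt_def ?x1 // mulNr EFinB.
Qed.

End Reindex.

(** * The weights as a standard exponential field *)

Section WeightField.
Context {d : measure_display} {T : measurableType d} {R : realType} (P : probability T R).
Variables (alpha : R) (w : pt -> T -> R).
Hypothesis alpha0 : 0 < alpha.
Hypothesis mw : forall p, measurable_fun setT (w p).
Hypothesis w_indep : mutually_independent P (fun p => ~~ Lplus p && ~~ Lminus p) w.
Hypothesis w_le : forall p : pt, ~~ Lplus p -> ~~ Lminus p -> forall x : R, 0 <= x ->
  P [set o | w p o <= x] = (1 - expR (- ((if (0 < p.2)%R then 1 else alpha) * x)))%:E.

(* The cell [(0, 0)] is the point [(1, 0)] of [Lminus], which carries no weight; the
   point [(0, 0)] stands in for it so that the field is defined on all cells. *)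
Definition cell_pt (c : nat * int) : pt := if c == (0%N, 0) then (0, 0) else (c.1.+1%:Z - c.2, c.2).
Definition pt_cell (p : pt) : nat * int := if p == (0, 0) then (0%N, 0) else (`|(p.1 + p.2 - 1)%R|%N, p.2).

Lemma cell_ptK : cancel cell_pt pt_cell.
Proof.
move=> [n j]; rewrite /cell_pt; case: eqVneq => [-> //|nj]; rewrite /pt_cell /= ifF; last first.
  by apply/negbTE; apply: contra nj => /eqP [h j0]; apply/eqP; congr pair; lia.
by congr pair; lia.
Qed.

Lemma cell_pt_free c : ~~ Lplus (cell_pt c) && ~~ Lminus (cell_pt c).
Proof.
rewrite LplusE LminusE /cell_pt; case: c => n j; case: eqVneq => //= nj.
have h : (n.+1%:Z - j + j == 0) = false by lia.
rewrite h !andbF /=; case: eqVneq => // j0.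
by apply: contra nj; rewrite j0 => /eqP h'; apply/eqP; congr pair; lia.
Qed.

Definition pt_rate (p : pt) : R := if 0 < p.2 then 1 else alpha.

(** The law makes the weights nonnegative only almost surely, whereas the field has to be
    nonnegative everywhere; hence the maximum. The factor normalises the rate to [1]. *)
Definition weight_field (c : nat * int) (o : T) : R :=
  Num.max 0 (w (cell_pt c) o) * pt_rate (cell_pt c).

Lemma pt_rate_gt0 p : 0 < pt_rate p. Proof. by rewrite /pt_rate; case: ifP. Qed.

Lemma weight_field_exp : exp_field P weight_field.
Proof.
have mf c : measurable_fun setT (fun x : R => Num.max 0 x * pt_rate (cell_pt c)).
  by apply: measurable_funM => //; apply: measurable_maxr.
split.
- by move=> c; apply: (measurableT_comp (mf c)); exact: mw.
- by move=> c o; rewrite mulr_ge0 ?le_max ?lexx // ltW // pt_rate_gt0.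
- move=> c x x0; have r0 := pt_rate_gt0 (cell_pt c).
  have /andP[h1 h2] := cell_pt_free c.
  have -> : [set o | weight_field c o <= x] = [set o | w (cell_pt c) o <= x / pt_rate (cell_pt c)].
    apply/seteqP; split => o /=; rewrite /weight_field -ler_pdivlMr // ge_max.
      by move=> /andP[].
    by rewrite divr_ge0 ?(ltW r0).
  rewrite w_le // ?divr_ge0 ?(ltW r0) // -/(pt_rate _).
  by congr (1 - expR (- _))%:E; rewrite mulrC divfK // gt_eqF.
- apply: (@mutually_independent_reindex _ _ _ P _ _ xpredT (fun p => ~~ Lplus p && ~~ Lminus p) w
    (fun c x => Num.max 0 x * pt_rate (cell_pt c)) cell_pt pt_cell) => //.
  + exact: cell_ptK.
  + by move=> c _; exact: cell_pt_free.
Qed.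

Lemma weights_ge0_ae : exists N, [/\ measurable N, P N = 0%E &
  forall o, ~ N o -> forall p, ~~ Lplus p -> ~~ Lminus p -> 0 <= w p o].
Proof.
pose A (n : nat) : set T := if (@unpickle pt n : option pt) is Some p then
  (if ~~ Lplus p && ~~ Lminus p then [set o | w p o <= 0] else set0) else set0.
have mA n : measurable (A n).
  rewrite /A; case: unpickle => // p; case: ifP => // _.
  rewrite (_ : [set o | _] = w p @^-1` `]-oo, 0]); last by apply/seteqP; split => o; rewrite /= in_itv.
  by rewrite -[X in measurable X]setTI; exact: mw.
exists (\bigcup_n A n); split; first exact: bigcup_measurable.
  apply/eqP; rewrite -measure_le0 (le_trans (measure_sigma_subadditive _ mA _ (@subset_refl _ _))) //.
    exact: bigcup_measurable.
  rewrite eseries0 // => n _ _; rewrite /A; case: unpickle => // p; case: ifP => // /andP[h1 h2].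
  by have := w_le h1 h2 (lexx (0 : R)); rewrite mulr0 oppr0 expR0 subrr.
move=> o No p h1 h2; rewrite leNgt; apply/negP => wp; apply: No; exists (pickle p); first by [].

by rewrite /A pickleK h1 h2 /= ltW.
Qed.

End WeightField.

(** * Asymptotic independence of the two passage times *)

Section Tilt.
Context {R : realType}.
Implicit Types (a b eta beta : R) (z : nat).

Definition step a b (k : int) : R := if k <= 0 then a else b.

(* Lowering the parameters seen by the rows of a path before or after the cell [(z1, z2)] and
   raising the others leaves the rates met by the path below the original ones. *)
Definition tilt a b eta (z1 z2 : nat) (k : int) : R :=
  if k < 1 - z1%:Z then step a b k + eta
  else if z2%:Z < k then step a b k - eta
  else if (k == z2%:Z) || (k == 1 - z1%:Z) then step a b k - `|eta|
  else step a b k.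

Lemma step_bnd a b beta (k : int) : beta <= a <= 1 -> beta <= b <= 1 -> beta <= step a b k <= 1.
Proof. by rewrite /step; case: ifP. Qed.

Lemma tilt_bnd a b beta eta z1 z2 (k : int) : beta <= a <= 1 -> beta <= b <= 1 -> `|eta| <= beta / 2 ->
  beta / 2 <= tilt a b eta z1 z2 k <= 2.
Proof.
move=> ab bb eb; have /andP[s1 s2] := step_bnd k ab bb.
have e1 := ler_norm eta; have e2 := ler_norm (- eta); rewrite normrN in e2.
have e0 := normr_ge0 eta.
rewrite /tilt; case: ifP => _; [|case: ifP => _; [|case: ifP => _]]; apply/andP; split; lra.
Qed.

(** Up to the cell, the rows involved lie between [1 - z1] and [z2], where no parameter is raised.
    Beyond it, the first row is at least [z2] and the second at most [1 - z1], so [- eta] and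
    [+ eta] cancel. The two boundary rows occur in both cases, whence their decrease by [|eta|]. *)
Lemma tilt_dom a b beta eta z1 z2 (e : nat * int -> R) c nz m : 0 < beta ->
  beta <= a <= 1 -> beta <= b <= 1 -> `|eta| <= beta / 2 -> (forall x, 0 <= e x) ->
  lattice c -> nz.+1 = (z1 + z2)%N -> c nz = z2%:Z ->
  wmod (step a b) e m (c m) <= wmod (tilt a b eta z1 z2) e m (c m).
Proof.
move=> beta0 ab bb eb e0 lc nzE cz.
have tp k : 0 < tilt a b eta z1 z2 k.
  by have /andP[h _] := tilt_bnd z1 z2 k ab bb eb; apply: lt_le_trans h; rewrite divr_gt0.
apply: wmod_anti => //; first exact: addr_gt0.
have e1 := ler_norm eta; have e2 := ler_norm (- eta); rewrite normrN in e2.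
have en := normr_ge0 eta.
have [mz|mz] := leqP m nz.
  have [h1 h2] := lattice_le lc mz.
  have le k : 1 - z1%:Z <= k <= z2%:Z -> tilt a b eta z1 z2 k <= step a b k.
    move=> /andP[k1 k2]; rewrite /tilt ltNge k1 ltNge k2 /=; case: ifP => _; last exact: lexx.
    by rewrite lerBlDr lerDl.
  by apply: lerD; apply: le; move: h1 h2 cz nzE mz; clear; lia.
have [h1 h2] := lattice_le lc (ltnW mz).
set k := c m; set l := k - m%:Z.
have kz : z2%:Z <= k by rewrite /k -cz.
have lz : l <= 1 - z1%:Z by rewrite /l /k; move: h1 h2 cz nzE mz; clear; lia.
have tk : tilt a b eta z1 z2 k <= step a b k - eta.
  rewrite /tilt ifF; last by rewrite ltNge (_ : 1 - z1%:Z <= k) //; move: kz nzE; clear; lia.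
  case: ifP => kz2; first exact: lexx.
  by rewrite ifT; [lra|apply/orP; left; apply/eqP; move: kz kz2; clear; lia].
have tl : tilt a b eta z1 z2 l <= step a b l + eta.
  rewrite /tilt; case: ifP => lz2; first exact: lexx.
  rewrite ifF; last by move: kz lz mz nzE; rewrite /l; clear; lia.
  by rewrite ifT; [lra|apply/orP; right; apply/eqP; move: lz lz2; clear; lia].
lra.
Qed.

Lemma inv_tilt (x beta eta : R) : 0 < beta -> beta <= x -> `|eta| <= beta / 2 ->
  (x + eta)^-1 <= x^-1 - eta / x ^+ 2 + 2 / beta ^+ 3 * eta ^+ 2.
Proof.
move=> b0 bx eb; have x0 : 0 < x by exact: lt_le_trans bx.
have xe : beta / 2 <= x + eta by have := ler_norm (- eta); rewrite normrN; lra.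
have xe0 : 0 < x + eta by apply: lt_le_trans xe; rewrite divr_gt0.
have -> : (x + eta)^-1 = x^-1 - eta / x ^+ 2 + (x ^+ 2 * (x + eta))^-1 * eta ^+ 2.
  by field; rewrite !gt_eqF.
rewrite lerD2l ler_wpM2r ?sqr_ge0 //.
have -> : 2 / beta ^+ 3 = (beta ^+ 2 * (beta / 2))^-1 by field; rewrite gt_eqF.
rewrite lef_pV2 ?posrE ?mulr_gt0 ?exprn_gt0 ?divr_gt0 //.
by apply: ler_pM => //; rewrite ?sqr_ge0 ?divr_ge0 ?(ltW b0) // ler_pXn2r ?nnegrE // ltW.
Qed.

Lemma inv_tilt_abs (x beta eta : R) : 0 < beta -> beta <= x -> `|eta| <= beta / 2 ->
  (x - `|eta|)^-1 <= x^-1 + 2 / beta ^+ 2 * `|eta|.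
Proof.
move=> b0 bx; have := normr_ge0 eta; move: `|eta| => e e0 eb; have x0 : 0 < x by exact: lt_le_trans bx.
have xe : beta / 2 <= x - e by lra.
have xe0 : 0 < x - e by apply: lt_le_trans xe; rewrite divr_gt0.
have -> : (x - e)^-1 = x^-1 + (x * (x - e))^-1 * e.
  by field; rewrite !gt_eqF.
rewrite lerD2l ler_wpM2r //.
have -> : 2 / beta ^+ 2 = (beta * (beta / 2))^-1 by field; rewrite gt_eqF.
rewrite lef_pV2 ?posrE ?mulr_gt0 ?divr_gt0 //.
by apply: ler_pM => //; rewrite ?divr_ge0 ?(ltW b0).
Qed.

Lemma sum_if_lt n N (x : R) : (n <= N)%N -> \sum_(l < N) (if (l < n)%N then x else 0) = n%:R * x.
Proof.
elim: N => [|N IH]; first by rewrite leqn0 => /eqP ->; rewrite big_ord0 mul0r.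
rewrite leq_eqVlt => /predU1P[->|nN].
  rewrite mulr_natl -[in RHS](card_ord N.+1) -sumr_const; apply: eq_bigr => l _.
  by rewrite ltn_ord.
by rewrite big_ord_recr /= IH // ltnNge -ltnS nN addr0.
Qed.

Lemma sum_if_ge n N (x : R) : (n <= N)%N -> \sum_(l < N) (if (n <= l)%N then x else 0) = (N - n)%:R * x.
Proof.
move=> nN; transitivity (\sum_(l < N) (x - (if (l < n)%N then x else 0))).
  by apply: eq_bigr => l _; case: leqP => _; rewrite ?subr0 ?subrr.
by rewrite sumrB sum_if_lt // sumr_const card_ord natrB // mulrBl !mulr_natl.
Qed.

Lemma sum_if_eq_le n N (x : R) : 0 <= x -> \sum_(l < N) (if l == n :> nat then x else 0) <= x.
Proof.
move=> x0; elim: N => [|N IH]; first by rewrite big_ord0.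
rewrite big_ord_recr /=; have [h|h] := eqVneq N n; last by rewrite addr0.
rewrite big1 ?add0r // => l _; rewrite ifF //.
by have := ltn_ord l; move: h; clear; lia.
Qed.

Lemma step_mean a b A B : flat_mean (step a b) (A + B) B%:Z = A%:R / a + B%:R / b.
Proof.
rewrite /flat_mean -(sum_if_lt b^-1 (leq_addl A B)).
have -> : A%:R / a = \sum_(l < A + B) (if (B <= l)%N then a^-1 else 0).
  by rewrite sum_if_ge ?leq_addl // addnK.
rewrite -big_split /=; apply: eq_bigr => l _.
rewrite /step [(_ <= 0)](_ : _ = (B <= l)%N); last by lia.
by case: leqP => _; rewrite ?addr0 ?add0r.
Qed.

(** To first order the mean changes by [- eta] times the bracket, so a suitable sign of [eta]
    dominates all paths through [(z1, z2)] by a passage time of smaller mean. The second order and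
    the boundary rows are errors. *)
Lemma tilt_mean a b beta eta z1 z2 A B : 0 < beta ->
  beta <= a <= 1 -> beta <= b <= 1 -> `|eta| <= beta / 2 -> (z1 <= A)%N -> (z2 <= B)%N -> (0 < z1 + z2)%N ->
  flat_mean (tilt a b eta z1 z2) (A + B) B%:Z <= A%:R / a + B%:R / b
    - eta * ((A - z1)%:R / a ^+ 2 - (B - z2)%:R / b ^+ 2)
    + 2 / beta ^+ 3 * eta ^+ 2 * ((A - z1)%:R + (B - z2)%:R) + 4 / beta ^+ 2 * `|eta|.
Proof.
move=> beta0 /andP[a1 a2] /andP[b1 b2] eb zA zB z12.
set K := 2 / beta ^+ 3; set C := 2 / beta ^+ 2.
have C0 : 0 <= C * `|eta| by rewrite mulr_ge0 // divr_ge0 // sqr_ge0.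
(* [s1] and [s2] are the corrections of the rows above [z2] and below [1 - z1], [s3] and [s4] those
   of the two boundary rows. *)
pose s1 (l : 'I_(A + B)) : R := if (l < B - z2)%N then eta / b ^+ 2 + K * eta ^+ 2 else 0.
pose s2 (l : 'I_(A + B)) : R := if (B + z1 <= l)%N then - (eta / a ^+ 2) + K * eta ^+ 2 else 0.
pose s3 (l : 'I_(A + B)) : R := if l == (B - z2)%N :> nat then C * `|eta| else 0.
pose s4 (l : 'I_(A + B)) : R := if l == (B + z1).-1 :> nat then C * `|eta| else 0.
have le1 (l : 'I_(A + B)) : (tilt a b eta z1 z2 (B%:Z - l%:Z))^-1 <=
    (step a b (B%:Z - l%:Z))^-1 + (s1 l + s2 l + s3 l + s4 l).
  have s30 : 0 <= s3 l by rewrite /s3; case: ifP.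
  have s40 : 0 <= s4 l by rewrite /s4; case: ifP.
  have bstep : beta <= step a b (B%:Z - l%:Z) by rewrite /step; case: ifP.
  rewrite /tilt; case: ifP => h1.
    have s1E : s1 l = 0 by rewrite /s1 ifF //; apply/negbTE; move: h1 zB z12; clear; lia.
    have s2E : s2 l = - (eta / a ^+ 2) + K * eta ^+ 2 by rewrite /s2 ifT //; move: h1; clear; lia.
    have := inv_tilt beta0 bstep eb.
    have -> : step a b (B%:Z - l%:Z) = a by rewrite /step ifT //; move: h1 zB z12; clear; lia.
    by rewrite s1E s2E -/K => h; apply: (le_trans h); rewrite -!addrA !lerD2l; move: s30 s40; clear; lra.
  case: ifP => h2.
    have s2E : s2 l = 0 by rewrite /s2 ifF //; apply/negbTE; move: h1 h2 zB z12; clear; lia.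
    have s1E : s1 l = (eta / b ^+ 2) + K * eta ^+ 2 by rewrite /s1 ifT //; move: h2; clear; lia.
    have ebN : `|- eta| <= beta / 2 by rewrite normrN.
    have := inv_tilt beta0 bstep ebN; rewrite sqrrN.
    have -> : step a b (B%:Z - l%:Z) = b by rewrite /step ifF //; apply/negbTE; move: h2; clear; lia.
    by rewrite s1E s2E -/K => h; apply: (le_trans h); rewrite -!addrA !lerD2l; move: s30 s40; clear; lra.
  have s10 : s1 l = 0 by rewrite /s1 ifF //; apply/negbTE; move: h2; clear; lia.
  have s20 : s2 l = 0 by rewrite /s2 ifF //; apply/negbTE; move: h1; clear; lia.
  rewrite s10 s20 !add0r; case: ifP => h3; last by rewrite lerDl addr_ge0.
  apply: (le_trans (inv_tilt_abs beta0 bstep eb)); rewrite lerD2l -/C.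
  case/orP: h3 => /eqP h3.
    by rewrite /s3 ifT ?lerDl //; apply/eqP; move: h3 zB; clear; lia.
  by rewrite /s4 ifT ?lerDr //; apply/eqP; move: h3 zB z12; clear; lia.
apply: (@le_trans _ _ (\sum_(l < A + B) ((step a b (B%:Z - l%:Z))^-1 + (s1 l + s2 l + s3 l + s4 l)))).
  exact: ler_sum.
rewrite !big_split /= -[X in X + _]/(flat_mean (step a b) (A + B) B%:Z) step_mean.
rewrite sum_if_lt; last by move: zB; clear; lia.
rewrite sum_if_ge; last by move: zA; clear; lia.
have -> : (A + B - (B + z1))%N = (A - z1)%N by clear; lia.
have h3 : \sum_l s3 l <= C * `|eta| by exact: sum_if_eq_le.
have h4 : \sum_l s4 l <= C * `|eta| by exact: sum_if_eq_le.
have -> : 4 / beta ^+ 2 * `|eta| = C * `|eta| + C * `|eta| by rewrite /C; field; rewrite gt_eqF.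
move: h3 h4.
move: (\sum_(i < A + B) s3 i) (\sum_(i < A + B) s4 i) (C * `|eta|) ((A - z1)%:R : R) ((B - z2)%:R : R) => x y z u v.
have -> : eta * (u / a ^+ 2 - v / b ^+ 2) = eta / a ^+ 2 * u - eta / b ^+ 2 * v by ring.
move: (eta / a ^+ 2) (eta / b ^+ 2) (A%:R / a + B%:R / b) => p q r.
move: (K) => k; clear; lra.
Qed.

End Tilt.

(** * The upper tail in units depending on the size alone *)

Section StepTail.
Context {d : measure_display} {T : measurableType d} {R : realType} (P : probability T R).
Variable E : nat * int -> T -> R.
Hypothesis fE : exp_field P E.
Local Notation e o := (fun c => E c o).

Definition tail_scale (beta : R) (n : nat) : R := (n%:R : R) `^ 3^-1 / beta.

Lemma tail_scale_gt0 beta n : 0 < beta -> (0 < n)%N -> 0 < tail_scale beta n.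
Proof. by move=> b0 n0; rewrite divr_gt0 // powR_gt0 // ltr0n. Qed.

Lemma flat_scale_tail beta (b : int -> R) n j : 0 < beta -> (forall i, beta <= b i) -> (0 < n)%N ->
  flat_scale b n j / 2 <= tail_scale beta n.
Proof.
move=> beta0 bb n0; have b0 i : 0 < b i by exact: lt_le_trans (bb i).
have [q0 q3] := flat_scale_cube j b0 n0.
have t0 := tail_scale_gt0 beta0 n0.
rewrite ler_pdivrMr // -(ler_pXn2r (n := 3)) ?nnegrE ?(ltW q0) ?(mulr_ge0 (ltW t0) (ler0n _ 2)) //.
have t3 : tail_scale beta n ^+ 3 = n%:R / beta ^+ 3.
  rewrite /tail_scale expr_div_n; congr (_ / _).
  by rewrite -powR_mulrn ?powR_ge0 // -powRrM mulVf // powRr1.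
rewrite q3 exprMn t3; apply: (@le_trans _ _ (2 * (n%:R / beta ^+ 3))).
  rewrite ler_wpM2l //; apply: sum_ord_le => l.
  by rewrite lef_pV2 ?posrE ?exprn_gt0 // ler_pXn2r ?nnegrE // ltW.
have : 0 <= n%:R / beta ^+ 3 by rewrite divr_ge0 // exprn_ge0 // ltW.
by move: (n%:R / beta ^+ 3) => x x0; lra.
Qed.

Lemma tail_cst_ge0 (beta B : R) : 0 <= tail_cst beta B.
Proof.
have f0 : 0 <= fred_cst 1 :> R by exact: sqrtr_ge0.
have k0 := ker_cst_ge0 (4 * (B / beta)); have x0 := expR_ge0 (1 : R).
rewrite /tail_cst; apply: addr_ge0 => //; apply: addr_ge0; last exact: mulr_ge0.
by apply: mulr_ge0 => //; exact: mulr_ge0.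
Qed.

Lemma flat_tail_abs (beta B m x : R) (b : int -> R) n j : 0 < beta -> (forall i, beta <= b i <= B) ->
  (8 / beta) ^+ 3 <= 2 * n%:R / B ^+ 3 -> (0 < n)%N -> 0 <= x -> flat_mean b n j <= m ->
  prob P [set o | m + x < lpp (wmod b (e o)) n j] <= tail_cst beta B * expR (- (x / tail_scale beta n)).
Proof.
move=> beta0 bB nB n0 x0 mm.
have b0 i : 0 < b i by have /andP[h _] := bB i; exact: lt_le_trans h.
have [q0 _] := flat_scale_cube j b0 n0.
set q := flat_scale b n j in q0.
have eta0 : 0 <= 2 * x / q by rewrite divr_ge0 ?mulr_ge0 // ltW.
have mes u : measurable [set o | u < lpp (wmod b (e o)) n j].
  rewrite (_ : [set o | _] = ~` [set o | lpp (wmod b (e o)) n j <= u]); last first.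
    by apply/seteqP; split => o /=; rewrite ltNge => /negP.
  by apply: measurableC; exact: (measurable_flat fE).
have qE : flat_mean b n j + q / 2 * (2 * x / q) = flat_mean b n j + x.
  by congr (_ + _); field; rewrite gt_eqF.
have := @flat_tail _ _ _ P E fE beta B b n j _ beta0 bB nB n0 eta0.
rewrite -/q qE => h; apply: le_trans (le_trans h _).
  by apply: prob_le => // o /=; apply: le_lt_trans; rewrite lerD2r.
rewrite ler_wpM2l ?tail_cst_ge0 //.
rewrite ler_expR lerN2.
have st := @flat_scale_tail beta b n j beta0 (fun i => (andP (bB i)).1) n0.
rewrite -/q in st; have -> : 2 * x / q = x / (q / 2) by field; rewrite gt_eqF.
have t0 := tail_scale_gt0 beta0 n0; have q20 : 0 < q / 2 by rewrite divr_gt0.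
by rewrite ler_wpM2l // lef_pV2 ?posrE.
Qed.

End StepTail.

(** * Exits of maximal paths from a region *)

Section Deterministic.
Context {R : realType}.
Variables (a b beta : R) (e : nat * int -> R).
Hypothesis beta0 : 0 < beta.
Hypothesis a_bnd : beta <= a <= 1.
Hypothesis b_bnd : beta <= b <= 1.
Hypothesis e0 : forall c, 0 <= e c.
Local Notation W := (wmod (step a b) e).

Let W0 m j : 0 <= W m j.
Proof. by apply: wmod_ge0 => // i; have /andP[h _] := step_bnd i a_bnd b_bnd; exact: lt_le_trans h. Qed.

(* The cells strictly to the right of the ray from [(1, 0)] to [(I + 1, J)]. *)
Definition right_of_ray (I J : nat) (m : nat) (j : int) : bool := j * I%:Z < (m%:Z - j) * J%:Z.

Definition mask (A : nat -> int -> bool) (V : nat -> int -> R) (m : nat) (j : int) : R :=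
  if A m j then V m j else 0.

Lemma mask_ge0 A V m j : (forall m j, 0 <= V m j) -> 0 <= mask A V m j.
Proof. by move=> V0; rewrite /mask; case: ifP. Qed.

Lemma mask_le A V m j : (forall m j, 0 <= V m j) -> mask A V m j <= V m j.
Proof. by move=> V0; rewrite /mask; case: ifP. Qed.

Lemma sum_mask_le (A : nat -> int -> bool) c n0 n :
  (n0 <= n)%N -> (forall m, (n0 <= m < n)%N -> A m (c m)) ->
  \sum_(n0 <= m < n) W m (c m) <= \sum_(0 <= m < n) mask A W m (c m).
Proof.
move=> nn Ac; rewrite [leRHS](big_cat_nat _ nn) //=.
rewrite (_ : \sum_(n0 <= m < n) mask A W m (c m) = \sum_(n0 <= m < n) W m (c m)).
  by rewrite lerDr; apply: sumr_ge0 => m _; exact: mask_ge0.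
by apply: eq_big_nat => m /Ac h; rewrite /mask h.
Qed.

(** A maximal path staying right of the ray would give the restricted passage time the value [v].
    Otherwise its last cell [(z1, z2)] off that side is followed by a horizontal step, which
    determines [z1] by [z2]; a union bound over [z2] will do. *)
Lemma ray_exit (I J A B : nat) (v eta : R) : (0 < I)%N -> (0 < J)%N -> `|eta| <= beta / 2 -> (0 < A + B)%N ->
  right_of_ray I J (A + B).-1 B%:Z ->
  lpp (mask (right_of_ray I J) W) (A + B) B%:Z < v -> v <= lpp W (A + B) B%:Z ->
  exists z1 z2 : nat, [/\ (z1 <= A)%N, (z2 <= B)%N, z1 = ((z2 * I) %/ J).+1 &
    v <= lpp (wmod (tilt a b eta z1 z2) e) (A + B) B%:Z].
Proof.
move=> I0 J0 eb; set n := (A + B)%N => n0 endR Yv vF.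
have [c [lc cn FE]] := lpp_attained W n B%:Z.
have [m [mn nR mR]] : exists m, [/\ (m < n)%N, ~~ right_of_ray I J m (c m) & forall k, (m < k < n)%N -> right_of_ray I J k (c k)].
  apply: last_exit; apply: contrapT => no.
  have allR m : (0 <= m < n)%N -> right_of_ray I J m (c m).
    by move=> /andP[_ mn]; apply: contrapT => /negP h; apply: no; exists m.
  have := sum_mask_le (leq0n n) allR; rewrite -FE => h.
  have := lpp_lattice (mask (right_of_ray I J) W) lc n0; rewrite cn => h'.
  by have := le_lt_trans (le_trans (le_trans vF h) h') Yv; rewrite ltxx.
have mn1 : (m.+1 < n)%N.
  rewrite ltn_neqAle mn andbT; apply/eqP => mE.
  by move: nR; rewrite (_ : m = n.-1) ?cn ?endR // -mE.
have R1 : right_of_ray I J m.+1 (c m.+1) by apply: mR; rewrite ltnSn.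
have mn' : (m <= n.-1)%N by rewrite -ltnS prednK.
have [h1 h2] := lattice_le lc mn'.
rewrite cn in h1 h2.
have cm : c m.+1 = c m.
  case: (lc m) => // cS; move: R1 nR; rewrite /right_of_ray cS; move: (c m) I0 J0; clear => j; nia.
move: R1 nR; rewrite /right_of_ray cm -leNgt => R1 nR.
have j0 : 0 <= c m by move: nR R1 I0 J0; clear; move: (c m) => j; nia.
have i0 : 0 < m.+1%:Z - c m by move: R1 j0 I0 J0; clear; move: (c m) => j; nia.
set z2 := `|c m|%N; set z1 := `|(m.+1%:Z - c m)%R|%N.
have z2E : c m = z2%:Z by rewrite /z2; move: j0; clear; lia.
have z1E : m.+1 = (z1 + z2)%N by rewrite /z1 /z2; move: j0 i0; clear; lia.
exists z1, z2; split.
- by move: h2 n0 mn z1E z2E; rewrite /n; clear; lia.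
- by move: h1 z2E; clear; lia.
- have h3 : (z2 * I < z1 * J)%N by move: R1; rewrite z1E z2E; clear; lia.
  have h4 : (z1.-1 * J <= z2 * I)%N.
    have mE : m%:Z - z2%:Z = z1.-1%:Z by move: i0 z1E; rewrite z2E; clear; lia.
    by move: nR; rewrite z2E mE; clear; lia.
  have z10 : (0 < z1)%N by move: i0; rewrite z1E z2E; clear; lia.
  apply/eqP; rewrite -(prednK z10) eqSS eqn_leq leq_divRL // h4 /=.
  by rewrite -ltnS ltn_divLR // prednK.
- apply: (le_trans vF); rewrite FE.
  apply: (@le_trans _ _ (\sum_(0 <= k < n) wmod (tilt a b eta z1 z2) e k (c k))).
    by apply: ler_sum => k _; exact: (tilt_dom _ beta0 a_bnd b_bnd eb e0 lc z1E z2E).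
  by rewrite -cn; exact: lpp_lattice.
Qed.

Definition quadrant (m : nat) (j : int) : bool := 1 <= j <= m%:Z.

(** The quadrant, where both coordinates are at least [1], is entered from a point [(z1, 0)] or
    [(0, z2)]. If that point is within [dd], the path up to it weighs at most [D]; if not, the tilt
    there applies, with the sign that lowers the mean. *)
Lemma quadrant_exit (A B dd : nat) (v D eta : R) : (0 < A)%N -> (0 < B)%N -> `|eta| <= beta / 2 ->
  lpp (mask quadrant W) (A + B) B%:Z < v - D -> v <= lpp W (A + B) B%:Z ->
  lpp W dd 0 <= D -> lpp W dd dd%:Z <= D ->
  (exists z1 : nat, (dd < z1 <= A)%N /\ v <= lpp (wmod (tilt a b (- `|eta|) z1 0) e) (A + B) B%:Z) \/
  (exists z2 : nat, (dd < z2 <= B)%N /\ v <= lpp (wmod (tilt a b `|eta| 0 z2) e) (A + B) B%:Z).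
Proof.
move=> A0 B0 eb; set n := (A + B)%N => Gv vF D1 D2.
have n0 : (0 < n)%N by rewrite addn_gt0 A0.
have [c [lc cn FE]] := lpp_attained W n B%:Z.
have [m [mn nQ mQ]] : exists m, [/\ (m < n)%N, ~~ quadrant m (c m) & forall k, (m < k < n)%N -> quadrant k (c k)].
  apply: last_exit; exists 0%N => //; rewrite /quadrant; move: (c 0%N); clear; lia.
have mn1 : (m.+1 < n)%N.
  rewrite ltn_neqAle mn andbT; apply/eqP => mE.
  move: nQ; rewrite (_ : m = n.-1) ?cn -?mE //= /quadrant; move: mE A0 B0; rewrite /n; clear; lia.
have Q1 : quadrant m.+1 (c m.+1) by apply: mQ; rewrite ltnSn.
have mn' : (m <= n.-1)%N by rewrite -ltnS prednK.
have [h1 h2] := lattice_le lc mn'.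
rewrite cn in h1 h2.
have h3 : n = (A + B)%N by [].
have cE : c m = 0 \/ c m = m.+1%:Z.
  by case: (lc m) => cS; move: Q1 nQ; rewrite /quadrant cS; clear; lia.
have through eta' z1 z2 : `|eta'| <= beta / 2 -> m.+1 = (z1 + z2)%N -> c m = z2%:Z ->
    v <= lpp (wmod (tilt a b eta' z1 z2) e) n B%:Z.
  move=> eb' mz cz; apply: (le_trans vF); rewrite FE.
  apply: (@le_trans _ _ (\sum_(0 <= k < n) wmod (tilt a b eta' z1 z2) e k (c k))).
    by apply: ler_sum => k _; exact: (tilt_dom _ beta0 a_bnd b_bnd eb' e0 lc mz cz).
  by rewrite -cn; exact: lpp_lattice.
have far : (dd < m.+1)%N.
  rewrite ltnNge; apply/negP => md.
  have LD : lpp W m.+1 (c m) <= D.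
    case: cE => ->; first exact: le_trans (lpp_le_height _ W0 md) D1.
    apply: le_trans D2; move: W0 md; clear => W0 /subnK <-.
    elim: (dd - m.+1)%N => [|k IH]; first by rewrite add0n.
    rewrite addSn lppS; apply: (le_trans IH); rewrite ler_wpDl // le_max.
    by apply/orP; right; rewrite (_ : (k + m.+1).+1%:Z - 1 = (k + m.+1)%:Z) // ; lia.
  have LG : \sum_(m.+1 <= k < n) W k (c k) <= lpp (mask quadrant W) n B%:Z.
    rewrite -cn; apply: le_trans (lpp_lattice _ lc n0).
    by apply: sum_mask_le (ltnW mn1) _ => // k /andP[mk kn]; apply: mQ; rewrite mk.
  have LM : \sum_(0 <= k < m.+1) W k (c k) <= lpp W m.+1 (c m) by exact: lpp_lattice.
  move: vF; rewrite FE (big_cat_nat _ (ltnW mn1)) //=; lra.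
case: cE => cE; [left; exists m.+1|right; exists m.+1]; split.
- by move: h2 far; rewrite cE h3; move: n0; rewrite h3; clear; lia.
- by apply: through; rewrite ?addn0 ?normrN ?normr_id.
- by move: h1 far; rewrite cE; clear; lia.
- by apply: through; rewrite ?add0n ?normr_id.
Qed.

(** A path to the cell at height [n1] is continued by one in the quadrant seen from there. The case
    distinctions concern predecessors outside the quadrant, where the second passage time is [0]. *)
Lemma lpp_concat (V V1 V2 : nat -> int -> R) (n1 : nat) (j1 : int) :
  (forall m j, 0 <= V m j) -> (forall m j, 0 <= V2 m j) -> (forall m j, V1 m j <= V m j) ->
  (forall m j, quadrant m j -> V2 m j <= V (n1 + m)%N (j1 + j)) ->
  forall (n : nat) (j : int), 0 <= j <= n%:Z -> lpp V1 n1 j1 + lpp (mask quadrant V2) n j <= lpp V (n1 + n) (j1 + j).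
Proof.
move=> V0 V20 V1V V2V; elim=> [|n IH] j jn.
  have -> : j = 0 by move: jn; clear; lia.
  by rewrite addn0 !addr0; apply: lpp_le.
rewrite addnS !lppS addrCA; apply: lerD.
  by rewrite /mask; case: ifP => // /V2V.
have L0 k l : 0 <= lpp V k l by exact: lpp_ge0.
have out k : ~~ (0 <= k <= n%:Z) -> lpp (mask quadrant V2) n k = 0.
  move=> kn; apply: lpp_eq0 => m i mn ik ki; rewrite /mask ifF // /quadrant.
  by move: kn mn ik ki; clear; lia.
have one k : k = j \/ k = j - 1 -> lpp V1 n1 j1 + lpp (mask quadrant V2) n k <=
    Num.max (lpp V (n1 + n) (j1 + j)) (lpp V (n1 + n) (j1 + j - 1)).
  move=> kj; have [kn|kn] := boolP (0 <= k <= n%:Z).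
    by rewrite le_max; case: kj => kj; move: (IH k kn); rewrite kj ?addrA => ->; rewrite ?orbT.
  rewrite out // addr0.
  have [k' [kj' kn']] : exists k' : int, (k' = j \/ k' = j - 1) /\ 0 <= k' <= n%:Z.
    by have [|] := boolP (0 <= j <= n%:Z) => h; [exists j|exists (j - 1)]; split; auto; move: h jn kn kj; clear; lia.
  have G0 : 0 <= lpp (mask quadrant V2) n k'.
    by apply: lpp_ge0 => m i; exact: mask_ge0.
  have := IH k' kn'; rewrite le_max; case: kj' G0 => -> G0; rewrite ?addrA => h.
    by apply/orP; left; apply: le_trans h; rewrite lerDl.
  by apply/orP; right; apply: le_trans h; rewrite lerDl.
by rewrite addr_maxr ge_max !one //; [right|left].
Qed.

End Deterministic.

Lemma tilt_drop (R : realType) (m eta H dd n c k h s : R) : 0 <= eta -> 0 <= k ->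
  h <= H - dd -> s <= n -> k * eta * n <= dd / 4 -> H + c <= dd / 4 ->
  m + eta * h + k * eta ^+ 2 * s + c * eta <= m - 2 * (eta * dd / 4).
Proof.
move=> e0 k0 hh ss kd hd; have h1 := ler_wpM2l e0 hh.
have h2 := ler_wpM2l (mulr_ge0 k0 (sqr_ge0 eta)) ss; have h3 := ler_wpM2l e0 kd.
have h4 := ler_wpM2l e0 hd; lra.
Qed.

Lemma drop_ineq (R : realType) (A i B p r H dd : R) : A * p - B * r <= H -> dd <= i -> i * 1 <= i * (1 * p) ->
  (A - i) * p - B * r <= H - dd.
Proof. by move=> h1 h2 h3; lra. Qed.

Lemma drop_ineq' (R : realType) (A i B p r H dd : R) : - H <= A * p - B * r -> dd <= i -> i * 1 <= i * (1 * r) ->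
  - (A * p - (B - i) * r) <= H - dd.
Proof. by move=> h1 h2 h3; lra. Qed.

(** * Probabilities of exits *)

Section ExitProbabilities.
Context {d : measure_display} {T : measurableType d} {R : realType} (P : probability T R).

Lemma probU (A B : set T) : measurable A -> measurable B -> prob P (A `|` B) <= prob P A + prob P B.
Proof.
move=> mA mB; rewrite -lee_fin EFinD -!probE //; last exact: measurableU.
exact: measureU2.
Qed.

Lemma prob_union_bound n (A A0 : set T) (D : nat -> set T) (c : R) :
  measurable A -> measurable A0 -> (forall i, measurable (D i)) ->
  (forall o, A o -> A0 o \/ exists2 i, (i < n)%N & D i o) ->
  (forall i, (i < n)%N -> prob P (D i) <= c) -> prob P A <= prob P A0 + n%:R * c.
Proof.
move=> mA + mD; elim: n A0 => [|n IH] A0 mA0 sub le.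
  by rewrite mul0r addr0; apply: prob_le => // o /sub [//| []].
have {}IH := IH (A0 `|` D n) (measurableU _ _ mA0 (mD n)).
apply: le_trans (IH _ _) _.
- move=> o /sub[h|[i iln' h]]; first by left; left.
  move: iln' h; rewrite ltnS leq_eqVlt => /predU1P[-> h|iln h]; [by left; right|by right; exists i].
- by move=> i iln; apply: le; exact: leqW.
- have := probU mA0 (mD n); have := le n (ltnSn n).
  by rewrite -natr1 mulrDl mul1r; move: (n%:R * c) (prob P _) (prob P _) (prob P _) => p q r s; lra.
Qed.

Variable E : nat * int -> T -> R.
Hypothesis fE : exp_field P E.
Local Notation e o := (fun c => E c o).
Variables (a b beta : R).
Hypothesis beta0 : 0 < beta.
Hypothesis a_bnd : beta <= a <= 1.
Hypothesis b_bnd : beta <= b <= 1.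
Local Notation W o := (wmod (step a b) (e o)).
Local Notation K := (2 / beta ^+ 3).
Local Notation C := (4 / beta ^+ 2).

Let E0 : forall c o, 0 <= E c o. Proof. by case: fE. Qed.
Let s0 (k : int) : 0 < step a b k.
Proof. by have /andP[h _] := step_bnd k a_bnd b_bnd; exact: lt_le_trans h. Qed.

Lemma measurable_mask A n j (u : R) : measurable [set o | lpp (mask A (W o)) n j <= u].
Proof.
have [mE _ _ _] := fE.
apply: (sgen_measurable mE (sgen_le (S := setT) _ _)).
apply: smeas_lpp => m i _ _ _; rewrite /mask; case: (A m i); last exact: smeas_cst.
by apply: smeasZr; exact: smeas_coord.
Qed.

Lemma measurable_mask_lt A n j (u : T -> R) : smeas E setT u ->
  measurable [set o | lpp (mask A (W o)) n j < u o].
Proof.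
move=> su; have [mE _ _ _] := fE.
have sY : smeas E setT (fun o => lpp (mask A (W o)) n j).
  apply: smeas_lpp => m i _ _ _; rewrite /mask; case: (A m i); last exact: smeas_cst.
  by apply: smeasZr; exact: smeas_coord.
have -> : [set o | lpp (mask A (W o)) n j < u o] =
   ~` [set o | u o + lpp (mask A (W o)) n j * (-1) <= 0].
  apply/seteqP; split => o /=; rewrite mulrN1 subr_le0 ltNge => /negP //.
apply: measurableC; apply: (sgen_measurable mE (sgen_le (S := setT) _ _)).
by apply: smeasD => //; exact: smeasZr.
Qed.

Lemma smeas_flat bb n j : smeas E setT (fun o => lpp (wmod bb (e o)) n j).
Proof. by apply: smeas_lpp => m i _ _ _; apply: smeasZr; exact: smeas_coord. Qed.

Lemma measurable_flat_gt (bb : int -> R) n j u : (forall i, 0 < bb i) ->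
  measurable [set o | u < lpp (wmod bb (e o)) n j].
Proof.
move=> bb0; rewrite (_ : [set o | _] = ~` [set o | lpp (wmod bb (e o)) n j <= u]); last first.
  by apply/seteqP; split => o /=; rewrite ltNge => /negP.
by apply: measurableC; exact: (measurable_flat fE).
Qed.

Lemma tilt_prob (eta m x : R) z1 z2 n j : `|eta| <= beta / 2 -> (16 / beta) ^+ 3 <= n%:R / 4 -> (0 < n)%N ->
  0 <= x -> flat_mean (tilt a b eta z1 z2) n j <= m ->
  prob P [set o | m + x < lpp (wmod (tilt a b eta z1 z2) (e o)) n j] <=
    tail_cst (beta / 2) 2 * expR (- (x / tail_scale (beta / 2) n)).
Proof.
move=> eb nB n0 x0 mm; apply: (flat_tail_abs fE) => //.
- by rewrite divr_gt0.
- by move=> i; exact: tilt_bnd.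
- have -> : 8 / (beta / 2) = 16 / beta by field; rewrite gt_eqF.
  by apply: (le_trans nB); lra.
Qed.

Let tilt0 (eta : R) z1 z2 i : `|eta| <= beta / 2 -> 0 < tilt a b eta z1 z2 i.
Proof.
move=> eb; have /andP[h _] := tilt_bnd z1 z2 i a_bnd b_bnd eb.
by apply: lt_le_trans h; rewrite divr_gt0.
Qed.

(** [kap] measures the distance of the direction [(I, J)] from the characteristic [(a^2, b^2)]. At
    every possible exit the tilt lowers the mean by [2 x]: one [x] is spent on the lower tail of the
    passage time, the other on the upper tail of the tilted one. *)
Lemma ray_prob (kap M H eta : R) (I J A B : nat) :
  0 < kap -> 0 <= M -> 0 < eta -> eta <= beta / 2 -> K * eta * (M + 1) <= kap / 2 ->
  (A <= I)%N -> (B <= J)%N -> (0 < I)%N -> (0 < J)%N -> I%:R <= M * J%:R ->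
  kap <= I%:R / J%:R / a ^+ 2 - 1 / b ^+ 2 ->
  (I - A)%:R / a ^+ 2 <= (J - B)%:R / b ^+ 2 + H ->
  H + 1 / a ^+ 2 + C <= kap * (J - B)%:R / 4 ->
  (16 / beta) ^+ 3 <= (A + B)%:R / 4 -> right_of_ray I J (A + B).-1 B%:Z ->
  prob P [set o | lpp (mask (right_of_ray I J) (W o)) (A + B) B%:Z < lpp (W o) (A + B) B%:Z] <=
  prob P [set o | lpp (W o) (A + B) B%:Z <= A%:R / a + B%:R / b - eta * kap * (J - B)%:R / 8] +
  B.+1%:R * (tail_cst (beta / 2) 2 * expR (- (eta * kap * (J - B)%:R / 8 / tail_scale (beta / 2) (A + B)))).
Proof.
move=> kap0 M0 eta0 etab Keta AI BJ I0 J0 IM kapE HE rH nB endR.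
have eb : `|eta| <= beta / 2 by rewrite gtr0_norm.
have n0 : (0 < A + B)%N.
  rewrite lt0n; apply/eqP => n0; move: nB; rewrite n0 mul0r leNgt exprn_gt0 //.
  by rewrite divr_gt0.
set x := eta * kap * (J - B)%:R / 8.
have x0 : 0 <= x by rewrite divr_ge0 ?mulr_ge0 // ltW.
pose zi j := ((j * I) %/ J).+1.
pose D j : set T := if (zi j <= A)%N then [set o | A%:R / a + B%:R / b - x < lpp (wmod (tilt a b eta (zi j) j) (e o)) (A + B) B%:Z] else set0.
apply: (prob_union_bound (D := D)).
- by apply: measurable_mask_lt; exact: smeas_flat.
- exact: (measurable_flat fE).
- move=> j; rewrite /D; case: ifP => // _; apply: measurable_flat_gt => i; exact: tilt0.
- move=> o /= YF; have [Fv|vF] := leP (lpp (W o) (A + B) B%:Z) (A%:R / a + B%:R / b - x); [by left|right].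
  have [z1 [z2 [z1A z2B z1E Fl]]] := @ray_exit R a b beta (e o) beta0 a_bnd b_bnd (fun c => E0 c o) I J A B _ eta I0 J0 eb n0 endR YF (lexx _).
  by exists z2 => //; rewrite /D /zi -z1E z1A /=; exact: lt_le_trans Fl.
move=> j jB; rewrite /D; case: ifP => ziA; last first.
  by rewrite /prob measure0 mulr_ge0 ?expR_ge0 ?tail_cst_ge0.
have -> : A%:R / a + B%:R / b - x = (A%:R / a + B%:R / b - 2 * x) + x by ring.
apply: tilt_prob => //.
have jB' : (j <= B)%N by [].
apply: (le_trans (tilt_mean beta0 a_bnd b_bnd eb ziA jB' _)); first by rewrite addSn.
have J0' : 0 < J%:R :> R by rewrite ltr0n.
have a0 : 0 < a by have /andP[h _] := a_bnd; exact: lt_le_trans h.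
have b0 : 0 < b by have /andP[h _] := b_bnd; exact: lt_le_trans h.
have z1 : (zi j)%:R <= j%:R * I%:R / J%:R + 1 :> R.
  by rewrite -natr1 lerD2r ler_pdivlMr // -!natrM ler_nat leq_divM.
have z2 : j%:R * I%:R / J%:R <= (zi j)%:R :> R.
  by rewrite ler_pdivrMr // -!natrM ler_nat ltnW // ltn_ceil.
move: HE rH x0; rewrite /x !natrB //.
move: ((zi j)%:R : R) z1 z2 => z z1 z2 HE rH x0.
set q : R := I%:R / J%:R in kapE.
have IE : I%:R = q * J%:R by rewrite /q divfK // gt_eqF.
have jJ : j%:R + (J%:R - B%:R) <= J%:R :> R by have : j%:R <= B%:R :> R by [rewrite ler_nat]; lra.
have qM : q <= M by rewrite /q ler_pdivrMr.
have zq1 : z <= q * j%:R + 1 by rewrite /q; move: z1; rewrite mulrAC; lra.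
have zq2 : q * j%:R <= z by rewrite /q; move: z2; rewrite mulrAC; lra.
have r20 : 0 <= J%:R - B%:R :> R by rewrite subr_ge0 ler_nat.
set y := J%:R - j%:R : R; have yr : J%:R - B%:R <= y by rewrite /y; lra.
(* Along the ray the bracket of [tilt_mean] is proportional to the distance [y] to [(I, J)], up to
   errors. As [y] is at least [J - B], the displacement of the end point keeps it large even for
   late exits. *)
have hlo : kap * y - H - 1 / a ^+ 2 <= (A%:R - z) / a ^+ 2 - (B%:R - j%:R) / b ^+ 2.
  have h1 : (q * y - 1) / a ^+ 2 - y / b ^+ 2 - ((I%:R - A%:R) / a ^+ 2 - (J%:R - B%:R) / b ^+ 2) <=
     (A%:R - z) / a ^+ 2 - (B%:R - j%:R) / b ^+ 2.
    have : (q * y - 1 - (I%:R - A%:R)) / a ^+ 2 <= (A%:R - z) / a ^+ 2.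
      by rewrite ler_wpM2r ?invr_ge0 ?sqr_ge0 // IE /y; lra.
    by move: (a ^+ 2)^-1 (b ^+ 2)^-1 => p r; rewrite /y; lra.
  have y0 : 0 <= y by lra.
  have := ler_wpM2r y0 kapE; move: h1 HE; move: (a ^+ 2)^-1 (b ^+ 2)^-1 => p r; lra.
have shi : (A%:R - z) + (B%:R - j%:R) <= (M + 1) * y.
  have y0 : 0 <= y by lra.
  have := ler_wpM2r y0 qM; have : A%:R <= I%:R :> R by rewrite ler_nat.
  have : B%:R <= J%:R :> R by rewrite ler_nat.
  rewrite IE /y; lra.
rewrite (gtr0_norm eta0).
have h2 := ler_wpM2l (ltW eta0) hlo.
have K0 : 0 <= K * eta ^+ 2 by rewrite mulr_ge0 ?sqr_ge0 // divr_ge0 // exprn_ge0 // ltW.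
have h3 := ler_wpM2l K0 shi.
have y0 : 0 <= y by lra.
have h4 := ler_wpM2r (mulr_ge0 (ltW eta0) y0) Keta.
have h5 := ler_wpM2l (ltW eta0) rH.
have h6 := ler_wpM2l (mulr_ge0 (ltW eta0) (ltW kap0)) yr.
move: h2 h3 h4 h5 h6; move: (_ / a ^+ 2 - _ / b ^+ 2) (1 / a ^+ 2) K C (A%:R / a + B%:R / b) => h p k c m.
move: (A%:R - z + (B%:R - j%:R)) => s.
lra.
Qed.

(** The end point lies on the characteristic up to [H], so an exit beyond [dd] makes the bracket of
    [tilt_mean] at least [dd - H] in absolute value. The second-order term and the remaining errors
    cost a quarter of [dd] each. *)
Lemma quadrant_prob (H eta : R) (A B dd : nat) : (0 < A)%N -> (0 < B)%N -> (0 < dd)%N ->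
  0 < eta -> eta <= beta / 2 -> `|A%:R / a ^+ 2 - B%:R / b ^+ 2| <= H ->
  H + C <= dd%:R / 4 -> K * eta * (A + B)%:R <= dd%:R / 4 ->
  (16 / beta) ^+ 3 <= (A + B)%:R / 4 -> (16 / beta) ^+ 3 <= dd%:R / 4 ->
  prob P [set o | lpp (mask quadrant (W o)) (A + B) B%:Z <
     A%:R / a + B%:R / b - eta * dd%:R / 4 - (dd%:R / beta + dd%:R)] <=
  prob P [set o | lpp (W o) (A + B) B%:Z <= A%:R / a + B%:R / b - eta * dd%:R / 4] +
  2 * (tail_cst (beta / 2) 2 * expR (- (dd%:R / tail_scale (beta / 2) dd))) +
  (A + B).+2%:R * (tail_cst (beta / 2) 2 * expR (- (eta * dd%:R / 8 / tail_scale (beta / 2) (A + B)))).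
Proof.
move=> A0 B0 d0 eta0 etab HE Hd Kd nB nd.
have eb : `|eta| <= beta / 2 by rewrite gtr0_norm.
have eb' : `|- eta| <= beta / 2 by rewrite normrN.
have n0 : (0 < A + B)%N by rewrite addn_gt0 A0.
set n := (A + B)%N in nB n0 Kd *; set m := A%:R / a + B%:R / b.
have a0 : 0 < a by have /andP[h _] := a_bnd; exact: lt_le_trans h.
have b0 : 0 < b by have /andP[h _] := b_bnd; exact: lt_le_trans h.
have a1 : 1 <= 1 / a ^+ 2 by rewrite ler_pdivlMr ?exprn_gt0 // mul1r expr_le1 ?(ltW a0) //; have /andP[] := a_bnd.
have b1 : 1 <= 1 / b ^+ 2 by rewrite ler_pdivlMr ?exprn_gt0 // mul1r expr_le1 ?(ltW b0) //; have /andP[] := b_bnd.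
have d0' : 0 < dd%:R :> R by rewrite ltr0n.
(* [dd / beta] bounds the means of the initial segments along the axes; the additional [dd] makes an
   excess over [D] exponentially unlikely. *)
set x := eta * dd%:R / 4; set D := dd%:R / beta + dd%:R.
have x0 : 0 <= eta * dd%:R / 8 by rewrite divr_ge0 // mulr_ge0 // ltW.
pose D1 := [set o | D < lpp (W o) dd 0]; pose D2 := [set o | D < lpp (W o) dd dd%:Z].
pose D0 := [set o | lpp (W o) n B%:Z <= m - x].
have mD1 : measurable D1 by exact: measurable_flat_gt.
have mD2 : measurable D2 by exact: measurable_flat_gt.
have mD0 : measurable D0 by exact: (measurable_flat fE).
have sb (i : int) : beta / 2 <= step a b i <= 2.
  by have /andP[h1 h2] := step_bnd i a_bnd b_bnd; apply/andP; split; lra.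
have near j : flat_mean (step a b) dd j <= dd%:R / beta -> 
    prob P [set o | D < lpp (W o) dd j] <= tail_cst (beta / 2) 2 * expR (- (dd%:R / tail_scale (beta / 2) dd)).
  move=> mj; apply: (flat_tail_abs fE) => //; first by rewrite divr_gt0.
  have -> : 8 / (beta / 2) = 16 / beta by field; rewrite gt_eqF.
  by apply: (le_trans nd); lra.
have P1 : prob P D1 <= tail_cst (beta / 2) 2 * expR (- (dd%:R / tail_scale (beta / 2) dd)).
  apply: near; have := step_mean a b dd 0; rewrite addn0 mul0r addr0 => ->.
  by rewrite ler_wpM2l // lef_pV2 ?posrE //; have /andP[] := a_bnd.
have P2 : prob P D2 <= tail_cst (beta / 2) 2 * expR (- (dd%:R / tail_scale (beta / 2) dd)).
  apply: near; have := step_mean a b 0 dd; rewrite add0n mul0r add0r => ->.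
  by rewrite ler_wpM2l // lef_pV2 ?posrE //; have /andP[] := b_bnd.
(* One index enumerates the exits [(i, 0)] with [i <= A] and, after them, the exits
   [(0, i - A.+1)]. *)
pose Z i : set T := if (i <= A)%N then
    (if (dd < i)%N then [set o | (m - 2 * x) + eta * dd%:R / 8 < lpp (wmod (tilt a b (- eta) i 0) (e o)) n B%:Z] else set0)
  else let k := (i - A.+1)%N in
    (if (dd < k <= B)%N then [set o | (m - 2 * x) + eta * dd%:R / 8 < lpp (wmod (tilt a b eta 0 k) (e o)) n B%:Z] else set0).
have vE : (m - 2 * x) + eta * dd%:R / 8 < m - x.
  have : 0 < eta * dd%:R by rewrite mulr_gt0.
  by rewrite /x; lra.
apply: (@le_trans _ _ (prob P (D0 `|` (D1 `|` D2)) + n.+2%:R * (tail_cst (beta / 2) 2 * expR (- (eta * dd%:R / 8 / tail_scale (beta / 2) n))))).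
  apply: (prob_union_bound (D := Z)).
  - by apply: measurable_mask_lt; exact: smeas_cst.
  - by do 2! apply: measurableU => //.
  - by move=> i; rewrite /Z /=; case: ifP => _; case: ifP => _ //; apply: measurable_flat_gt => k; exact: tilt0.
  - move=> o /= Go.
    have [Fv|vF] := leP (lpp (W o) n B%:Z) (m - x); first by left; left.
    have [d1|d1] := leP (lpp (W o) dd 0) D; last by left; right; left.
    have [d2|d2] := leP (lpp (W o) dd dd%:Z) D; last by left; right; right.
    right; have := @quadrant_exit R a b beta (e o) beta0 a_bnd b_bnd (fun c => E0 c o) A B dd _ D eta A0 B0 eb Go (ltW vF) d1 d2.
    rewrite (gtr0_norm eta0) => -[[z1 [/andP[z1d z1A] h]]|[z2 [/andP[z2d z2B] h]]].
      exists z1; first by rewrite /n; move: z1A; clear; lia.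
      by rewrite /Z z1A z1d /=; exact: lt_le_trans h.
    exists (A.+1 + z2)%N; first by rewrite /n; move: z2B; clear; lia.
    rewrite /Z ifF; last by clear; lia.
    by rewrite /= addKn z2d z2B /=; exact: lt_le_trans h.
  move=> i _; rewrite /Z /=.
  have c0 : 0 <= tail_cst (beta / 2) 2 * expR (- (eta * dd%:R / 8 / tail_scale (beta / 2) n)).
    by rewrite mulr_ge0 ?expR_ge0 ?tail_cst_ge0.
  have set0E : prob P set0 = 0 by rewrite /prob measure0.
  have K0 : 0 <= K by rewrite divr_ge0 // exprn_ge0 // ltW.
  have fin (h s : R) : h <= H - dd%:R -> s <= n%:R -> m + eta * h + K * eta ^+ 2 * s + C * eta <= m - 2 * x.
    by move=> hh ss; apply: (tilt_drop _ (ltW eta0) K0 hh ss Kd Hd).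
  have [iA|iA] := boolP (i <= A)%N.
    have [di|_] := boolP (dd < i)%N; last by rewrite set0E.
    apply: tilt_prob => //.
    have z12 : (0 < i + 0)%N by rewrite addn0 (leq_trans _ di).
    apply: (le_trans (tilt_mean beta0 a_bnd b_bnd eb' iA (leq0n B) z12)).
    have di' : dd%:R <= i%:R :> R by rewrite ler_nat ltnW.
    rewrite sqrrN normrN (gtr0_norm eta0) subn0 natrB // -/m mulNr opprK; apply: fin.
      move: HE; rewrite ler_norml => /andP[_ HE].
      by apply: drop_ineq HE di' _; rewrite ler_wpM2l.
    by rewrite /n natrD lerD2r gerBl.
  have [/andP[dk kB]|_] := boolP (dd < i - A.+1 <= B)%N; last by rewrite set0E.
  move: (i - A.+1)%N dk kB => k dk kB; apply: tilt_prob => //.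
  have z12 : (0 < 0 + k)%N by rewrite add0n (leq_trans _ dk).
  apply: (le_trans (tilt_mean beta0 a_bnd b_bnd eb (leq0n A) kB z12)).
  have di' : dd%:R <= k%:R :> R by rewrite ler_nat ltnW.
  rewrite (gtr0_norm eta0) subn0 natrB // -/m -mulrN; apply: fin.
    move: HE; rewrite ler_norml => /andP[HE _].
    by apply: drop_ineq' HE di' _; rewrite ler_wpM2l.
  by rewrite /n natrD lerD2l gerBl.
have := probU mD0 (measurableU _ _ mD1 mD2); have := probU mD1 mD2.
rewrite -/D0; move: P1 P2.
move: (prob P D1) (prob P D2) (prob P D0) (prob P (D1 `|` D2)) (prob P (D0 `|` (D1 `|` D2))) => p1 p2 p0 p12 p012.
by move: (n.+2%:R * _) (tail_cst _ _ * _) => u v; lra.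
Qed.

End ExitProbabilities.

(** * Choice of the distances *)

Section Growth.
Context {R : realType}.

Lemma near_large (u : nat -> R) c : u k @[k --> \oo] --> +oo -> \forall k \near \oo, c <= u k.
Proof. by move/cvgryPge; apply. Qed.

Lemma poly_expR_cvg0 (u : nat -> R) (c C : R) m : 0 < c -> 0 <= C -> u k @[k --> \oo] --> +oo ->
  C * u k ^+ m * expR (- (c * u k)) @[k --> \oo] --> 0.
Proof.
move=> c0 C0 uoo; pose F : R := (m.+1)`!%:R / c ^+ m.+1.
have F0 : 0 <= C * F by rewrite mulr_ge0 // divr_ge0 // exprn_ge0 // ltW.
apply/cvgr0Pnorm_le => e e0; near=> k.
have u1 : 1 <= u k by near: k; exact: near_large.
have u0 : 0 < u k by exact: lt_le_trans u1.
have ue : C * F / e <= u k by near: k; exact: near_large.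
rewrite ger0_norm ?mulr_ge0 ?expR_ge0 ?exprn_ge0 ?(ltW u0) //.
rewrite expRN ler_pdivrMr ?expR_gt0 //.
have h : (c * u k) ^+ m.+1 / (m.+1)`!%:R <= expR (c * u k).
  apply: le_trans (expR_ge1Dxn m (mulr_ge0 (ltW c0) (ltW u0))); by rewrite lerDr.
apply: (@le_trans _ _ (e * ((c * u k) ^+ m.+1 / (m.+1)`!%:R))); last by rewrite ler_pM2l.
rewrite ler_pdivrMr // in ue.
have f0 : 0 < (m.+1)`!%:R :> R by rewrite ltr0n fact_gt0.
have -> : C * u k ^+ m = C * F * (c ^+ m.+1 / (m.+1)`!%:R) * u k ^+ m.
  by rewrite /F; field; rewrite expf_neq0 ?gt_eqF.
have -> : e * ((c * u k) ^+ m.+1 / (m.+1)`!%:R) = (u k * e) * (c ^+ m.+1 / (m.+1)`!%:R) * u k ^+ m.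
  by rewrite exprMn [u k ^+ m.+1]exprS; ring.
by rewrite ler_wpM2r ?exprn_ge0 ?(ltW u0) // ler_wpM2r // divr_ge0 ?exprn_ge0 // ltW.
Unshelve. all: by end_near. Qed.

Lemma expr_ge_id (U : R) m : 1 <= U -> U <= U ^+ m.+1.
Proof. by move=> U1; rewrite exprS ler_peMr ?exprn_ege1 // (le_trans ler01). Qed.

Lemma cbrt_le (n : nat) (x : R) : 0 <= x -> n%:R <= x ^+ 3 -> (n%:R : R) `^ 3^-1 <= x.
Proof.
move=> x0 nx; have -> : x = (x ^+ 3) `^ 3^-1.
  by rewrite -powR_mulrn // -powRrM mulfV // powRr1.
by rewrite ge0_ler_powR ?invr_ge0 ?nnegrE ?exprn_ge0.
Qed.

(** The displacement is [U^21] times [(a^2, b^2)], rounded down, so [r1 / a^2] and [r2 / b^2] agree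
    up to [1 / beta^2]. As [I / J] exceeds [a^2 / b^2] by a margin proportional to [kap], this moves
    the end point strictly to the right of the ray; the lower bounds on [U] absorb the rounding. *)
Lemma radii (a b beta kap M U : R) (I J : nat) : 0 < beta -> beta <= a <= 1 -> beta <= b <= 1 ->
  0 < kap -> 0 <= M -> (0 < I)%N -> (0 < J)%N -> (I + J)%:R = U ^+ 60 -> I%:R <= M * J%:R ->
  kap <= I%:R / J%:R / a ^+ 2 - 1 / b ^+ 2 ->
  3 <= U -> 2 * (M + 1) <= U -> 4 / beta ^+ 2 <= U -> 4 * (1 + 1 / beta ^+ 2) / (beta ^+ 4 * kap) <= U ->
  let r1 := Num.truncn (U ^+ 21 * a ^+ 2) in let r2 := Num.truncn (U ^+ 21 * b ^+ 2) in
  [/\ (r1 <= I)%N, (r2 <= J)%N, beta ^+ 2 / 2 * U ^+ 21 <= r2%:R /\ beta ^+ 2 / 2 * U ^+ 21 <= r1%:R,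
    r1%:R <= U ^+ 21 /\ r2%:R <= U ^+ 21 &
    [/\ U <= ((I - r1) + (J - r2))%:R :> R, `|r1%:R / a ^+ 2 - r2%:R / b ^+ 2| <= 1 / beta ^+ 2,
     right_of_ray I J ((I - r1) + (J - r2)).-1 (J - r2)%:Z & U ^+ 60 <= 2 * ((I - r1) + (J - r2))%:R]].
Proof.
move=> beta0 /andP[a1 a2] /andP[b1 b2] kap0 M0 I0 J0 NE IM kapE U3 UM Ub Uk r1 r2.
have a0 : 0 < a by exact: lt_le_trans a1.
have b0 : 0 < b by exact: lt_le_trans b1.
have U1 : 1 <= U by apply: le_trans U3; rewrite ler1n.
have U0 : 0 <= U by exact: le_trans U1.
set x := U ^+ 21; have xU : U <= x by exact: expr_ge_id.
have x0 : 0 <= x by exact: le_trans xU.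
have NU : x * U <= (I + J)%:R.
  rewrite NE (_ : U ^+ 60 = x * U ^+ 39); last by rewrite /x -exprD.
  by rewrite ler_wpM2l // expr_ge_id.
have sq c : beta <= c -> c <= 1 -> 0 < c -> [/\ beta ^+ 2 <= c ^+ 2, c ^+ 2 <= 1, 0 < c ^+ 2 & 1 / c ^+ 2 <= 1 / beta ^+ 2].
  move=> c1 c2 c0; have h : beta ^+ 2 <= c ^+ 2 by rewrite ler_pXn2r ?nnegrE // ltW.
  have c3 : c ^+ 2 <= 1 by rewrite expr_le1 // ltW.
  by split => //; rewrite ?exprn_gt0 // ler_wpM2l // lef_pV2 ?posrE ?exprn_gt0.
have [as1 as2 as0 as3] := sq a a1 a2 a0; have [bs1 bs2 bs0 bs3] := sq b b1 b2 b0.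
have bb0 : 0 < beta ^+ 2 by rewrite exprn_gt0.
have /andP[r1a r1b] := truncn_itv (mulr_ge0 x0 (ltW as0)).
have /andP[r2a r2b] := truncn_itv (mulr_ge0 x0 (ltW bs0)).
rewrite -/r1 -natr1 in r1a r1b; rewrite -/r2 -natr1 in r2a r2b.
have J0' : 0 < J%:R :> R by rewrite ltr0n.
set q : R := I%:R / J%:R in kapE.
have IE : I%:R = q * J%:R by rewrite /q divfK // gt_eqF.
have xb : 4 <= x * beta ^+ 2 by move: Ub; rewrite ler_pdivrMr // => h; apply: le_trans h _; rewrite ler_pM2r.
have qa : a ^+ 2 * (kap + 1 / b ^+ 2) <= q.
  have : kap + 1 / b ^+ 2 <= q / a ^+ 2 by move: kapE; clear; lra.
  by rewrite ler_pdivlMr // mulrC.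
have ibs : 1 <= 1 / b ^+ 2 by rewrite ler_pdivlMr // mul1r.
have q1 : a ^+ 2 <= q.
  by apply: le_trans qa; rewrite ler_peMr ?(ltW as0) //; move: kap0 ibs; clear; lra.
have NJ : (I + J)%:R <= (M + 1) * J%:R :> R by rewrite natrD mulrDl mul1r lerD2r.
have J2x : 2 * x <= J%:R.
  have M1 : 0 < M + 1 by rewrite ltr_wpDl.
  rewrite -(ler_pM2l M1) (le_trans _ NJ) // (le_trans _ NU) // mulrA mulrC ler_wpM2l //.
  by rewrite mulrC.
have I2x : 2 * x * a ^+ 2 <= I%:R.
  rewrite IE mulrC; apply: ler_pM => //; [exact: ltW|by rewrite mulr_ge0].
have r1I : (r1 <= I)%N by rewrite -(ler_nat R); have := mulr_ge0 x0 (ltW as0); move: r1a I2x; clear; lra.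
have r2J : (r2 <= J)%N.
  rewrite -(ler_nat R); apply: (le_trans r2a); apply: le_trans J2x.
  have : x * b ^+ 2 <= x * 1 by rewrite ler_wpM2l.
  by move: x0; clear; lra.
have xas : x * beta ^+ 2 <= x * a ^+ 2 by rewrite ler_wpM2l.
have xbs : x * beta ^+ 2 <= x * b ^+ 2 by rewrite ler_wpM2l.
have xa1 : x * a ^+ 2 <= x * 1 by rewrite ler_wpM2l.
have xb1 : x * b ^+ 2 <= x * 1 by rewrite ler_wpM2l.
have c2 : beta ^+ 2 / 2 * x = x * beta ^+ 2 / 2 by ring.
have r2lo : beta ^+ 2 / 2 * x <= r2%:R by rewrite c2; move: xbs xb r2b; clear; lra.
have NA : (I - r1 + (J - r2))%:R = (I + J)%:R - r1%:R - r2%:R :> R by rewrite !natrD !natrB //; ring.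
have A1 : (0 < I - r1)%N by rewrite subn_gt0 -(ltr_nat R); move: r1a I2x xas xb bb0 x0; clear; lra.
split => //; first by split => //; rewrite c2; move: xas xb r1b; clear; lra.
  by split; [move: r1a xa1|move: r2a xb1]; clear; lra.
split.
- rewrite NA; have : x * 3 <= x * U by rewrite ler_wpM2l.
  by move: NU xU r1a r2a xa1 xb1 x0; clear; lra.
- have h1 : x - 1 / beta ^+ 2 <= r1%:R / a ^+ 2 <= x.
    rewrite ler_pdivlMr // ler_pdivrMr // r1a andbT.
    have : 1 / a ^+ 2 * a ^+ 2 <= 1 / beta ^+ 2 * a ^+ 2 by rewrite ler_wpM2r // ltW.
    by rewrite divfK ?gt_eqF // mulrBl; move: r1b; clear; lra.
  have h2 : x - 1 / beta ^+ 2 <= r2%:R / b ^+ 2 <= x.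
    rewrite ler_pdivlMr // ler_pdivrMr // r2a andbT.
    have : 1 / b ^+ 2 * b ^+ 2 <= 1 / beta ^+ 2 * b ^+ 2 by rewrite ler_wpM2r // ltW.
    by rewrite divfK ?gt_eqF // mulrBl; move: r2b; clear; lra.
  by move: h1 h2 => /andP[h1 h1'] /andP[h2 h2']; rewrite ler_norml lerBrDr lerBlDr; apply/andP; split; [move: h1 h2'|move: h1' h2]; clear; lra.
- suff h : (J - r2)%:R * I%:R < ((I - r1)%:R - 1) * J%:R :> R.
    rewrite /right_of_ray -(ltr_int R) !intrM !intrB /= (_ : (I - r1 + (J - r2)).-1 = ((I - r1).-1 + (J - r2))%N); last by move: A1; clear; lia.
    have e1 : (I - r1)%:R - 1 = (I - r1).-1%:R :> R by rewrite -{1}(prednK A1) -natr1 addrK.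
    by move: h; rewrite e1 !pmulrn PoszD intrD addrK.
  rewrite !natrB // IE.
  suff : r1%:R + 1 < r2%:R * q.
    by rewrite -(ltr_pM2r J0'); clear; lra.
  have h1 : r2%:R * (a ^+ 2 * (kap + 1 / b ^+ 2)) <= r2%:R * q by rewrite ler_wpM2l.
  have h2 : (x * b ^+ 2 - 1) * (a ^+ 2 * (1 / b ^+ 2)) <= r2%:R * (a ^+ 2 * (1 / b ^+ 2)).
    by rewrite ler_wpM2r ?mulr_ge0 ?invr_ge0 ?ltW //; move: r2b; clear; lra.
  have h3 : (x * b ^+ 2 - 1) * (a ^+ 2 * (1 / b ^+ 2)) = x * a ^+ 2 - a ^+ 2 * (1 / b ^+ 2).
    by field; rewrite gt_eqF.
  have h4 : a ^+ 2 * (1 / b ^+ 2) <= 1 / beta ^+ 2.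
    by apply: le_trans bs3; rewrite ler_piMl // divr_ge0 // ltW.
  have h5 : beta ^+ 2 / 2 * x * (beta ^+ 2 * kap) <= r2%:R * (a ^+ 2 * kap).
    have p1 : 0 <= beta ^+ 2 / 2 * x by apply: mulr_ge0 => //; apply: divr_ge0 => //; exact: ltW.
    have p2 : 0 <= beta ^+ 2 * kap by apply: mulr_ge0; exact: ltW.
    by apply: ler_pM => //; rewrite ler_wpM2r // ltW.
  have h6 : 4 * (1 + 1 / beta ^+ 2) <= x * (beta ^+ 4 * kap).
    have bk : 0 < beta ^+ 4 * kap by rewrite mulr_gt0 // exprn_gt0.
    by move: Uk; rewrite ler_pdivrMr // => h; apply: (le_trans h); rewrite ler_pM2r.
  have h7 : beta ^+ 2 / 2 * x * (beta ^+ 2 * kap) = x * (beta ^+ 4 * kap) / 2 by ring.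
  have h8 : 0 < 1 / beta ^+ 2 by rewrite divr_gt0.
  have h9 : r2%:R * (a ^+ 2 * (kap + 1 / b ^+ 2)) = r2%:R * (a ^+ 2 * kap) + r2%:R * (a ^+ 2 * (1 / b ^+ 2)) by ring.
  by move: r1a h1 h2 h3 h4 h5 h6 h7 h8 h9; clear; lra.
- rewrite NA; have : x * 4 <= x * U ^+ 39.
    by rewrite ler_wpM2l //; apply: (@le_trans _ _ (U ^+ 2)); [move: U3; clear; nra|rewrite ler_weXn2l].
  have -> : U ^+ 60 = x * U ^+ 39 by rewrite /x -exprD.
  rewrite NE (_ : U ^+ 60 = x * U ^+ 39); last by rewrite /x -exprD.
  by move: r1a r2a xa1 xb1; clear; lra.
Qed.

End Growth.

(** * The lower tail from the limit law *)

Section LowTail.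
Context {d : measure_display} {T : measurableType d} {R : realType} (P : probability T R).

(** For each fixed [y] the level eventually falls below the mean plus [y] times half the scale, so
    the probability is asymptotically at most [F_GOE y], which can be made small. *)
Lemma low_tail (EE : nat -> nat * int -> T -> R) (beta B : R) (b : nat -> int -> R)
    (n : nat -> nat) (j : nat -> int) (x : nat -> R) :
  (forall k, exp_field P (EE k)) -> (forall e : R, 0 < e -> exists y : R, F_GOE y < e) ->
  0 < beta -> (forall k i, beta <= b k i <= B) -> ((n k)%:R : R) @[k --> \oo] --> +oo ->
  (forall M : R, \forall k \near \oo, M * (n k)%:R `^ 3^-1 <= x k) ->
  prob P [set o | lpp (wmod (b k) (fun c => EE k c o)) (n k) (j k) <= flat_mean (b k) (n k) (j k) - x k]
    @[k --> \oo] --> 0.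
Proof.
move=> fEE F0 beta0 bB noo xx; apply/cvgr0Pnorm_le => e e0.
have [y ye] := F0 e e0.
have b0 k i : 0 < b k i by have /andP[h _] := bB k i; exact: lt_le_trans h.
have cy : (fun=> y) k @[k --> \oo] --> y by exact: cvg_cst.
have Fe := @cvgr_lt R nat \oo _ _ _ (@flat_cvg _ _ _ P EE fEE beta B b n j (fun=> y) y beta0 bB noo cy) e ye.
near=> k; rewrite ger0_norm ?prob_ge0 //.
have n0 : (0 < n k)%N.
  by rewrite -(ltr_nat R) (@lt_le_trans _ _ (1 : R)) //; near: k; exact: near_large.
apply: ltW; apply: (@le_lt_trans _ _ (prob P [set o | lpp (wmod (b k) (fun c => EE k c o)) (n k) (j k) <=
  flat_mean (b k) (n k) (j k) + flat_scale (b k) (n k) (j k) / 2 * y])); last by near: k; apply: Fe.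
apply: prob_le; [exact: (measurable_flat (fEE k))..|].
move=> o /= h; apply: (le_trans h); rewrite lerD2l.
have st := flat_scale_tail (j k) beta0 (fun i => (andP (bB k i)).1) n0.
have [q0 _] := flat_scale_cube (j k) (b0 k) n0.
have hx : `|y| / beta * (n k)%:R `^ 3^-1 <= x k by near: k; exact: xx.
rewrite lerNl -mulrN; apply: le_trans hx; apply: (@le_trans _ _ (flat_scale (b k) (n k) (j k) / 2 * `|y|)).
  by rewrite ler_wpM2l ?divr_ge0 ?(ltW q0) // -normrN ler_norm.
by have := ler_wpM2r (normr_ge0 y) st; rewrite /tail_scale => h'; apply: (le_trans h'); rewrite mulrC mulrAC mulrA.
Unshelve. all: by end_near. Qed.

End LowTail.

Lemma powR60 (R : realType) (n : nat) : ((n%:R : R) `^ 60%:R^-1) ^+ 60 = n%:R.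
Proof. by rewrite -powR_mulrn ?powR_ge0 // -powRrM mulVf ?powRr1 // pnatr_eq0. Qed.

(** * Paths to the moved point and the last stretch *)

Section Decor.
Context {d : measure_display} {T : measurableType d} {R : realType} (P : probability T R).
Variable E : nat * int -> T -> R.
Hypothesis fE : exp_field P E.
Local Notation e o := (fun c => E c o).
Variables (a b beta kap M : R) (I J : nat -> nat).
Hypothesis beta0 : 0 < beta.
Hypothesis a_bnd : beta <= a <= 1.
Hypothesis b_bnd : beta <= b <= 1.
Hypothesis kap0 : 0 < kap.
Hypothesis M0 : 0 <= M.
Hypothesis I0 : forall k, (0 < I k)%N.
Hypothesis J0 : forall k, (0 < J k)%N.
Hypothesis IM : forall k, (I k)%:R <= M * (J k)%:R.
Hypothesis kapE : forall k, kap <= (I k)%:R / (J k)%:R / a ^+ 2 - 1 / b ^+ 2.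
Hypothesis Noo : ((I k + J k)%N%:R : R) @[k --> \oo] --> +oo.
Hypothesis F_GOE0 : forall e : R, 0 < e -> exists y : R, F_GOE y < e.
Local Notation W o := (wmod (step a b) (e o)).

(* Everything is measured in powers of the 60th root of the size: the fluctuations are of order
   [u ^+ 20], the end point is moved back by [u ^+ 21], and the paths of length [u ^+ 21] are
   controlled up to [u ^+ 19]. *)
Definition unit_scale (k : nat) : R := (I k + J k)%:R `^ 60%:R^-1.
Local Notation u := unit_scale.
Definition back1 k := Num.truncn (u k ^+ 21 * a ^+ 2).
Definition back2 k := Num.truncn (u k ^+ 21 * b ^+ 2).
Definition entry k := Num.truncn (u k ^+ 19).
Local Notation A k := (I k - back1 k)%N.
Local Notation B k := (J k - back2 k)%N.

Lemma unit_scale_oo : u k @[k --> \oo] --> +oo.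
Proof.
apply/cvgryPge => c; pose c' := Num.max c 1.
have c0 : 0 <= c' by rewrite le_max ler01 orbT.
near=> k; apply: (@le_trans _ _ c'); first by rewrite le_max lexx.
rewrite leNgt; apply/negP => uc.
have : u k ^+ 60 < c' ^+ 60 by rewrite ltr_pXn2r ?nnegrE ?powR_ge0.
rewrite powR60; apply/negP; rewrite -leNgt; near: k; exact: near_large.
Unshelve. all: by end_near. Qed.

Definition radii_ok k : Prop :=
  [/\ [/\ (back1 k <= I k)%N, (back2 k <= J k)%N, 1 <= u k & (A k + B k)%:R <= u k ^+ 60],
    beta ^+ 2 / 2 * u k ^+ 21 <= (back2 k)%:R, beta ^+ 2 / 2 * u k ^+ 21 <= (back1 k)%:R,
    (back1 k)%:R <= u k ^+ 21 /\ (back2 k)%:R <= u k ^+ 21 &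
    [/\ u k <= (A k + B k)%:R, `|(back1 k)%:R / a ^+ 2 - (back2 k)%:R / b ^+ 2| <= 1 / beta ^+ 2,
     right_of_ray (I k) (J k) (A k + B k).-1 (B k)%:Z & u k ^+ 60 <= 2 * (A k + B k)%:R]].

Lemma radii_near : \forall k \near \oo, radii_ok k.
Proof.
near=> k.
have U3 : 3 <= u k by near: k; exact: (near_large _ unit_scale_oo).
have U1 : 2 * (M + 1) <= u k by near: k; exact: (near_large _ unit_scale_oo).
have U2 : 4 / beta ^+ 2 <= u k by near: k; exact: (near_large _ unit_scale_oo).
have U4 : 4 * (1 + 1 / beta ^+ 2) / (beta ^+ 4 * kap) <= u k by near: k; exact: (near_large _ unit_scale_oo).
have [h1 h2 [h3 h4] h5 h6] := radii beta0 a_bnd b_bnd kap0 M0 (I0 k) (J0 k) (esym (powR60 R _)) (IM k) (kapE k) U3 U1 U2 U4.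
split => //; split => //; first by apply: le_trans U3; rewrite ler1n.
by rewrite powR60 ler_nat leq_add // leq_subr.
Unshelve. all: by end_near. Qed.

Lemma radii_oo : ((A k + B k)%N%:R : R) @[k --> \oo] --> +oo.
Proof.
apply/cvgryPge => x; near=> k; apply: (@le_trans _ _ (u k)).
  by near: k; exact: (near_large _ unit_scale_oo).
by have [_ _ _ _ []] : radii_ok k by near: k; exact: radii_near.
Unshelve. all: by end_near. Qed.

Lemma cbrt_radii k : radii_ok k -> (A k + B k)%:R `^ 3^-1 <= u k ^+ 20.
Proof.
move=> [[_ _ u1 le] _ _ _ _]; apply: cbrt_le; first by rewrite exprn_ge0 // (le_trans ler01).
by rewrite -exprM.
Qed.

(** The tilt is constant here: the drop of order [u^21] beats the fluctuations [u^20], and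
    [e^(- c u)] beats the number of exits, at most of order [u^60]. *)
Lemma ray_cvg : prob P [set o | lpp (mask (right_of_ray (I k) (J k)) (W o)) (A k + B k) (B k)%:Z <
    lpp (W o) (A k + B k) (B k)%:Z] @[k --> \oo] --> 0.
Proof.
pose eta := Num.min (beta / 2) (kap * beta ^+ 3 / (4 * (M + 1))).
have M1 : 0 < M + 1 by rewrite ltr_wpDl.
have b3 : 0 < beta ^+ 3 by rewrite exprn_gt0.
have eta0 : 0 < eta by rewrite lt_min !divr_gt0 ?mulr_gt0.
have eta1 : eta <= beta / 2 by rewrite ge_min lexx.
have eta2 : 2 / beta ^+ 3 * eta * (M + 1) <= kap / 2.
  have : eta <= kap * beta ^+ 3 / (4 * (M + 1)) by rewrite ge_min lexx orbT.
  rewrite ler_pdivlMr ?mulr_gt0 // => h.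
  have -> : 2 / beta ^+ 3 * eta * (M + 1) = (eta * (4 * (M + 1))) / (2 * beta ^+ 3).
    by field; rewrite gt_eqF.
  by rewrite ler_pdivrMr ?mulr_gt0 //; lra.
pose c := eta * kap * beta ^+ 3 / 32.
have c0 : 0 < c by rewrite divr_gt0 // !mulr_gt0.
pose tc := tail_cst (beta / 2) 2.
have tc0 : 0 <= tc by exact: tail_cst_ge0.
have ek0 : 0 < eta * kap by rewrite mulr_gt0.
have low : prob P [set o | lpp (W o) (A k + B k) (B k)%:Z <= flat_mean (step a b) (A k + B k) (B k)%:Z -
     eta * kap * (back2 k)%:R / 8] @[k --> \oo] --> 0.
  apply: (@low_tail _ _ _ P (fun=> E) beta 1 (fun=> step a b) (fun k => A k + B k)%N (fun k => (B k)%:Z)) => //.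
  - by move=> k i; exact: step_bnd.
  - exact: radii_oo.
  - move=> x; near=> k.
    have ok : radii_ok k by near: k; exact: radii_near.
    have ux : `|x| * 16 / (eta * kap * beta ^+ 2) <= u k by near: k; exact: (near_large _ unit_scale_oo).
    rewrite ler_pdivrMr ?mulr_gt0 ?exprn_gt0 // in ux.
    have [[_ _ u1 _] r2 _ _ _] := ok; have u20 : 0 <= u k ^+ 20 by rewrite exprn_ge0 // (le_trans ler01).
    apply: (@le_trans _ _ (`|x| * u k ^+ 20)).
      apply: (@le_trans _ _ (`|x| * (A k + B k)%:R `^ 3^-1)); first by rewrite ler_wpM2r ?powR_ge0 // ler_norm.
      by rewrite ler_wpM2l // cbrt_radii.
    apply: (@le_trans _ _ (eta * kap * (beta ^+ 2 / 2 * u k ^+ 21) / 8)); last first.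
      by rewrite ler_pM2r ?invr_gt0 // ler_wpM2l // ltW.
    have -> : eta * kap * (beta ^+ 2 / 2 * u k ^+ 21) / 8 = u k * (eta * kap * beta ^+ 2) / 16 * u k ^+ 20.
      by rewrite [u k ^+ 21]exprS; move: (eta * kap) (u k) (u k ^+ 20) => p v w; field.
    by rewrite ler_wpM2r //; move: ux; move: (u k * _) => p; lra.
apply: (@squeeze_cvgr _ _ _ _ (fun=> 0) (fun k => prob P [set o | lpp (W o) (A k + B k) (B k)%:Z <= flat_mean (step a b) (A k + B k) (B k)%:Z -
     eta * kap * (back2 k)%:R / 8] + 2 * tc * u k ^+ 60 * expR (- (c * u k)))); last 2 first.
- exact: cvg_cst.
- rewrite -[X in _ --> X]addr0; apply: cvgD => //.
  by apply: poly_expR_cvg0 => //; [rewrite mulr_ge0|exact: unit_scale_oo].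
near=> k; rewrite prob_ge0 /=.
have ok : radii_ok k by near: k; exact: radii_near.
have [[r1I r2J u1 AB60] r2lo _ [r1u r2u] [uAB rH rR _]] := ok.
have nB : (16 / beta) ^+ 3 <= (A k + B k)%:R / 4.
  rewrite ler_pdivlMr //; apply: le_trans uAB; near: k; exact: (near_large _ unit_scale_oo).
have [b0' _] := andP b_bnd; have [a0' _] := andP a_bnd.
have a0 : 0 < a by exact: lt_le_trans a0'.
have bb0 : 0 < beta ^+ 2 by rewrite exprn_gt0.
have HE : (I k - A k)%:R / a ^+ 2 <= (J k - B k)%:R / b ^+ 2 + 1 / beta ^+ 2.
  by rewrite !subKn //; move: rH; rewrite ler_norml => /andP[_]; lra.
have rHk : 1 / beta ^+ 2 + 1 / a ^+ 2 + 4 / beta ^+ 2 <= kap * (J k - B k)%:R / 4.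
  rewrite subKn //.
  have ux : 6 / beta ^+ 2 * 8 / (kap * beta ^+ 2) <= u k by near: k; exact: (near_large _ unit_scale_oo).
  rewrite ler_pdivrMr ?mulr_gt0 // in ux.
  have as3 : 1 / a ^+ 2 <= 1 / beta ^+ 2.
    by rewrite ler_wpM2l // lef_pV2 ?posrE ?exprn_gt0 // ler_pXn2r ?nnegrE // ltW.
  have h1 := ler_wpM2l (ltW kap0) r2lo.
  have h2 : kap * (beta ^+ 2 / 2 * u k) <= kap * (beta ^+ 2 / 2 * u k ^+ 21).
    rewrite ler_wpM2l ?(ltW kap0) // ler_wpM2l ?divr_ge0 ?(ltW bb0) // expr_ge_id //.
  move: as3 ux h1 h2; have -> : 6 / beta ^+ 2 * 8 = 48 * (1 / beta ^+ 2) by ring.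
  have -> : 4 / beta ^+ 2 = 4 * (1 / beta ^+ 2) by ring.
  move: (1 / beta ^+ 2) (1 / a ^+ 2) ((back2 k)%:R : R) (u k) (u k ^+ 21) => x y z v w; lra.
have := @ray_prob _ _ _ P E fE a b beta beta0 a_bnd b_bnd kap M (1 / beta ^+ 2) eta (I k) (J k) (A k) (B k) kap0 M0 eta0 eta1 eta2
  (leq_subr _ _) (leq_subr _ _) (I0 k) (J0 k) (IM k) (kapE k) HE rHk nB rR.
rewrite -step_mean subKn // => h; apply: (le_trans h); rewrite lerD2l -/tc.
have n0 : (0 < A k + B k)%N by rewrite -(ltr_nat R) (lt_le_trans _ uAB) // (lt_le_trans ltr01).
have bh : 0 < beta / 2 by rewrite divr_gt0.
have ts0 := tail_scale_gt0 bh n0.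
have -> : 2 * tc * u k ^+ 60 * expR (- (c * u k)) = (2 * u k ^+ 60) * (tc * expR (- (c * u k))).
  by rewrite [2 * tc * _]mulrAC mulrA.
apply: ler_pM; rewrite ?mulr_ge0 ?expR_ge0 //.
  have : (B k)%:R <= (A k + B k)%:R :> R by rewrite ler_nat leq_addl.
  have : 1 <= u k ^+ 60 by exact: exprn_ege1.
  by rewrite -natr1; lra.
rewrite ler_wpM2l // ler_expR lerN2 ler_pdivlMr //.
apply: (@le_trans _ _ (c * u k * (u k ^+ 20 / (beta / 2)))).
  have cu0 : 0 <= c * u k by apply: mulr_ge0; [exact: ltW|exact: le_trans u1].
  by rewrite (ler_wpM2l cu0) // /tail_scale ler_pM2r ?invr_gt0 // cbrt_radii.
apply: (@le_trans _ _ (eta * kap * (beta ^+ 2 / 2 * u k ^+ 21) / 8)); last first.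
  by rewrite ler_pM2r ?invr_gt0 // (ler_wpM2l (ltW ek0)).
rewrite le_eqVlt; apply/orP; left; apply/eqP; rewrite /c [u k ^+ 21]exprS; move: (eta * kap) (u k) (u k ^+ 20) => p v w; field; rewrite gt_eqF //.
Unshelve. all: by end_near. Qed.

Let s_bnd (i : int) : beta <= step a b i <= 1. Proof. exact: step_bnd. Qed.

Definition local_field k (c : nat * int) : T -> R := E ((A k + B k + c.1)%N, (B k)%:Z + c.2).

Lemma local_field_exp k : exp_field P (local_field k).
Proof.
apply: (exp_field_reindex (s := fun c => ((A k + B k + c.1)%N, (B k)%:Z + c.2))
  (r := fun c => ((c.1 - (A k + B k))%N, c.2 - (B k)%:Z)) _ fE).
by move=> [m j] /=; rewrite addKn addrAC subrr add0r.
Qed.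

Local Notation Wloc k o := (wmod (step a b) (fun c => local_field k c o)).
(** What the restriction to the quadrant may cost on the last stretch: the drop allowed by the tilt,
    and the weight of a segment of length [entry]. It is of order [u^19], below the fluctuations
    [u^20]. *)
Definition loss k : R := beta ^+ 3 / 32 / u k ^+ 2 * (entry k)%:R / 4 + ((entry k)%:R / beta + (entry k)%:R).

Lemma entry_bnd k : 2 <= u k -> u k ^+ 19 / 2 <= (entry k)%:R <= u k ^+ 19.
Proof.
move=> u2; have u1 : 1 <= u k by apply: le_trans u2; rewrite ler1n.
have u0 : 0 <= u k ^+ 19 by rewrite exprn_ge0 // (le_trans ler01).
have /andP[h1 h2] := truncn_itv u0; rewrite -/(entry k) -natr1 in h1 h2.
rewrite h1 andbT; have := @expr_ge_id _ _ 18 u1; lra.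
Qed.

Lemma loss_le k : 2 <= u k -> 0 <= loss k <= (2 + 1 / beta) * u k ^+ 19.
Proof.
move=> u2; have /andP[h1 h2] := entry_bnd u2.
have b1 : beta <= 1 by have /andP[] := s_bnd 0; exact: le_trans.
have u1 : 1 <= u k by apply: le_trans u2; rewrite ler1n.
have d0 : 0 <= (entry k)%:R :> R by [].
have th : 0 <= beta ^+ 3 / 32 / u k ^+ 2 <= 1.
  have b3 : 0 <= beta ^+ 3 <= 1 by rewrite exprn_ge0 ?(ltW beta0) //= exprn_ile1 // ltW.
  have u22 : 1 <= u k ^+ 2 by exact: exprn_ege1.
  rewrite !divr_ge0 ?exprn_ge0 ?(ltW beta0) ?(le_trans ler01 u1) //= ler_pdivrMr ?mul1r ?(lt_le_trans ltr01) //.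
  by apply: le_trans u22; lra.
have i0 : 0 <= 1 / beta by rewrite divr_ge0 // ltW.
rewrite /loss; have -> : (entry k)%:R / beta = (1 / beta) * (entry k)%:R by ring.
have h3 := ler_wpM2l i0 h2.
have /andP[t0 t1] := th.
have h4 := ler_wpM2r d0 t1.
have h5 := mulr_ge0 t0 d0; have h6 := mulr_ge0 i0 d0.
move: h2 h3 h4 h5 h6 d0; move: (beta ^+ 3 / 32 / u k ^+ 2 * (entry k)%:R) => p.
move: (1 / beta * (entry k)%:R) ((entry k)%:R : R) => q r.
move: (u k ^+ 19) (1 / beta) => v w h2 h3 h4 h5 h6 d0.
by apply/andP; split; lra.
Qed.

(** On a stretch of length [u^21] the second-order term [eta^2 u^21] must not exceed the gain
    [eta u^19] from an exit at distance [u^19], so the tilt is of order [u^-2]; the constant is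
    fixed by [tilt_square]. The gain [u^17] still beats the fluctuations [u^7] of the stretch. *)
Let th k : R := beta ^+ 3 / 32 / u k ^+ 2.
Let c : R := beta ^+ 4 / 2048.
Let b3 : 0 < beta ^+ 3. Proof. by rewrite exprn_gt0. Qed.
Let bb0 : 0 < beta ^+ 2. Proof. by rewrite exprn_gt0. Qed.
Let b1 : beta <= 1. Proof. by have /andP[] := s_bnd 0; exact: le_trans. Qed.
Let c0 : 0 < c. Proof. by apply: divr_gt0; [exact: exprn_gt0|rewrite ltr0n]. Qed.

Let back_cbrt k : radii_ok k -> (back1 k + back2 k)%:R `^ 3^-1 <= 2 * u k ^+ 7.
Proof.
move=> [[_ _ u1 _] _ _ [r1u r2u] _]; have u0 := le_trans ler01 u1.
apply: cbrt_le; first by rewrite mulr_ge0 // exprn_ge0.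
rewrite natrD exprMn -exprM; have : 0 <= u k ^+ 21 by exact: exprn_ge0.
by lra.
Qed.

Let tilt_entry k : 2 <= u k -> beta ^+ 3 / 64 * u k ^+ 17 <= th k * (entry k)%:R.
Proof.
move=> u2; have /andP[h _] := entry_bnd u2.
have u0 : 0 < u k by apply: lt_le_trans u2.
have t0 : 0 <= th k by rewrite !divr_ge0 ?exprn_ge0 // ltW.
have -> : beta ^+ 3 / 64 * u k ^+ 17 = th k * (u k ^+ 19 / 2).
  by rewrite /th (exprD _ 17 2); field; rewrite gt_eqF.
by rewrite ler_wpM2l.
Qed.

Let tilt_le k : 2 <= u k -> th k <= beta / 2.
Proof.
move=> u2; have u1 : 1 <= u k by apply: le_trans u2; rewrite ler1n.
rewrite /th ler_pdivrMr ?exprn_gt0 //; last exact: lt_le_trans u2.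
have u22 : 1 <= u k ^+ 2 by exact: exprn_ege1.
have : beta / 2 * 1 <= beta / 2 * u k ^+ 2 by rewrite ler_wpM2l // divr_ge0 // ltW.
have : beta ^+ 3 <= beta by rewrite exprS ler_piMr ?exprn_ile1 // ltW.
by rewrite mulr1; move: (beta / 2 * u k ^+ 2) => y; have := beta0; lra.
Qed.

Let entry_large k (y : R) : 2 <= u k -> 8 * y <= u k -> y <= (entry k)%:R / 4.
Proof.
move=> u2 uy; have /andP[d1 _] := entry_bnd u2.
have u1 : 1 <= u k by apply: le_trans u2; rewrite ler1n.
by have := expr_ge_id 18 u1; lra.
Qed.

Let tilt_square k : radii_ok k -> 2 <= u k -> 2 / beta ^+ 3 * th k * (back1 k + back2 k)%:R <= (entry k)%:R / 4.
Proof.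
move=> [_ _ _ [r1u r2u] _] u2; have /andP[d1 _] := entry_bnd u2.
have u0 : 0 < u k by exact: lt_le_trans u2.
have t0 : 0 <= th k by rewrite !divr_ge0 ?exprn_ge0 // ltW.
apply: (@le_trans _ _ (2 / beta ^+ 3 * th k * (2 * u k ^+ 21))).
  have K0 : 0 <= 2 / beta ^+ 3 * th k by apply: mulr_ge0 => //; apply: divr_ge0 => //; exact: ltW.
  by rewrite (ler_wpM2l K0) // natrD; lra.
have -> : 2 / beta ^+ 3 * th k * (2 * u k ^+ 21) = u k ^+ 19 / 8.
  by rewrite /th (exprD _ 19 2); field; rewrite !gt_eqF.
by have : 0 <= u k ^+ 19 by [rewrite exprn_ge0 // ltW]; lra.
Qed.

Let back_large k (y : R) : radii_ok k -> 4 * y / beta ^+ 2 <= u k -> y <= (back1 k + back2 k)%:R / 4.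
Proof.
move=> [[_ _ u1 _] r2lo r1lo _ _]; rewrite ler_pdivrMr // => uy.
have := ler_wpM2r (ltW bb0) (expr_ge_id 20 u1).
move: r2lo r1lo; rewrite natrD (_ : beta ^+ 2 / 2 * u k ^+ 21 = u k ^+ 21 * beta ^+ 2 / 2); last by ring.
by lra.
Qed.

Let entry_rate k : 2 <= u k -> c * u k <= (entry k)%:R / tail_scale (beta / 2) (entry k).
Proof.
move=> u2; have u0 : 0 < u k by exact: lt_le_trans u2.
have /andP[d1 d2] := entry_bnd u2; have bh : 0 < beta / 2 by rewrite divr_gt0.
have d0 : (0 < entry k)%N by rewrite -(ltr_nat R); apply: lt_le_trans d1; rewrite divr_gt0 ?exprn_gt0.
have cu0 : 0 <= c * u k by apply: mulr_ge0; exact: ltW.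
rewrite ler_pdivlMr ?tail_scale_gt0 //.
have d3 : (entry k)%:R `^ 3^-1 <= u k ^+ 7.
  apply: cbrt_le; first by rewrite exprn_ge0 // ltW.
  by apply: (le_trans d2); rewrite -exprM ler_weXn2l // (le_trans _ u2) // ler1n.
apply: (@le_trans _ _ (c * u k * (u k ^+ 7 / (beta / 2)))).
  by rewrite (ler_wpM2l cu0) // /tail_scale ler_pM2r ?invr_gt0.
apply: le_trans d1; have -> : c * u k * (u k ^+ 7 / (beta / 2)) = beta ^+ 3 / 1024 * u k ^+ 8.
  by rewrite /c [u k ^+ 8]exprS; move: (u k) (u k ^+ 7) => v w; field; rewrite gt_eqF.
have b31 : beta ^+ 3 <= 1 by rewrite exprn_ile1 // ltW.
have h8 : 0 <= u k ^+ 8 by rewrite exprn_ge0 // ltW.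
have h819 : u k ^+ 8 <= u k ^+ 19 by rewrite ler_weXn2l // (le_trans _ u2) // ler1n.
by have := ler_wpM2r h8 b31; lra.
Qed.

Let back_rate k : radii_ok k -> 2 <= u k -> (0 < back1 k + back2 k)%N ->
  c * u k <= th k * (entry k)%:R / 8 / tail_scale (beta / 2) (back1 k + back2 k).
Proof.
move=> ok u2 n0; have u0 : 0 < u k by exact: lt_le_trans u2.
have bh : 0 < beta / 2 by rewrite divr_gt0.
have cu0 : 0 <= c * u k by apply: mulr_ge0; exact: ltW.
rewrite ler_pdivlMr ?tail_scale_gt0 //.
apply: (@le_trans _ _ (c * u k * (2 * u k ^+ 7 / (beta / 2)))).
  by rewrite (ler_wpM2l cu0) // /tail_scale ler_pM2r ?invr_gt0 // back_cbrt.
apply: (@le_trans _ _ (beta ^+ 3 / 64 * u k ^+ 17 / 8)); last by rewrite ler_pM2r ?invr_gt0 // tilt_entry.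
have -> : c * u k * (2 * u k ^+ 7 / (beta / 2)) = beta ^+ 3 / 512 * u k ^+ 8.
  by rewrite /c [u k ^+ 8]exprS; move: (u k) (u k ^+ 7) => v w; field; rewrite gt_eqF.
have -> : beta ^+ 3 / 64 * u k ^+ 17 / 8 = beta ^+ 3 / 512 * u k ^+ 17 by field.
apply: ler_wpM2l; last by rewrite ler_weXn2l // (le_trans _ u2) // ler1n.
by apply: divr_ge0; [exact: ltW|rewrite ler0n].
Qed.

Let back_count k : radii_ok k -> 2 <= u k -> (back1 k + back2 k).+2%:R <= 4 * u k ^+ 21 :> R.
Proof.
move=> [[_ _ u1 _] _ _ [r1u r2u] _] u2.
by rewrite -2!natr1 natrD; have := expr_ge_id 20 u1; lra.
Qed.

Lemma quadrant_cvg : prob P [set o | lpp (mask quadrant (Wloc k o)) (back1 k + back2 k) (back2 k)%:Z <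
    (back1 k)%:R / a + (back2 k)%:R / b - loss k] @[k --> \oo] --> 0.
Proof.
pose tc := tail_cst (beta / 2) 2.
have tc0 : 0 <= tc by exact: tail_cst_ge0.
have roo : ((back1 k + back2 k)%N%:R : R) @[k --> \oo] --> +oo.
  apply/cvgryPge => x; near=> k.
  have [[_ _ u1 _] r2lo _ _ _] : radii_ok k by near: k; exact: radii_near.
  apply: (@le_trans _ _ (back2 k)%:R); last by rewrite ler_nat leq_addl.
  apply: le_trans r2lo; have ux : `|x| * 2 / beta ^+ 2 <= u k by near: k; exact: (near_large _ unit_scale_oo).
  rewrite ler_pdivrMr // in ux; apply: (le_trans (ler_norm x)).
  have := ler_wpM2r (ltW bb0) (expr_ge_id 20 u1).
  by move: ux; rewrite (_ : beta ^+ 2 / 2 * u k ^+ 21 = u k ^+ 21 * beta ^+ 2 / 2); [lra|ring].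
have low : prob P [set o | lpp (Wloc k o) (back1 k + back2 k) (back2 k)%:Z <=
    flat_mean (step a b) (back1 k + back2 k) (back2 k)%:Z - th k * (entry k)%:R / 4] @[k --> \oo] --> 0.
  apply: (@low_tail _ _ _ P local_field beta 1 (fun=> step a b) (fun k => back1 k + back2 k)%N (fun k => (back2 k)%:Z)) => //.
  - exact: local_field_exp.
  - move=> x; near=> k.
    have ok : radii_ok k by near: k; exact: radii_near.
    have u2 : 2 <= u k by near: k; exact: (near_large _ unit_scale_oo).
    have ux : `|x| * 512 / beta ^+ 3 <= u k by near: k; exact: (near_large _ unit_scale_oo).
    rewrite ler_pdivrMr // in ux.
    have u1 : 1 <= u k by apply: le_trans u2; rewrite ler1n.
    have u7 : 0 <= u k ^+ 7 by rewrite exprn_ge0 // (le_trans ler01).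
    apply: (@le_trans _ _ (`|x| * (2 * u k ^+ 7))).
      apply: (@le_trans _ _ (`|x| * (back1 k + back2 k)%:R `^ 3^-1)); first by rewrite ler_wpM2r ?powR_ge0 // ler_norm.
      by rewrite ler_wpM2l // back_cbrt.
    apply: (@le_trans _ _ (beta ^+ 3 / 64 * u k ^+ 17 / 4)); last by rewrite ler_pM2r ?invr_gt0 // tilt_entry.
    have h1 : u k ^+ 7 * (u k * beta ^+ 3) <= u k ^+ 7 * (u k ^+ 10 * beta ^+ 3).
      by rewrite ler_wpM2l // ler_wpM2r ?(ltW b3) // expr_ge_id.
    have h2 := ler_wpM2l u7 ux.
    by move: h1 h2; rewrite (exprD _ 7 10) -/(th k); move: (u k ^+ 7) (u k ^+ 10) (beta ^+ 3) (`|x|) => p q r s; lra.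
apply: (@squeeze_cvgr _ _ _ _ (fun=> 0) (fun k => prob P [set o | lpp (Wloc k o) (back1 k + back2 k) (back2 k)%:Z <=
    flat_mean (step a b) (back1 k + back2 k) (back2 k)%:Z - th k * (entry k)%:R / 4] +
   2 * tc * u k ^+ 0 * expR (- (c * u k)) + 4 * tc * u k ^+ 21 * expR (- (c * u k)))); last 2 first.
- exact: cvg_cst.
- rewrite -[X in _ --> X]addr0 -[X in _ --> X + _]addr0; apply: cvgD; first apply: cvgD => //.
    by apply: poly_expR_cvg0 => //; [rewrite mulr_ge0|exact: unit_scale_oo].
  by apply: poly_expR_cvg0 => //; [rewrite mulr_ge0|exact: unit_scale_oo].
near=> k; rewrite prob_ge0 /=.
have ok : radii_ok k by near: k; exact: radii_near.
have [[r1I r2J u1 AB60] r2lo r1lo [r1u r2u] [uAB rH rR _]] := ok.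
have u2 : 2 <= u k by near: k; exact: (near_large _ unit_scale_oo).
have /andP[d1 d2] := entry_bnd u2.
have u0 : 0 < u k by exact: lt_le_trans u2.
have ub : (4 * (16 / beta) ^+ 3) / beta ^+ 2 <= u k by near: k; exact: (near_large _ unit_scale_oo).
have ub2 : 8 * (16 / beta) ^+ 3 <= u k by near: k; exact: (near_large _ unit_scale_oo).
have ub3 : 8 * (1 / beta ^+ 2 + 4 / beta ^+ 2) <= u k by near: k; exact: (near_large _ unit_scale_oo).
have r20 : (0 < back2 k)%N by rewrite -(ltr_nat R); apply: lt_le_trans r2lo; rewrite mulr_gt0 ?divr_gt0 ?exprn_gt0.
have r10 : (0 < back1 k)%N by rewrite -(ltr_nat R); apply: lt_le_trans r1lo; rewrite mulr_gt0 ?divr_gt0 ?exprn_gt0.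
have d0 : (0 < entry k)%N by rewrite -(ltr_nat R); apply: lt_le_trans d1; rewrite divr_gt0 ?exprn_gt0.
have t0 : 0 < th k by rewrite !divr_gt0 ?exprn_gt0.
have Hd := entry_large u2 ub3; have nd := entry_large u2 ub2.
have nB := back_large ok ub; have Kd := tilt_square ok u2.
have := @quadrant_prob _ _ _ P (local_field k) (local_field_exp k) a b beta beta0 a_bnd b_bnd (1 / beta ^+ 2) (th k)
  (back1 k) (back2 k) (entry k) r10 r20 d0 t0 (tilt_le u2) rH Hd Kd nB nd.
rewrite -/tc -step_mean /loss -/(th k) => h.
rewrite opprD addrA; apply: (le_trans h).
have n0 : (0 < back1 k + back2 k)%N by rewrite addn_gt0 r10.
rewrite -!addrA lerD2l; apply: lerD.
  by rewrite expr0 mulr1 -mulrA ler_wpM2l // ler_wpM2l // ler_expR lerN2 entry_rate.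
have -> : 4 * tc * u k ^+ 21 * expR (- (c * u k)) = (4 * u k ^+ 21) * (tc * expR (- (c * u k))).
  by rewrite [4 * tc * _]mulrAC mulrA.
apply: ler_pM; rewrite ?mulr_ge0 ?expR_ge0 ?back_count //.
by rewrite ler_wpM2l // ler_expR lerN2 back_rate.
Unshelve. all: by end_near. Qed.

End Decor.

Section StepScale.
Context {R : realType}.

Lemma step_scale_cube (a b : R) A B : 0 < a -> 0 < b -> (0 < A + B)%N ->
  0 < flat_scale (step a b) (A + B) B%:Z /\
  flat_scale (step a b) (A + B) B%:Z ^+ 3 = 2 * (A%:R / a ^+ 3 + B%:R / b ^+ 3).
Proof.
move=> a0 b0 n0; have s0 i : 0 < step a b i by rewrite /step; case: ifP.
have [h1 h2] := flat_scale_cube B%:Z s0 n0; split => //.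
rewrite h2 -step_mean /flat_mean; congr (_ * _); apply: eq_bigr => l _.
by rewrite /step; case: ifP.
Qed.

End StepScale.

(** * Replacing a passage time by an event to the right of the ray *)

Section Decorrelation.
Context {d : measure_display} {T : measurableType d} {R : realType} (P : probability T R).
Variable E : nat * int -> T -> R.
Hypothesis fE : exp_field P E.
Local Notation e o := (fun c => E c o).
Variables (a b beta kap M : R) (I J : nat -> nat).
Hypothesis beta0 : 0 < beta.
Hypothesis a_bnd : beta <= a <= 1.
Hypothesis b_bnd : beta <= b <= 1.
Hypothesis kap0 : 0 < kap.
Hypothesis M0 : 0 <= M.
Hypothesis I0 : forall k, (0 < I k)%N.
Hypothesis J0 : forall k, (0 < J k)%N.
Hypothesis IM : forall k, (I k)%:R <= M * (J k)%:R.
Hypothesis kapE : forall k, kap <= (I k)%:R / (J k)%:R / a ^+ 2 - 1 / b ^+ 2.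
Hypothesis Noo : ((I k + J k)%N%:R : R) @[k --> \oo] --> +oo.
Hypothesis F_GOE0 : forall e : R, 0 < e -> exists y : R, F_GOE y < e.
Local Notation W o := (wmod (step a b) (e o)).
Local Notation u := (@unit_scale R I J).
Local Notation r1 k := (back1 a I J k).
Local Notation r2 k := (back2 b I J k).
Local Notation A k := (I k - r1 k)%N.
Local Notation B k := (J k - r2 k)%N.

Let a0 : 0 < a. Proof. by have /andP[h _] := a_bnd; exact: lt_le_trans h. Qed.
Let b0 : 0 < b. Proof. by have /andP[h _] := b_bnd; exact: lt_le_trans h. Qed.
Let s_bnd (i : int) : beta <= step a b i <= 1. Proof. exact: step_bnd. Qed.
Let s0 (i : int) : 0 < step a b i.
Proof. by have /andP[h _] := s_bnd i; exact: lt_le_trans h. Qed.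

Let ok_near : \forall k \near \oo, radii_ok a b beta I J k.
Proof. exact: (radii_near beta0 a_bnd b_bnd kap0 M0 I0 J0 IM kapE Noo). Qed.
Let uoo : u k @[k --> \oo] --> +oo. Proof. exact: unit_scale_oo. Qed.

Let uV_cvg0 : (u k)^-1 @[k --> \oo] --> (0 : R).
Proof.
apply/cvgr0Pnorm_le => x x0; near=> k.
have ux : x^-1 <= u k by near: k; exact: near_large.
have u0 : 0 < u k by apply: lt_le_trans ux; rewrite invr_gt0.
by rewrite ger0_norm ?invr_ge0 ?(ltW u0) // -(invrK x) lef_pV2 ?posrE ?invr_gt0.
Unshelve. all: by end_near. Qed.

Local Notation sc k := (flat_scale (step a b) (I k + J k) (J k)%:Z).
Local Notation sc' k := (flat_scale (step a b) (A k + B k) (B k)%:Z).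

Lemma back_scale_ge k : radii_ok a b beta I J k -> u k ^+ 20 <= sc' k.
Proof.
move=> [[_ _ u1 _] _ _ _ [uAB _ _ u60]].
have n0 : (0 < A k + B k)%N by rewrite -(ltr_nat R) (lt_le_trans _ uAB) // (lt_le_trans ltr01).
have [q0 _] := step_scale_cube a0 b0 n0.
have u0 := le_trans ler01 u1.
rewrite -(ler_pXn2r (n := 3)) ?nnegrE ?(ltW q0) ?exprn_ge0 // -exprM.
have := @flat_scale_ge _ (step a b) (A k + B k) (B k)%:Z 1 n0 (fun i => introT andP (conj (s0 i) (andP (s_bnd i)).2)).
by rewrite expr1n divr1; exact: le_trans.
Qed.

Lemma scale_ratio_cvg : sc k / sc' k @[k --> \oo] --> (1 : R).
Proof.
have b3 : 0 < beta ^+ 3 by rewrite exprn_gt0.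
apply: (@cvg_dist_le _ _ (fun k => 4 / beta ^+ 3 * (u k)^-1)); last first.
  rewrite -[X in _ --> X](mulr0 (4 / beta ^+ 3)); apply: cvgM; first exact: cvg_cst.
  exact: uV_cvg0.
near=> k.
have ok : radii_ok a b beta I J k by near: k; exact: ok_near.
have [[r1I r2J u1 _] _ _ [r1u r2u] [uAB _ _ u60]] := ok.
have u0 : 0 < u k by exact: lt_le_trans u1.
have n0 : (0 < A k + B k)%N by rewrite -(ltr_nat R) (lt_le_trans _ uAB).
have N0 : (0 < I k + J k)%N by rewrite addn_gt0 I0.
have [q0 q3] := step_scale_cube a0 b0 N0.
have [q0' q3'] := step_scale_cube a0 b0 n0.
set x := sc k / sc' k; have x0 : 0 < x by rewrite divr_gt0.
have x3 : x ^+ 3 = 1 + ((r1 k)%:R / a ^+ 3 + (r2 k)%:R / b ^+ 3) / ((A k)%:R / a ^+ 3 + (B k)%:R / b ^+ 3).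
  have nz : (A k)%:R / a ^+ 3 + (B k)%:R / b ^+ 3 != 0.
    by apply/eqP => h; move: q3'; rewrite h mulr0 => /eqP; rewrite expf_eq0 /= gt_eqF.
  rewrite /x expr_div_n q3 q3' -{1}(subnK r1I) -{1}(subnK r2J) !natrD -mulf_div divff ?mul1r; last by rewrite pnatr_eq0.
  move: nz; move: ((A k)%:R : R) ((B k)%:R : R) ((r1 k)%:R : R) ((r2 k)%:R : R) => p q r s.
  move: (a ^+ 3)^-1 (b ^+ 3)^-1 => y z nz.
  by rewrite -[X in _ = X + _](divff nz) -mulrDl; congr (_ / _); ring.
have inv3 c : beta <= c <= 1 -> 1 <= (c ^+ 3)^-1 <= (beta ^+ 3)^-1.
  move=> /andP[c1 c2]; have c0 : 0 < c by exact: lt_le_trans c1.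
  by rewrite invf_ge1 ?exprn_gt0 // exprn_ile1 ?(ltW c0) //= lef_pV2 ?posrE ?exprn_gt0 // ler_pXn2r ?nnegrE // ltW.
have /andP[ia1 ia2] := inv3 a a_bnd; have /andP[ib1 ib2] := inv3 b b_bnd.
have D1 : (A k + B k)%:R <= (A k)%:R / a ^+ 3 + (B k)%:R / b ^+ 3 :> R.
  by rewrite natrD; apply: lerD; rewrite ler_peMr.
have D2 : (r1 k)%:R / a ^+ 3 + (r2 k)%:R / b ^+ 3 <= 2 * u k ^+ 21 / beta ^+ 3.
  have -> : 2 * u k ^+ 21 / beta ^+ 3 = u k ^+ 21 / beta ^+ 3 + u k ^+ 21 / beta ^+ 3 by ring.
  by apply: lerD; apply: ler_pM => //; apply: le_trans ia1 || apply: le_trans ib1.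
have u21 : 0 < u k ^+ 21 by rewrite exprn_gt0.
have nn0 : 0 < (A k + B k)%:R :> R by rewrite ltr0n.
have D3 : ((r1 k)%:R / a ^+ 3 + (r2 k)%:R / b ^+ 3) / ((A k)%:R / a ^+ 3 + (B k)%:R / b ^+ 3) <= 4 / beta ^+ 3 / u k.
  rewrite ler_pdivrMr ?(lt_le_trans nn0) //; apply: (le_trans D2).
  apply: (@le_trans _ _ (4 / beta ^+ 3 / u k * (A k + B k)%:R)); last first.
    by rewrite ler_wpM2l // !divr_ge0 // ltW.
  apply: (@le_trans _ _ (4 / beta ^+ 3 / u k * (u k ^+ 60 / 2))); last first.
    have K0 : 0 <= 4 / beta ^+ 3 / u k by apply: divr_ge0; [apply: divr_ge0 => //; exact: ltW|exact: ltW].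
    by rewrite (ler_wpM2l K0) // ler_pdivrMr // mulrC.
  have -> : 4 / beta ^+ 3 / u k * (u k ^+ 60 / 2) = 2 * u k ^+ 59 / beta ^+ 3.
    by rewrite [u k ^+ 60]exprS; move: (u k ^+ 59) => z; field; rewrite !gt_eqF.
  by rewrite ler_pM2r ?invr_gt0 // ler_pM2l // ler_weXn2l.
have D4 : 0 <= ((r1 k)%:R / a ^+ 3 + (r2 k)%:R / b ^+ 3) / ((A k)%:R / a ^+ 3 + (B k)%:R / b ^+ 3).
  by rewrite !(divr_ge0, addr_ge0) // exprn_ge0 // ltW.
have x1 : 1 <= x.
  by rewrite -(ler_pXn2r (n := 3)) ?nnegrE ?(ltW x0) // expr1n x3; lra.
have xx3 : x <= x ^+ 3 by exact: (@expr_ge_id _ _ 2 x1).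
by rewrite ger0_norm ?subr_ge0 // lerBlDl (le_trans xx3) // x3 lerD2l.
Unshelve. all: by end_near. Qed.

Lemma loss_ratio_cvg : loss beta I J k / sc' k @[k --> \oo] --> (0 : R).
Proof.
apply: (@cvg_dist_le _ _ (fun k => (2 + 1 / beta) * (u k)^-1)); last first.
  rewrite -[X in _ --> X](mulr0 (2 + 1 / beta)); apply: cvgM; first exact: cvg_cst.
  exact: uV_cvg0.
near=> k; rewrite subr0.
have ok : radii_ok a b beta I J k by near: k; exact: ok_near.
have u2 : 2 <= u k by near: k; exact: near_large.
have u0 : 0 < u k by exact: lt_le_trans u2.
have sl := back_scale_ge ok.
have u20 : 0 < u k ^+ 20 by rewrite exprn_gt0.
have /andP[l0 l1] := loss_le beta0 a_bnd b_bnd u2.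
have q0 : 0 < sc' k by exact: lt_le_trans sl.
rewrite ger0_norm ?divr_ge0 ?(ltW q0) // ler_pdivrMr //; apply: (le_trans l1).
apply: (@le_trans _ _ ((2 + 1 / beta) / u k * u k ^+ 20)).
  by rewrite [u k ^+ 20]exprS; move: (2 + _) (u k) (u k ^+ 19) u0 => p v w v0; rewrite mulrA divfK // gt_eqF.
by rewrite ler_wpM2l // divr_ge0 ?(ltW u0) // addr_ge0 // divr_ge0 // ltW.
Unshelve. all: by end_near. Qed.

Variable V : T -> nat -> int -> R.
Hypothesis V0 : forall o m j, 0 <= V o m j.
Hypothesis VW : forall o m j, V o m j <= W o m j.
Hypothesis VR : forall k o m j, right_of_ray (I k) (J k) m j -> W o m j <= V o m j.
Hypothesis VQ : forall o m j, quadrant m j -> W o m j <= V o m j.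
Hypothesis sV : forall m j, smeas E setT (fun o => V o m j).

(** A path right of the ray to the moved point, continued in a quadrant, meets only cells where [V]
    agrees with the full field. *)
Lemma lpp_back k o : radii_ok a b beta I J k ->
  lpp (mask (right_of_ray (I k) (J k)) (W o)) (A k + B k) (B k)%:Z +
  lpp (mask quadrant (wmod (step a b) (fun c => local_field E a b I J k c o))) (r1 k + r2 k) (r2 k)%:Z <=
  lpp (V o) (I k + J k) (J k)%:Z.
Proof.
move=> [[r1I r2J _ _] _ _ _ _].
have [_ E0 _ _] := fE.
have := @lpp_concat R (V o) (mask (right_of_ray (I k) (J k)) (W o))
  (wmod (step a b) (fun c => local_field E a b I J k c o)) (A k + B k) (B k)%:Z (V0 o) _ _ _ (r1 k + r2 k) (r2 k)%:Z.
have -> : (A k + B k + (r1 k + r2 k))%N = (I k + J k)%N by rewrite addnACA !subnK.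
have -> : (B k)%:Z + (r2 k)%:Z = (J k)%:Z by rewrite -PoszD subnK.
apply => //.
- by move=> m j; apply: wmod_ge0 => // c; exact: E0.
- by move=> m j; rewrite /mask; case: ifP => // /VR.
- move=> m j mj; apply: le_trans (VQ _ _); last by move: mj; rewrite /quadrant; clear; lia.
  rewrite /wmod /local_field /= le_eqVlt; apply/orP; left; apply/eqP; congr (_ / _).
  have -> : step a b j = b by rewrite /step ifF //; move: mj; rewrite /quadrant; clear; lia.
  have -> : step a b (j - m%:Z) = a by rewrite /step ifT //; move: mj; rewrite /quadrant; clear; lia.
  have -> : step a b ((B k)%:Z + j) = b by rewrite /step ifF //; move: mj; rewrite /quadrant; clear; lia.
  by have -> : step a b ((B k)%:Z + j - (A k + B k + m)%N%:Z) = a by rewrite /step ifT //; move: mj; rewrite /quadrant; clear; lia.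
- by rewrite lez_nat leq_addl.
Qed.

Variables (lev : nat -> R) (eta0 : R).
Hypothesis lev_cvg : (lev k - ((I k)%:R / a + (J k)%:R / b)) / (sc k / 2) @[k --> \oo] --> eta0.
(** The mean of the last stretch is subtracted and [loss] added back, so that violating this level
    while respecting [lev] forces an atypical last stretch. *)
Definition back_level k := lev k - ((r1 k)%:R / a + (r2 k)%:R / b) + loss beta I J k.
Definition back_event k : set T :=
  [set o | lpp (mask (right_of_ray (I k) (J k)) (W o)) (A k + B k) (B k)%:Z <= back_level k].
Let L k : set T := [set o | lpp (V o) (I k + J k) (J k)%:Z <= lev k].
Local Notation Y k := (back_event k).

Let mL k : measurable (L k).
Proof.
have [mE _ _ _] := fE; apply: (sgen_measurable mE (sgen_le (S := setT) _ _)).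
by apply: smeas_lpp => m i _ _ _.
Qed.

Let mY k : measurable (Y k). Proof. exact: (measurable_mask fE). Qed.

(** [V] is squeezed: it lies below the full field, whose law is known, and by [lpp_back] its passage
    time is at least one right of the ray plus an almost deterministic stretch. The same bounds give
    the limit law and make the difference of the two events negligible. *)
Lemma decorrelation :
  [/\ prob P [set o | lpp (V o) (I k + J k) (J k)%:Z <= lev k] @[k --> \oo] --> F_GOE eta0,
      prob P (back_event k) @[k --> \oo] --> F_GOE eta0 &
      prob P ([set o | lpp (V o) (I k + J k) (J k)%:Z <= lev k] `\` back_event k) @[k --> \oo] --> 0].
Proof.
pose eta k := (lev k - ((I k)%:R / a + (J k)%:R / b)) / (sc k / 2).
have levE k : lev k = (I k)%:R / a + (J k)%:R / b + sc k / 2 * eta k.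
  have N0 : (0 < I k + J k)%N by rewrite addn_gt0 I0.
  have [q0 _] := step_scale_cube a0 b0 N0.
  by rewrite /eta [sc k / 2 * _]mulrC divfK ?gt_eqF ?divr_gt0 // addrC subrK.
have [mE E0 _ _] := fE.
have W0 o m j : 0 <= W o m j by apply: wmod_ge0 => // c; exact: E0.
have c3 : prob P (L k `\` Y k) @[k --> \oo] --> 0.
  apply: (@squeeze_cvgr _ _ _ _ (fun=> 0) _ _ _ 0 (cvg_cst _)
    (quadrant_cvg fE beta0 a_bnd b_bnd kap0 M0 I0 J0 IM kapE Noo F_GOE0)).
  near=> k; have ok : radii_ok a b beta I J k by near: k; exact: ok_near.
  rewrite prob_ge0 /=; apply: prob_le.
  - exact: measurableD.
  - apply: (measurable_mask_lt (local_field_exp fE a b I J k)); exact: smeas_cst.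
  - move=> o /= [Lo /negP]; rewrite -ltNge => Yo.
    have h := lpp_back o ok; have [[r1I r2J _ _] _ _ _ _] := ok.
    by move: Lo Yo h; rewrite /L /= /back_level; lra.
have low : prob P [set o | lpp (W o) (I k + J k) (J k)%:Z <= lev k] @[k --> \oo] --> F_GOE eta0.
  have := @flat_cvg _ _ _ P (fun=> E) (fun=> fE) beta 1 (fun=> step a b) (fun k => I k + J k)%N (fun k => (J k)%:Z) eta eta0 beta0 (fun=> s_bnd) Noo lev_cvg.
  by under eq_fun do rewrite step_mean -levE.
pose eta' k := sc k / sc' k * eta k + 2 * (loss beta I J k / sc' k).
have eta'_cvg : eta' k @[k --> \oo] --> eta0.
  rewrite -[eta0]addr0 -[X in _ --> X + _]mul1r -[X in _ --> _ + X](mulr0 2).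
  apply: cvgD; first by apply: cvgM; [exact: scale_ratio_cvg|exact: lev_cvg].
  by apply: cvgM; [exact: cvg_cst|exact: loss_ratio_cvg].
have back : prob P [set o | lpp (W o) (A k + B k) (B k)%:Z <= back_level k] @[k --> \oo] --> F_GOE eta0.
  have roo := radii_oo beta0 a_bnd b_bnd kap0 M0 I0 J0 IM kapE Noo.
  have := @flat_cvg _ _ _ P (fun=> E) (fun=> fE) beta 1 (fun=> step a b) (fun k => A k + B k)%N (fun k => (B k)%:Z) eta' eta0 beta0 (fun=> s_bnd) roo eta'_cvg.
  apply: cvg_trans; apply: near_eq_cvg; near=> k.
  have ok : radii_ok a b beta I J k by near: k; exact: ok_near.
  have q0 : 0 < sc' k.
    by have [[_ _ u1 _] _ _ _ _] := ok; apply: lt_le_trans (back_scale_ge ok); rewrite exprn_gt0 // (lt_le_trans ltr01).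
  have -> : flat_mean (step a b) (A k + B k) (B k)%:Z + sc' k / 2 * eta' k = back_level k.
    rewrite step_mean /back_level /eta' levE.
    have [[r1I r2J _ _] _ _ _ _] := ok.
    have -> : (I k)%:R / a = (A k)%:R / a + (r1 k)%:R / a by rewrite -mulrDl -natrD subnK.
    have -> : (J k)%:R / b = (B k)%:R / b + (r2 k)%:R / b by rewrite -mulrDl -natrD subnK.
    move: ((A k)%:R / a) ((B k)%:R / b) ((r1 k)%:R / a) ((r2 k)%:R / b) => x1 x2 x3 x4.
    by move: (sc k) (sc' k) (eta k) (loss _ _ _ k) q0 => p q r v q0; field; rewrite gt_eqF.
  by [].
have c2 : prob P (Y k) @[k --> \oo] --> F_GOE eta0.
  have rc := ray_cvg fE beta0 a_bnd b_bnd kap0 M0 I0 J0 IM kapE Noo F_GOE0.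
  have up : prob P [set o | lpp (W o) (A k + B k) (B k)%:Z <= back_level k] +
      prob P [set o | lpp (mask (right_of_ray (I k) (J k)) (W o)) (A k + B k) (B k)%:Z < lpp (W o) (A k + B k) (B k)%:Z]
      @[k --> \oo] --> F_GOE eta0.
    by rewrite -[F_GOE _]addr0; exact: cvgD.
  apply: (squeeze_cvgr _ back up); near=> k; apply/andP; split.
    apply: prob_le => //; first exact: (measurable_flat fE).
    move=> o /=; apply: le_trans; apply: lpp_le => m i _ _ _; exact: mask_le.
  apply: le_trans (probU P _ _); [apply: prob_le => //|..].
  - apply: measurableU; first exact: (measurable_flat fE).
    by apply: (measurable_mask_lt fE); exact: smeas_flat.
  - move=> o /= Yo.
    have [FY|YF] := leP (lpp (W o) (A k + B k) (B k)%:Z) (lpp (mask (right_of_ray (I k) (J k)) (W o)) (A k + B k) (B k)%:Z).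
      by left; exact: le_trans Yo.
    by right.
  - exact: (measurable_flat fE).
  - by apply: (measurable_mask_lt fE); exact: smeas_flat.
split => //; change (prob P (L k) @[k --> \oo] --> F_GOE eta0).
have up : prob P (Y k) + prob P (L k `\` Y k) @[k --> \oo] --> F_GOE eta0.
  by rewrite -[F_GOE _]addr0; exact: cvgD.
apply: (squeeze_cvgr _ low up); near=> k; apply/andP; split.
  apply: prob_le => //; first exact: (measurable_flat fE).
  by move=> o /=; apply: le_trans; apply: lpp_le.
apply: le_trans (probU P _ _); [apply: prob_le => //|..] => //.
- by apply: measurableU => //; exact: measurableD.
- by move=> o Lo; have [Yo|Yo] := pselect (Y k o); [left|right].
- exact: measurableD.
Unshelve. all: by end_near. Qed.

End Decorrelation.

(** * Convergence of the interface *)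

Section JointLaw.
Context {d : measure_display} {T : measurableType d} {R : realType} (P : probability T R).

Lemma prob_setD (A B : set T) : measurable A -> measurable B -> A `<=` B -> prob P (B `\` A) = prob P B - prob P A.
Proof.
move=> mA mB AB; rewrite /prob measureD //; last by rewrite ltey_eq fin_num_measure.
by rewrite (_ : B `&` A = A) ?fineB ?fin_num_measure //; apply/setIidPr.
Qed.

Lemma prob_setDI (A B : set T) : measurable A -> measurable B -> prob P (A `\` B) = prob P A - prob P (A `&` B).
Proof.
move=> mA mB; rewrite -prob_setD //; last exact: measurableI.
congr (prob P _); apply/seteqP; split => o /= [Ao nB]; split => //; first by move=> [].
by move=> Bo; apply: nB.
Qed.

Variables (U V : T -> R).
Hypothesis mU : forall x, measurable [set o | U o <= x].
Hypothesis mV : forall x, measurable [set o | V o <= x].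
Hypothesis mUV : measurable [set o | U o <= V o].
Definition marg (x : R) : R := prob P [set o | U o <= x].
Definition joint (x y : R) : R := prob P ([set o | U o <= x] `&` [set o | V o <= y]).

(** The terms are the probabilities of [x_i < U <= x_(i+1) < V]; in [upper_sum] the condition on [V]
    is [x_i < V]. *)
Definition lower_sum (F : R -> R) (H : R -> R -> R) (x : nat -> R) N : R :=
  \sum_(i < N) (F (x i.+1) - F (x i) - (H (x i.+1) (x i.+1) - H (x i) (x i.+1))).
Definition upper_sum (F : R -> R) (H : R -> R -> R) (x : nat -> R) N : R :=
  F (x 0%N) + \sum_(i < N) (F (x i.+1) - F (x i) - (H (x i.+1) (x i) - H (x i) (x i))).

Let cell x x' y : set T := ([set o | U o <= x'] `\` [set o | U o <= x]) `\` [set o | V o <= y].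

Let mcell x x' y : measurable (cell x x' y).
Proof. by apply: measurableD => //; exact: measurableD. Qed.

Let cell_prob x x' y : x <= x' -> prob P (cell x x' y) = marg x' - marg x - (joint x' y - joint x y).
Proof.
move=> xx'; have UU : [set o | U o <= x] `<=` [set o | U o <= x'] by move=> o /=; move/le_trans; apply.
rewrite /cell prob_setDI //; last exact: measurableD.
rewrite prob_setD // -/(marg _) -/(marg _); congr (_ - _).
rewrite /joint -prob_setD; [|exact: measurableI|exact: measurableI|by move=> o /= [/UU]].
congr (prob P _); apply/seteqP; split => o /=; first by move=> [[h1 h2] h3]; split => // -[].
by move=> [[h1 h3] h2]; split => //; split => // h; apply: h2.
Qed.

Variable x : nat -> R.
Hypothesis xS : forall i, x i <= x i.+1.

Let D N : set T := [set o | U o <= x N] `&` [set o | U o <= V o].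

Let mD N : measurable (D N). Proof. exact: measurableI. Qed.

Let D_bnd N : lower_sum marg joint x N <= prob P (D N) <= upper_sum marg joint x N.
Proof.
elim: N => [|N /andP[lo hi]].
  rewrite /lower_sum /upper_sum !big_ord0 prob_ge0 addr0 /=.
  by apply: prob_le => // o [].
rewrite /lower_sum /upper_sum !big_ord_recr /= -!cell_prob //; apply/andP; split.
  apply: (@le_trans _ _ (prob P (D N) + prob P (cell (x N) (x N.+1) (x N.+1)))); first by rewrite lerD2r.
  have dj : D N `&` cell (x N) (x N.+1) (x N.+1) = set0 by apply/seteqP; split => // o [[h _] [[_ h'] _]].
  rewrite /prob -fineD ?fin_num_measure // -measureU //.
  apply: fine_le; rewrite ?fin_num_measure //; first exact: measurableU.
  apply: le_measure; [apply/mem_set; exact: measurableU|exact/mem_set|].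
  move=> o [[h1 h2]|[[h1 h2] h3]]; split => //=; first exact: le_trans (xS N).
  by apply: (le_trans h1); move/negP: h3; rewrite -ltNge => /ltW.
apply: (@le_trans _ _ (prob P (D N) + prob P (cell (x N) (x N.+1) (x N)))); last by rewrite addrA lerD2r.
apply: le_trans (probU P (mD N) (mcell _ _ _)); apply: prob_le => //; first exact: measurableU.
move=> o [/= h1 h2]; have [h|h] := leP (U o) (x N); [by left|right].
split; first by split => //; apply/negP; rewrite -ltNge.
by apply/negP; rewrite -ltNge (lt_le_trans h).
Qed.

Lemma joint_bnd N : lower_sum marg joint x N <= prob P [set o | U o <= V o] <=
  upper_sum marg joint x N + (1 - marg (x N)).
Proof.
have /andP[lo hi] := D_bnd N; apply/andP; split.
  by apply: (le_trans lo); apply: prob_le => // o [].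
apply: (@le_trans _ _ (prob P (D N) + (1 - marg (x N)))); last by rewrite lerD2r.
rewrite /marg -probC //; apply: le_trans (probU P (mD N) (measurableC (mU _))).
apply: prob_le => //; first by apply: measurableU => //; exact: measurableC.
move=> o /= h; have [h'|h'] := leP (U o) (x N); first by left.
by right.
Qed.

End JointLaw.

(** * Convergence of the probability of a comparison *)

Section Comparison.
Context {d : measure_display} {T : measurableType d} {R : realType} (P : probability T R).
Context {d' : measure_display} {T' : measurableType d'} (Q : probability T' R).
Variables (U V : nat -> T -> R) (X Y : T' -> R).
Hypothesis mU : forall k x, measurable [set o | U k o <= x].
Hypothesis mV : forall k x, measurable [set o | V k o <= x].
Hypothesis mUV : forall k, measurable [set o | U k o <= V k o].
Hypothesis mX : forall x, measurable [set o | X o <= x].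
Hypothesis mY : forall x, measurable [set o | Y o <= x].
Hypothesis mXY : measurable [set o | X o <= Y o].
Local Notation G1 := (marg Q X).
Local Notation G2 := (marg Q Y).
Hypothesis indep : forall x y, joint Q X Y x y = G1 x * G2 y.
Hypothesis Ucvg : forall x, marg P (U k) x @[k --> \oo] --> G1 x.
Hypothesis UVcvg : forall x y, joint P (U k) (V k) x y @[k --> \oo] --> G1 x * G2 y.
Hypothesis G1c : continuous G1.
Hypothesis G1lo : forall e : R, 0 < e -> exists x, G1 x < e.
Hypothesis G1hi : forall e : R, 0 < e -> exists x, 1 - e < G1 x.

Let mono x y : x <= y -> G1 x <= G1 y.
Proof. by move=> xy; apply: prob_le => // o /=; move/le_trans; apply. Qed.

Let quantile (v : R) : 0 < v < 1 -> exists x, G1 x = v.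
Proof.
move=> /andP[v0 v1]; have [x xv] := G1lo v0.
have v1' : 0 < 1 - v by rewrite subr_gt0.
have [y yv] := G1hi v1'; rewrite subKr in yv.
have xy : x <= y by rewrite leNgt; apply/negP => /ltW /mono; rewrite leNgt (lt_trans xv).
have c : {within `[x, y], continuous G1} by exact: continuous_subspaceT.
have m : Num.min (G1 x) (G1 y) <= v <= Num.max (G1 x) (G1 y) by rewrite ge_min le_max (ltW xv) (ltW yv) orbT.
by have [z _ zE] := IVT xy c m; exists z.
Qed.

Let grid N : exists x : nat -> R, forall i, (i <= N)%N -> G1 (x i) = (i.+1)%:R / (N.+2)%:R.
Proof.
have H i : exists x, (i <= N)%N -> G1 x = (i.+1)%:R / (N.+2)%:R.
  have [iN|iN] := leqP i N; last by exists 0.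
  have [|x xE] := @quantile ((i.+1)%:R / (N.+2)%:R); last by exists x.
  by rewrite divr_gt0 ?ltr0n //= ltr_pdivrMr ?ltr0n // mul1r ltr_nat !ltnS.
by exists (fun i => projT1 (cid (H i))) => i; exact: (projT2 (cid (H i))).
Qed.

(** The grid consists of quantiles of [X], so each cell has mass [1 / (N + 2)]. For the independent
    pair the gap between upper and lower sum telescopes in [G2], and with the two ends it is at most
    [3 / (N + 2)]. *)
Lemma comparison_cvg : prob P [set o | U k o <= V k o] @[k --> \oo] --> prob Q [set o | X o <= Y o].
Proof.
apply/cvgrPdist_le => e e0; pose N := (Num.truncn (4 / e)).
have N2 : (0 : R) < N.+2%:R by rewrite ltr0n.
have Ne : 4 / (N.+2)%:R <= e.
  rewrite ler_pdivrMr // mulrC -ler_pdivrMr //.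
  have : 0 <= 4 / e by rewrite divr_ge0 // ltW.
  move=> /truncn_itv /andP[_ /ltW h]; apply: (le_trans h); by rewrite ler_nat.
have [x0 x0E] := grid N.
(* The grid is frozen beyond [N], which makes it monotone everywhere. *)
pose x i := x0 (minn i N).
have xE i : (i <= N)%N -> G1 (x i) = (i.+1)%:R / (N.+2)%:R by move=> iN; rewrite /x (minn_idPl iN) x0E.
have xS i : x i <= x i.+1.
  have [iN|iN] := ltnP i N; last by rewrite /x (minn_idPr iN) (minn_idPr (leqW iN)).
  rewrite leNgt; apply/negP => /ltW /mono; rewrite !xE // 1?ltnW // ler_pM2r ?invr_gt0 //.
  by rewrite ler_nat ltnn.
pose H y z := G1 y * G2 z.
have /andP[lo hi] := @joint_bnd _ _ _ Q X Y mX mY mXY x xS N.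
have jH : joint Q X Y = H by apply/funext => y; apply/funext => z; exact: indep.
rewrite jH in lo hi.
have width : upper_sum G1 H x N + (1 - G1 (x N)) - lower_sum G1 H x N <= 3 / (N.+2)%:R.
  have -> : upper_sum G1 H x N + (1 - G1 (x N)) - lower_sum G1 H x N =
     G1 (x 0%N) + (1 - G1 (x N)) + \sum_(i < N) (G1 (x i.+1) - G1 (x i)) * (G2 (x i.+1) - G2 (x i)).
    have -> : \sum_(i < N) (G1 (x i.+1) - G1 (x i)) * (G2 (x i.+1) - G2 (x i)) =
       \sum_(i < N) (G1 (x i.+1) - G1 (x i) - (H (x i.+1) (x i) - H (x i) (x i))) - lower_sum G1 H x N.
      by rewrite /lower_sum -sumrB; apply: eq_bigr => i _; rewrite /H; ring.
    by rewrite /upper_sum; ring.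
  have -> : \sum_(i < N) (G1 (x i.+1) - G1 (x i)) * (G2 (x i.+1) - G2 (x i)) =
      (N.+2)%:R^-1 * (G2 (x N) - G2 (x 0%N)).
    rewrite -(telescope_sumr (fun i => G2 (x i)) (leq0n N)) big_mkord mulr_sumr; apply: eq_bigr => i _.
    congr (_ * _); have iN := ltn_ord i.
    by rewrite !xE // 1?ltnW // -mulrBl -natrB // subSnn mul1r.
  rewrite !xE // mul1r.
  have -> : 1 - N.+1%:R / N.+2%:R = N.+2%:R^-1 :> R.
    apply: (@mulIf _ (N.+2%:R) (lt0r_neq0 N2)).
    by rewrite mulrBl mul1r divfK ?mulVf ?lt0r_neq0 // -natrB // subSnn.
  have g1 : G2 (x N) <= 1 by apply: prob_le1.
  have g0 : 0 <= G2 (x 0%N) by exact: prob_ge0.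
  have n0 : 0 <= (N.+2)%:R^-1 :> R by rewrite invr_ge0 ltW.
  have : (N.+2)%:R^-1 * (G2 (x N) - G2 (x 0%N)) <= (N.+2)%:R^-1 * 1 by rewrite ler_wpM2l //; lra.
  move: ((N.+2)%:R^-1 * (_ - _)) => p; rewrite mulr1; move: ((N.+2)%:R^-1 : R) => n; lra.
have cl : lower_sum (marg P (U k)) (joint P (U k) (V k)) x N @[k --> \oo] --> lower_sum G1 H x N.
  apply: cvg_bigsum => i; apply: cvgB; first by apply: cvgB; exact: Ucvg.
  by apply: cvgB; exact: UVcvg.
have cu : upper_sum (marg P (U k)) (joint P (U k) (V k)) x N + (1 - marg P (U k) (x N)) @[k --> \oo] -->
    upper_sum G1 H x N + (1 - G1 (x N)).
  apply: cvgD; last by apply: cvgB; [exact: cvg_cst|exact: Ucvg].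
  apply: cvgD; first exact: Ucvg.
  apply: cvg_bigsum => i; apply: cvgB; first by apply: cvgB; exact: Ucvg.
  by apply: cvgB; exact: UVcvg.
have e1 : 0 < 1 / (N.+2)%:R :> R by rewrite divr_gt0.
near=> k.
have /andP[klo khi] := @joint_bnd _ _ _ P (U k) (V k) (mU k) (mV k) (mUV k) x xS N.
have h1 : `|lower_sum G1 H x N - lower_sum (marg P (U k)) (joint P (U k) (V k)) x N| <= 1 / (N.+2)%:R.
  by near: k; move/cvgrPdist_le : cl; apply.
have h2 : `|upper_sum G1 H x N + (1 - G1 (x N)) - (upper_sum (marg P (U k)) (joint P (U k) (V k)) x N + (1 - marg P (U k) (x N)))| <= 1 / (N.+2)%:R.
  by near: k; move/cvgrPdist_le : cu; apply.
move: h1 h2; rewrite !ler_norml => /andP[a1 a2] /andP[b1 b2].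
have e3 : 4 / (N.+2)%:R = 3 / (N.+2)%:R + 1 / (N.+2)%:R :> R by rewrite -mulrDl; congr (_ / _); ring.
move: lo hi width klo khi a1 a2 b1 b2 Ne; rewrite e3 /marg.
move: (lower_sum _ _ _ _) (lower_sum _ _ _ _) (upper_sum _ _ _ _) (upper_sum _ _ _ _).
move: (prob P [set o | U k o <= V k o]) (prob Q [set o | X o <= Y o]).
move: (prob P _) (prob Q _) (1 / _ : R) (3 / _ : R) => p q n1 n3 pp qq l1 l2 m1 m2 *.
by apply/andP; split; lra.
Unshelve. all: by end_near. Qed.

End Comparison.

(** * Limits of the rescaled levels *)

Section Limits.
Context {R : realType}.

Lemma cvg_of_cube (y : nat -> R) (Y : R) : 0 < Y -> (forall k, 0 <= y k) -> y k ^+ 3 @[k --> \oo] --> Y ^+ 3 ->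
  y k @[k --> \oo] --> Y.
Proof.
move=> Y0 y0 y3; apply: (@cvg_dist_le _ _ (fun k => `|y k ^+ 3 - Y ^+ 3| / Y ^+ 2)).
  near=> k; rewrite ler_pdivlMr ?exprn_gt0 //.
  have -> : y k ^+ 3 - Y ^+ 3 = (y k - Y) * (y k ^+ 2 + y k * Y + Y ^+ 2) by ring.
  have yk := y0 k; have p0 : 0 <= y k ^+ 2 + y k * Y by rewrite addr_ge0 ?sqr_ge0 // mulr_ge0 // ltW.
  by rewrite normrM ler_wpM2l // ger0_norm ?lerDr // addr_ge0 // sqr_ge0.
rewrite -[X in _ --> X](mul0r (Y ^+ 2)^-1); apply: cvgM; last exact: cvg_cst.
rewrite -(normr0 R); apply: (@cvg_norm _ R^o); rewrite -[X in _ --> X](subrr (Y ^+ 3)).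
by apply: cvgB => //; exact: cvg_cst.
Unshelve. all: by end_near. Qed.

(** The leading orders cancel by [x0 / a + y0 / b = 2]; the displacements [p] and [q] of the end
    point shift the mean at order [t^(1/3)], the order of the fluctuations. *)
Lemma level_cvg (a b x0 y0 p q kap S : R) (t : nat -> R) (I J : nat -> nat) : 0 < a -> 0 < b ->
  (forall k, 0 < t k) -> (forall k, (0 < I k + J k)%N) -> x0 / a + y0 / b = 2 ->
  (I k)%:R / t k @[k --> \oo] --> x0 -> (J k)%:R / t k @[k --> \oo] --> y0 ->
  ((I k)%:R - x0 * t k) / t k `^ 3^-1 @[k --> \oo] --> p ->
  ((J k)%:R - y0 * t k) / t k `^ 3^-1 @[k --> \oo] --> q ->
  0 < S -> S ^+ 3 = 2 * (x0 / a ^+ 3 + y0 / b ^+ 3) ->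
  (2 * t k + kap * t k `^ 3^-1 - ((I k)%:R / a + (J k)%:R / b)) /
    (flat_scale (step a b) (I k + J k) (J k)%:Z / 2) @[k --> \oo] --> (kap - (p / a + q / b)) / (S / 2).
Proof.
move=> a0 b0 t0 IJ0 xy It Jt Ip Jq S0 S3.
pose c k := t k `^ 3^-1.
have c0 k : 0 < c k by exact: powR_gt0.
have c3 k : c k ^+ 3 = t k by rewrite -powR_mulrn ?powR_ge0 // -powRrM mulVf // powRr1 // ltW.
pose s k := flat_scale (step a b) (I k + J k) (J k)%:Z.
have s3 k : 0 < s k /\ s k ^+ 3 = 2 * ((I k)%:R / a ^+ 3 + (J k)%:R / b ^+ 3).
  exact: step_scale_cube.
have sc : s k / c k @[k --> \oo] --> S.
  apply: cvg_of_cube => // [k|]; first by rewrite divr_ge0 ?ltW //; case: (s3 k).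
  have -> : (fun k => (s k / c k) ^+ 3) = (fun k => 2 * ((I k)%:R / t k / a ^+ 3 + (J k)%:R / t k / b ^+ 3)).
    apply/funext => k; rewrite expr_div_n c3 (s3 k).2; move: (t0 k); move: (t k) => z z0.
    by field; rewrite !gt_eqF.
  rewrite S3; apply: cvgM; first exact: cvg_cst.
  by apply: cvgD; (apply: cvgM; last exact: cvg_cst).
have -> : (fun k => (2 * t k + kap * t k `^ 3^-1 - ((I k)%:R / a + (J k)%:R / b)) / (flat_scale (step a b) (I k + J k) (J k)%:Z / 2)) =
  (fun k => (kap - (((I k)%:R - x0 * t k) / c k / a + ((J k)%:R - y0 * t k) / c k / b)) / (s k / c k / 2)).
  apply/funext => k; rewrite -/(s k) -/(c k).
  have -> : 2 * t k = (x0 / a + y0 / b) * t k by rewrite xy.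
  have := c0 k; have := (s3 k).1; move: (c k) (s k) (t k) => u v w v0 u0.
  by field; rewrite !gt_eqF.
apply: cvgM; last first.
  by apply: cvgV; [rewrite mulf_neq0 ?invr_eq0 ?gt_eqF|apply: cvgM => //; exact: cvg_cst].
apply: cvgB; first exact: cvg_cst.
by apply: cvgD; (apply: cvgM; last exact: cvg_cst).
Qed.

End Limits.

(** * Measurability of the interface *)

Section MeasurableInterface.
Context {d : measure_display} {T : measurableType d} {R : realType}.
Variable w : pt -> T -> R.
Hypothesis mw : forall p, measurable_fun setT (w p).

Lemma measurable_LPP (SA SE : pred pt) : measurable_fun setT (fun o => LPP (fun p => w p o) SA SE).
Proof.
pose val (xs : pt * seq pt) o : R := \sum_(q <- xs.1 :: xs.2 | ~~ SA q) w q o.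
pose ok (xs : pt * seq pt) := [&& SA xs.1, SE (last xs.1 xs.2) & path ur_step xs.1 xs.2].
pose g (n : nat) (o : T) : \bar R := if (unpickle n : option (pt * seq pt)) is Some xs then
  (if ok xs then (val xs o)%:E else -oo%E) else -oo%E.
have -> : (fun o => LPP (fun p => w p o) SA SE) = (fun o => esups (g ^~ o) 0%N).
  apply/funext => o; rewrite /LPP /esups /sdrop; apply/eqP; rewrite eq_le; apply/andP; split.
    apply: ub_ereal_sup => _ [x [s [h1 h2 h3 ->]]]; apply: ereal_sup_ubound.
    by exists (pickle (x, s)) => //; rewrite /g pickleK /ok /= h1 h2 h3.
  apply: ub_ereal_sup => _ [n _ <-]; rewrite /g; case: unpickle => [[x s]|]; last exact: leNye.
  case: ifP => [/and3P[h1 h2 h3]|_]; last exact: leNye.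
  by apply: ereal_sup_ubound; exists x, s; split.
apply: measurable_fun_esups => n; rewrite /g; case: unpickle => [xs|]; last exact: measurable_cst.
case: (ok xs); last exact: measurable_cst.
apply/measurable_EFinP; rewrite /val.
under eq_fun do rewrite big_mkcond.
by apply: measurable_sum => q; case: (~~ SA q); [exact: mw|exact: measurable_cst].
Qed.

(** The family [F] of sets carries the induction: the next position depends on the present one and
    on one comparison of passage times, which can be moved into [F]. *)
Lemma measurable_interface n (F : pt -> set T) : (forall p, measurable (F p)) ->
  measurable [set o | F (comp_interface (fun p => w p o) n) o].
Proof.
elim: n F => [|n IH] F mF; first exact: mF.
pose q (p : pt) : pt := (p.1 + 1, p.2 + 1).
pose A (p : pt) := [set o | (LPP (fun p => w p o) Lminus (pred1 (q p)) < LPP (fun p => w p o) Lplus (pred1 (q p)))%E].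
have mA p : measurable (A p).
  by rewrite /A -[X in measurable X]setTI; apply: measurable_lte => //; exact: measurable_LPP.
have := IH (fun p => (A p `&` F (p.1 + 1, p.2)) `|` (~` A p `&` F (p.1, p.2 + 1))).
have -> : [set o | F (comp_interface (fun p => w p o) n.+1) o] = [set o |
   ((A (comp_interface (fun p => w p o) n) `&` F ((comp_interface (fun p => w p o) n).1 + 1, (comp_interface (fun p => w p o) n).2)) `|`
   (~` A (comp_interface (fun p => w p o) n) `&` F ((comp_interface (fun p => w p o) n).1, (comp_interface (fun p => w p o) n).2 + 1))) o].
  apply/seteqP; split => o /=; rewrite /A /=; case: ifP => h Fo.
  - by left.
  - by right; split => //; rewrite /setC /= h.
  - by case: Fo => [[_ //]|[/(_ isT)]].
  - by case: Fo => [[//]|[_ //]].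
by apply => p; apply: measurableU; apply: measurableI => //; exact: measurableC.
Qed.

End MeasurableInterface.

(** * From independent approximations to asymptotic independence *)

Section AsymptoticIndependence.
Context {d : measure_display} {T : measurableType d} {R : realType} (P : probability T R).

(** Since an event and its approximation have the same limiting probability, smallness of one
    difference implies that of the other; then the events may be exchanged inside the
    intersection. *)
Lemma asymptotic_independence (Am Ap Ym Yp : nat -> set T) (lm lp : R) :
  (forall k, measurable (Am k)) -> (forall k, measurable (Ap k)) ->
  (forall k, measurable (Ym k)) -> (forall k, measurable (Yp k)) ->
  (forall k, prob P (Ym k `&` Yp k) = prob P (Ym k) * prob P (Yp k)) ->
  [/\ prob P (Am k) @[k --> \oo] --> lm, prob P (Ym k) @[k --> \oo] --> lm &
    prob P (Am k `\` Ym k) @[k --> \oo] --> 0] ->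
  [/\ prob P (Ap k) @[k --> \oo] --> lp, prob P (Yp k) @[k --> \oo] --> lp &
    prob P (Ap k `\` Yp k) @[k --> \oo] --> 0] ->
  prob P (Ap k `&` Am k) @[k --> \oo] --> lp * lm.
Proof.
move=> mAm mAp mYm mYp ind [m1 m2 m3] [p1 p2 p3].
have back (A Y : nat -> set T) (l : R) : (forall k, measurable (A k)) -> (forall k, measurable (Y k)) ->
    prob P (A k) @[k --> \oo] --> l -> prob P (Y k) @[k --> \oo] --> l -> prob P (A k `\` Y k) @[k --> \oo] --> 0 ->
    prob P (Y k `\` A k) @[k --> \oo] --> 0.
  move=> mA mY c1 c2 c3.
  have -> : (fun k => prob P (Y k `\` A k)) = (fun k => prob P (Y k) - prob P (A k) + prob P (A k `\` Y k)).
    apply/funext => k; rewrite !prob_setDI // setIC; ring.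
  rewrite -[X in _ --> X]addr0 -[X in _ --> X + _](subrr l); apply: cvgD => //; exact: cvgB.
have m4 := back _ _ _ mAm mYm m1 m2 m3; have p4 := back _ _ _ mAp mYp p1 p2 p3.
have prod : prob P (Yp k) * prob P (Ym k) @[k --> \oo] --> lp * lm by exact: cvgM.
apply: (@cvg_dist_le _ _ (fun k => prob P (Am k `\` Ym k) + prob P (Ap k `\` Yp k) + prob P (Ym k `\` Am k) + prob P (Yp k `\` Ap k) +
   `|prob P (Yp k) * prob P (Ym k) - lp * lm|)); last first.
  have z : (0 : R) = 0 + 0 + 0 + 0 + 0 by rewrite !addr0.
  rewrite [X in _ --> X]z; apply: cvgD; first by do 3! apply: cvgD => //.
  rewrite -(normr0 R); apply: (@cvg_norm _ R^o); rewrite -[X in _ --> X](subrr (lp * lm)).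
  by apply: cvgB => //; exact: cvg_cst.
near=> k.
have step1 (X1 X2 Y1 Y2 : set T) : measurable X1 -> measurable X2 -> measurable Y1 -> measurable Y2 ->
    prob P (X1 `&` X2) <= prob P (Y1 `&` Y2) + (prob P (X1 `\` Y1) + prob P (X2 `\` Y2)).
  move=> mX1 mX2 mY1 mY2; have mD1 := measurableD mX1 mY1; have mD2 := measurableD mX2 mY2.
  apply: le_trans (_ : prob P ((Y1 `&` Y2) `|` ((X1 `\` Y1) `|` (X2 `\` Y2))) <= _); last first.
    apply: le_trans (probU _ _ _) _; [exact: measurableI|exact: measurableU|].
    by rewrite lerD2l; exact: probU.
  apply: prob_le; [exact: measurableI|by apply: measurableU; [exact: measurableI|exact: measurableU]|].
  move=> o [x1 x2]; have [y1|y1] := pselect (Y1 o); last by right; left.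
  by have [y2|y2] := pselect (Y2 o); [left|right; right].
have s1 := step1 _ _ _ _ (mAp k) (mAm k) (mYp k) (mYm k).
have s2 := step1 _ _ _ _ (mYp k) (mYm k) (mAp k) (mAm k).
have yE : prob P (Yp k `&` Ym k) = prob P (Yp k) * prob P (Ym k) by rewrite setIC ind mulrC.
rewrite yE in s1 s2.
have g1 := prob_ge0 P (Am k `\` Ym k); have g2 := prob_ge0 P (Ap k `\` Yp k).
have g3 := prob_ge0 P (Ym k `\` Am k); have g4 := prob_ge0 P (Yp k `\` Ap k).
have -> : prob P (Ap k `&` Am k) - lp * lm =
  (prob P (Ap k `&` Am k) - prob P (Yp k) * prob P (Ym k)) + (prob P (Yp k) * prob P (Ym k) - lp * lm) by ring.
apply: (le_trans (ler_normD _ _)); rewrite lerD2r ler_norml.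
move: s1 s2 g1 g2 g3 g4; move: (prob P (Ap k `&` Am k)) (prob P (Yp k) * prob P (Ym k)) => x y.
move: (prob P (Am k `\` Ym k)) (prob P (Ap k `\` Yp k)) (prob P (Ym k `\` Am k)) (prob P (Yp k `\` Ap k)) => c1 c2 c3 c4 *.
by apply/andP; split; lra.
Unshelve. all: by end_near. Qed.

End AsymptoticIndependence.

(** * The two passage times as models with step parameters *)

Section TwoModels.
Context {d : measure_display} {T : measurableType d} {R : realType} (P : probability T R).
Variables (alpha : R) (w : pt -> T -> R).
Hypothesis alpha01 : 0 < alpha < 1.
Hypothesis mw : forall p, measurable_fun setT (w p).
Hypothesis w_indep : mutually_independent P (fun p => ~~ Lplus p && ~~ Lminus p) w.
Hypothesis w_le : forall p : pt, ~~ Lplus p -> ~~ Lminus p -> forall x : R, 0 <= x ->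
  P [set o | w p o <= x] = (1 - expR (- ((if (0 < p.2)%R then 1 else alpha) * x)))%:E.
(** The rates are [a + a = alpha] in the lower rows and [a + b = 1] in the upper ones; from [Lplus]
    only upper rows are seen, and [h + h = 1]. *)
Let a : R := alpha / 2.
Let b : R := 1 - alpha / 2.
Let h : R := 2^-1.
Let E := weight_field alpha w.
Let E' (c : nat * int) : T -> R := E (c.1, c.1.+1%:Z - c.2).
Local Notation Wm o := (wmod (step a b) (fun c => E c o)).
Local Notation Wp o := (wmod (step h h) (fun c => E' c o)).

Let alpha0 : 0 < alpha. Proof. by case/andP: alpha01. Qed.

Let fE : exp_field P E. Proof. exact: weight_field_exp. Qed.

Let fE' : exp_field P E'.
Proof.
apply: (exp_field_reindex (s := fun c => (c.1, c.1.+1%:Z - c.2)) (r := fun c => (c.1, c.1.+1%:Z - c.2)) _ fE).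
by move=> [m j] /=; rewrite subKr.
Qed.

(** The weights met from [Lminus], as a field below the full one: cells with [j > m] are out of
    reach, and the cell [(0, 0)] is a point of [Lminus]. *)
Definition minus_model o m j : R := if (j <= m%:Z) && ((m, j) != (0%N, 0)) then Wm o m j else 0.
Definition plus_model o m i : R := if i <= m%:Z then Wp o m i else 0.

Lemma minus_modelE o m j : (forall p, ~~ Lplus p -> ~~ Lminus p -> 0 <= w p o) ->
  minus_model o m j = Lminus_weight (fun p => w p o) m j.
Proof.
move=> w0; rewrite /minus_model /Lminus_weight; case: ifP => // /andP[jm mj].
have := @weight_ge0 _ (fun p => w p o) w0 m j mj.
rewrite /wmod /E /weight_field /cell_pt (negbTE mj) /= => w1.
rewrite /Num.max lt_neqAle w1 andbT /pt_rate /= /step.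
have -> : (j - m%:Z <= 0) by lia.
have -> : (if 0 != w (m.+1%:Z - j, j) o then w (m.+1%:Z - j, j) o else 0) = w (m.+1%:Z - j, j) o.
  by case: eqVneq => [<-|].
have [j0|j0] := leP j 0; last by rewrite /b /a mulr1 subrK divr1.
by rewrite /a -splitr mulfK // gt_eqF.
Qed.

Lemma plus_modelE o m (i : int) : (forall p, ~~ Lplus p -> ~~ Lminus p -> 0 <= w p o) ->
  plus_model o m i = Lplus_weight (fun p => w p o) m (m.+1%:Z - i).
Proof.
move=> w0; rewrite /plus_model /Lplus_weight.
have -> : (1 <= m.+1%:Z - i) = (i <= m%:Z) by apply/idP/idP; lia.
case: ifP => // im.
have mj : (m, m.+1%:Z - i) != (0%N, 0) by apply/eqP => -[]; lia.
have := @weight_ge0 _ (fun p => w p o) w0 m _ mj.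
rewrite /wmod /E' /E /weight_field /cell_pt /= (negbTE mj) /= => w1.
rewrite /Num.max lt_neqAle w1 andbT /pt_rate /= /step.
have -> : (0 < m.+1%:Z - i) by lia.
have -> : (if 0 != w (m.+1%:Z - (m.+1%:Z - i), m.+1%:Z - i) o then w (m.+1%:Z - (m.+1%:Z - i), m.+1%:Z - i) o else 0) = w (m.+1%:Z - (m.+1%:Z - i), m.+1%:Z - i) o.
  by case: eqVneq => [<-|].
by rewrite !if_same (_ : h + h = 1) ?mulr1 ?divr1 // /h; lra.
Qed.

Variables (beta kap M : R) (I J : nat -> nat).
Hypothesis beta0 : 0 < beta.
Hypothesis a_bnd : beta <= a <= 1.
Hypothesis b_bnd : beta <= b <= 1.
Hypothesis h_bnd : beta <= h <= 1.
Hypothesis kap0 : 0 < kap.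
Hypothesis M0 : 0 <= M.
Hypothesis I0 : forall k, (0 < I k)%N.
Hypothesis J0 : forall k, (0 < J k)%N.
Hypothesis IM : forall k, (I k)%:R <= M * (J k)%:R.
Hypothesis JM : forall k, (J k)%:R <= M * (I k)%:R.
Hypothesis kapm : forall k, kap <= (I k)%:R / (J k)%:R / a ^+ 2 - 1 / b ^+ 2.
Hypothesis kapp : forall k, kap <= (J k)%:R / (I k)%:R / h ^+ 2 - 1 / h ^+ 2.
Hypothesis Noo : ((I k + J k)%N%:R : R) @[k --> \oo] --> +oo.
Hypothesis F_GOE0 : forall e : R, 0 < e -> exists y : R, F_GOE y < e.

Definition minus_lpp k o : R := lpp (minus_model o) (I k + J k) (J k)%:Z.
Definition plus_lpp k o : R := lpp (plus_model o) (J k + I k) (I k)%:Z.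

Let Wm0 o m j : 0 <= Wm o m j.
Proof.
apply: wmod_ge0 => [i|c]; last by case: fE.
by have /andP[g _] := step_bnd i a_bnd b_bnd; exact: lt_le_trans g.
Qed.

Let Wp0 o m j : 0 <= Wp o m j.
Proof.
apply: wmod_ge0 => [i|c]; last by case: fE'.
by have /andP[g _] := step_bnd i h_bnd h_bnd; exact: lt_le_trans g.
Qed.

Let ray_region (I' J' m : nat) (j : int) : (0 < I')%N -> (0 < J')%N -> right_of_ray I' J' m j -> j <= m%:Z /\ (m, j) != (0%N, 0).
Proof.
rewrite /right_of_ray => i0 j0 rr; have jm : j <= m%:Z by move: rr i0 j0; clear; nia.
by split => //; apply/eqP => -[m0 jE]; move: rr; rewrite m0 jE; clear; lia.
Qed.

Lemma smeas_minus_model (m : nat) (j : int) : smeas E setT (fun o => minus_model o m j).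
Proof.
rewrite /minus_model; case: (_ && _); last exact: smeas_cst.
by apply: smeasZr; exact: smeas_coord.
Qed.

Let smeas_plus_model' (m : nat) (j : int) : smeas E' setT (fun o => plus_model o m j).
Proof.
rewrite /plus_model; case: (_ <= _); last exact: smeas_cst.
by apply: smeasZr; exact: smeas_coord.
Qed.

Lemma smeas_plus_model (m : nat) (j : int) : smeas E setT (fun o => plus_model o m j).
Proof.
rewrite /plus_model; case: (_ <= _); last exact: smeas_cst.
by apply: smeasZr; apply: (@smeas_coord _ _ _ _ E setT (m, m.+1%:Z - j)).
Qed.

Variables (lm lp : nat -> R) (etam etap : R).
Hypothesis lm_cvg : (lm k - ((I k)%:R / a + (J k)%:R / b)) / (flat_scale (step a b) (I k + J k) (J k)%:Z / 2)
  @[k --> \oo] --> etam.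
Hypothesis lp_cvg : (lp k - ((J k)%:R / h + (I k)%:R / h)) / (flat_scale (step h h) (J k + I k) (I k)%:Z / 2)
  @[k --> \oo] --> etap.
Let Am k : set T := [set o | minus_lpp k o <= lm k].
Let Ap k : set T := [set o | plus_lpp k o <= lp k].

Lemma measurable_minus_lpp k (u : R) : measurable [set o | minus_lpp k o <= u].
Proof.
have [mE _ _ _] := fE; apply: (sgen_measurable mE (sgen_le (S := setT) _ _)).
by apply: smeas_lpp => m i _ _ _; exact: smeas_minus_model.
Qed.

Lemma measurable_plus_lpp k (u : R) : measurable [set o | plus_lpp k o <= u].
Proof.
have [mE _ _ _] := fE; apply: (sgen_measurable mE (sgen_le (S := setT) _ _)).
by apply: smeas_lpp => m i _ _ _; exact: smeas_plus_model.
Qed.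

(** The approximating events depend on the cells right of the ray and, after reflection, on those
    right of the reflected ray. Undoing the reflection puts the latter strictly on the other side,
    so the two sets of cells are disjoint. *)
Lemma joint_cvg : [/\ prob P (Am k) @[k --> \oo] --> F_GOE etam, prob P (Ap k) @[k --> \oo] --> F_GOE etap &
  prob P (Ap k `&` Am k) @[k --> \oo] --> F_GOE etap * F_GOE etam].
Proof.
have [mE _ _ indE] := fE.
have Noo' : ((J k + I k)%N%:R : R) @[k --> \oo] --> +oo by under eq_fun do rewrite addnC.
have minus_le o m j : minus_model o m j <= Wm o m j by rewrite /minus_model; case: ifP.
have minus_ge0 o m j : 0 <= minus_model o m j by rewrite /minus_model; case: ifP.
have plus_le o m j : plus_model o m j <= Wp o m j by rewrite /plus_model; case: ifP.
have plus_ge0 o m j : 0 <= plus_model o m j by rewrite /plus_model; case: ifP.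
have ray_m k o m j : right_of_ray (I k) (J k) m j -> Wm o m j <= minus_model o m j.
  by move=> /(ray_region (I0 k) (J0 k)) [r1 r2]; rewrite /minus_model r1 r2.
have ray_p k o m j : right_of_ray (J k) (I k) m j -> Wp o m j <= plus_model o m j.
  by move=> /(ray_region (J0 k) (I0 k)) [r1 _]; rewrite /plus_model r1.
have quad_m o m j : quadrant m j -> Wm o m j <= minus_model o m j.
  rewrite /quadrant /minus_model => /andP[q1 q2]; rewrite q2 /= ifT //.
  by apply/eqP => -[_ jE]; rewrite jE in q1.
have quad_p o m j : quadrant m j -> Wp o m j <= plus_model o m j.
  by rewrite /quadrant /plus_model => /andP[_ ->].
have Dm := decorrelation fE beta0 a_bnd b_bnd kap0 M0 I0 J0 IM kapm Noo F_GOE0 minus_ge0 minus_le ray_m quad_m smeas_minus_model lm_cvg.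
have Dp := decorrelation fE' beta0 h_bnd h_bnd kap0 M0 J0 I0 JM kapp Noo' F_GOE0 plus_ge0 plus_le ray_p quad_p smeas_plus_model' lp_cvg.
have mY1 k := measurable_mask fE a b (right_of_ray (I k) (J k)) (I k - back1 a I J k + (J k - back2 b I J k)) (J k - back2 b I J k)%:Z.
have mY2 k := measurable_mask fE' h h (right_of_ray (J k) (I k)) (J k - back1 h J I k + (I k - back2 h J I k)) (I k - back2 h J I k)%:Z.
move: Dm Dp; move: (F_GOE etam) (F_GOE etap) => l1 l2 Dm Dp.
have [m1 _ _] := Dm; have [p1 _ _] := Dp.
split; [exact: m1|exact: p1|].
apply: (@asymptotic_independence _ _ _ P Am Ap (back_event E a b beta I J lm) (back_event E' h h beta J I lp) l1 l2 _ _ _ _ _ Dm Dp).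
- by move=> k; exact: measurable_minus_lpp.
- by move=> k; exact: measurable_plus_lpp.
- by move=> k; exact: mY1.
- by move=> k; exact: mY2.
move=> k; pose Sm : set (nat * int) := [set c | right_of_ray (I k) (J k) c.1 c.2].
pose Sp : set (nat * int) := [set c | right_of_ray (J k) (I k) c.1 (c.1.+1%:Z - c.2)].
have dj : Sm `&` Sp = set0.
  apply/seteqP; split => // -[m j] /= [] ; rewrite /Sm /Sp /= /right_of_ray.
  by have := I0 k; have := J0 k; clear; nia.
have sm : sgen E Sm (back_event E a b beta I J lm k).
  apply: sgen_le; apply: smeas_lpp => m j _ _ _; rewrite /mask; have [rr|_] := boolP (right_of_ray _ _ _ _); last exact: smeas_cst.
  by apply: smeasZr; exact: smeas_coord.
have sp : sgen E Sp (back_event E' h h beta J I lp k).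
  apply: sgen_le; apply: smeas_lpp => m j _ _ _; rewrite /mask; have [rr|_] := boolP (right_of_ray _ _ _ _); last exact: smeas_cst.
  by apply: smeasZr; apply: (@smeas_coord _ _ _ _ E Sp (m, m.+1%:Z - j)); rewrite /Sp /= subKr.
rewrite /prob (@sgen_indep _ _ _ _ _ E mE indE Sm Sp _ _ dj sm sp) fineM //; apply: fin_num_measure; [exact: mY1|exact: mY2].
Qed.

End TwoModels.

(** * The tested point along a sequence of times *)

Section Sequences.
Context {R : realType}.
Variables (alpha s : R).
Hypothesis alpha01 : 0 < alpha < 1.
Let a : R := alpha / 2.
Let b : R := 1 - alpha / 2.
Let h : R := 2^-1.

(* The interface stays in the tested half-line at time [t] iff it has climbed at least to the row
   [ceil (test_height t)]. *)
Definition test_height (t : R) : R := ((Num.truncn t)%:R - (alpha - 1) * t - s * t `^ 3^-1) / 2.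
Definition test_row (t : R) : nat := `|Num.ceil (test_height t)|%N.
Definition test_col (t : R) : nat := ((Num.truncn t).+1 - test_row t)%N.

Let a0 : 0 < a. Proof. by rewrite divr_gt0 //; case/andP: alpha01. Qed.
Let b0 : 0 < b. Proof. by rewrite /b; case/andP: alpha01; lra. Qed.
Let h0 : 0 < h. Proof. by rewrite invr_gt0. Qed.
Let ab : a < b. Proof. by rewrite /a /b; case/andP: alpha01; lra. Qed.
Let ab1 : a + b = 1. Proof. by rewrite /a /b; ring. Qed.

(** Half the smaller of the two gaps that separate the limiting direction [(a, b)] from the
    characteristics [(a^2, b^2)] and [(1, 1)]; both are positive because [a < b]. *)
Definition ratio_gap : R := Num.min ((a / b / a ^+ 2 - 1 / b ^+ 2) / 2) ((b / a / h ^+ 2 - 1 / h ^+ 2) / 2).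
Definition ratio_bound : R := a / b + b / a + 1.

Lemma ratio_gap_gt0 : 0 < ratio_gap.
Proof.
rewrite lt_min; apply/andP; split; rewrite divr_gt0 // subr_gt0.
  have -> : a / b / a ^+ 2 = b / a * (1 / b ^+ 2) by field; rewrite !gt_eqF.
  by rewrite ltr_pMl ?divr_gt0 ?exprn_gt0 // ltr_pdivlMr // mul1r.
by rewrite ltr_pM2r ?invr_gt0 ?exprn_gt0 // ltr_pdivlMr // mul1r.
Qed.

Lemma ratio_bound_ge0 : 0 <= ratio_bound.
Proof. by rewrite !addr_ge0 // divr_ge0 // ltW. Qed.

(** What the comparison of the two models asks of a single time. It holds for large times only, so
    sequences of times are shifted before use. *)
Record test_ok (t : R) : Prop := TestOk {
  test_pos : 0 < t;
  test_ceil : Num.ceil (test_height t) = (test_row t)%:Z;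
  test_row_gt0 : (0 < test_row t)%N;
  test_col_gt0 : (0 < test_col t)%N;
  test_sum : (test_col t + test_row t = (Num.truncn t).+1)%N;
  test_ratio1 : (test_col t)%:R <= ratio_bound * (test_row t)%:R;
  test_ratio2 : (test_row t)%:R <= ratio_bound * (test_col t)%:R;
  test_gap1 : ratio_gap <= (test_col t)%:R / (test_row t)%:R / a ^+ 2 - 1 / b ^+ 2;
  test_gap2 : ratio_gap <= (test_row t)%:R / (test_col t)%:R / h ^+ 2 - 1 / h ^+ 2 }.

Variable t : nat -> R.
Hypothesis too : t k @[k --> \oo] --> +oo.
Local Notation c k := (t k `^ 3^-1).
Local Notation n k := (Num.truncn (t k)).

Let cc k : 0 < t k -> 0 < c k /\ c k ^+ 3 = t k.
Proof.
move=> t0; split; first exact: powR_gt0.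
by rewrite -powR_mulrn ?powR_ge0 // -powRrM mulVf // powRr1 // ltW.
Qed.

Let coo : c k @[k --> \oo] --> +oo.
Proof.
apply/cvgryPge => x; pose x' := Num.max x 1.
have x0 : 0 <= x' by rewrite le_max ler01 orbT.
near=> k; apply: (@le_trans _ _ x'); first by rewrite le_max lexx.
have t0 : 0 < t k by apply: lt_le_trans ltr01 _; near: k; exact: near_large.
have [c0 c3] := cc t0; rewrite leNgt; apply/negP => cx.
have : c k ^+ 3 < x' ^+ 3 by rewrite ltr_pXn2r ?nnegrE // ltW.
rewrite c3; apply/negP; rewrite -leNgt; near: k; exact: near_large.
Unshelve. all: by end_near. Qed.

Let cV0 : (c k)^-1 @[k --> \oo] --> (0 : R).
Proof.
apply/cvgr0Pnorm_le => x x0; near=> k.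
have ux : x^-1 <= c k by near: k; exact: near_large.
have u0 : 0 < c k by apply: lt_le_trans ux; rewrite invr_gt0.
by rewrite ger0_norm ?invr_ge0 ?(ltW u0) // -(invrK x) lef_pV2 ?posrE ?invr_gt0.
Unshelve. all: by end_near. Qed.

Let bounded_div (y : nat -> R) (B : R) : (\forall k \near \oo, `|y k| <= B) -> y k / c k @[k --> \oo] --> 0.
Proof.
move=> yB; apply: (@cvg_dist_le _ _ (fun k => B * (c k)^-1)); last first.
  by rewrite -[X in _ --> X](mulr0 B); apply: cvgM => //; exact: cvg_cst.
near=> k; have t0 : 0 < t k by apply: lt_le_trans ltr01 _; near: k; exact: near_large.
have [c0 _] := cc t0.
rewrite subr0 normrM normfV (gtr0_norm c0) ler_pM2r ?invr_gt0 //; near: k; exact: yB.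
Unshelve. all: by end_near. Qed.

Let trunc_near : \forall k \near \oo, `|(n k)%:R - t k| <= 1.
Proof.
near=> k; have t0 : 0 <= t k by near: k; exact: near_large.
have /andP[h1 /ltW h2] := truncn_itv t0; rewrite -natr1 in h2.
by rewrite ler_norml; apply/andP; split; lra.
Unshelve. all: by end_near. Qed.

Let height_cvg : (test_height (t k) - b * t k) / c k @[k --> \oo] --> - (s / 2).
Proof.
have h1 := bounded_div trunc_near.
have -> : - (s / 2) = 0 / 2 - s / 2 :> R by rewrite mul0r add0r.
have : ((n k)%:R - t k) / c k / 2 - s / 2 @[k --> \oo] --> (0 / 2 - s / 2 : R).
  by apply: cvgB; [apply: cvgM => //; exact: cvg_cst|exact: cvg_cst].
apply: cvg_trans; apply: near_eq_cvg; near=> k.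
have t0 : 0 < t k by apply: lt_le_trans ltr01 _; near: k; exact: near_large.
have [c0 _] := cc t0; rewrite /test_height /b; move: (c k) ((n k)%:R : R) (t k) c0 => u v w u0.
by field; rewrite gt_eqF.
Unshelve. all: by end_near. Qed.

Let to_ratio (y : nat -> R) (x0 p : R) : (y k - x0 * t k) / c k @[k --> \oo] --> p -> y k / t k @[k --> \oo] --> x0.
Proof.
move=> yp; have : (y k - x0 * t k) / c k * (c k)^-1 * (c k)^-1 + x0 @[k --> \oo] --> p * 0 * 0 + x0.
  by apply: cvgD; [do 2! apply: cvgM => //|exact: cvg_cst].
rewrite mulr0 add0r.
apply: cvg_trans; apply: near_eq_cvg; near=> k.
have t0 : 0 < t k by apply: lt_le_trans ltr01 _; near: k; exact: near_large.
have [c0 c3] := cc t0; move: (c k) (y k) c0 c3 => u v u0 <-.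
by field; rewrite gt_eqF.
Unshelve. all: by end_near. Qed.

Let height_pos : \forall k \near \oo, 1 <= test_height (t k).
Proof.
have hr := to_ratio height_cvg.
have b2 : b / 2 < b by rewrite ltr_pdivrMr // ltr_pMr // ltr1n.
near=> k; have t0 : 2 / b <= t k by near: k; exact: near_large.
have hk : b / 2 < test_height (t k) / t k by near: k; apply: (@cvgr_gt R nat \oo _ _ _ hr).
have tp : 0 < t k by apply: lt_le_trans t0; rewrite divr_gt0.
move: hk t0; rewrite ltr_pdivlMr // ler_pdivrMr // (_ : b / 2 * t k = t k * b / 2); last by ring.
by move: (t k * b) => y; lra.
Unshelve. all: by end_near. Qed.

Let row_near : \forall k \near \oo, Num.ceil (test_height (t k)) = (test_row (t k))%:Z /\
  `|(test_row (t k))%:R - test_height (t k)| <= 1 /\ (0 < test_row (t k))%N.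
Proof.
near=> k; have hk : 1 <= test_height (t k) by near: k; exact: height_pos.
have /andP[c1 c2] := ceil_itv (test_height (t k)).
have c3 : 0 < Num.ceil (test_height (t k)) by rewrite -(ltr_int R) (lt_le_trans _ c2) // (lt_le_trans ltr01).
have cE : Num.ceil (test_height (t k)) = (test_row (t k))%:Z by rewrite /test_row; move: c3; clear; lia.
rewrite cE in c1 c2 c3; split => //; split; last by [].
rewrite intrB /= in c1; rewrite ler_norml; apply/andP; split; move: c1 c2; rewrite -!pmulrn; lra.
Unshelve. all: by end_near. Qed.

Lemma row_cvg : ((test_row (t k))%:R - b * t k) / c k @[k --> \oo] --> - (s / 2).
Proof.
have h1 : ((test_row (t k))%:R - test_height (t k)) / c k @[k --> \oo] --> (0 : R).
  by apply: (@bounded_div _ 1); apply: filterS row_near => k [_ []].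
have : ((test_row (t k))%:R - test_height (t k)) / c k + (test_height (t k) - b * t k) / c k @[k --> \oo] --> 0 + - (s / 2).
  exact: cvgD.
rewrite add0r; apply: cvg_trans; apply: near_eq_cvg; near=> k.
by rewrite /= -mulrDl; congr (_ / _); ring.
Unshelve. all: by end_near. Qed.

Let sum_near : \forall k \near \oo, (0 < test_col (t k))%N /\ (test_col (t k) + test_row (t k) = (n k).+1)%N.
Proof.
have rr := to_ratio row_cvg.
have b1 : b < 1 by rewrite -ab1 ltrDr.
near=> k.
have t0 : 1 <= t k by near: k; exact: near_large.
have tp : 0 < t k by apply: lt_le_trans t0.
have hk : (test_row (t k))%:R / t k < 1 by near: k; apply: (@cvgr_lt R nat \oo _ _ _ rr).
rewrite ltr_pdivrMr // mul1r in hk.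
have /andP[_ h2] := truncn_itv (ltW tp).
have jn : (test_row (t k) < (n k).+1)%N by rewrite -(ltr_nat R) (lt_trans hk).
by rewrite /test_col subn_gt0 jn subnK // ltnW.
Unshelve. all: by end_near. Qed.

Lemma col_cvg : ((test_col (t k))%:R - a * t k) / c k @[k --> \oo] --> s / 2.
Proof.
have h1 : ((n k)%:R - t k + 1) / c k @[k --> \oo] --> (0 : R).
  apply: (@bounded_div _ 2); near=> k.
  have : `|(n k)%:R - t k| <= 1 by near: k; exact: trunc_near.
  by rewrite !ler_norml => /andP[? ?]; apply/andP; split; lra.
have : ((n k)%:R - t k + 1) / c k - ((test_row (t k))%:R - b * t k) / c k @[k --> \oo] --> 0 - - (s / 2).
  by apply: cvgB => //; exact: row_cvg.
rewrite sub0r opprK; apply: cvg_trans; apply: near_eq_cvg; near=> k.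
have [_ sE] : (0 < test_col (t k))%N /\ (test_col (t k) + test_row (t k) = (n k).+1)%N by near: k; exact: sum_near.
have sR : (test_col (t k))%:R + (test_row (t k))%:R = (n k)%:R + 1 :> R by rewrite -natrD sE -natr1.
rewrite /= -mulrBl; congr (_ / _).
have -> : a * t k = t k - b * t k by rewrite -{2}[t k]mul1r -ab1 mulrDl addrK.
by move: sR; lra.
Unshelve. all: by end_near. Qed.

Lemma row_ratio : (test_row (t k))%:R / t k @[k --> \oo] --> b. Proof. exact: to_ratio row_cvg. Qed.
Lemma col_ratio : (test_col (t k))%:R / t k @[k --> \oo] --> a. Proof. exact: to_ratio col_cvg. Qed.

Lemma test_near : \forall k \near \oo, test_ok (t k).
Proof.
have q1 : (test_col (t k))%:R / t k / ((test_row (t k))%:R / t k) @[k --> \oo] --> a / b.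
  by apply: cvgM; [exact: col_ratio|apply: cvgV; [rewrite gt_eqF|exact: row_ratio]].
have q2 : (test_row (t k))%:R / t k / ((test_col (t k))%:R / t k) @[k --> \oo] --> b / a.
  by apply: cvgM; [exact: row_ratio|apply: cvgV; [rewrite gt_eqF|exact: col_ratio]].
have g1 : (test_col (t k))%:R / t k / ((test_row (t k))%:R / t k) / a ^+ 2 - 1 / b ^+ 2 @[k --> \oo] --> a / b / a ^+ 2 - 1 / b ^+ 2.
  by apply: cvgB; [apply: cvgM => //|]; exact: cvg_cst.
have g2 : (test_row (t k))%:R / t k / ((test_col (t k))%:R / t k) / h ^+ 2 - 1 / h ^+ 2 @[k --> \oo] --> b / a / h ^+ 2 - 1 / h ^+ 2.
  by apply: cvgB; [apply: cvgM => //|]; exact: cvg_cst.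
have := ratio_gap_gt0; rewrite {1}/ratio_gap lt_min => /andP[r1 r2].
have g1' : ratio_gap < a / b / a ^+ 2 - 1 / b ^+ 2 by rewrite gt_min; apply/orP; left; move: r1; lra.
have g2' : ratio_gap < b / a / h ^+ 2 - 1 / h ^+ 2 by rewrite gt_min; apply/orP; right; move: r2; lra.
have ab' : 0 < a / b by rewrite divr_gt0.
have ba' : 0 < b / a by rewrite divr_gt0.
have m1 : a / b < ratio_bound by rewrite /ratio_bound; lra.
have m2 : b / a < ratio_bound by rewrite /ratio_bound; lra.
near=> k.
have t0 : 0 < t k by apply: lt_le_trans ltr01 _; near: k; exact: near_large.
have [cE [_ row0]] : Num.ceil (test_height (t k)) = (test_row (t k))%:Z /\
  `|(test_row (t k))%:R - test_height (t k)| <= 1 /\ (0 < test_row (t k))%N by near: k; exact: row_near.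
have [col0 sE] : (0 < test_col (t k))%N /\ (test_col (t k) + test_row (t k) = (n k).+1)%N by near: k; exact: sum_near.
have R0 : 0 < (test_row (t k))%:R :> R by rewrite ltr0n.
have C0 : 0 < (test_col (t k))%:R :> R by rewrite ltr0n.
have E1 : (test_col (t k))%:R / t k / ((test_row (t k))%:R / t k) = (test_col (t k))%:R / (test_row (t k))%:R :> R.
  by rewrite -mulf_div divff ?mulr1 // ?invr_eq0 gt_eqF.
have E2 : (test_row (t k))%:R / t k / ((test_col (t k))%:R / t k) = (test_row (t k))%:R / (test_col (t k))%:R :> R.
  by rewrite -mulf_div divff ?mulr1 // ?invr_eq0 gt_eqF.
split => //.
- rewrite -ler_pdivrMr // -E1 ltW //; near: k; exact: (@cvgr_lt R nat \oo _ _ _ q1).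
- rewrite -ler_pdivrMr // -E2 ltW //; near: k; exact: (@cvgr_lt R nat \oo _ _ _ q2).
- rewrite -E1 ltW //; near: k; exact: (@cvgr_gt R nat \oo _ _ _ g1).
- rewrite -E2 ltW //; near: k; exact: (@cvgr_gt R nat \oo _ _ _ g2).
Unshelve. all: by end_near. Qed.

End Sequences.

(** * Identities between the constants of the limit laws *)

Section Constants.
Context {R : realType}.

Lemma powR_third (x : R) (m : nat) : x `^ (m%:R / 3) = (x `^ 3^-1) ^+ m.
Proof. by rewrite -powR_mulrn ?powR_ge0 // -powRrM mulrC. Qed.

Lemma powR_cbrt (x : R) : 0 <= x -> (x `^ 3^-1) ^+ 3 = x.
Proof. by move=> x0; rewrite -powR_mulrn ?powR_ge0 // -powRrM mulVf // powRr1. Qed.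

(** In terms of cube roots the identities are rational. The first concerns the common shift; the
    other two identify the cubes of the limiting scales of the two models. *)
Lemma scaling_constants (alpha r v z y : R) : 0 < r -> 0 < v -> 0 < z ->
  r ^+ 3 = 2 -> v ^+ 3 = 2 - alpha -> z ^+ 3 = alpha -> y ^+ 3 = 2 - 2 * alpha + alpha ^+ 2 ->
  [/\ v / r * (r ^+ 4 / v ^+ 4) = 1 / (1 - alpha / 2),
    (2 * (v / r * (r ^+ 2 / v))) ^+ 3 = 2 * ((1 - alpha / 2) / 2^-1 ^+ 3 + alpha / 2 / 2^-1 ^+ 3) &
    (2 * (v / r * (r ^+ 2 * y / (z ^+ 2 * (2 - alpha))))) ^+ 3 =
      2 * (alpha / 2 / (alpha / 2) ^+ 3 + (1 - alpha / 2) / (1 - alpha / 2) ^+ 3)].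
Proof.
move=> r0 v0 z0 rr vv zz yy.
have va0 : 2 - alpha != 0 by rewrite -vv expf_neq0 // gt_eqF.
have al : alpha != 0 by rewrite -zz expf_neq0 // gt_eqF.
have nz : [/\ r != 0, v != 0 & z != 0] by rewrite !gt_eqF.
case: nz => rn vn zn; split.
- have -> : v / r * (r ^+ 4 / v ^+ 4) = r ^+ 3 / v ^+ 3 by field; rewrite rn vn.
  by rewrite rr vv; field; rewrite va0.
- have -> : (2 * (v / r * (r ^+ 2 / v))) ^+ 3 = 8 * r ^+ 3 by field; rewrite rn vn.
  by rewrite rr; field.
- have -> : (2 * (v / r * (r ^+ 2 * y / (z ^+ 2 * (2 - alpha))))) ^+ 3 = 8 * r ^+ 3 * v ^+ 3 * y ^+ 3 / ((z ^+ 3) ^+ 2 * (2 - alpha) ^+ 3).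
    by field; rewrite rn zn va0.
  by rewrite rr vv zz yy; field; rewrite al va0.
Qed.

End Constants.

Section Law.
Context {d : measure_display} {T : measurableType d} {R : realType} (P : probability T R).

Lemma prob_ae_eq (A B N : set T) : measurable A -> measurable B -> measurable N -> P N = 0%E ->
  (forall o, ~ N o -> A o <-> B o) -> prob P A = prob P B.
Proof.
move=> mA mB mN N0 AB.
have N0' : prob P N = 0 by rewrite /prob N0.
have half (X Y : set T) : measurable X -> measurable Y -> (forall o, ~ N o -> X o -> Y o) -> prob P X <= prob P Y.
  move=> mX mY XY; rewrite -[leRHS]addr0 -N0'; apply: le_trans (probU P mY mN).
  apply: prob_le => //; first exact: measurableU.
  by move=> o Xo; have [No|No] := pselect (N o); [right|left; exact: XY].
by apply/eqP; rewrite eq_le !half // => o /AB [].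
Qed.

Lemma measurable_fun_sublevel (f : T -> R) : (forall x, measurable [set o | f o <= x]) -> measurable_fun setT f.
Proof.
move=> mf; apply: (measurability (@RGenOInfty.G R)) => [|/= _ [_] [r] -> <-]; first exact: RGenOInfty.measurableE.
rewrite setTI (_ : f @^-1` _ = ~` [set o | f o <= r]); first exact: measurableC.
by apply/seteqP; split => o; rewrite /= in_itv /= andbT ltNge => /negP.
Qed.

Lemma measurable_le_set (f g : T -> R) : (forall x, measurable [set o | f o <= x]) ->
  (forall x, measurable [set o | g o <= x]) -> measurable [set o | f o <= g o].
Proof.
move=> /measurable_fun_sublevel mf /measurable_fun_sublevel mg.
by have := @measurable_fun_ler _ _ _ setT f g mf mg measurableT [set true] I; rewrite setTI.
Qed.

Lemma cdf_small (X : {RV P >-> R}) (e : R) : 0 < e -> exists x, prob P [set o | X o <= x] < e.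
Proof.
move=> e0; have /fine_cvgP [_] := cvg_cdfNy0 X.
move/(cvgr_lt) => /(_ e e0) => -[M [_ H]].
exists (M - 1); have := H (M - 1) _; rewrite ltrBlDr ltrDl => /(_ ltr01) /=.
rewrite /cdf /distribution /pushforward /prob; congr (fine (P _) < e).
Qed.

Lemma cdf_large (X : {RV P >-> R}) (e : R) : 0 < e -> exists x, 1 - e < prob P [set o | X o <= x].
Proof.
move=> e0; have /fine_cvgP [_] := cvg_cdfy1 X.
have e1 : 1 - e < 1 by rewrite ltrBlDr ltrDl.
move/(cvgr_gt) => /(_ (1 - e) e1) => -[M [_ H]].
exists (M + 1); have := H (M + 1) _; rewrite ltrDl => /(_ ltr01) /=.
rewrite /cdf /distribution /pushforward /prob; congr (_ < fine (P _)).
Qed.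

End Law.

(** * The limit of the interface *)

Section Main.
Context {d : measure_display} {T : measurableType d} {R : realType} (P : probability T R).
Variables (alpha s : R) (w : pt -> T -> R).
Hypothesis alpha01 : 0 < alpha < 1.
Hypothesis mw : forall p, measurable_fun setT (w p).
Hypothesis w_indep : mutually_independent P (fun p => ~~ Lplus p && ~~ Lminus p) w.
Hypothesis w_le : forall p : pt, ~~ Lplus p -> ~~ Lminus p -> forall x : R, 0 <= x ->
  P [set o | w p o <= x] = (1 - expR (- ((if (0 < p.2)%R then 1 else alpha) * x)))%:E.
Context {d' : measure_display} {T' : measurableType d'} (Q : probability T' R).
Variables chi1 chi2 : {RV Q >-> R}.
Hypothesis chi_indep : independent2 Q chi1 chi2.
Let gam : R := 2 `^ (4 / 3) / (2 - alpha) `^ (4 / 3).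
Let sig1 : R := 2 `^ (2 / 3) / (2 - alpha) `^ (1 / 3).
Let sig2 : R := 2 `^ (2 / 3) * (2 - 2 * alpha + alpha ^+ 2) `^ (1 / 3) / (alpha `^ (2 / 3) * (2 - alpha)).
Hypothesis chi1_law : forall x : R, Q [set o | chi1 o <= x] = (F_GOE ((x - gam * s) / sig1))%:E.
Hypothesis chi2_law : forall x : R, Q [set o | chi2 o <= x] = (F_GOE ((x - gam * s / alpha) / sig2))%:E.
Let a : R := alpha / 2.
Let b : R := 1 - alpha / 2.
Let h : R := 2^-1.

Definition interface_event (t : R) : set T :=
  [set o | (((comp_interface (fun p => w p o) (Num.truncn t)).1
             - (comp_interface (fun p => w p o) (Num.truncn t)).2)%:~R - (alpha - 1) * t) / t `^ (1 / 3) <= s].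

Lemma measurable_interface_event t : measurable (interface_event t).
Proof.
pose F (p : pt) : set T := if ((p.1 - p.2)%:~R - (alpha - 1) * t) / t `^ (1 / 3) <= s then setT else set0.
have -> : interface_event t = [set o | F (comp_interface (fun p => w p o) (Num.truncn t)) o].
  by apply/seteqP; split => o; rewrite /interface_event /F /=; case: (_ <= _).
by apply: measurable_interface => // p; rewrite /F; case: ifP.
Qed.

(** The coordinates of the interface add up to the number of steps, so the event bounds the second
    one from below by [test_height], equivalently by its ceiling. By [interface_lpp] this is the
    failure of the strict inequality tested at that row. *)
Lemma interface_eventE t o : test_ok alpha s t -> (forall p, ~~ Lplus p -> ~~ Lminus p -> 0 <= w p o) ->
  interface_event t o <->
  plus_lpp alpha w (fun=> test_col alpha s t) (fun=> test_row alpha s t) 0 o <=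
  minus_lpp alpha w (fun=> test_col alpha s t) (fun=> test_row alpha s t) 0 o.
Proof.
move=> ok w0; have [t0 cE r0 c0 sE _ _ _ _] := ok.
have jn : 1 <= (test_row alpha s t)%:Z <= (Num.truncn t)%:Z by move: r0 c0 sE; clear; lia.
have [ij lt] := @interface_lpp _ (fun p => w p o) w0 (Num.truncn t) (test_row alpha s t)%:Z jn.
have mE : minus_lpp alpha w (fun=> test_col alpha s t) (fun=> test_row alpha s t) 0 o =
    lpp (Lminus_weight (fun p => w p o)) (Num.truncn t).+1 (test_row alpha s t)%:Z.
  rewrite /minus_lpp sE; congr (lpp _ _ _); apply/funext => m; apply/funext => j.
  exact: minus_modelE.
have pE : plus_lpp alpha w (fun=> test_col alpha s t) (fun=> test_row alpha s t) 0 o =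
    lpp (Lplus_weight (fun p => w p o)) (Num.truncn t).+1 (test_row alpha s t)%:Z.
  rewrite /plus_lpp addnC sE -[RHS]lpp_transpose; have -> : (Num.truncn t).+1%:Z - (test_row alpha s t)%:Z = (test_col alpha s t)%:Z.
    by move: sE; clear; lia.
  by congr (lpp _ _ _); apply/funext => m; apply/funext => j; exact: plus_modelE.
rewrite mE pE leNgt -lt -leNgt /interface_event /=.
move: ij; set phi := comp_interface _ _ => ij.
have c0' : 0 < t `^ (1 / 3) by exact: powR_gt0.
have -> : (((phi.1 - phi.2)%:~R - (alpha - 1) * t) / t `^ (1 / 3) <= s) = ((test_row alpha s t)%:Z <= phi.2); last by [].
rewrite -cE ceil_le_int ler_pdivrMr // /test_height div1r.
have -> : phi.1 - phi.2 = (Num.truncn t)%:Z - 2 * phi.2 by move: ij; clear; lia.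
rewrite intrB intrM ler_pdivrMr // -!pmulrn.
move: (t `^ 3^-1) ((Num.truncn t)%:R : R) ((phi.2)%:~R : R) => u v x.
by apply/idP/idP; lra.
Qed.

Let a0 : 0 < a. Proof. by rewrite divr_gt0 //; case/andP: alpha01. Qed.
Let b0 : 0 < b. Proof. by rewrite /b; case/andP: alpha01; lra. Qed.
(** The conversion between the units of [chi1], [chi2] and those of the passage times divided by
    [t^(1/3)]: [2 * lam * sig1] and [2 * lam * sig2] are the limits of the two scales. *)
Let lam : R := (2 - alpha) `^ 3^-1 / 2 `^ 3^-1.
Let v0 : 0 < (2 - alpha) `^ 3^-1. Proof. by apply: powR_gt0; case/andP: alpha01; lra. Qed.
Let lam0 : 0 < lam. Proof. exact: divr_gt0. Qed.
Let sig10 : 0 < sig1. Proof. by rewrite divr_gt0 // powR_gt0 //; case/andP: alpha01; lra. Qed.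
Let y0 : 0 < 2 - 2 * alpha + alpha ^+ 2. Proof. by case/andP: alpha01 => ? ?; nra. Qed.
Let sig20 : 0 < sig2.
Proof.
case/andP: alpha01 => h1 h2.
by rewrite divr_gt0 // ?mulr_gt0 ?powR_gt0 //; lra.
Qed.

Let consts : [/\ lam * gam = 1 / b, (2 * (lam * sig1)) ^+ 3 = 2 * (b / h ^+ 3 + a / h ^+ 3) &
  (2 * (lam * sig2)) ^+ 3 = 2 * (a / a ^+ 3 + b / b ^+ 3)].
Proof.
have al0 : 0 < alpha by case/andP: alpha01.
have va : 0 <= 2 - alpha by case/andP: alpha01; lra.
have rr : ((2 : R) `^ 3^-1) ^+ 3 = 2 by exact: powR_cbrt.
have vv : ((2 - alpha) `^ 3^-1) ^+ 3 = 2 - alpha by exact: powR_cbrt.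
have zz : (alpha `^ 3^-1) ^+ 3 = alpha by apply: powR_cbrt; exact: ltW.
have yy : ((2 - 2 * alpha + alpha ^+ 2) `^ 3^-1) ^+ 3 = 2 - 2 * alpha + alpha ^+ 2 by apply: powR_cbrt; exact: ltW.
have z0 : 0 < alpha `^ 3^-1 by exact: powR_gt0.
have E4 (x : R) : x `^ (4 / 3) = (x `^ 3^-1) ^+ 4 by exact: powR_third.
have E2 (x : R) : x `^ (2 / 3) = (x `^ 3^-1) ^+ 2 by exact: powR_third.
have E1 (x : R) : x `^ (1 / 3) = x `^ 3^-1 by rewrite div1r.
by rewrite /lam /gam /sig1 /sig2 /b /a /h !E4 !E2 !E1; exact: scaling_constants.
Qed.

(** Read off the law of [chi1]: a distribution function takes arbitrarily small values. *)
Let F_GOE0 e : 0 < e -> exists y : R, F_GOE y < e.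
Proof.
move=> e0; have [x xe] := cdf_small chi1 e0.
by exists ((x - gam * s) / sig1); rewrite /prob chi1_law in xe.
Qed.

Lemma interface_seq_cvg (t : nat -> R) : (forall k, test_ok alpha s (t k)) -> t k @[k --> \oo] --> +oo ->
  prob P (interface_event (t k)) @[k --> \oo] --> prob Q [set o | chi1 o <= chi2 o].
Proof.
move=> ok too; have [c1 c2 c3] := consts.
have [al0 al1] : 0 < alpha /\ alpha < 1 by case/andP: alpha01.
pose I k := test_col alpha s (t k); pose J k := test_row alpha s (t k); pose c k := t k `^ 3^-1.
have t0 k : 0 < t k by case: (ok k).
have cp k : 0 < c k by exact: powR_gt0.
have I0 k : (0 < I k)%N by case: (ok k).
have J0 k : (0 < J k)%N by case: (ok k).
(* Both passage times have leading mean [2 t]. The common shift [s / b] and factor [lam] bring their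
   limits to the laws of [chi1] and [chi2] without affecting the comparison. *)
pose U k o := ((plus_lpp alpha w I J k o - 2 * t k) / c k + s / b) / lam.
pose V k o := ((minus_lpp alpha w I J k o - 2 * t k) / c k + s / b) / lam.
pose lev x k := 2 * t k + (lam * x - s / b) * c k.
have levE k u x : (((u - 2 * t k) / c k + s / b) / lam <= x) = (u <= lev x k).
  by rewrite /lev ler_pdivrMr // -lerBrDr ler_pdivrMr // lerBlDl [x * _]mulrC.
have UE k x : [set o | U k o <= x] = [set o | plus_lpp alpha w I J k o <= lev x k].
  by apply/seteqP; split => o /=; rewrite levE.
have VE k x : [set o | V k o <= x] = [set o | minus_lpp alpha w I J k o <= lev x k].
  by apply/seteqP; split => o /=; rewrite levE.
have a_bnd : a <= a <= 1 by rewrite lexx /a; lra.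
have b_bnd : a <= b <= 1 by rewrite /a /b; apply/andP; split; lra.
have h_bnd : a <= h <= 1 by rewrite /a /h; apply/andP; split; lra.
have Noo : ((I k + J k)%N%:R : R) @[k --> \oo] --> +oo.
  apply: (@ger_cvgy _ _ _ _ t) too.
  near=> k; have [_ _ _ _ sE _ _ _ _] := ok k; rewrite /I /J sE.
  by have /andP[_ /ltW] := truncn_itv (ltW (t0 k)).
have lm_cvg x : (lev x k - ((I k)%:R / a + (J k)%:R / b)) / (flat_scale (step a b) (I k + J k) (J k)%:Z / 2)
    @[k --> \oo] --> (x - gam * s / alpha) / sig2.
  have -> : (x - gam * s / alpha) / sig2 = (lam * x - s / b - (s / 2 / a + - (s / 2) / b)) / (2 * (lam * sig2) / 2).
    have -> : lam * x - s / b - (s / 2 / a + - (s / 2) / b) = lam * (x - gam * s / alpha).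
      have -> : lam * (x - gam * s / alpha) = lam * x - lam * gam * (s / alpha) by field; rewrite gt_eqF.
      rewrite c1 /a /b; move: (lam * x) => y; field; rewrite gt_eqF //=.
      by apply/negP => /eqP; lra.
    by field; rewrite !gt_eqF.
  apply: (level_cvg (x0 := a) (y0 := b)) => //.
  - by move=> k; rewrite addn_gt0 I0.
  - by rewrite !divff ?gt_eqF.
  - exact: col_ratio.
  - exact: row_ratio.
  - exact: col_cvg.
  - exact: row_cvg.
  - by apply: mulr_gt0 => //; apply: mulr_gt0.
have lp_cvg x : (lev x k - ((J k)%:R / h + (I k)%:R / h)) / (flat_scale (step h h) (J k + I k) (I k)%:Z / 2)
    @[k --> \oo] --> (x - gam * s) / sig1.
  have -> : (x - gam * s) / sig1 = (lam * x - s / b - (- (s / 2) / h + s / 2 / h)) / (2 * (lam * sig1) / 2).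
    have -> : lam * x - s / b - (- (s / 2) / h + s / 2 / h) = lam * (x - gam * s).
      have -> : lam * (x - gam * s) = lam * x - lam * gam * s by ring.
      by rewrite c1; move: (lam * x) (b^-1) (h^-1) => y y' y''; ring.
    by field; rewrite !gt_eqF.
  have h0 : 0 < h by rewrite invr_gt0.
  apply: (level_cvg (x0 := b) (y0 := a)) => //.
  - by move=> k; rewrite addn_gt0 J0.
  - by rewrite -mulrDl /a /b /h invrK; ring.
  - exact: row_ratio.
  - exact: col_ratio.
  - exact: row_cvg.
  - exact: col_cvg.
  - by apply: mulr_gt0 => //; apply: mulr_gt0.
have J3 x y := joint_cvg alpha01 mw w_indep w_le a0 a_bnd b_bnd h_bnd (ratio_gap_gt0 alpha01) (ratio_bound_ge0 alpha01) I0 J0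
   (fun k => test_ratio1 (ok k)) (fun k => test_ratio2 (ok k)) (fun k => test_gap1 (ok k)) (fun k => test_gap2 (ok k))
   Noo F_GOE0 (lm_cvg y) (lp_cvg x).
have G1E x : marg Q chi1 x = F_GOE ((x - gam * s) / sig1) by rewrite /marg /prob chi1_law.
have G2E x : marg Q chi2 x = F_GOE ((x - gam * s / alpha) / sig2) by rewrite /marg /prob chi2_law.
have mle (X : {RV Q >-> R}) x : measurable [set o | X o <= x].
  rewrite (_ : [set o | _] = X @^-1` `]-oo, x]); last by apply/seteqP; split => o; rewrite /= in_itv.
  by rewrite -[X in measurable X]setTI; exact: measurable_funP.
have mU k x : measurable [set o | U k o <= x] by rewrite UE; exact: (measurable_plus_lpp alpha01 mw w_indep w_le).
have mV k x : measurable [set o | V k o <= x] by rewrite VE; exact: (measurable_minus_lpp alpha01 mw w_indep w_le).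
have -> : (fun k => prob P (interface_event (t k))) = (fun k => prob P [set o | U k o <= V k o]).
  apply/funext => k; have [N [mN N0 w0]] := weights_ge0_ae mw w_le.
  apply: (prob_ae_eq (measurable_interface_event _) (measurable_le_set (mU k) (mV k)) mN N0) => o /w0 wo.
  rewrite (interface_eventE (ok k) wo) /= /U /V ler_pM2r ?invr_gt0 // lerD2r ler_pM2r ?invr_gt0 //.
  by rewrite lerD2r.
apply: comparison_cvg => //.
- by move=> k; exact: measurable_le_set.
- exact: measurable_le_set.
- move=> x y; rewrite /joint /marg /prob.
  have E (X : {RV Q >-> R}) z : [set o | X o <= z] = X @^-1` `]-oo, z].
    by apply/seteqP; split => o; rewrite /= in_itv.
  by rewrite !E chi_indep // fineM // fin_num_measure // -E.
- move=> x; rewrite G1E; have [_ + _] := J3 x 0.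
  by rewrite (_ : (fun k => marg P (U k) x) = fun k => prob P [set o | plus_lpp alpha w I J k o <= lev x k]) //;
    apply/funext => k; rewrite /marg UE.
- move=> x y; rewrite G1E G2E; have [_ _] := J3 x y.
  by rewrite (_ : (fun k => joint P (U k) (V k) x y) = fun k => prob P ([set o | plus_lpp alpha w I J k o <= lev x k] `&`
    [set o | minus_lpp alpha w I J k o <= lev y k])) //; apply/funext => k; rewrite /joint UE VE.
- apply: continuous_seq => u p up; rewrite G1E; under eq_fun do rewrite G1E.
  apply: F_GOE_cvg; apply: cvgM; last exact: cvg_cst.
  by apply: cvgB => //; exact: cvg_cst.
- exact: cdf_small.
- exact: cdf_large.
Unshelve. all: by end_near. Qed.

Lemma interface_cvg : P (interface_event t) @[t --> +oo] --> Q [set o | 0 <= chi2 o - chi1 o].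
Proof.
have mle (X : {RV Q >-> R}) x : measurable [set o | X o <= x].
  rewrite (_ : [set o | _] = X @^-1` `]-oo, x]); last by apply/seteqP; split => o; rewrite /= in_itv.
  by rewrite -[X in measurable X]setTI; exact: measurable_funP.
have -> : [set o | 0 <= chi2 o - chi1 o] = [set o | chi1 o <= chi2 o].
  by apply/seteqP; split => o /=; rewrite subr_ge0.
rewrite probE; last by apply: measurable_le_set; exact: mle.
apply/cvge_pinftyP => t too.
have -> : (fun n => P (interface_event (t n))) = (fun n => (prob P (interface_event (t n)))%:E).
  by apply/funext => n; rewrite probE //; exact: measurable_interface_event.
apply: cvg_EFin; first by near=> n.
have [K _ Kok] := test_near s alpha01 too.
have too' : t (n + K)%N @[n --> \oo] --> +oo by rewrite cvg_shiftn.
have : prob P (interface_event (t (n + K)%N)) @[n --> \oo] --> prob Q [set o | chi1 o <= chi2 o].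
  by apply: (interface_seq_cvg (t := fun n => t (n + K)%N)) => // k; apply: Kok; rewrite /= leq_addl.
by rewrite (cvg_shiftn K (fun n => prob P (interface_event (t n)))).
Unshelve. all: by end_near. Qed.

End Main.

Theorem theorem2p1 (R : realType) (alpha : R) (halpha : 0 < alpha < 1)
  (d : measure_display) (T : measurableType d) (P : probability T R)
  (w : pt -> {RV P >-> R})
  (w_indep : mutually_independent P (fun p => ~~ Lplus p && ~~ Lminus p)
               (fun p => (w p : T -> R)))
  (w_exp : forall p : pt, ~~ Lplus p -> ~~ Lminus p ->
     forall A : set R, measurable A ->
       distribution P (w p) A
       = exponential_prob (if (0 < p.2)%R then 1 else alpha) A)
  (s : R)
  (d' : measure_display) (T' : measurableType d') (Q : probability T' R)
  (chi1 chi2 : {RV Q >-> R})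
  (chi_indep : independent2 Q chi1 chi2)
  (chi1_law : forall x : R, Q [set o | chi1 o <= x] =
     (F_GOE ((x - (2 `^ (4 / 3) / (2 - alpha) `^ (4 / 3)) * s)
             / (2 `^ (2 / 3) / (2 - alpha) `^ (1 / 3))))%:E)
  (chi2_law : forall x : R, Q [set o | chi2 o <= x] =
     (F_GOE ((x - (2 `^ (4 / 3) / (2 - alpha) `^ (4 / 3)) * s / alpha)
             / (2 `^ (2 / 3) * (2 - 2 * alpha + alpha ^+ 2) `^ (1 / 3)
                / (alpha `^ (2 / 3) * (2 - alpha)))))%:E) :
  P [set o | ((((comp_interface (fun p => w p o) (Num.truncn t)).1
                - (comp_interface (fun p => w p o) (Num.truncn t)).2)%:~R
               - (alpha - 1) * t) / t `^ (1 / 3) <= s)]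
    @[t --> +oo] --> Q [set o | 0 <= chi2 o - chi1 o].
Proof.
have mw p : measurable_fun setT (w p : T -> R) by exact: measurable_funP.
have w_le (p : pt) : ~~ Lplus p -> ~~ Lminus p -> forall x : R, 0 <= x ->
    P [set o | w p o <= x] = (1 - expR (- ((if (0 < p.2)%R then 1 else alpha) * x)))%:E.
  move=> p1 p2 x x0; rewrite -exponential_prob_le // -w_exp; [|by []|by []|exact: measurable_itv].
  by rewrite /distribution /pushforward; congr (P _); apply/seteqP; split => o; rewrite /= in_itv.
exact: (interface_cvg halpha mw w_indep w_le chi_indep chi1_law chi2_law).
Qed.
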